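(* Let $n\ge1$ and let $\Omega\subset\mathbb{R}^{n+1}$ be a bounded convex domain whose boundary $\Sigma=\partial\Omega$ is a smooth closed convex hypersurface. Then the weighted curvature integral $\int_\Sigma H_n|X-X_0|^2\,d\mu(X)$, regarded as a function of $X_0\in\mathbb{R}^{n+1}$, is minimized at the Steiner point $X_0=z(\Omega)$. In this case, $$\int_\Sigma H_n|X-z(\Omega)|^2\,d\mu=\frac{n+1}{\omega_n}I_{n-1}^2-nI_{n-2}+(n+1)\,\delta_2\left(\Omega,B_z(\Omega)\right)^2 .$$
   Context: $X$ is the position vector, $d\mu$ the induced area measure, $\kappa_1,\dots,\kappa_n$ the principal curvatures of $\Sigma$ with respect to the outward unit normal (positive for round spheres), $H_j=\binom{n}{j}^{-1}\sigma_j(\kappa)$ with $\sigma_j$ the $j$-th elementary symmetric polynomial ($H_0=1$). $I_{-1}=(n+1)|\Omega|$, $I_j=\int_\Sigma H_j\,d\mu$ for $0\le j\le n$. $\omega_n=|\mathbb{S}^n|$. For a convex body $K$, $u_K:\mathbb{S}^n\to\mathbb{R}$ is its support function, and $\delta_2(K_1,K_2)=\left(\int_{\mathbb{S}^n}(u_{K_1}-u_{K_2})^2\,d\theta\right)^{1/2}$ with $d\theta$ the standard measure on $\mathbb{S}^n$. The Steiner point is $z(\Omega)=\frac{1}{|\mathbb{B}^{n+1}|}\int_{\mathbb{S}^n}u_\Omega(\xi)\,\xi\,d\theta$, where $|\mathbb{B}^{n+1}|$ is the volume of the unit ball. The Steiner ball $B_z(\Omega)$ is the ball whose center is $z(\Omega)$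 and whose diameter is the mean width of $\Omega$, i.e. the average over $\xi\in\mathbb{S}^n$ of $u_\Omega(\xi)+u_\Omega(-\xi)$. *)

(* Defs.v *)
From HB Require Import structures.
From mathcomp Require Import all_boot all_order all_algebra.
From mathcomp Require Import all_classical all_reals all_analysis.
Set Implicit Arguments.
Unset Strict Implicit.
Unset Printing Implicit Defensive.
Import Order.TTheory GRing.Theory Num.Theory.
Import numFieldNormedType.Exports.
Local Open Scope classical_set_scope.
Local Open Scope ring_scope.

(* The norm carried by 'rV[R]_n is the sup norm; it is used only for the
   topology, boundedness and differentiability.  All metric notions below go
   through the Euclidean inner product. *)
Section Euclidean.
Context {R : realType} {n : nat}.
Implicit Types (x y : 'rV[R]_n).

Definition dotv x y : R := \sum_(i < n) x 0 i * y 0 i.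

Definition enorm x : R := Num.sqrt (dotv x x).

Definition eball (c : 'rV[R]_n) (r : R) : set 'rV[R]_n :=
  [set x | enorm (x - c) <= r].

Definition esphere : set 'rV[R]_n := [set x | enorm x = 1].

End Euclidean.
Arguments esphere : clear implicits.

(* 'rV[R]_n as a measurable space: the sigma-algebra generated by the
   coordinates, i.e. the n-fold product of the Borel sigma-algebra of R. *)
Definition measure_rV_display : measure_display.
Proof. exact: default_measure_display. Qed.

Section MeasurableRowVector.
Variables (R : realType) (n : nat).

Definition rV_coord (i : 'I_n) (x : 'rV[R]_n) : measurableTypeR R := x 0 i.

Let rV_set0 : g_sigma_preimage rV_coord set0.
Proof. exact: sigma_algebra0. Qed.

Let rV_setC A : g_sigma_preimage rV_coord A -> g_sigma_preimage rV_coord (~` A).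
Proof. exact: sigma_algebraC. Qed.

Let rV_bigcup (F : _^nat) : (forall i, g_sigma_preimage rV_coord (F i)) ->
  g_sigma_preimage rV_coord (\bigcup_i (F i)).
Proof. exact: sigma_algebra_bigcup. Qed.

HB.instance Definition _ := @isMeasurable.Build measure_rV_display
  'rV[R]_n (g_sigma_preimage rV_coord) rV_set0 rV_setC rV_bigcup.

Lemma measurable_rV_coord (i : 'I_n) : measurable_fun setT (rV_coord i).
Proof.
move=> _ Y mY; rewrite setTI; apply: sub_sigma_algebra => /=.
rewrite -bigcup_seq/=; exists i => /=; first by rewrite mem_index_enum.
by exists Y => //; rewrite setTI.
Qed.

End MeasurableRowVector.

Lemma measurable_fun_rV (R : realType) n d (T : measurableType d)
    (f : T -> 'rV[R]_n) :
  (forall i, measurable_fun setT (@rV_coord R n i \o f)) ->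
  measurable_fun setT f.
Proof.
move=> mf.
suff prefS : g_sigma_preimage (fun i => @rV_coord R n i \o f) `<=` measurable.
  by rewrite g_sigma_preimage_comp in prefS => _ A mA; apply: prefS; exists A.
apply: smallest_sub; first exact: sigma_algebra_measurable.
case: n f mf => [|m] f mf; first by rewrite big_ord0.
rewrite -bigcup_mkord_ord; apply: bigcup_sub => i Ii.
by move=> A [B mB <-]; exact: mf.
Qed.

Section LebesgueStep.
Variables (R : realType) (n : nat).

Definition consv (p : measurableTypeR R * 'rV[R]_n) : 'rV[R]_n.+1 :=
  \row_(i < n.+1) oapp (fun j => p.2 0 j) p.1 (unlift ord0 i).

Definition splitv (x : 'rV[R]_n.+1) : measurableTypeR R * 'rV[R]_n :=
  (x 0 ord0, \row_(i < n) x 0 (lift ord0 i)).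

Lemma consvK : cancel consv splitv.
Proof.
case=> t y; rewrite /consv /splitv /=; congr pair.
  by rewrite mxE unlift_none.
by apply/rowP => i; rewrite !mxE liftK.
Qed.

Lemma measurable_consv : measurable_fun setT consv.
Proof.
apply: measurable_fun_rV => i.
case: (unliftP ord0 i) => [j|] ->.
  rewrite (_ : _ \o _ = @rV_coord R n j \o snd); last first.
    by apply/funext => p /=; rewrite /rV_coord mxE liftK.
  by apply: measurableT_comp => //; exact: measurable_rV_coord.
rewrite (_ : _ \o _ = fst) //.
by apply/funext => p /=; rewrite /rV_coord mxE unlift_none.
Qed.

Lemma measurable_splitv : measurable_fun setT splitv.
Proof.
apply: measurable_fun_pair; first exact: (measurable_rV_coord (ord0 : 'I_n.+1)).
apply: measurable_fun_rV => i.
rewrite (_ : _ \o _ = @rV_coord R n.+1 (lift ord0 i)).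
  exact: measurable_rV_coord.
by apply/funext => x /=; rewrite /rV_coord mxE.
Qed.

Variable m : {sigma_finite_measure set 'rV[R]_n -> \bar R}.

Definition lebesgue_rV_succ : set 'rV[R]_n.+1 -> \bar R :=
  pushforward (product_measure1 (@lebesgue_measure R) m) consv.

Let measurable_preconsv (A : set 'rV[R]_n.+1) :
  measurable A -> measurable (consv @^-1` A).
Proof. by move=> mA; rewrite -[X in measurable X]setTI; exact: measurable_consv. Qed.

Let lebesgue_rV_succ0 : lebesgue_rV_succ set0 = 0%E.
Proof. by rewrite /lebesgue_rV_succ /pushforward preimage_set0 measure0. Qed.

Let lebesgue_rV_succ_ge0 A : (0 <= lebesgue_rV_succ A)%E.
Proof. by rewrite /lebesgue_rV_succ /pushforward measure_ge0. Qed.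

Let lebesgue_rV_succ_sigma_additive : semi_sigma_additive lebesgue_rV_succ.
Proof.
move=> F mF tF mUF; rewrite /lebesgue_rV_succ /pushforward preimage_bigcup.
apply: measure_semi_sigma_additive.
- by move=> k; exact: measurable_preconsv.
- apply/trivIsetP => /= i j _ _ ij; rewrite -preimage_setI.
  by move/trivIsetP : tF => /(_ _ _ _ _ ij) ->//; rewrite preimage_set0.
- by rewrite -preimage_bigcup; exact: measurable_preconsv.
Qed.

HB.instance Definition _ := isMeasure.Build _ _ _ lebesgue_rV_succ
  lebesgue_rV_succ0 lebesgue_rV_succ_ge0 lebesgue_rV_succ_sigma_additive.

Let lebesgue_rV_succ_sigma_finite : sigma_finite setT lebesgue_rV_succ.
Proof.
have /sigma_finiteP[F [TF ndF Foo]] := sigma_finiteT (@lebesgue_measure R).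
have /sigma_finiteP[G [TG ndG Goo]] := sigma_finiteT m.
have FGT : \bigcup_k (F k `*` G k) = setT.
  rewrite predeqE => -[x y]; split => // _.
  have [k _ Fkx] : (\bigcup_k F k) x by rewrite -TF.
  have [l _ Gly] : (\bigcup_k G k) y by rewrite -TG.
  exists (maxn k l) => //=; split.
  - by move: x Fkx; exact/subsetPset/ndF/leq_maxl.
  - by move: y Gly; exact/subsetPset/ndG/leq_maxr.
exists (fun k => splitv @^-1` (F k `*` G k)) => [|k].
  by rewrite -preimage_bigcup FGT preimage_setT.
have [mF Fk] := Foo k; have [mG Gk] := Goo k; split.
  by rewrite -[X in measurable X]setTI; apply: measurable_splitv => //;
    exact: measurableX.
rewrite /lebesgue_rV_succ /pushforward -comp_preimage.
rewrite (_ : splitv \o consv = id); last first.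
  by apply/funext => p; exact: consvK.
by rewrite [X in (X < _)%E]product_measure1E// lte_mul_pinfty// ge0_fin_numE.
Qed.

HB.instance Definition _ := Measure_isSigmaFinite.Build _ _ _ lebesgue_rV_succ
  lebesgue_rV_succ_sigma_finite.

Definition lebesgue_rV_step : {sigma_finite_measure set 'rV[R]_n.+1 -> \bar R} :=
  lebesgue_rV_succ.

End LebesgueStep.

(* Lebesgue measure on R^n: the n-fold product of Lebesgue measure on R, the
   unit mass at the unique point for n = 0. *)
Fixpoint lebesgue_rV (R : realType) (n : nat) :
    {sigma_finite_measure set 'rV[R]_n -> \bar R} :=
  match n with
  | 0 => \d_(0 : 'rV[R]_0)
  | n'.+1 => lebesgue_rV_step (lebesgue_rV R n')
  end.

Definition volume {R : realType} {n : nat} (A : set 'rV[R]_n) : R :=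
  fine (lebesgue_rV R n A).

Definition boundary {T : topologicalType} (A : set T) : set T :=
  closure A `\` A°.

(* f is C^k on the open set U. *)
Fixpoint Ck {R : realType} {n m : nat} (k : nat) (U : set 'rV[R]_n)
    (f : 'rV[R]_n -> 'rV[R]_m) : Prop :=
  match k with
  | 0 => forall x, U x -> {for x, continuous f}
  | k'.+1 => (forall x, U x -> differentiable f x) /\
             (forall v, Ck k' U ('D_v f))
  end.

Definition smooth {R : realType} {n m : nat} (U : set 'rV[R]_n)
    (f : 'rV[R]_n -> 'rV[R]_m) : Prop := forall k, Ck k U f.

Section Hypersurface.
Context {R : realType} {n : nat}.
Implicit Types (S : set 'rV[R]_n.+1) (U : set 'rV[R]_n)
  (phi : 'rV[R]_n -> 'rV[R]_n.+1).

(* phi restricted to U is a local parametrization of S: a smooth immersion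
   that is a homeomorphism onto a relatively open subset of S (the last clause,
   with W = U for the openness of the image).  The values of phi outside U are
   irrelevant.  The rows of 'J phi x are the partial derivatives of phi at x,
   and they span the tangent space of S at phi x. *)
Definition local_param S U phi : Prop :=
  [/\ open U, smooth U phi,
      forall x, U x -> row_free ('J phi x),
      {in U &, injective phi} &
      forall W, open W -> W `<=` U ->
        exists2 V, open V & phi @` W = S `&` V].

Definition smooth_hypersurface S : Prop :=
  forall p, S p -> exists U phi, local_param S U phi /\ (phi @` U) p.

(* First fundamental form (Gram matrix of the partial derivatives). *)
Definition first_form phi (x : 'rV[R]_n) : 'M[R]_n :=
  'J phi x *m ('J phi x)^T.

(* mu is the Riemannian measure of S for the metric induced by the Euclidean
   one, seen as a measure on the ambient space carried by S: in every local
   parametrization it has density sqrt (det g). *)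
Definition area_measure S (mu : {measure set 'rV[R]_n.+1 -> \bar R}) : Prop :=
  mu (~` S) = 0%E /\
  forall U phi, local_param S U phi ->
    forall A, measurable A -> A `<=` U ->
      mu (phi @` A) =
        (\int[lebesgue_rV R n]_(x in A) (Num.sqrt (\det (first_form phi x)))%:E)%E.

End Hypersurface.

Section Curvature.
Context {R : realType} {n : nat}.
Implicit Types (Omega : set 'rV[R]_n.+1) (p v : 'rV[R]_n.+1)
  (phi : 'rV[R]_n -> 'rV[R]_n.+1).

Definition is_outward_unit_normal Omega p v : Prop :=
  [/\ enorm v = 1,
      forall U phi x, local_param (boundary Omega) U phi -> U x -> phi x = p ->
        'J phi x *m v^T = 0 &
      \forall t \near 0^'+, ~ closure Omega (p + t *: v)].

Definition outward_normal Omega p : 'rV[R]_n.+1 :=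
  get (is_outward_unit_normal Omega p).

(* Second fundamental form h_ij = - < d_i d_j phi, nu >, with nu the outward
   unit normal; the sign makes it positive on round spheres. *)
Definition second_form Omega phi (x : 'rV[R]_n) : 'M[R]_n :=
  \matrix_(i, j) - dotv ('D_(delta_mx 0 i) ('D_(delta_mx 0 j) phi) x)
                        (outward_normal Omega (phi x)).

Definition weingarten Omega phi (x : 'rV[R]_n) : 'M[R]_n :=
  invmx (first_form phi x) *m second_form Omega phi x.

(* k lists the eigenvalues of the Weingarten map at p, with multiplicity. *)
Definition is_principal_curvatures Omega p (k : 'rV[R]_n) : Prop :=
  exists U phi x, [/\ local_param (boundary Omega) U phi, U x, phi x = p &
    char_poly (weingarten Omega phi x) = \prod_(i < n) ('X - (k 0 i)%:P)].

Definition principal_curvatures Omega p : 'rV[R]_n :=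
  get (is_principal_curvatures Omega p).

Definition elem_sym (j : nat) (k : 'rV[R]_n) : R :=
  \sum_(A : {set 'I_n} | #|A| == j) \prod_(i in A) k 0 i.

Definition mean_curv Omega (j : nat) p : R :=
  ('C(n, j)%:R)^-1 * elem_sym j (principal_curvatures Omega p).

(* I_j, meaningful for -1 <= j <= n *)
Definition curv_integral Omega (mu : {measure set 'rV[R]_n.+1 -> \bar R})
    (j : int) : R :=
  match j with
  | Posz j' => \int[mu]_(p in boundary Omega) mean_curv Omega j' p
  | Negz 0 => n.+1%:R * volume Omega
  | Negz _ => 0
  end.

Definition weighted_curv_integral Omega
    (mu : {measure set 'rV[R]_n.+1 -> \bar R}) (X0 : 'rV[R]_n.+1) : R :=
  \int[mu]_(X in boundary Omega) (mean_curv Omega n X * enorm (X - X0) ^+ 2).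

End Curvature.

(* In this section theta stands for the standard measure on the unit sphere. *)
Section ConvexBodies.
Context {R : realType} {n : nat}.
Variable theta : {measure set 'rV[R]_n.+1 -> \bar R}.
Implicit Types (K : set 'rV[R]_n.+1).
Local Notation sphere := (esphere R n.+1).

Definition support_fun K (xi : 'rV[R]_n.+1) : R :=
  sup [set dotv x xi | x in K].

Definition delta2 K1 K2 : R :=
  Num.sqrt (\int[theta]_(xi in sphere)
    ((support_fun K1 xi - support_fun K2 xi) ^+ 2)).

Definition sphere_area : R := fine (theta sphere).

Definition steiner_point K : 'rV[R]_n.+1 :=
  \row_i ((volume (eball 0 1 : set 'rV[R]_n.+1))^-1 *
          \int[theta]_(xi in sphere) (support_fun K xi * xi 0 i)).

Definition mean_width K : R :=
  sphere_area^-1 *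
  \int[theta]_(xi in sphere) (support_fun K xi + support_fun K (- xi)).

Definition steiner_ball K : set 'rV[R]_n.+1 :=
  eball (steiner_point K) (mean_width K / 2).

End ConvexBodies.

(* Main.v *)
(* Write K for the closure of Omega, nu for the outward normal, sigma_j for the
   elementary symmetric functions of the principal curvatures, K_t for the
   parallel body of K at distance t and u for the support function.  The change
   of variables y = p + s nu(p) gives the shell formula
     int_(~ K) f = int_Sigma int_(s > 0) f(p + s nu) (sum_j s^j sigma_j).
   (1) For f homogeneous about X0, the inequality
   dist((1 + h) y, K) >= h <p - X0, nu> + (1 + h) s compares the integrals of f
   over K_t before and after a dilation by 1 + h.  It is an equality at h = 0,
   so the derivative in h vanishes.  Reading off the powers of t for f = 1 and
   f = |y - X0|^2 gives the Minkowski identities and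
   int H_n |X - X0|^2 + n I_(n-2) = (n + 1) int <X - X0, nu>^2 H_n.
   (2) For F Lipschitz and positively 1-homogeneous, the leading term in t of
   the integral of F^2 over K_t is proportional to int F(nu)^2 sigma_n; since
   K_t lies between two balls of radius t + O(1), this term is the same for the
   unit ball.  Hence nu maps sigma_n dmu to dtheta.
   Applying (2) with F = u - <X0, .> turns (1) into
   int H_n |X - X0|^2 + n I_(n-2) = (n + 1) int_S (u - <X0, xi>)^2, a quadratic
   polynomial in X0 centred at the Steiner point. *)
Require Import Defs.
From HB Require Import structures.
From mathcomp Require Import all_boot all_order all_algebra.
From mathcomp Require Import all_classical all_reals all_analysis.
Set Implicit Arguments.
Unset Strict Implicit.
Unset Printing Implicit Defensive.
Import Order.TTheory GRing.Theory Num.Theory.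
Import numFieldNormedType.Exports.
From mathcomp Require Import measurable_realfun ring lra.
Local Open Scope classical_set_scope.
Local Open Scope ring_scope.

(** * Measurability of open sets and of continuous maps *)

Section MeasurabilityRowVector.
Context {R : realType}.

(** Everything is reduced to Lebesgue measure on the ambient space. The change of variables behind
    the shell formula is proved by bisection of boxes, for a differentiable bijection of open sets
    with invertible derivative, continuous Jacobian determinant and continuous inverse. The normal
    and the principal curvatures are chosen by [get], so they must first be identified with the
    supporting normal and, in every chart, with the eigenvalues of the derivative of the normal.
    Convexity makes these nonnegative: the shells never fold, and every s > 0 is admissible. The
    measure [theta] is known only through charts, and no invariance under rotations or reflections
    is given. The unit ball is therefore treated as one more body. The last formula of (1), applied
    to it with X0 = v, -v and 0, yields int_S <v, xi> = 0 and int_S <v, xi>^2 = |v|^2 |B|, where |B|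
    is the volume of the unit ball. The second value is what makes the normalization of the Steiner
    point the right one. Reflection symmetry, needed for the mean width, comes from the comparison
    of tubes in (2) and the symmetry of Lebesgue measure. *)

Lemma ball_rVP n (x y : 'rV[R]_n) e : 0 < e ->
  ball x e y <-> forall i, `|x 0 i - y 0 i| < e.
Proof.
move=> e0; split=> [[_ h] i|h]; first exact: (h 0 i).
by split=> // i j; rewrite (ord1 i); exact: h.
Qed.

Lemma measurable_coord_preimage n (i : 'I_n) (Y : set R) :
  measurable (Y : set (measurableTypeR R)) ->
  measurable [set x : 'rV[R]_n | Y (x 0 i)].
Proof.
by move=> mY; rewrite -[X in measurable X]setTI; exact: measurable_rV_coord.
Qed.

Lemma measurable_forall_coord n (Y : 'I_n -> set R) :
  (forall i, measurable (Y i : set (measurableTypeR R))) ->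
  measurable [set x : 'rV[R]_n | forall i, Y i (x 0 i)].
Proof.
move=> mY.
rewrite (_ : [set _ | _] =
  \bigcap_(i in [set: 'I_n]) [set x : 'rV[R]_n | Y i (x 0 i)]); last first.
  by apply/seteqP; split=> x /= h i; [move=> _|]; exact: h.
apply: fin_bigcap_measurable => //.
by move=> i _; exact: measurable_coord_preimage.
Qed.

(** The sigma-algebra comes from the coordinates and the topology from the sup norm. They meet
    because an open set is the countable union of the cubes with rational centre and radius 1/(k+1)
    that it contains. *)
Lemma open_measurable_rV n (A : set 'rV[R]_n) : open A -> measurable A.
Proof.
move=> oA.
pose B (q : 'rV[rat]_n * nat) : set 'rV[R]_n :=
  [set x | forall i, `|ratr (q.1 0 i) - x 0 i| < (q.2.+1%:R)^-1].
pose F q := if `[< B q `<=` A >] then B q else set0.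
have -> : A = \bigcup_q F q.
  apply/seteqP; split=> [x Ax|x [q _]]; last first.
    by rewrite /F; case: asboolP => // h /h.
  have /nbhs_ballP[e /= e0 he] : nbhs x A by apply: open_nbhs_nbhs.
  have [k hk] : exists k : nat, (k.+1%:R)^-1 < e / 2 :> R.
    exists (Num.truncn (e / 2)^-1).
    rewrite invf_plt ?posrE// ?divr_gt0//; exact: truncnS_gt.
  have k0 : 0 < (k.+1%:R)^-1 :> R by rewrite invr_gt0.
  have /choice[q hq] : forall i, exists r : rat, `|ratr r - x 0 i| < (k.+1%:R)^-1.
    move=> i; have [r] := @rat_in_itvoo R (x 0 i - (k.+1%:R)^-1) (x 0 i + (k.+1%:R)^-1) ltac:(by rewrite ltrBlDr -addrA ltrDl addr_gt0).
    rewrite in_itv/= => hr; exists r; rewrite distrC.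
    by rewrite ltr_distlC.
  exists (\row_i q i, k) => //.
  rewrite /F; case: asboolP => [_ i|]; first by rewrite mxE.
  case; move=> y hy; apply: he; apply/ball_rVP => // i.
  have := hy i; rewrite mxE/= => h1.
  rewrite (splitr e) -(subrKA (ratr (q i))).
  apply: (le_lt_trans (ler_normD _ _)); apply: ltrD.
    by rewrite distrC; exact: lt_trans hk.
  exact: lt_trans hk.
apply: countable_bigcupT_measurable => [|q]; first exact: countableP.
rewrite /F; case: asboolP => // _.
rewrite /B; apply: (@measurable_forall_coord n
   (fun i => [set t : R | `|ratr (q.1 0 i) - t| < (q.2.+1%:R)^-1])) => i.
rewrite (_ : [set _ | _] = ball (ratr (q.1 0 i) : R) (q.2.+1%:R)^-1) //.
exact: measurable_ball.
Qed.

Lemma closed_measurable_rV n (A : set 'rV[R]_n) : closed A -> measurable A.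
Proof.
by move=> cA; rewrite -(setCK A); apply: measurableC; apply: open_measurable_rV;
  exact: closed_openC.
Qed.

Lemma measurable_fun_rV_in n d (T : measurableType d) (D : set T)
    (f : T -> 'rV[R]_n) :
  (forall i, measurable_fun D (fun x => f x 0 i : measurableTypeR R)) ->
  measurable_fun D f.
Proof.
move=> mf mD.
apply: (@measurability _ _ _ _ D f (\big[setU/set0]_(i < n)
  preimage_set_system setT (@rV_coord R n i) measurable)) => //.
move=> _ [B + <-].
case: n f mf B => [|n] f mf B; first by rewrite big_ord0.
rewrite -bigcup_mkord_ord => -[i Ii [Y mY <-]].
by rewrite setTI -comp_preimage; exact: mf.
Qed.

(** Only the trace of the neighbourhoods on [D] counts. This is the continuity of inverse charts and
    of the normal field, whose values off the hypersurface are arbitrary. *)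
Definition continuous_on {T S : topologicalType} (D : set T) (f : T -> S) :=
  forall x, D x -> f @ within D (nbhs x) --> f x.

Lemma continuous_on_preimage {T S : topologicalType} (D : set T) (f : T -> S)
    (O : set S) : continuous_on D f -> open O ->
  exists2 V, open V & D `&` f @^-1` O = D `&` V.
Proof.
move=> cf oO; exists (interior [set y | D y -> O (f y)]).
  exact: open_interior.
apply/seteqP; split=> x [Dx]; last by move=> /interior_subset h; split=> //; exact: h.
move=> Ofx; split=> //.
by have := cf x Dx O (open_nbhs_nbhs (conj oO Ofx)).
Qed.

Lemma continuous_on_measurable n (D : set 'rV[R]_n) (f : 'rV[R]_n -> R) :
  continuous_on D f -> measurable_fun D (f : _ -> measurableTypeR R).
Proof.
move=> cf mD; move: (mD).
apply: (measurability _ (RGenOInfty.measurableE R)).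
move=> _ [_ [x ->] <-].
have [|V oV ->] := continuous_on_preimage cf (_ : open `]x, +oo[%classic).
  exact: interval_open.
by apply: measurableI => //; exact: open_measurable_rV.
Qed.

End MeasurabilityRowVector.

(** * Lebesgue measure under affine maps *)

Section LebesgueRowVector.
Context {R : realType}.
Local Notation leb n := (lebesgue_rV R n).

Definition box n (a b : 'rV[R]_n) : set 'rV[R]_n :=
  [set x | forall i, a 0 i < x 0 i <= b 0 i].

Lemma measurable_box n (a b : 'rV[R]_n) : measurable (box a b).
Proof.
apply: (@measurable_forall_coord R n (fun i => `]a 0 i, b 0 i]%classic)) => i.
exact: measurable_itv.
Qed.

Lemma measurable_slice1 n (A : set 'rV[R]_n.+1) (t : R) : measurable A ->
  measurable [set y : 'rV[R]_n | A (consv (t, y))].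
Proof.
move=> mA; have := measurable_xsection t (measurable_consv measurableT mA).
by rewrite setTI /xsection; congr measurable; apply/seteqP; split=> y; rewrite /= in_setE.
Qed.

Lemma measurable_slice2 n (A : set 'rV[R]_n.+1) (y : 'rV[R]_n) : measurable A ->
  measurable ([set t : R | A (consv (t, y))] : set (measurableTypeR R)).
Proof.
move=> mA; have := measurable_ysection y (measurable_consv measurableT mA).
by rewrite setTI /ysection; congr measurable; apply/seteqP; split=> t; rewrite /= in_setE.
Qed.

Lemma lebesgue_rVS n (A : set 'rV[R]_n.+1) : measurable A ->
  leb n.+1 A = (\int[@lebesgue_measure R]_t leb n [set y | A (consv (t, y))])%E.
Proof.
move=> mA; rewrite /= /lebesgue_rV_succ /pushforward /product_measure1.
apply: eq_integral => t _ /=; congr (leb n _).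
by apply/seteqP; split=> y; rewrite /xsection /= in_setE.
Qed.

(** The measure is defined by slicing along the first coordinate; uniqueness of the product measure
    allows the slices to be taken in the other order. *)
Lemma lebesgue_rVS2 n (A : set 'rV[R]_n.+1) : measurable A ->
  leb n.+1 A = (\int[leb n]_y (@lebesgue_measure R) [set t | A (consv (t, y))])%E.
Proof.
move=> mA; rewrite /= /lebesgue_rV_succ /pushforward.
have mB : measurable (@consv R n @^-1` A).
  by rewrite -[X in measurable X]setTI; exact: measurable_consv.
transitivity ((@lebesgue_measure R \x^ leb n)%E (@consv R n @^-1` A)).
  by apply: product_measure_unique => //= ? ? ? ?; rewrite product_measure2E.
rewrite /product_measure2; apply: eq_integral => t _ /=; congr lebesgue_measure.
by apply/seteqP; split=> y; rewrite /ysection /= in_setE.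
Qed.

Lemma consvE n t (y : 'rV[R]_n) : consv (t, y) = row_mx t%:M y :> 'rV_(1 + n).
Proof.
apply/rowP => i; rewrite !mxE; case: splitP => j ij.
  rewrite (_ : i = ord0) ?unlift_none/= ?mxE ?eqxx ?mulr1n.
    by rewrite ord1 eqxx.
  by apply/val_inj; rewrite /= ij (ord1 j).
rewrite (_ : i = lift ord0 j) ?liftK//.
by apply/val_inj; rewrite /= ij.
Qed.

Lemma measurable_affine n m (M : 'M[R]_(n, m)) (w : 'rV[R]_m) :
  measurable_fun setT (fun x : 'rV[R]_n => x *m M + w).
Proof.
apply: measurable_fun_rV_in => j.
rewrite (_ : (fun _ => _) = (fun x : 'rV[R]_n => \sum_i x 0 i * M i j + w 0 j)).
  apply: measurable_funD => //; apply: measurable_sum => i.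
  by apply: measurable_funM => //; exact: measurable_rV_coord.
by apply/funext => x; rewrite !mxE.
Qed.

Lemma measurable_affine_preimage n m (M : 'M[R]_(n, m)) (w : 'rV[R]_m) A :
  measurable A -> measurable [set x : 'rV[R]_n | A (x *m M + w)].
Proof.
by move=> mA; rewrite -[X in measurable X]setTI; exact: measurable_affine.
Qed.

Lemma lebesgue_affine1 (a b : R) (A : set (measurableTypeR R)) : a != 0 -> measurable A ->
  lebesgue_measure [set t : R | A (t * a + b)] = ((`|a|^-1)%:E * lebesgue_measure A)%E.
Proof.
move=> a0 mA.
have mf : measurable_fun setT (fun t : measurableTypeR R => t * a + b : measurableTypeR R).
  by apply: measurable_funD => //; exact: measurable_funM.
pose f := (fun t : measurableTypeR R => t * a + b : measurableTypeR R).
pose nu := mscale (NngNum (normr_ge0 a)) (pushforward (@lebesgue_measure R) f).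
have a0' : 0 < `|a| by rewrite normr_gt0.
have -> : lebesgue_measure A = nu mf A.
  apply: lebesgue_measure_unique => //= _ [[x y]] _ <-.
  rewrite /nu /mscale/= /pushforward.
  have [ap|ap] := ltP 0 a.
    rewrite (_ : _ @^-1` _ = `](x - b) / a, (y - b) / a]%classic); last first.
      apply/seteqP; split=> t; rewrite /= !in_itv/=;
        by rewrite ltr_pdivrMr// ler_pdivlMr// ltrBlDr lerBrDr.
    rewrite !lebesgue_measure_itv/= !lte_fin ltr_pM2r ?invr_gt0// ltrD2r.
    case: ifP => _; rewrite ?mule0// -!EFinD -EFinM; congr _%:E.
    by rewrite gtr0_norm//; field.
  have {}ap : a < 0 by rewrite lt_neqAle a0.
  rewrite (_ : _ @^-1` _ = `[(y - b) / a, (x - b) / a[%classic); last first.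
    apply/seteqP; split=> t; rewrite /= !in_itv/=;
      by rewrite ltr_ndivlMr// ler_ndivrMr// ltrBlDr lerBrDr andbC.
  rewrite !lebesgue_measure_itv/= !lte_fin ltr_nM2r ?invr_lt0// ltrD2r.
  case: ifP => _; rewrite ?mule0// -!EFinD -EFinM; congr _%:E.
  by rewrite ltr0_norm//; field.
rewrite /nu /mscale/= muleA -EFinM mulVf ?gt_eqF// mul1e /pushforward.
by [].
Qed.

(** The shift of the tail is handled on slices by induction. The shift of the first coordinate is
    then handled on lines by the one-dimensional case, after the order of integration has been
    exchanged. *)
Lemma lebesgue_translate n (w : 'rV[R]_n) A : measurable A ->
  leb n [set x | A (x + w)] = leb n A.
Proof.
have mT m (v : 'rV[R]_m) B : measurable B -> measurable [set x | B (x + v)].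
  move=> mB; have := measurable_affine_preimage 1%:M v mB.
  by congr measurable; apply/seteqP; split=> x /=; rewrite mulmx1.
elim: n w A => [|n IHn] w A mA.
  by congr (leb 0 _); apply/seteqP; split=> x /=;
    rewrite (_ : x + w = x) //; apply/rowP => -[].
rewrite lebesgue_rVS; last exact: mT.
pose w1 := (splitv w).2; pose w0 := (splitv w).1.
have E t y : consv (t, y) + w = consv (t + w0, y + w1) :> 'rV[R]_n.+1.
  apply/rowP => i; rewrite !mxE /=.
  by case: (unliftP ord0 i) => [j|] -> /=; rewrite ?mxE.
transitivity (leb n.+1 [set x : 'rV_n.+1 | A (x + consv (w0, 0))]).
  rewrite lebesgue_rVS; last exact: mT.
  apply: eq_integral => t _ /=.
  have mA' := mT _ (consv (w0, 0) : 'rV_n.+1) _ mA.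
  rewrite -(IHn w1 _ (measurable_slice1 t mA')).
  congr (leb n _); apply/seteqP; split=> y /=; rewrite E;
   by (rewrite (_ : consv _ + _ = consv (t + w0, y + w1)) //;
     apply/rowP => i; rewrite !mxE /=; case: (unliftP ord0 i) => [j|] _ /=;
     rewrite ?mxE ?addr0).
rewrite !lebesgue_rVS2//; last exact: mT.
apply: eq_integral => y _ /=.
transitivity (lebesgue_measure ([set t : R | [set s : R | A (consv (s, y))] (t * 1 + w0)])).
  congr lebesgue_measure; apply/seteqP; split=> t /=; rewrite mulr1;
   by (rewrite (_ : consv _ + _ = consv (t + w0, y)) //;
     apply/rowP => i; rewrite !mxE /=; case: (unliftP ord0 i) => [j|] _ /=;
     rewrite ?mxE ?addr0).
rewrite lebesgue_affine1 ?oner_eq0//; last exact: measurable_slice2.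
by rewrite normr1 invr1 mul1e.
Qed.

(** The set on the left is the preimage of [A] under x |-> x M, whence the inverse of the
    determinant. In this form the property is multiplicative in [M], which allows a proof by
    factorization. *)
Definition scales_lebesgue n (M : 'M[R]_n) := forall A, measurable A ->
  leb n [set x | A (x *m M)] = ((`|\det M|^-1)%:E * leb n A)%E.

Lemma scales_lebesgueM n (M N : 'M[R]_n) :
  scales_lebesgue M -> scales_lebesgue N -> scales_lebesgue (M *m N).
Proof.
move=> hM hN A mA.
have mL m (P : 'M[R]_m) B : measurable B -> measurable [set x | B (x *m P)].
  move=> mB; have := measurable_affine_preimage P 0 mB.
  by congr measurable; apply/seteqP; split=> x /=; rewrite addr0.
rewrite (_ : [set x | _] = [set x | [set y | A (y *m N)] (x *m M)]); last first.
  by apply/seteqP; split=> x /=; rewrite mulmxA.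
rewrite hM; last exact: mL.
by rewrite hN// muleA -EFinM det_mulmx normrM invfM.
Qed.

Lemma scales_lebesgue_lower n (a : R) (c : 'cV[R]_n) : a != 0 ->
  scales_lebesgue (block_mx a%:M 0 c 1%:M : 'M[R]_(1 + n)).
Proof.
move=> a0 A mA; rewrite det_lblock det1 mulr1 det_scalar1.
have mL m (P : 'M[R]_m) B : measurable B -> measurable [set x | B (x *m P)].
  move=> mB; have := measurable_affine_preimage P 0 mB.
  by congr measurable; apply/seteqP; split=> x /=; rewrite addr0.
rewrite lebesgue_rVS2; last exact: mL.
rewrite lebesgue_rVS2// -ge0_integralZl_EFin ?invr_ge0//; last first.
  rewrite (_ : (fun _ => _) = @lebesgue_measure R \o ysection (@consv R n @^-1` A)).
    apply: measurable_fun_ysection.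
    by rewrite -[X in measurable X]setTI; exact: measurable_consv.
  apply/funext => y /=; congr lebesgue_measure; apply/seteqP.
  by split=> t; rewrite /ysection /= in_setE.
apply: eq_integral => y _ /=.
rewrite -(@lebesgue_affine1 a ((y *m c) 0 0)) //; last exact: measurable_slice2.
congr lebesgue_measure; apply/seteqP; split=> t /=;
rewrite !consvE mul_row_block mulmx0 mulmx1 add0r -scalar_mxM;
by rewrite (_ : _ + _ = (t * a + (y *m c) 0 0)%:M) // raddfD/= -mx11_scalar.
Qed.

Lemma scales_lebesgue_upper n (b : 'rV[R]_n) (d : 'M[R]_n) : scales_lebesgue d ->
  scales_lebesgue (block_mx 1%:M b 0 d : 'M[R]_(1 + n)).
Proof.
move=> hd A mA; rewrite det_ublock det1 mul1r.
have mL m (P : 'M[R]_m) B : measurable B -> measurable [set x | B (x *m P)].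
  move=> mB; have := measurable_affine_preimage P 0 mB.
  by congr measurable; apply/seteqP; split=> x /=; rewrite addr0.
rewrite lebesgue_rVS; last exact: mL.
rewrite lebesgue_rVS// -ge0_integralZl_EFin ?invr_ge0//; last first.
  rewrite (_ : (fun _ => _) = leb n \o xsection (@consv R n @^-1` A)).
    apply: measurable_fun_xsection.
    by rewrite -[X in measurable X]setTI; exact: measurable_consv.
  apply/funext => y /=; congr (leb n _); apply/seteqP.
  by split=> t; rewrite /xsection /= in_setE.
apply: eq_integral => t _ /=.
have mS := @measurable_slice1 n A t mA.
rewrite -(lebesgue_translate (t *: b) mS) -hd; last first.
  have := measurable_affine_preimage 1%:M (t *: b) mS.
  by congr measurable; apply/seteqP; split=> x /=; rewrite mulmx1.
congr (leb n _); apply/seteqP; split=> y /=;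
by rewrite !consvE mul_row_block !mulmx0 mulmx1 ?addr0 mul_scalar_mx addrC.
Qed.

(** Block elimination: a nonzero pivot factors [M] into a lower triangular block, an upper one, and
    the Schur complement d - c a^-1 b of smaller size. *)
Lemma scales_lebesgue_pivot n (M : 'M[R]_n.+1) :
  (forall d : 'M[R]_n, d \in unitmx -> scales_lebesgue d) ->
  M \in unitmx -> M 0 0 != 0 -> scales_lebesgue M.
Proof.
move=> IH; rewrite -[M](@submxK _ 1 n 1 n).
set a := ulsubmx _; set b := ursubmx _; set c := dlsubmx _; set d := drsubmx _.
move=> uM a0.
have {}a0 : a 0 0 != 0.
  rewrite (_ : a 0 0 = block_mx a b c d 0 0) //; clear a0 uM; rewrite [RHS]mxE.
  by case: splitP => // j _; rewrite [RHS]mxE; case: splitP => // k _; rewrite !ord1.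
have E : block_mx a b c d =
   (block_mx (a 0 0)%:M 0 c 1%:M : 'M[R]_(1 + n)) *m
   block_mx 1%:M ((a 0 0)^-1 *: b) 0 (d - c *m ((a 0 0)^-1 *: b)).
  rewrite mulmx_block !mulmx0 !mul0mx !mulmx1 !addr0 mul1mx mul_scalar_mx.
  by rewrite -mx11_scalar scalerA mulfV// scale1r addrC subrK.
rewrite E; apply: scales_lebesgueM; first exact: scales_lebesgue_lower.
apply: scales_lebesgue_upper; apply: IH.
move: uM; rewrite E unitmxE det_mulmx unitrM => /andP[_].
have D := @det_ublock R 1 n 1%:M ((a 0 0)^-1 *: b) (d - c *m ((a 0 0)^-1 *: b)).
by rewrite [X in X \is a _]D det1 mul1r -unitmxE.
Qed.

Lemma lebesgue_linear n (M : 'M[R]_n) : M \in unitmx -> scales_lebesgue M.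
Proof.
elim: n M => [|n IHn] M uM.
  move=> A mA; rewrite det_mx00 normr1 invr1 mul1e.
  by congr (leb 0 _); apply/seteqP; split=> x /=;
    rewrite (_ : x *m M = x) //; apply/rowP => -[].
have [M0|M0] := eqVneq (M 0 0) 0; last exact: scales_lebesgue_pivot.
have [i Mi0] : exists i, M i 0 != 0.
  apply/existsP; rewrite -negb_forall; apply/negP => /forallP h.
  move: uM; rewrite unitmxE unitfE (expand_det_col _ 0) big1 ?eqxx// => j _.
  by rewrite (eqP (h j)) mul0r.
case: (unliftP ord0 i) => [j|] ij; last by move: Mi0; rewrite ij M0 eqxx.
(* When the corner vanishes, the shear [E 1] adds row [i] to row 0 and so creates a pivot; [E (-1)]
   undoes it. *)
pose E (s : R) : 'M[R]_(1 + n) := block_mx 1%:M (s *: delta_mx 0 j) 0 1%:M.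
have sE s : scales_lebesgue (E s).
  by apply: scales_lebesgue_upper; apply: IHn; exact: unitmx1.
have EE : E (-1) *m E 1 = 1%:M.
  rewrite /E mulmx_block !mulmx0 !mul0mx !mulmx1 !mul1mx !addr0 scaleN1r scale1r.
  by rewrite subrr add0r -scalar_mx_block.
have -> : M = E (-1) *m (E 1 *m M) by rewrite mulmxA EE mul1mx.
apply: scales_lebesgueM; first exact: sE.
apply: scales_lebesgue_pivot => //.
  rewrite unitmx_mul uM andbT unitmxE.
  have D := @det_ublock R 1 n 1%:M (1 *: delta_mx 0 j) 1%:M.
  by rewrite [X in X \is a _]D !det1 mulr1 unitr1.
rewrite mxE (bigD1 0)//= M0 mulr0 add0r (bigD1 i)/=; last by rewrite ij.
rewrite big1 ?addr0.
  suff -> : E 1 0 i = 1 by rewrite mul1r.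
  rewrite ij /E scale1r !mxE; case: splitP => //= k _.
  rewrite mxE; case: splitP => [l /= hl|l /= hl].
    by have := ltn_ord l; rewrite -hl.
  by rewrite mxE ord1 eqxx (_ : l == j)//; apply/eqP/val_inj; move: hl => [].
move=> k /andP[k0 ki]; suff -> : E 1 0 k = 0 by rewrite mul0r.
case: (unliftP ord0 k) k0 ki => [l|] ->; last by rewrite eqxx.
move=> _ lj; rewrite /E scale1r !mxE; case: splitP => //= p _.
rewrite mxE; case: splitP => [q /= hq|q /= hq].
  by have := ltn_ord q; rewrite -hq.
rewrite mxE (_ : q = l) ?andbF; last by apply/val_inj; move: hq => [].
rewrite (_ : l == j = false) ?andbF//; apply/negbTE.
by apply: contraNneq lj => ->; rewrite ij.
Qed.

Lemma lebesgue_box n (a b : 'rV[R]_n) : (forall i, a 0 i <= b 0 i) ->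
  leb n (box a b) = (\prod_i (b 0 i - a 0 i))%:E.
Proof.
elim: n a b => [|n IHn] a b ab.
  rewrite big_ord0 /= diracE mem_set//; by case.
rewrite /= /lebesgue_rV_succ /pushforward.
pose a' := (splitv a).2; pose b' := (splitv b).2.
rewrite (_ : _ @^-1` _ = `]a 0 0, b 0 0]%classic `*` box a' b'); last first.
  apply/seteqP; split=> [[t y] /= h|[t y] /= [ht hy] i].
    split; first by have := h ord0; rewrite mxE unlift_none in_itv.
    by move=> i; have := h (lift ord0 i); rewrite !mxE liftK.
  rewrite !mxE; case: (unliftP ord0 i) => [j|] -> /=; last by rewrite in_itv in ht.
  by have := hy j; rewrite !mxE.
rewrite [LHS]product_measure1E//; last exact: measurable_box.
rewrite IHn; last by move=> i; rewrite !mxE.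
rewrite big_ord_recl /= lebesgue_measure_itv/= lte_fin EFinM.
congr (_ * _)%E; last by congr _%:E; apply: eq_bigr => i _; rewrite !mxE.
case: ltP => // h; have : b 0 0 = a 0 0 by apply/le_anti; rewrite h ab.
by move=> ->; rewrite subrr.
Qed.

End LebesgueRowVector.

(** * Densities and transfer of integrals *)

Section Density.
Import HBNNSimple.
Local Open Scope ereal_scope.
Context d (T : measurableType d) (R : realType).
Variable m : {measure set T -> \bar R}.
Variables (w : T -> R) (w0 : forall x, (0 <= w x)%R) (mw : measurable_fun setT w).

(** The anonymous arguments are the proofs of nonnegativity and measurability of [w]: the measure
    structure attached to the head symbol [density] depends on them. *)
Definition density of (forall x, (0 <= w x)%R) & measurable_fun setT w :=
  fun A : set T => \int[m]_(x in A) (w x)%:E.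

Let density0 : density w0 mw set0 = 0.
Proof. exact: integral_set0. Qed.

Let density_ge0 A : 0 <= density w0 mw A.
Proof. by apply: integral_ge0 => x _; rewrite lee_fin. Qed.

Let density_sigma_additive : semi_sigma_additive (density w0 mw).
Proof.
move=> F mF tF mUF; rewrite /density ge0_integral_bigcup//; last 2 first.
- by apply/measurable_EFinP; exact: measurable_funTS.
- by move=> x _; rewrite lee_fin.
apply: is_cvg_ereal_nneg_natsum_cond => n _ _.
exact: density_ge0.
Qed.

HB.instance Definition _ := isMeasure.Build _ _ _ (density w0 mw)
  density0 density_ge0 density_sigma_additive.

(** For simple functions the identity is linear in indicators; both sides pass to the limit by
    monotone convergence along simple approximations of [f]. *)
Lemma ge0_integral_density (f : T -> \bar R) E :
  measurable E -> measurable_fun E f -> (forall x, E x -> 0 <= f x) ->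
  \int[density w0 mw]_(x in E) f x = \int[m]_(x in E) (f x * (w x)%:E).
Proof.
move=> mE mf f0.
pose h := nnsfun_approx mE mf.
have mwE : measurable_fun E (EFin \o w).
  by apply/measurable_EFinP; exact: measurable_funTS.
have mh n : measurable_fun E (EFin \o h n).
  by apply/measurable_EFinP; apply: (measurable_funS measurableT).
have fE x : E x -> (EFin \o h n) x @[n --> \oo] --> f x.
  by move=> Ex; exact: cvg_nnsfun_approx.
transitivity (limn (fun n => \int[density w0 mw]_(x in E) (EFin \o h n) x)).
  rewrite -monotone_convergence//.
  - by apply: eq_integral => x /[!inE] /fE h1; apply/esym/cvg_lim.
  - by move=> n x Ex //=; rewrite lee_fin.
  - by move=> x Ex a b ab; rewrite lee_fin; exact/lefP/nd_nnsfun_approx.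
transitivity (limn (fun n => \int[m]_(x in E) ((EFin \o h n) x * (w x)%:E))); last first.
  rewrite -monotone_convergence//.
  - apply: eq_integral => x /[!inE] /fE h1; apply/cvg_lim => //.
    exact: cvgeZr.
  - by move=> n; exact: emeasurable_funM.
  - by move=> n x Ex /=; rewrite mule_ge0 ?lee_fin.
  - by move=> x Ex a b ab/=; rewrite lee_wpmul2r ?lee_fin//;
      exact/lefP/nd_nnsfun_approx.
apply: congr_lim; apply/funext => n.
transitivity (\sum_(y \in range (h n))
    \int[density w0 mw]_(x in E) (y * \1_(h n @^-1` [set y]) x)%:E).
  rewrite -ge0_integral_fsum//.
  - by apply: eq_integral => t tE; rewrite /= fimfunE -fsumEFin.
  - move=> y; apply/measurable_EFinP.
    by apply: (measurable_funS measurableT) => //; exact: measurable_funM.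
  - by move=> y x Ex; exact: nnfun_muleindic_ge0.
transitivity (\sum_(y \in range (h n))
    \int[m]_(x in E) ((y * \1_(h n @^-1` [set y]) x)%:E * (w x)%:E)); last first.
  rewrite -ge0_integral_fsum//.
  - apply: eq_integral => x xE /=.
    rewrite -ge0_mule_fsuml => [|y]; last exact: nnfun_muleindic_ge0.
    by rewrite fsumEFin // -(fimfunE _ x).
  - move=> y; apply: emeasurable_funM => //; apply/measurable_EFinP.
    by apply: (measurable_funS measurableT) => //; exact: measurable_funM.
  - by move=> y x Ey; rewrite mule_ge0 ?lee_fin// -lee_fin nnfun_muleindic_ge0.
apply: eq_fsbigr => r rhn.
under [LHS]eq_integral do rewrite EFinM.
rewrite integralZl_indic_nnsfun => //.
under [RHS]eq_integral do rewrite EFinM -muleA.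
have mS : measurable (h n @^-1` [set r]) by [].
rewrite [RHS]ge0_integralZl//.
- congr (_ * _); rewrite integral_indic// setIC.
  transitivity (\int[m]_(x in E `&` h n @^-1` [set r]) (w x)%:E) => //.
  rewrite integral_mkcondr; apply: eq_integral => x _.
  rewrite /patch indicE; case: ifP => // _; rewrite ?mul1e ?mul0e//.
- by apply: emeasurable_funM => //; exact/measurable_EFinP.
- by move=> x Ex; rewrite mule_ge0 ?lee_fin.
- by move: rhn; rewrite inE => -[y _ <-]; rewrite lee_fin.
Qed.

End Density.

Section Transfer.
Local Open Scope ereal_scope.
Context d1 d2 (T1 : measurableType d1) (T2 : measurableType d2) (R : realType).
Variables (m1 : {measure set T1 -> \bar R}) (m2 : {measure set T2 -> \bar R}).

(** The hypothesis on sets says that [m2] on [V] is the image under [Phi] of the measure with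
    density [w] on [U]. The lemma turns each such statement about measures of sets into one about
    integrals. *)
Lemma ge0_integral_transfer (U : set T1) (V : set T2) (Phi : T1 -> T2) (w : T1 -> R)
    (h : T2 -> \bar R) :
  measurable U -> measurable V -> measurable_fun U Phi ->
  measurable_fun U w -> (forall x, U x -> (0 <= w x)%R) ->
  (forall x, U x -> V (Phi x)) ->
  (forall B, measurable B -> B `<=` V ->
     m2 B = \int[m1]_(x in U `&` Phi @^-1` B) (w x)%:E) ->
  measurable_fun V h -> (forall y, V y -> 0 <= h y) ->
  \int[m2]_(y in V) h y = \int[m1]_(x in U) (h (Phi x) * (w x)%:E).
Proof.
move=> mU mV mPhi mw w0 UV m12 mh h0.
(* Pushforwards require maps measurable on the whole space. The value [point] off [U] does no harm
   because the density is extended by 0 there. *)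
pose Phi' := fun x => if x \in U then Phi x else point.
pose w' := w \_ U.
have w'0 x : (0 <= w' x)%R.
  by rewrite /w' patchE; case: ifPn => //; rewrite inE => /w0.
have mw' : measurable_fun setT w' by apply/(measurable_restrictT _ mU).
have mPhi' : measurable_fun setT Phi'.
  apply: measurable_fun_if => //.
  - apply: (measurable_fun_bool true); rewrite setTI (_ : _ @^-1` _ = U) //.
    by apply/seteqP; split=> x /=; [move=> h1; apply: set_mem|move=> Ux; apply: mem_set].
  - rewrite setTI (_ : _ @^-1` _ = U) //.
    by apply/seteqP; split=> x /=; [move=> h1; apply: set_mem|move=> Ux; apply: mem_set].
have E1 x : U x -> Phi' x = Phi x by move=> Ux; rewrite /Phi' mem_set.
have E2 x : U x -> w' x = w x by move=> Ux; rewrite /w' patchE mem_set.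
have mpre B : measurable B -> measurable (Phi' @^-1` B).
  by move=> mB; rewrite -[X in measurable X]setTI; exact: mPhi'.
have restrictE (f : T1 -> \bar R) A : measurable A ->
    \int[m1]_(x in A) (f x * (w' x)%:E) = \int[m1]_(x in U `&` A) (f x * (w x)%:E).
  move=> mA; rewrite setIC integral_mkcondr; apply: eq_integral => x _.
  by rewrite /w' !patchE; case: ifP => _ //; rewrite mule0.
have P := ge0_integral_pushforward mPhi' (density m1 w'0 mw') mV mh
  (fun y yV => h0 y (set_mem yV)).
apply: (etrans (etrans _ P)).
  apply: eq_measure_integral => B mB BV; rewrite /= /pushforward /density.
  rewrite m12//; under [RHS]eq_integral do rewrite -[(w' _)%:E]mul1e.
  rewrite restrictE; last exact: mpre.
  under [RHS]eq_integral do rewrite mul1e.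
  by congr integral; apply/seteqP; split=> x [Ux] /=; rewrite E1.
rewrite ge0_integral_density; last 3 first.
- exact: mpre.
- apply: (measurable_comp mV) => //; first by move=> _ [x Vx <-].
  by apply: (measurable_funS measurableT).
- by move=> x Vx; exact: h0.
rewrite (restrictE (h \o Phi')); last exact: mpre.
rewrite (_ : U `&` _ = U); last first.
  by apply/seteqP; split=> [x []//|x Ux]; split=> //=; rewrite E1//; exact: UV.
by apply: eq_integral => x; rewrite inE => Ux /=; rewrite E1.
Qed.

End Transfer.

(** * Derivatives as matrices *)

Section HasDerivative.
Context {R : realType}.

Lemma coord_le_norm n (x : 'rV[R]_n) i : `|x 0 i| <= `|x|.
Proof.
rewrite [leRHS]/Num.norm /= mx_normrE.
by apply/bigmax_geP; right => /=; exists (0, i).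
Qed.

Lemma norm_le_coord n (x : 'rV[R]_n) e : 0 <= e ->
  (forall i, `|x 0 i| <= e) -> `|x| <= e.
Proof.
move=> e0 h; rewrite [leLHS]/Num.norm /= mx_normrE.
by apply/bigmax_leP; split=> // -[i j] _ /=; rewrite (ord1 i); exact: h.
Qed.

Lemma mulmx_bound n m (M : 'M[R]_(n, m)) :
  exists2 C, 0 < C & forall v : 'rV[R]_n, `|v *m M| <= C * `|v|.
Proof.
pose C := 1 + \sum_i \sum_j `|M i j|.
have S0 : 0 <= \sum_i \sum_j `|M i j| by do 2 apply: sumr_ge0 => ? _.
exists C => [|v]; first by rewrite /C ltr_pwDl.
apply: norm_le_coord => [|j]; first by rewrite mulr_ge0// /C addr_ge0.
rewrite mxE; apply: (le_trans (ler_norm_sum _ _ _)).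
apply: (@le_trans _ _ (\sum_i `|v| * `|M i j|)).
  by apply: ler_sum => i _; rewrite normrM ler_wpM2r// coord_le_norm.
rewrite -mulr_sumr mulrC ler_wpM2r//.
rewrite /C (@le_trans _ _ (\sum_i \sum_j `|M i j|)) ?lerDr//.
by apply: ler_sum => i _; rewrite (bigD1 j)//= lerDl sumr_ge0.
Qed.

(** Frechet differentiability with the derivative exhibited as a matrix acting on row vectors from
    the right. It suits maps obtained by choice, such as the normal or a transition map, whose
    derivative is found before any differentiability is known. *)
Definition has_derivative n m (f : 'rV[R]_n -> 'rV[R]_m) x (L : 'M[R]_(n, m)) :=
  forall e, 0 < e -> \forall y \near x, `|f y - f x - (y - x) *m L| <= e * `|y - x|.

Lemma has_derivative_lipschitz n m (f : 'rV[R]_n -> 'rV[R]_m) x L :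
  has_derivative f x L ->
  exists2 C, 0 < C & \forall y \near x, `|f y - f x| <= C * `|y - x|.
Proof.
move=> df; have [C C0 hC] := mulmx_bound L; exists (1 + C); first by rewrite addr_gt0.
apply: filterS (df 1 ltr01) => y h.
rewrite -[f y - f x](subrK ((y - x) *m L)) (le_trans (ler_normD _ _))// mulrDl lerD//.
Qed.

Lemma has_derivative_continuous n m (f : 'rV[R]_n -> 'rV[R]_m) x L :
  has_derivative f x L -> {for x, continuous f}.
Proof.
move=> /has_derivative_lipschitz[C C0 hC] A /nbhs_ballP[e /= e0 hA].
have hb : \forall y \near x, `|y - x| < e / C.
  apply/nbhs_ballP; exists (e / C) => /=; first by rewrite divr_gt0.
  by move=> y; rewrite -ball_normE /= distrC.
apply: filterS2 hC hb => y hC hb; apply: hA.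
by rewrite -ball_normE /= distrC (le_lt_trans hC)// -ltr_pdivlMl// mulrC.
Qed.

Lemma has_derivative_affine n m (M : 'M[R]_(n, m)) w x :
  has_derivative (fun y => y *m M + w) x M.
Proof.
move=> e e0; apply/nbhs_ballP; exists 1 => [|y _] /=; first exact: ltr01.
rewrite opprD addrACA subrr addr0 -mulmxBl subrr normr0.
by rewrite mulr_ge0// ltW.
Qed.

Lemma has_derivative_comp n m p (f : 'rV[R]_n -> 'rV[R]_m) (g : 'rV[R]_m -> 'rV[R]_p) x L M :
  has_derivative f x L -> has_derivative g (f x) M -> has_derivative (g \o f) x (L *m M).
Proof.
move=> df dg e e0.
have [C C0 hC] := mulmx_bound M; have [D D0 hD] := has_derivative_lipschitz df.
have cf : f y @[y --> x] --> f x := has_derivative_continuous df.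
have e1 : 0 < e / (2 * D) by rewrite divr_gt0// mulr_gt0.
have e2 : 0 < C^-1 * (e / 2) by rewrite mulr_gt0 ?invr_gt0// divr_gt0.
have Hg : \forall y \near x, `|g (f y) - g (f x) - (f y - f x) *m M| <=
  e / (2 * D) * `|f y - f x| := cf _ (dg _ e1).
apply: filterS3 Hg (df _ e2) hD => y h1 h2 h3.
have -> : (g \o f) y - (g \o f) x - (y - x) *m (L *m M) =
    (g (f y) - g (f x) - (f y - f x) *m M) + (f y - f x - (y - x) *m L) *m M.
  by rewrite [in X in _ = _ + X]mulmxBl mulmxA /= addrA subrK.
rewrite (le_trans (ler_normD _ _))// (splitr e) mulrDl lerD//.
  apply: (le_trans h1); rewrite [leRHS](_ : _ = e / (2 * D) * (D * `|y - x|)).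
    by rewrite ler_wpM2l// ltW.
  by field; rewrite gt_eqF.
by apply: (le_trans (hC _)); rewrite -ler_pdivlMl// mulrA.
Qed.

Lemma has_derivative_near n m (f g : 'rV[R]_n -> 'rV[R]_m) x L :
  (\forall y \near x, f y = g y) -> has_derivative f x L -> has_derivative g x L.
Proof.
move=> fg df e e0; have fgx : f x = g x := nbhs_singleton fg.
by apply: filterS2 fg (df e e0) => y <- ; rewrite fgx.
Qed.

(** With r the remainder of [f] at [g y], one has g y - x = (y - f x - r) L^-1. Since [g] is
    continuous, r is small compared with g y - x, and it can be absorbed in the left-hand side. *)
Lemma has_derivative_inverse n (f g : 'rV[R]_n -> 'rV[R]_n) x L :
  has_derivative f x L -> L \in unitmx ->
  (\forall y \near f x, f (g y) = y) -> g (f x) = x ->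
  {for f x, continuous g} -> has_derivative g (f x) (invmx L).
Proof.
move=> df uL fg gfx cg e e0.
have [C C0 hC] := mulmx_bound (invmx L).
have cg' : g y @[y --> f x] --> x by rewrite -{2}gfx.
(* The first bound makes the absorption possible and gives |g y - x| <= 2 C |y - f x|; the second
   turns this into the final error e |y - f x|. *)
pose e1 := Num.min ((2 * C)^-1) (e / (2 * C * C)).
have e10 : 0 < e1 by rewrite lt_min invr_gt0 divr_gt0 ?mulr_gt0.
have Hg : \forall y \near f x, `|f (g y) - f x - (g y - x) *m L| <= e1 * `|g y - x|
  := cg' _ (df _ e10).
apply: filterS2 fg Hg => y fgy Hr; rewrite gfx.
set r := f (g y) - f x - (g y - x) *m L in Hr.
have E : g y - x - (y - f x) *m invmx L = - (r *m invmx L).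
  by rewrite /r fgy [in RHS]mulmxBl mulmxK// opprB.
have Hb : `|g y - x| <= 2 * C * `|y - f x|.
  have h1 : `|g y - x| <= C * `|y - f x| + C * (e1 * `|g y - x|).
    rewrite -[X in `|X| <= _](subrK ((y - f x) *m invmx L)) E addrC.
    rewrite (le_trans (ler_normD _ _))// lerD// normrN.
    by rewrite (le_trans (hC _))// ler_pM2l.
  have h2 : C * (e1 * `|g y - x|) <= `|g y - x| / 2.
    rewrite mulrA [leRHS]mulrC ler_wpM2r//.
    apply: (@le_trans _ _ (C * (2 * C)^-1)).
      by rewrite ler_pM2l// /e1 ge_min lexx.
    by rewrite invfM mulrCA mulfV ?gt_eqF// mulr1.
  lra.
rewrite E normrN (le_trans (hC _))//.
apply: (@le_trans _ _ (C * (e1 * (2 * C * `|y - f x|)))).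
  by rewrite ler_pM2l// (le_trans Hr)// ler_pM2l.
apply: (@le_trans _ _ (C * (e / (2 * C * C) * (2 * C * `|y - f x|)))).
  rewrite ler_pM2l// ler_wpM2r//; first by rewrite !mulr_ge0// ltW.
  by rewrite /e1 ge_min lexx orbT.
rewrite [leLHS](_ : _ = e * `|y - f x|)//.
by field; rewrite gt_eqF.
Qed.

Lemma has_derivative_unique n m (f : 'rV[R]_n -> 'rV[R]_m) x L M :
  has_derivative f x L -> has_derivative f x M -> L = M.
Proof.
move=> dL dM; apply/matrixP => i j; apply/eqP; rewrite -subr_eq0 -normr_eq0.
apply/eqP/le_anti; rewrite normr_ge0 andbT; apply/ler_addgt0Pl => e e0; rewrite addr0.
have e2 : 0 < e / 2 by rewrite divr_gt0.
have /nbhs_ballP[r /= r0 hr] : nbhs x [set y | `|(y - x) *m (L - M)| <= e * `|y - x|].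
  move: (dL _ e2) (dM _ e2); apply: filterS2 => y h1 h2.
  rewrite /= mulmxBr (splitr e) mulrDl.
  rewrite (_ : _ - _ = (f y - f x - (y - x) *m M) - (f y - f x - (y - x) *m L)).
    by rewrite (le_trans (ler_normB _ _))// addrC lerD.
  by rewrite opprB [RHS]addrC addrA subrK.
have := hr (x + (r / 2) *: delta_mx 0 i).
rewrite -ball_normE /= opprD addrA subrr sub0r normrN addrAC subrr add0r.
have N : `|(r / 2) *: (delta_mx 0 i : 'rV[R]_n)| <= r / 2.
  apply: norm_le_coord => [|k]; first by rewrite divr_ge0// ltW.
  rewrite !mxE normrM gtr0_norm ?divr_gt0//.
  rewrite ler_piMr//; first by rewrite divr_ge0// ltW.
  by case: (_ && _); rewrite ?normr1 ?normr0.
move=> /(_ (le_lt_trans N _)) H.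
have {}H := H ltac:(by rewrite ltr_pdivrMr// mulr_natr mulr2n ltrDl).
have := le_trans (le_trans (coord_le_norm _ j) H) (ler_wpM2l (ltW e0) N).
rewrite -scalemxAl -rowE !mxE normrM gtr0_norm ?divr_gt0// mulrC.
by rewrite ler_pM2r ?divr_gt0.
Qed.

Lemma compact_image_bounded n (V : normedModType R) (K : set 'rV[R]_n)
    (f : 'rV[R]_n -> V) : compact K -> (forall x, K x -> {for x, continuous f}) ->
  exists2 C, 0 < C & forall x, K x -> `|f x| <= C.
Proof.
move=> cK cf.
have /compact_bounded[C [_ hC]] : compact (f @` K).
  apply: continuous_compact => //; apply: continuous_in_subspaceT => x.
  by rewrite inE => /cf.
exists (`|C| + 1); first by rewrite ltr_wpDl.
move=> x Kx; apply: hC; last by exists x.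
by rewrite (le_lt_trans (ler_norm C))// ltrDl.
Qed.

End HasDerivative.

(** * A bisection principle for additive box functions *)

Section Bisection.
Context {R : realType} (n : nat).
Implicit Types (a c d s : 'rV[R]_n) (F : 'rV[R]_n -> 'rV[R]_n -> R).

Definition upd c i m : 'rV[R]_n := \row_k if k == i then m else c 0 k.

Definition box_additive F := forall c d i m,
  (forall k, c 0 k <= d 0 k) -> c 0 i <= m <= d 0 i ->
  F c d = F c (upd d i m) + F (upd c i m) d.

Let half (j : nat) (l : R) s : 'rV[R]_n :=
  \row_i ((if (i < j)%N then l / 2 else l) * s 0 i).

(** The sides are halved one coordinate at a time. Of the two pieces produced by a cut, one keeps at
    least half of |F|, so the ratio of |F| to the volume does not drop below [K]. *)
Let halve F s c l K : box_additive F -> (forall i, 0 < s 0 i) -> 0 < l ->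
  K * \prod_i (l * s 0 i) <= `|F c (c + l *: s)| ->
  forall j, (j <= n)%N -> exists c',
    (forall i, c 0 i <= c' 0 i <= c 0 i + l / 2 * s 0 i) /\
    (forall i : 'I_n, ~~ (i < j)%N -> c' 0 i = c 0 i) /\
    K * \prod_i half j l s 0 i <= `|F c' (c' + half j l s)|.
Proof.
move=> aF s0 l0 h; elim=> [_|j IH jn].
  exists c; split=> [i|]; first by rewrite lexx lerDl mulr_ge0 ?divr_ge0// ltW.
  split=> //.
  rewrite (_ : half 0 l s = l *: s); last by apply/rowP => i; rewrite !mxE.
  by under eq_bigr do rewrite mxE.
have [c' [h1 [h2 h3]]] := IH (ltnW jn).
pose i0 := Ordinal jn.
pose m := c' 0 i0 + l / 2 * s 0 i0.
have half0 k i : 0 < half k l s 0 i.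
  by rewrite mxE mulr_gt0//; case: ifP => _ //; rewrite divr_gt0.
have kE (k : 'I_n) : k != i0 -> (k < j.+1)%N = (k < j)%N.
  move=> ki0; rewrite [RHS]ltn_neqAle ltnS.
  suff -> : val k != j by [].
  by apply: contraNneq ki0 => kj; apply/eqP/val_inj.
have E := aF c' (c' + half j l s) i0 m.
have {}E : F c' (c' + half j l s) =
    F c' (c' + half j.+1 l s) + F (upd c' i0 m) (upd c' i0 m + half j.+1 l s).
  rewrite E.
  - congr (F _ _ + F _ _); apply/rowP => k; rewrite !mxE.
      case: eqP => [->|/eqP ki0]; first by rewrite /m /= ltnSn.
      by rewrite kE.
    case: eqP => [->|/eqP ki0].
      by rewrite /m /= ltnSn ltnn -addrA -mulrDl -splitr.
    by rewrite kE.
  - by move=> k; rewrite [leRHS]mxE lerDl ltW.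
  - rewrite /m lerDl !mxE /= ltnn lerD2l ler_pM2r// mulr_ge0 ?divr_ge0 ?ltW//=.
    by rewrite ltr_pdivrMr// mulr_natr mulr2n ltrDl.
have V : \prod_i half j l s 0 i = 2 * \prod_i half j.+1 l s 0 i.
  rewrite (bigD1 i0)//= [in RHS](bigD1 i0)//= mulrA; congr (_ * _).
    by rewrite !mxE /= ltnn ltnSn; field.
  by apply: eq_bigr => k ki0; rewrite !mxE kE.
have [hA|hB] : K * \prod_i half j.+1 l s 0 i <= `|F c' (c' + half j.+1 l s)| \/
   K * \prod_i half j.+1 l s 0 i <= `|F (upd c' i0 m) (upd c' i0 m + half j.+1 l s)|.
  move: h3; rewrite E V.
  set p := \prod_i _; set A := F _ _; set B := F _ _ => h3.
  case: (lerP (K * p) `|A|) => hA; [by left|right].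
  have := le_trans h3 (ler_normD A B); lra.
- exists c'; split=> //; split=> // i ij; apply: h2; apply: contra ij => ij.
  exact: ltnW.
- exists (upd c' i0 m); split=> [i|]; last first.
    split=> // i ij; rewrite mxE; case: eqP => [iE|_].
      by move: ij; rewrite iE /= ltnSn.
    by apply: h2; apply: contra ij => ij; exact: ltnW.
  rewrite mxE; case: eqP => [->|_]//.
  rewrite /m h2 /= ?ltnn// lexx andbT lerDl mulr_ge0 ?divr_ge0 ?ltW//.
Qed.

(** If F were nonzero, successive halvings would give nested boxes of similar shape on which |F|
    stays at least [K] times the volume, where [K] is the initial ratio. They shrink to a point [z],
    where the local hypothesis with e = K/2 is contradicted. *)
Lemma bisection_eq0 F a s : (forall i, 0 < s 0 i) -> box_additive F ->
  (forall z : 'rV[R]_n, (forall i, a 0 i <= z 0 i <= a 0 i + s 0 i) -> forall e, 0 < e ->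
    exists2 dl, 0 < dl & forall c (l : R), 0 < l < dl ->
      (forall i, c 0 i <= z 0 i <= c 0 i + l * s 0 i) ->
      (forall i, a 0 i <= c 0 i /\ c 0 i + l * s 0 i <= a 0 i + s 0 i) ->
      `|F c (c + l *: s)| <= e * \prod_i (l * s 0 i)) ->
  F a (a + s) = 0.
Proof.
move=> s0 aF loc; apply/eqP; rewrite -normr_eq0; apply/negPn/negP => F0.
have {}F0 : 0 < `|F a (a + s)| by rewrite lt_neqAle eq_sym F0 normr_ge0.
have vs : 0 < \prod_i s 0 i by exact: prodr_gt0.
pose K := `|F a (a + s)| / \prod_i s 0 i.
have K0 : 0 < K by rewrite divr_gt0.
pose l k : R := 2^-1 ^+ k.
have l0 k : 0 < l k by rewrite exprn_gt0// invr_gt0.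
pose good c k := K * \prod_i (l k * s 0 i) <= `|F c (c + l k *: s)|.
have step c k : good c k -> exists c', good c' k.+1 /\
    forall i, c 0 i <= c' 0 i <= c 0 i + l k.+1 * s 0 i.
  move=> gc; have [c' [h1 [_ h2]]] := halve aF s0 (l0 k) gc (leqnn n).
  have lS : l k.+1 = l k / 2 by rewrite /l exprSr.
  have hE : half n (l k) s = l k.+1 *: s.
    by apply/rowP => i; rewrite !mxE ltn_ord lS.
  exists c'; split; last by rewrite lS.
  by move: h2; rewrite /good hE; under eq_bigr do rewrite mxE.
pose f := fix f k := if k is k'.+1 then
  xget (f k') [set c' | good c' k'.+1 /\
    forall i, f k' 0 i <= c' 0 i <= f k' 0 i + l k'.+1 * s 0 i] else a.
have fS k : good (f k) k -> good (f k.+1) k.+1 /\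
    forall i, f k 0 i <= f k.+1 0 i <= f k 0 i + l k.+1 * s 0 i.
  by move=> gk; rewrite /=; case: xgetP => [y _ //|h]; have [c' hc'] := step _ _ gk;
    case: (h c').
have gf k : good (f k) k.
  elim: k => [|k /fS[]//]; rewrite /good /l expr0 scale1r /=.
  by under eq_bigr do rewrite mul1r; rewrite /K divfK// gt_eqF.
have fl k j i : f k 0 i <= f (k + j)%N 0 i /\
    f (k + j)%N 0 i + l (k + j)%N * s 0 i <= f k 0 i + l k * s 0 i.
  elim: j => [|j [IH1 IH2]]; first by rewrite addn0.
  have [_ /(_ i)/andP[h1 h2]] := fS _ (gf (k + j)%N).
  rewrite addnS; split; first exact: le_trans h1.
  apply: le_trans IH2.
  have -> : l (k + j)%N = l (k + j).+1 + l (k + j).+1 by rewrite /l exprS; field.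
  by rewrite mulrDl addrA lerD2r.
have fle k j i : f k 0 i <= f j 0 i + l j * s 0 i.
  have [kj|/ltnW jk] := leqP k j.
    have [h _] := fl k (j - k)%N i; move: h; rewrite subnKC// => h.
    by rewrite (le_trans h)// lerDl mulr_ge0// ltW.
  have [_ h] := fl j (k - j)%N i; move: h; rewrite subnKC// => h.
  by apply: le_trans h; rewrite lerDl mulr_ge0// ltW.
(* The common point of the nested boxes: the lower corners increase in each coordinate and are
   bounded by every upper corner. *)
pose z : 'rV[R]_n := \row_i sup (range (fun k => f k 0 i)).
have zP k i : f k 0 i <= z 0 i <= f k 0 i + l k * s 0 i.
  rewrite mxE; apply/andP; split.
    apply: ub_le_sup; last by exists k.
    by exists (f 0 0 i + l 0 * s 0 i) => _ [j _ <-].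
  apply: ge_sup; first by exists (f 0 0 i), 0.
  by move=> _ [j _ <-].
have K20 : 0 < K / 2 by rewrite divr_gt0.
have [i|dl dl0 hdl] := loc z _ (K / 2) K20.
  by have := zP 0 i; rewrite /l expr0 mul1r.
have [k hk] : exists k, l k < dl.
  have /cvgrPdist_lt/(_ _ dl0)[k _ hk] : l k @[k --> \oo] --> (0 : R).
    by apply: cvg_expr; rewrite ger0_norm ?invr_ge0// invf_lt1// ltr1n.
  by exists k; have := hk k (leqnn k); rewrite /= sub0r normrN gtr0_norm.
have := hdl (f k) (l k); rewrite l0 hk => /(_ isT (zP k)) H.
have {}H := le_trans (gf k) (H _).
have /H : forall i, a 0 i <= f k 0 i /\ f k 0 i + l k * s 0 i <= a 0 i + s 0 i.
  by move=> i; have := fl 0%N k i; rewrite add0n /l expr0 mul1r.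
rewrite ler_pM2r; last by apply: prodr_gt0 => i _; rewrite mulr_gt0.
by rewrite ler_pdivlMr// mulr_natr mulr2n gerDl leNgt K0.
Qed.

End Bisection.

(** * The change of variables formula *)

Section ChangeOfVariables.
Context {R : realType}.
Local Notation leb n := (lebesgue_rV R n).

Lemma continuous_on_measurable_rV n m (D : set 'rV[R]_n) (f : 'rV[R]_n -> 'rV[R]_m) :
  continuous_on D f -> measurable_fun D f.
Proof.
move=> cf; apply: measurable_fun_rV_in => i.
apply: (@continuous_on_measurable _ _ D (fun x => f x 0 i)) => x Dx A hA.
apply: (cf x Dx [set y : 'rV[R]_m | A (y 0 i)]).
exact: (@coord_continuous R 1 m 0 i (f x)).
Qed.

Lemma continuous_continuous_on {T S : topologicalType} (D : set T) (f : T -> S) :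
  (forall x, D x -> {for x, continuous f}) -> continuous_on D f.
Proof. by move=> cf x Dx; apply: cvg_within_filter; exact: cf. Qed.

Lemma boxI n (a b c d : 'rV[R]_n) : box a b `&` box c d =
  box (\row_i Num.max (a 0 i) (c 0 i)) (\row_i Num.min (b 0 i) (d 0 i)).
Proof.
apply/seteqP; split=> [x [h1 h2] i|x h].
  have /andP[? ?] := h1 i; have /andP[? ?] := h2 i.
  by rewrite !mxE gt_max le_min; apply/andP; split; apply/andP.
split=> i; have := h i; rewrite !mxE gt_max le_min => /andP[/andP[? ?] /andP[? ?]];
  exact/andP.
Qed.

Lemma measurable_rV_boxes n : @measurable _ 'rV[R]_n =
  <<s [set A | exists a b, A = box a b] >>.
Proof.
apply/seteqP; split; last first.
  apply: smallest_sub; first exact: sigma_algebra_measurable.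
  by move=> _ [a [b ->]]; exact: measurable_box.
apply: smallest_sub; first exact: smallest_sigma_algebra.
case: n => [|n]; first by rewrite big_ord0.
rewrite -bigcup_mkord_ord => A [i Ii [Y mY <-]].
rewrite setTI; set j := inord i; move: j => j {Ii A}.
pose G := <<s [set A | exists a b : 'rV[R]_n.+1, A = box a b] >>.
suff : measurable `<=` [set Z : set (measurableTypeR R) | G (@rV_coord R _ j @^-1` Z)].
  by apply.
have sG : sigma_algebra setT G by exact: smallest_sigma_algebra.
apply: smallest_sub.
  split=> [|Z hZ|F hF] /=.
  - by rewrite preimage_set0; case: sG.
  - by rewrite setTD preimage_setC -setTD; case: sG => _ h _; exact: h.
  - by rewrite preimage_bigcup; case: sG => _ _; exact.
move=> _ [[x y] _ <-] /=.
(* A slab in direction [j] is the increasing union of boxes whose other sides are ]-k, k]. *)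
rewrite (_ : _ @^-1` _ = \bigcup_k box
   (\row_i (if i == j then x else - k%:R))
   (\row_i (if i == j then y else k%:R))).
  by case: sG => _ _; apply=> k; apply: sub_sigma_algebra; eexists; eexists.
apply/seteqP; split=> [z|z [k _ /(_ j)]]; last by rewrite !mxE eqxx /rV_coord /= in_itv.
rewrite /rV_coord /= in_itv /= => hz.
exists (Num.truncn `|z|).+1 => // p; rewrite !mxE; case: eqP => [->//|_].
have h : `|z 0 p| < (Num.truncn `|z|).+1%:R.
  exact: le_lt_trans (coord_le_norm z p) (truncnS_gt _).
by move: h; rewrite ltr_norml => /andP[-> /ltW].
Qed.

(** The boxes keep the fixed proportions [s], so |x - z| is at most a constant times each side. An
    error that is small relative to |x - z| is therefore small relative to every side at once. *)
Lemma near_identity_box n (G : 'rV[R]_n -> 'rV[R]_n) z (P : 'rV[R]_n -> Prop) (s : 'rV[R]_n) (e : R) :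
  has_derivative G z 1%:M -> G z = z -> (\forall x \near z, P x) ->
  (forall i, 0 < s 0 i) -> 0 < e ->
  exists2 dl, 0 < dl & forall (l : R) (x : 'rV[R]_n), 0 < l < dl ->
    (forall i, `|x 0 i - z 0 i| <= l * s 0 i) ->
    P x /\ forall i, `|G x 0 i - x 0 i| <= e * (l * s 0 i).
Proof.
move=> dG Gz Pz s0 e0.
pose k := `|s| * \sum_i (s 0 i)^-1 + 1.
have S0 : 0 <= \sum_i (s 0 i)^-1 by apply: sumr_ge0 => i _; rewrite invr_ge0 ltW.
have k0 : 0 < k by rewrite ltr_wpDl// mulr_ge0.
have ks i : `|s| <= k * s 0 i.
  have h : (s 0 i)^-1 <= \sum_i (s 0 i)^-1.
    by rewrite [leRHS](bigD1 i)//= lerDl sumr_ge0// => j _; rewrite invr_ge0 ltW.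
  rewrite /k mulrDl mul1r (@le_trans _ _ (`|s| * (\sum_i (s 0 i)^-1) * s 0 i))//.
    rewrite -mulrA ler_peMr// -[leLHS](@mulVf _ (s 0 i)) ?gt_eqF//.
    by rewrite ler_wpM2r// ltW.
  by rewrite lerDl ltW.
have ek : 0 < e / k by rewrite divr_gt0.
have /nbhs_ballP[r /= r0 hr] : nbhs z [set x | P x /\
    `|G x - G z - (x - z) *m 1%:M| <= e / k * `|x - z|].
  exact: filterI Pz (dG _ ek).
exists (r / (`|s| + 1)); first by rewrite divr_gt0// ltr_wpDl.
move=> l x /andP[l0 ldl] hx.
have ls i : 0 <= l * s 0 i by rewrite mulr_ge0// ltW.
have xz : `|x - z| <= l * `|s|.
  apply: norm_le_coord => [|i]; first by rewrite mulr_ge0// ltW.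
  rewrite !mxE (le_trans (hx i))// ler_wpM2l//; first exact: ltW.
  by rewrite (le_trans (ler_norm _))// coord_le_norm.
have [] := hr x.
  rewrite -ball_normE /= distrC (le_lt_trans xz)//.
  apply: (@le_lt_trans _ _ (l * (`|s| + 1))); first by rewrite ler_pM2l// lerDl.
  by rewrite -ltr_pdivlMr// ltr_wpDl.
move=> Px; rewrite Gz mulmx1 => h; split=> // i.
have -> : G x 0 i - x 0 i = (G x - z - (x - z)) 0 i by rewrite !mxE; ring.
rewrite (le_trans (coord_le_norm _ _))// (le_trans h)//.
apply: (@le_trans _ _ (e / k * (l * (k * s 0 i)))).
  rewrite ler_pM2l//; apply: (le_trans xz); rewrite ler_pM2l//.
by rewrite [leLHS](_ : _ = e * (l * s 0 i))//; field; rewrite gt_eqF.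
Qed.

Lemma prod_cst_scale n (t : R) (v : 'I_n -> R) :
  \prod_i (t * v i) = t ^+ n * \prod_i v i.
Proof. by rewrite big_split /= prodr_const card_ord. Qed.

(** Moving every face of a box outwards or inwards by t times the corresponding side multiplies the
    volume by (1 + 2t)^n or (1 - 2t)^n. *)
Lemma power_near1 n (e : R) : 0 < e -> exists2 t, 0 < t < 2^-1 &
  (1 + 2 * t) ^+ n <= 1 + e /\ 1 - e <= (1 - 2 * t) ^+ n.
Proof.
move=> e0.
have /cvgrPdist_le/(_ _ e0)/nbhs_ballP[r /= r0 hr] := @exprn_continuous R n 1.
pose t := Num.min (4^-1) (r / 4).
have t0 : 0 < t by rewrite lt_min divr_gt0// andbT invr_gt0.
have tr : t <= r / 4 by rewrite ge_min lexx orbT.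
have t4 : t <= 4^-1 by rewrite ge_min lexx.
exists t; first by apply/andP; split=> //; lra.
have h1 : `|1 ^+ n - (1 + 2 * t) ^+ n| <= e.
  by apply: hr; rewrite /ball /= opprD addrA subrr sub0r normrN gtr0_norm; lra.
have h2 : `|1 ^+ n - (1 - 2 * t) ^+ n| <= e.
  by apply: hr; rewrite /ball /= opprB addrC subrK gtr0_norm; lra.
move: h1 h2; rewrite expr1n !ler_norml => /andP[? ?] /andP[? ?]; lra.
Qed.

Lemma lebesgue_affine_box n (M : 'M[R]_n) (y0 z c : 'rV[R]_n) t (s : 'rV[R]_n) :
  M \in unitmx -> 0 <= t -> (forall i, 0 <= s 0 i) ->
  leb n [set y | box c (c + t *: s) ((y - y0) *m invmx M + z)] =
   (`|\det M| * (t ^+ n * \prod_i s 0 i))%:E.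
Proof.
move=> uM t0 s0.
have mB := measurable_box c (c + t *: s).
have mB' : measurable [set x | box c (c + t *: s) (x + (z - y0 *m invmx M))].
  have := measurable_affine_preimage 1%:M (z - y0 *m invmx M) mB.
  by congr measurable; apply/seteqP; split=> x /=; rewrite mulmx1.
rewrite (_ : [set y | _] = [set y | [set x | box c (c + t *: s)
    (x + (z - y0 *m invmx M))] (y *m invmx M)]); last first.
  by apply/seteqP; split=> y /=; rewrite mulmxBl addrA addrAC.
rewrite lebesgue_linear ?unitmx_inv// lebesgue_translate// lebesgue_box.
  rewrite det_inv normfV invrK -EFinM; congr (_ * _)%:E.
  rewrite -prod_cst_scale; apply: eq_bigr => i _; rewrite !mxE; ring.
by move=> i; rewrite !mxE lerDl mulr_ge0.
Qed.

Section Setting.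
Variables (n : nat) (U V : set 'rV[R]_n) (Phi Psi : 'rV[R]_n -> 'rV[R]_n).
Variable L : 'rV[R]_n -> 'M[R]_n.
Hypotheses (oU : open U) (oV : open V).
Hypothesis UV : forall x, U x -> V (Phi x) /\ Psi (Phi x) = x.
Hypothesis VU : forall y, V y -> U (Psi y) /\ Phi (Psi y) = y.
Hypothesis dPhi : forall x, U x -> has_derivative Phi x (L x).
Hypothesis uL : forall x, U x -> L x \in unitmx.
Hypothesis cPsi : forall y, V y -> {for y, continuous Psi}.
Hypothesis cL : forall x, U x -> {for x, continuous (fun x => \det (L x))}.

Let w x := `|\det (L x)|.

Let mU : measurable U. Proof. exact: open_measurable_rV. Qed.
Let mV : measurable V. Proof. exact: open_measurable_rV. Qed.

Let cw x : U x -> {for x, continuous w}.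
Proof.
move=> Ux; apply: continuous_comp; first exact: cL.
exact: norm_continuous.
Qed.

Let mw : measurable_fun U w.
Proof. by apply: continuous_on_measurable; exact: continuous_continuous_on. Qed.

Let mPsi : measurable_fun V Psi.
Proof. by apply: continuous_on_measurable_rV; exact: continuous_continuous_on. Qed.

Let w'0 x : 0 <= (w \_ U) x.
Proof. by rewrite patchE; case: ifP => // _; exact: normr_ge0. Qed.

Let mw' : measurable_fun setT (w \_ U).
Proof. exact/(measurable_restrictT _ mU). Qed.

Let Psi' := Psi \_ V.

Let mPsi' : measurable_fun setT Psi'.
Proof. exact/(measurable_restrictT _ mV). Qed.

(** [N] carries Lebesgue measure on [V] to [U] by [Psi], and [M] has density |det L| on [U]. The
    existential keeps these values and hides the extensions of [Psi] and [w] to the whole space. *)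
Let NM : exists N M : {measure set 'rV[R]_n -> \bar R},
  (forall A, measurable A -> N A = leb n (V `&` Psi @^-1` A)) /\
  (forall A, measurable A -> M A = (\int[leb n]_(x in U `&` A) (w x)%:E)%E).
Proof.
pose N := pushforward (mrestr (leb n) mV) Psi' : {measure set _ -> \bar R}.
exists (N mPsi'), (density (leb n) w'0 mw'); split=> A mA.
  rewrite /N /= /pushforward /mrestr; congr (leb n _).
  by apply/seteqP; split=> y /= [h1 h2]; split=> //; move: h1 h2;
    rewrite /Psi' /= patchE => h1 h2; first (by rewrite mem_set in h1); rewrite mem_set.
rewrite /= /density setIC [in RHS]integral_mkcondr; apply: eq_integral => x _.
by rewrite !patchE; case: ifP.
Qed.

(** After composition with the affine approximation at [z], both [Phi] and [Psi] have derivative 1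
    there. The estimate for [Phi] puts the image of a small box inside the affine image of a
    slightly larger box; the one for [Psi] shows that it contains the affine image of a slightly
    smaller one. *)
Let box_local z : U z -> forall (s : 'rV[R]_n) (e : R), (forall i, 0 < s 0 i) -> 0 < e ->
  exists2 dl, 0 < dl & forall (c : 'rV[R]_n) (l : R), 0 < l < dl ->
    (forall i, c 0 i <= z 0 i <= c 0 i + l * s 0 i) ->
    [/\ forall x, box c (c + l *: s) x -> U x,
     (leb n (V `&` Psi @^-1` box c (c + l *: s)) <=
        ((w z + e) * \prod_i (l * s 0 i))%:E)%E,
     (((w z - e) * \prod_i (l * s 0 i))%:E <=
       leb n (V `&` Psi @^-1` box c (c + l *: s)))%E &
     (\int[leb n]_(x in box c (c + l *: s)) (w x)%:E <=
        ((w z + e) * \prod_i (l * s 0 i))%:E /\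
     ((w z - e) * \prod_i (l * s 0 i))%:E <=
     \int[leb n]_(x in box c (c + l *: s)) (w x)%:E)%E].
Proof.
move=> Uz s e s0 e0.
have w0 : 0 < w z by rewrite normr_gt0 -unitfE -unitmxE uL.
have [t /andP[t0 t2] [t1 t3]] := power_near1 n (divr_gt0 e0 w0).
have uLz := uL Uz; have [Vz PPz] := UV Uz.
have dPsi : has_derivative Psi (Phi z) (invmx (L z)).
  apply: has_derivative_inverse (dPhi Uz) uLz _ PPz (cPsi Vz).
  by apply: filterS (open_nbhs_nbhs (conj oV Vz)) => y /VU[].
pose G1 x := (Phi x - Phi z) *m invmx (L z) + z.
have dG1 : has_derivative G1 z 1%:M.
  rewrite -(mulmxV uLz).
  have -> : G1 = (fun y => y *m invmx (L z) + (z - Phi z *m invmx (L z))) \o Phi.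
    by apply/funext => x; rewrite /G1 /= mulmxBl addrA addrAC.
  exact: has_derivative_comp (dPhi Uz) (has_derivative_affine _ _ _).
have G1z : G1 z = z by rewrite /G1 subrr mul0mx add0r.
pose A2 x := x *m L z + (Phi z - z *m L z).
have A2z : A2 z = Phi z by rewrite /A2 addrCA subrr addr0.
have dA2 : has_derivative A2 z (L z) := has_derivative_affine _ _ _.
have dG2 : has_derivative (Psi \o A2) z 1%:M.
  by rewrite -(mulmxV uLz); apply: has_derivative_comp dA2 _; rewrite A2z.
have G2z : (Psi \o A2) z = z by rewrite /= A2z.
have nU : \forall x \near z, U x /\ `|w z - w x| <= e.
  apply: filterI; first exact: open_nbhs_nbhs.
  by have /cvgrPdist_le/(_ _ e0) := cw Uz.
have nV : \forall x \near z, V (A2 x).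
  have cA : A2 x @[x --> z] --> A2 z := has_derivative_continuous dA2.
  by apply: cA; rewrite A2z; exact: open_nbhs_nbhs.
have [d1 d10 h1] := near_identity_box dG1 G1z nU s0 t0.
have [d2 d20 h2] := near_identity_box dG2 G2z nV s0 t0.
exists (Num.min d1 d2); first by rewrite lt_min d10.
move=> c l /andP[l0]; rewrite lt_min => /andP[ld1 ld2] hz.
have {}h1 x := h1 l x ltac:(by rewrite l0 ld1).
have {}h2 x := h2 l x ltac:(by rewrite l0 ld2).
have ls i : 0 < l * s 0 i by rewrite mulr_gt0.
pose v := \prod_i (l * s 0 i).
have v0 : 0 < v by apply: prodr_gt0.
set Q := box c (c + l *: s).
have mQ : measurable Q by exact: measurable_box.
have Qz x : Q x -> forall i, `|x 0 i - z 0 i| <= l * s 0 i.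
  move=> Qx i; have := Qx i; have := hz i; rewrite !mxE ler_norml.
  by move=> /andP[? ?] /andP[? ?]; apply/andP; split; lra.
have volQ : leb n Q = v%:E.
  rewrite lebesgue_box => [|i]; last by rewrite !mxE lerDl ltW.
  by congr _%:E; apply: eq_bigr => i _; rewrite !mxE; ring.
have mA (B : set 'rV[R]_n) : measurable B ->
    measurable [set y | B ((y - Phi z) *m invmx (L z) + z)].
  move=> mB; have := measurable_affine_preimage (invmx (L z)) (z - Phi z *m invmx (L z)) mB.
  by congr measurable; apply/seteqP; split=> x /=; rewrite mulmxBl addrA addrAC.
have mPQ : measurable (V `&` Psi @^-1` Q) by exact: mPsi.
have QU x : Q x -> U x by move=> /Qz/h1[[]].
have v_ls : \prod_i (l *: s) 0 i = v by apply: eq_bigr => i _; rewrite mxE.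
split=> //.
- pose c' := c - t *: (l *: s).
  have E : (`|\det (L z)| * ((1 + 2 * t) ^+ n * v))%:E =
     leb n [set y | box c' (c' + (1 + 2 * t) *: (l *: s)) ((y - Phi z) *m invmx (L z) + z)].
    rewrite lebesgue_affine_box ?v_ls//; first by lra.
    by move=> i; rewrite mxE ltW.
  apply: (@le_trans _ _ (`|\det (L z)| * ((1 + 2 * t) ^+ n * v))%:E); last first.
    rewrite lee_fin mulrA ler_pM2r//.
    apply: (@le_trans _ _ (w z * (1 + e / w z))); first by rewrite ler_pM2l.
    by rewrite mulrDr mulr1 mulrCA mulfV ?mulr1// gt_eqF.
  rewrite E; apply: le_measure; rewrite ?inE//.
    by apply: mA; exact: measurable_box.
  move=> y [/VU[_ PPy] Qy] i /=; have [_ /(_ i)] := h1 _ (Qz _ Qy).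
  have := Qy i; rewrite /G1 PPy !mxE ler_norml => /andP[? ?] /andP[? ?].
  by apply/andP; split; nra.
- pose c' := c + t *: (l *: s).
  have E : (`|\det (L z)| * ((1 - 2 * t) ^+ n * v))%:E =
     leb n [set y | box c' (c' + (1 - 2 * t) *: (l *: s)) ((y - Phi z) *m invmx (L z) + z)].
    rewrite lebesgue_affine_box ?v_ls//; first by lra.
    by move=> i; rewrite mxE ltW.
  apply: (@le_trans _ _ (`|\det (L z)| * ((1 - 2 * t) ^+ n * v))%:E).
    rewrite lee_fin mulrA ler_pM2r//.
    apply: (@le_trans _ _ (w z * (1 - e / w z))); last by rewrite ler_pM2l.
    by rewrite mulrBr mulr1 mulrCA mulfV ?mulr1// gt_eqF.
  rewrite E; apply: le_measure; rewrite ?inE//.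
    by apply: mA; exact: measurable_box.
  move=> y /=; set x := _ + z => hx.
  have A2x : A2 x = y.
    by rewrite /A2 /x mulmxDl mulmxKV// -addrA [_ *m _ + (_ - _)]addrC !subrK.
  have Qx : Q x.
    move=> i; have := hx i; rewrite !mxE => /andP[? ?].
    by apply/andP; split; have := ls i; nra.
  have [Vx hG] := h2 _ (Qz _ Qx); rewrite A2x in Vx; split=> // i.
  have := hG i; rewrite /= A2x ler_norml; have := hx i; rewrite !mxE.
  by move=> /andP[? ?] /andP[? ?]; apply/andP; split; nra.
- have wb x : Q x -> w z - e <= w x <= w z + e.
    move=> /Qz/h1[[_]]; rewrite ler_norml => /andP[? ?] _.
    by apply/andP; split; lra.
  have mwQ : measurable_fun Q (EFin \o w).
    by apply/measurable_EFinP; apply: measurable_funS mw.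
  split.
    rewrite EFinM -volQ -integral_cst//; apply: ge0_le_integral => //.
    all: try by move=> x _; rewrite lee_fin ?addr_ge0 ?normr_ge0// ltW.
    by move=> x /wb/andP[_ h]; rewrite lee_fin.
  have [we|we] := leP (w z - e) 0.
    apply: (@le_trans _ _ 0%E); first by rewrite lee_fin mulr_le0_ge0// ltW.
    by apply: integral_ge0 => x _; rewrite lee_fin normr_ge0.
  rewrite EFinM -volQ -integral_cst//; apply: ge0_le_integral => //.
  all: try by move=> x _; rewrite lee_fin ?normr_ge0// ltW.
  by move=> x /wb/andP[h _]; rewrite lee_fin.
Qed.

(** The difference of the two measures is an additive box function that is o(volume) at every point,
    so bisection applies. Compactness of the closed box bounds [Phi] and the density, which makes
    both measures finite; intersecting with the box keeps all later values finite too. *)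
Let box_eq (N M : {measure set 'rV[R]_n -> \bar R}) :
  (forall A, measurable A -> N A = leb n (V `&` Psi @^-1` A)) ->
  (forall A, measurable A -> M A = (\int[leb n]_(x in U `&` A) (w x)%:E)%E) ->
  forall a s : 'rV[R]_n, (forall i, 0 < s 0 i) ->
  (forall x : 'rV[R]_n, (forall i, a 0 i <= x 0 i <= a 0 i + s 0 i) -> U x) ->
  N (box a (a + s)) = M (box a (a + s)) /\ (N (box a (a + s)) < +oo)%E.
Proof.
move=> NE ME a s s0 hU.
pose Q := box a (a + s).
have mQ : measurable Q by exact: measurable_box.
pose K : set 'rV[R]_n := [set x | forall i, a 0 i <= x 0 i <= a 0 i + s 0 i].
have cK : compact K.
  have := @rV_compact R n (fun i => `[a 0 i, (a + s) 0 i]%classic)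
    (fun i => @segment_compact _ _ _).
  by congr compact; apply/seteqP; split=> x /= h i; have := h i; rewrite mxE in_itv.
have QK x : Q x -> K x.
  by move=> h i; have /andP[h1 h2] := h i; rewrite (ltW h1)/=; rewrite mxE in h2.
have QU x : Q x -> U x by move=> /QK/hU.
have volQ : leb n Q = (\prod_i s 0 i)%:E.
  rewrite lebesgue_box => [|i]; last by rewrite !mxE lerDl ltW.
  by congr _%:E; apply: eq_bigr => i _; rewrite !mxE; ring.
have Moo : (M Q < +oo)%E.
  have [C C0 hC] := @compact_image_bounded R n _ K w cK (fun x Kx => cw (hU x Kx)).
  rewrite ME// (_ : U `&` Q = Q); last by apply/seteqP; split=> x => [[]//|Qx]; split=> //; exact: QU.
  apply: (@le_lt_trans _ _ (C * \prod_i s 0 i)%:E); last exact: ltry.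
  rewrite EFinM -volQ -integral_cst//; apply: ge0_le_integral => //.
  all: try by move=> x _; rewrite lee_fin ?normr_ge0// ltW.
    by apply/measurable_EFinP; exact: measurable_funS mw.
  by move=> x /QK/hC; rewrite lee_fin; apply: le_trans; exact: ler_norm.
have Noo : (N Q < +oo)%E.
  have [C C0 hC] := @compact_image_bounded R n _ K Phi cK
    (fun x Kx => has_derivative_continuous (dPhi (hU x Kx))).
  rewrite NE//.
  pose c : 'rV[R]_n := const_mx (- C - 1); pose d : 'rV[R]_n := const_mx C.
  apply: (@le_lt_trans _ _ (leb n (box c d))).
    apply: le_measure; rewrite ?inE; [exact: mPsi|exact: measurable_box|].
    move=> y [Vy Qy] i; have [_ E] := VU Vy; have := hC _ (QK _ Qy); rewrite E => h.
    have := le_trans (coord_le_norm y i) h; rewrite ler_norml !mxE => /andP[? ->].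
    by rewrite andbT; lra.
  by rewrite lebesgue_box ?ltry// => i; rewrite !mxE; lra.
have fin (m : {measure set 'rV[R]_n -> \bar R}) A : (m Q < +oo)%E -> measurable A ->
    m (A `&` Q) \is a fin_num.
  move=> mQoo mA; rewrite ge0_fin_numE//; apply: le_lt_trans mQoo.
  by apply: le_measure; rewrite ?inE//; exact: measurableI.
pose f (m : {measure set 'rV[R]_n -> \bar R}) (c d : 'rV[R]_n) := fine (m (box c d `&` Q)).
have addf (m : {measure set 'rV[R]_n -> \bar R}) : (m Q < +oo)%E -> box_additive (f m).
  move=> moo c d i t cd /andP[ct td].
  have E : box c d `&` Q = (box c (upd d i t) `&` Q) `|` (box (upd c i t) d `&` Q).
    rewrite -setIUl; congr (_ `&` _); apply/seteqP; split=> x.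
      move=> h; have [xt|xt] := leP (x 0 i) t; [left|right] => k;
        have := h k; rewrite mxE; case: eqP => [->|//] /andP[h1 h2]; apply/andP; split=> //.
    case=> h k; have := h k; rewrite mxE; case: eqP => [->|//] /andP[h1 h2];
      apply/andP; split=> //; first exact: le_trans td.
    exact: le_lt_trans h1.
  rewrite /f E measureU; first by rewrite fineD// fin//; exact: measurable_box.
  - by apply: measurableI => //; exact: measurable_box.
  - by apply: measurableI => //; exact: measurable_box.
  - rewrite setIACA setIid boxI; apply/seteqP; split=> // x [h _].
    have := h i; rewrite !mxE !eqxx => /andP[h1 h2].
    have : t < t; last by rewrite ltxx.
    apply: (@lt_le_trans _ _ (x 0 i)).
      by apply: le_lt_trans h1; rewrite le_max lexx orbT.
    by apply: (le_trans h2); rewrite ge_min lexx.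
suff : f N a (a + s) - f M a (a + s) = 0.
  rewrite /f setIid => /eqP; rewrite subr_eq0 => /eqP h.
  by split=> //; rewrite -[LHS]fineK ?ge0_fin_numE// -[RHS]fineK ?ge0_fin_numE// h.
apply: (@bisection_eq0 R n (fun c d => f N c d - f M c d)) => //.
  move=> c d i t cd h; rewrite (addf N Noo c d i t)// (addf M Moo c d i t)//; ring.
move=> z hz e e0.
have Uz := hU _ hz.
have e2 : 0 < e / 2 by rewrite divr_gt0.
have [dl dl0 hdl] := box_local Uz s0 e2.
exists dl => // c l hl hc hca.
have [BU n1 n2 [m1 m2]] := hdl c l hl hc.
set B := box c (c + l *: s) in BU n1 n2 m1 m2.
have mB : measurable B by exact: measurable_box.
have BQ : B `&` Q = B.
  apply/setIidl => x Bx i; have := Bx i; rewrite !mxE => /andP[h1 h2].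
  have [h3 h4] := hca i; apply/andP; split; first exact: le_lt_trans h1.
  exact: le_trans h4.
have UB : U `&` B = B by apply/setIidr.
have NB : N B \is a fin_num by rewrite -BQ fin.
have MB : M B \is a fin_num by rewrite -BQ fin.
move: n1 n2 m1 m2; rewrite -(NE _ mB).
have -> : (\int[leb n]_(x in B) (w x)%:E)%E = M B by rewrite ME// UB.
rewrite /f -/B BQ -(fineK NB) -(fineK MB) !lee_fin /=.
set v := \prod_i _ => ? ? ? ?; rewrite ler_norml; apply/andP; split; lra.
Qed.

(** [N] and [M] agree on boxes inside [U], hence on measurable subsets of such a box because boxes
    form a generating class stable under intersection, hence on all measurable subsets of [U] by a
    countable cover. The formula is this equality for the preimage of [B]. *)
Theorem change_of_variables (B : set 'rV[R]_n) : measurable B -> B `<=` V ->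
  leb n B = (\int[leb n]_(x in U `&` Phi @^-1` B) `|\det (L x)|%:E)%E.
Proof.
have [N [M [NE ME]]] := NM.
have boxNM (a s : 'rV[R]_n) : (forall i, 0 < s 0 i) ->
  (forall x : 'rV[R]_n, (forall i, a 0 i <= x 0 i <= a 0 i + s 0 i) -> U x) ->
  forall A, measurable A -> N (A `&` box a (a + s)) = M (A `&` box a (a + s)).
  move=> s0 hU A mA.
  have mQ := measurable_box a (a + s).
  have boxes (c d : 'rV[R]_n) : N (box c d `&` box a (a + s)) = M (box c d `&` box a (a + s)).
    rewrite boxI; set c' := \row_i _; set d' := \row_i _.
    have [h|] := pselect (forall i, c' 0 i < d' 0 i); last first.
      move=> /existsNP[i /negP]; rewrite -leNgt => dc.
      rewrite (_ : box c' d' = set0) ?measure0//; apply/seteqP; split=> // x /(_ i) /andP[h1 h2].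
      by have := lt_le_trans h1 (le_trans h2 dc); rewrite ltxx.
    have -> : d' = c' + (d' - c') by rewrite addrC subrK.
    have [||-> //] := box_eq NE ME (a := c') (s := d' - c').
      by move=> i; rewrite !mxE subr_gt0; have := h i; rewrite !mxE.
    move=> x hx; apply: hU => i; have := hx i.
    rewrite [(d' - c') 0 i]mxE [(- c') 0 i]mxE [c' 0 i + _]addrC subrK !mxE.
    by rewrite ge_max le_min => /andP[/andP[_ ->] /andP[_ ->]].
  have [_ Noo] := box_eq NE ME s0 hU.
  pose g k : set 'rV[R]_n := box (const_mx (- k%:R)) (const_mx k%:R).
  apply: (@measure_unique _ _ _ [set A | exists a b : 'rV[R]_n, A = box a b] g
    (measurable_rV_boxes n) _ _ _ (mrestr N mQ) (mrestr M mQ)) => //.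
  - by move=> _ _ [c [d ->]] [c' [d' ->]]; rewrite boxI; eexists; eexists.
  - by move=> k; eexists; eexists.
  - apply/seteqP; split=> // x _; exists (Num.truncn `|x|).+1 => // i; rewrite !mxE.
    have h : `|x 0 i| < (Num.truncn `|x|).+1%:R.
      exact: le_lt_trans (coord_le_norm x i) (truncnS_gt _).
    by move: h; rewrite ltr_norml => /andP[-> /ltW].
  - by move=> _ [c [d ->]]; exact: boxes.
  - move=> k; apply: le_lt_trans Noo; apply: le_measure; rewrite ?inE//.
    by apply: measurableI => //; exact: measurable_box.
(* The closed cube [box_of] has to lie in [U], as [box_eq] requires, while its half-open version
   [obox] belongs to the generating class. *)
pose box_of (q : 'rV[rat]_n * nat) : set 'rV[R]_n :=
  [set x | forall i, ratr (q.1 0 i) - (q.2.+1%:R)^-1 <= x 0 i <=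
      ratr (q.1 0 i) - (q.2.+1%:R)^-1 + 2 / q.2.+1%:R].
pose obox (q : 'rV[rat]_n * nat) : set 'rV[R]_n :=
  let a := \row_i (ratr (q.1 0 i) - (q.2.+1%:R)^-1) in
  box a (a + const_mx (2 / q.2.+1%:R)).
pose F k := if unpickle k is Some q then
  (if `[< box_of q `<=` U >] then obox q else set0) else set0.
have FNM k A : measurable A -> N (A `&` F k) = M (A `&` F k).
  move=> mA; rewrite /F; case: unpickle => [q|]; last by rewrite setI0 !measure0.
  case: asboolP => hq; last by rewrite setI0 !measure0.
  apply: boxNM => // [i|x hx]; first by rewrite mxE divr_gt0.
  by apply: hq => i; have := hx i; rewrite !mxE.
have mF k : measurable (F k).
  rewrite /F; case: unpickle => // q; case: asboolP => // _; exact: measurable_box.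
have UF : U = \bigcup_k F k.
  apply/seteqP; split=> [x Ux|x [k _]]; last first.
    rewrite /F; case: unpickle => // q; case: asboolP => // hq hx; apply: hq => i.
    by have := hx i; rewrite !mxE => /andP[/ltW -> ->].
  have /nbhs_ballP[e /= e0 he] : nbhs x U by apply: open_nbhs_nbhs.
  have [k hk] : exists k : nat, (k.+1%:R)^-1 < e / 2 :> R.
    exists (Num.truncn (e / 2)^-1).
    rewrite invf_plt ?posrE// ?divr_gt0//; exact: truncnS_gt.
  have k0 : 0 < (k.+1%:R)^-1 :> R by rewrite invr_gt0.
  have /choice[q hq] : forall i, exists r : rat, `|ratr r - x 0 i| < (k.+1%:R)^-1.
    move=> i; have [r] := @rat_in_itvoo R (x 0 i - (k.+1%:R)^-1) (x 0 i + (k.+1%:R)^-1) ltac:(by rewrite ltrBlDr -addrA ltrDl addr_gt0).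
    rewrite in_itv/= => hr; exists r; rewrite distrC.
    by rewrite ltr_distlC.
  exists (pickle (\row_i q i, k)) => //; rewrite /F pickleK.
  case: asboolP => [_ i|].
    have := hq i; rewrite !mxE /= ltr_norml; move: hk k0.
    by move: (k.+1%:R^-1) => r ? ? /andP[? ?]; apply/andP; split; lra.
  case=> y hy; apply: he; apply/ball_rVP => // i.
  have := hq i; have := hy i; rewrite !mxE /= !ltr_norml; move: hk k0.
  by move: (k.+1%:R^-1) => r ? ? /andP[? ?] /andP[? ?]; apply/andP; split; lra.
have NMU A : measurable A -> A `<=` U -> N A = M A.
  move=> mA AU; pose D := seqDU F.
  have mD k : measurable (D k) by exact: seqDU_measurable.
  have AE : A = \bigcup_k (A `&` D k).
    by rewrite -setI_bigcupr -seqDU_bigcup_eq -UF; apply/esym/setIidl.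
  have tD : trivIset setT (fun k => A `&` D k).
    by apply: trivIset_setIl; exact: trivIset_seqDU.
  rewrite AE !measure_bigcup//; try by move=> k _; exact: measurableI.
  apply: eq_eseriesr => k _.
  have -> : A `&` D k = A `&` D k `&` F k.
    by rewrite -setIA; congr (_ `&` _); apply/esym/setIidl; exact: subset_seqDU.
  by rewrite FNM//; exact: measurableI.
move=> mB BV.
have mUB : measurable (U `&` Phi @^-1` B).
  apply: continuous_on_measurable_rV => //; apply: continuous_continuous_on => x Ux.
  exact: has_derivative_continuous (dPhi Ux).
have -> : leb n B = N (U `&` Phi @^-1` B).
  rewrite NE//; congr (leb n _); apply/seteqP; split=> y.
    move=> By; have Vy := BV _ By; have [Uy PPy] := VU Vy.
    by split=> //; split=> //=; rewrite PPy.
  by move=> [Vy [_ /=]]; have [_ ->] := VU Vy.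
rewrite NMU//; first by rewrite ME// setIA setIid.
Qed.

End Setting.

End ChangeOfVariables.

(** * Euclidean norm and inner product *)

Section EuclideanTheory.
Context {R : realType} {n : nat}.
Implicit Types (x y z : 'rV[R]_n) (t : R).

Lemma dotvE x y : dotv x y = (x *m y^T) 0 0.
Proof. by rewrite /dotv mxE; apply: eq_bigr => i _; rewrite mxE. Qed.

Lemma dotvC x y : dotv x y = dotv y x.
Proof. by apply: eq_bigr => i _; rewrite mulrC. Qed.

Lemma dotvDl x y z : dotv (x + y) z = dotv x z + dotv y z.
Proof. by rewrite /dotv -big_split; apply: eq_bigr => i _; rewrite mxE mulrDl. Qed.

Lemma dotvDr x y z : dotv z (x + y) = dotv z x + dotv z y.
Proof. by rewrite dotvC dotvDl !(dotvC z). Qed.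

Lemma dotvZl t x z : dotv (t *: x) z = t * dotv x z.
Proof. by rewrite /dotv mulr_sumr; apply: eq_bigr => i _; rewrite mxE mulrA. Qed.

Lemma dotvZr t x z : dotv z (t *: x) = t * dotv z x.
Proof. by rewrite dotvC dotvZl dotvC. Qed.

Lemma dotvNl x z : dotv (- x) z = - dotv x z.
Proof. by rewrite -scaleN1r dotvZl mulN1r. Qed.

Lemma dotvNr x z : dotv z (- x) = - dotv z x.
Proof. by rewrite dotvC dotvNl dotvC. Qed.

Lemma dotvBl x y z : dotv (x - y) z = dotv x z - dotv y z.
Proof. by rewrite dotvDl dotvNl. Qed.

Lemma dotvBr x y z : dotv z (x - y) = dotv z x - dotv z y.
Proof. by rewrite dotvDr dotvNr. Qed.

Lemma dotv0l z : dotv 0 z = 0.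
Proof. by rewrite -(scale0r 0) dotvZl mul0r. Qed.

Lemma dotv0r z : dotv z 0 = 0.
Proof. by rewrite dotvC dotv0l. Qed.

Definition dotvL := (dotvDl, dotvDr, dotvNl, dotvNr, dotvZl, dotvZr).

Lemma dotv_subZ x y t : dotv (x - t *: y) (x - t *: y) =
  dotv x x - 2 * t * dotv y x + t ^+ 2 * dotv y y.
Proof. by rewrite !dotvL (dotvC x y); ring. Qed.

Lemma dotv_ge0 x : 0 <= dotv x x.
Proof. by apply: sumr_ge0 => i _; rewrite -expr2 sqr_ge0. Qed.

Lemma dotv_eq0 x : dotv x x = 0 -> x = 0.
Proof.
move=> /eqP; rewrite psumr_eq0; last by move=> i _; rewrite -expr2 sqr_ge0.
move=> /allP h; apply/rowP => i; rewrite mxE.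
by have := h i; rewrite mem_index_enum => /(_ isT); rewrite /= mulf_eq0 orbb => /eqP.
Qed.

Lemma enorm_ge0 x : 0 <= enorm x. Proof. exact: sqrtr_ge0. Qed.

Lemma enorm2 x : enorm x ^+ 2 = dotv x x.
Proof. by rewrite sqr_sqrtr// dotv_ge0. Qed.

Lemma enorm_eq0 x : enorm x = 0 -> x = 0.
Proof. by move=> h; apply: dotv_eq0; rewrite -enorm2 h expr0n. Qed.

Lemma enorm0 : enorm (0 : 'rV[R]_n) = 0.
Proof. by rewrite /enorm dotv0l sqrtr0. Qed.

Lemma enormZ t x : enorm (t *: x) = `|t| * enorm x.
Proof. by rewrite /enorm dotvZl dotvZr mulrA -expr2 sqrtrM ?sqr_ge0// sqrtr_sqr. Qed.

Lemma enormN x : enorm (- x) = enorm x.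
Proof. by rewrite /enorm dotvNl dotvNr opprK. Qed.

Lemma enormB x y : enorm (x - y) = enorm (y - x).
Proof. by rewrite -enormN opprB. Qed.

Lemma le_enorm2 x (c : R) : 0 <= c -> dotv x x <= c ^+ 2 -> enorm x <= c.
Proof. by move=> c0; rewrite -enorm2 ler_sqr ?nnegrE ?enorm_ge0. Qed.

Lemma dotv_le_enorm x y : dotv x y <= enorm x * enorm y.
Proof.
have [->|y0] := eqVneq y 0; first by rewrite dotv0r enorm0 mulr0.
have yy : 0 < dotv y y.
  rewrite lt_neqAle dotv_ge0 andbT eq_sym; apply: contraNneq y0 => /dotv_eq0 ->.
  exact: eqxx.
have [h|h] := lerP (dotv x y) 0.
  by apply: (le_trans h); rewrite mulr_ge0// enorm_ge0.
rewrite -ler_sqr ?nnegrE ?mulr_ge0 ?enorm_ge0 ?(ltW h)//.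
rewrite exprMn !enorm2 -subr_ge0 -(pmulr_rge0 _ yy).
have := dotv_ge0 (dotv y y *: x - dotv x y *: y).
rewrite !dotvL (dotvC y x) => H.
by apply: (le_trans H); rewrite le_eqVlt; apply/orP; left; apply/eqP; ring.
Qed.

Lemma dotv_abs_le x y : `|dotv x y| <= enorm x * enorm y.
Proof.
rewrite ler_norml dotv_le_enorm andbT lerNl -dotvNl (le_trans (dotv_le_enorm _ _))//.
by rewrite enormN.
Qed.

Lemma enormD x y : enorm (x + y) <= enorm x + enorm y.
Proof.
apply: le_enorm2; first by rewrite addr_ge0 ?enorm_ge0.
rewrite !dotvL sqrrD !enorm2 (dotvC y x).
by have := dotv_le_enorm x y; lra.
Qed.

Lemma enorm_distD z x y : enorm (x - y) <= enorm (x - z) + enorm (z - y).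
Proof. by rewrite -{1}(subrK z x) -addrA enormD. Qed.

Lemma norm_le_enorm x : `|x| <= enorm x.
Proof.
apply: norm_le_coord => [|i]; first exact: enorm_ge0.
rewrite -ler_sqr ?nnegrE ?enorm_ge0// enorm2 real_normK ?num_real//.
by rewrite /dotv (bigD1 i)//= -expr2 lerDl sumr_ge0// => j _; rewrite -expr2 sqr_ge0.
Qed.

Lemma enorm_le_norm x : enorm x <= n%:R * `|x|.
Proof.
apply: le_enorm2; first by rewrite mulr_ge0.
apply: (@le_trans _ _ (\sum_(i < n) `|x| ^+ 2)).
  apply: ler_sum => i _; rewrite -expr2 -real_normK ?num_real//.
  by rewrite ler_sqr ?nnegrE// coord_le_norm.
rewrite sumr_const card_ord -[leLHS]mulr_natl exprMn ler_wpM2r ?sqr_ge0//.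
by rewrite -natrX ler_nat; case: (n) => // k; rewrite expnS leq_pmulr// expn_gt0.
Qed.

Lemma unit_neq0 x : enorm x = 1 -> x != 0.
Proof. by move=> x1; apply: contra_eq_neq x1 => ->; rewrite enorm0 eq_sym oner_eq0. Qed.

Lemma enorm1_dotv x : enorm x = 1 -> dotv x x = 1.
Proof. by rewrite -enorm2 => ->; rewrite expr1n. Qed.

Lemma enorm_lip x y : `|enorm x - enorm y| <= enorm (x - y).
Proof.
rewrite ler_norml; apply/andP; split.
  by rewrite lerNl opprB lerBlDr enormB -{1}(subrK x y) enormD.
by rewrite lerBlDr -{1}(subrK y x) enormD.
Qed.

Lemma near_enorm x e : 0 < e -> \forall y \near x, enorm (y - x) < e.
Proof.
move=> e0; apply/nbhs_ballP; exists (e / n.+1%:R) => /=; first by rewrite divr_gt0.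
move=> y; rewrite -ball_normE /= distrC => h.
apply: (le_lt_trans (enorm_le_norm _)).
apply: (@le_lt_trans _ _ (n.+1%:R * `|y - x|)); first by rewrite ler_wpM2r// ler_nat.
by rewrite -ltr_pdivlMl// mulrC.
Qed.

Lemma nbhs_enormP x (A : set 'rV[R]_n) :
  nbhs x A <-> exists2 e, 0 < e & forall y, enorm (y - x) < e -> A y.
Proof.
split=> [/nbhs_ballP[e /= e0 h]|[e e0 h]].
  exists e => // y hy; apply: h; rewrite -ball_normE /= distrC.
  exact: le_lt_trans (norm_le_enorm _) hy.
by apply: filterS (near_enorm x e0) => y; exact: h.
Qed.

Lemma lipschitz_continuous (f : 'rV[R]_n -> 'rV[R]_n) C :
  (forall x y, enorm (f x - f y) <= C * enorm (x - y)) -> continuous f.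
Proof.
move=> lf x A /nbhs_ballP[e /= e0 he].
have C1 : 0 < `|C| + 1 by rewrite ltr_wpDl.
apply: filterS (near_enorm x (divr_gt0 e0 C1)) => y hy; apply: he.
rewrite -ball_normE /= distrC (le_lt_trans (norm_le_enorm _))// (le_lt_trans (lf _ _))//.
apply: (@le_lt_trans _ _ ((`|C| + 1) * enorm (y - x))).
  by rewrite ler_wpM2r ?enorm_ge0// ler_wpDr// ler_norm.
by rewrite -ltr_pdivlMl// mulrC.
Qed.

Lemma lipschitz_continuousR (f : 'rV[R]_n -> R) C :
  (forall x y, `|f x - f y| <= C * enorm (x - y)) -> continuous f.
Proof.
move=> lf x A /nbhs_ballP[e /= e0 he].
have C1 : 0 < `|C| + 1 by rewrite ltr_wpDl.
apply: filterS (near_enorm x (divr_gt0 e0 C1)) => y hy; apply: he.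
rewrite /ball /= distrC (le_lt_trans (lf _ _))//.
apply: (@le_lt_trans _ _ ((`|C| + 1) * enorm (y - x))).
  by rewrite ler_wpM2r ?enorm_ge0// ler_wpDr// ler_norm.
by rewrite -ltr_pdivlMl// mulrC.
Qed.

Lemma enorm_continuous : continuous (@enorm R n).
Proof. by apply: (@lipschitz_continuousR _ 1) => x y; rewrite mul1r enorm_lip. Qed.

Lemma dotvl_continuous v : continuous (fun x => dotv x v).
Proof.
apply: (@lipschitz_continuousR _ (enorm v)) => x y.
by rewrite -dotvBl mulrC dotv_abs_le.
Qed.

Lemma esphere_compact : compact (esphere R n).
Proof.
apply: bounded_closed_compact.
  exists 1; split=> // e e1 x /= hx; apply: le_trans (ltW e1).
  by rewrite -hx norm_le_enorm.
have -> : esphere R n = (@enorm R n) @^-1` [set 1] by [].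
by apply: preimage_closed; [move=> x _; exact: enorm_continuous|exact: closed_eq].
Qed.

End EuclideanTheory.

(** * Nearest points and supporting directions of a convex body *)

Section ConvexBody.
Context {R : realType} {n : nat}.
Implicit Types (K : set 'rV[R]_n) (x y z p q v w : 'rV[R]_n).

Definition convex_body K := [/\ compact K, K !=set0 &
  forall x y t, K x -> K y -> 0 <= t <= 1 -> K (x + t *: (y - x))].

Definition proj K y : 'rV[R]_n :=
  get [set p | K p /\ forall x, K x -> enorm (y - p) <= enorm (y - x)].

Definition dist K y : R := enorm (y - proj K y).

Definition supports K p v := K p /\ forall x, K x -> dotv (x - p) v <= 0.

Section Body.
Variable K : set 'rV[R]_n.
Hypothesis bK : convex_body K.

Lemma projP y : K (proj K y) /\ forall x, K x -> dist K y <= enorm (y - x).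
Proof.
suff : exists p, K p /\ forall x, K x -> enorm (y - p) <= enorm (y - x).
  by move=> [p hp]; exact: (@getPex _ [set p | K p /\ _] (ex_intro _ p hp)).
have [cK K0 _] := bK.
have [|p pK h] := @EVT_min_rV R n (fun x => enorm (y - x)) K K0 cK.
  apply: continuous_subspaceT; apply: (@lipschitz_continuousR _ _ _ 1) => x z.
  rewrite mul1r (le_trans (enorm_lip _ _))// enormB le_eqVlt; apply/orP; left.
  by apply/eqP; congr enorm; apply/rowP => i; rewrite !mxE; ring.
exists p; split; first exact: set_mem.
by move=> x Kx; apply: h; exact: mem_set.
Qed.

Lemma proj_in y : K (proj K y). Proof. by case: (projP y). Qed.

Lemma dist_le y x : K x -> dist K y <= enorm (y - x).
Proof. by move=> Kx; case: (projP y) => _; apply. Qed.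

Lemma proj_obtuse y x : K x -> dotv (x - proj K y) (y - proj K y) <= 0.
Proof.
move=> Kx; set p := proj K y; set a := dotv _ _.
pose b := dotv (x - p) (x - p).
have b0 : 0 <= b by exact: dotv_ge0.
rewrite leNgt; apply/negP => a0.
(* A step of length t from p towards x changes the squared distance to y by -2ta + t^2 b, which is
   negative because tb < a. *)
pose t := Num.min 1 (a / (b + 1)).
have b1 : 0 < b + 1 by rewrite ltr_wpDl.
have t0 : 0 < t by rewrite lt_min ltr01 divr_gt0.
have t1 : t <= 1 by rewrite ge_min lexx.
have tb : t * (b + 1) <= a by rewrite -ler_pdivlMr// ge_min lexx orbT.
have [_ _ cv] := bK.
have := dist_le y (cv p x t (proj_in y) Kx ltac:(by rewrite (ltW t0) t1)).
rewrite -ler_sqr ?nnegrE ?enorm_ge0// /dist !enorm2 -/p.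
have -> : y - (p + t *: (x - p)) = (y - p) - t *: (x - p) by rewrite opprD addrA.
rewrite dotv_subZ -/b -/a.
have := ler_wpM2l (ltW t0) tb; have := mulr_gt0 t0 a0; have := mulr_gt0 t0 t0.
by move: (dotv (y - p) (y - p)) => D; nra.
Qed.

Lemma proj_unique y p : K p -> (forall x, K x -> dotv (x - p) (y - p) <= 0) -> proj K y = p.
Proof.
move=> Kp h; apply/eqP; rewrite -subr_eq0; apply/eqP/dotv_eq0/le_anti.
rewrite dotv_ge0 andbT.
have := h _ (proj_in y); have := proj_obtuse y Kp.
rewrite !dotvL; lra.
Qed.

Lemma proj_lipschitz y z : enorm (proj K y - proj K z) <= enorm (y - z).
Proof.
have [->|ne] := eqVneq (proj K y - proj K z) 0; first by rewrite enorm0 enorm_ge0.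
have e0 : 0 < enorm (proj K y - proj K z).
  rewrite lt_neqAle enorm_ge0 andbT eq_sym; apply: contra_neq ne; exact: enorm_eq0.
rewrite -(ler_pM2l e0) -expr2 enorm2 (le_trans _ (dotv_le_enorm _ _))//.
have := proj_obtuse y (proj_in z); have := proj_obtuse z (proj_in y).
rewrite !dotvL; lra.
Qed.

Lemma proj_continuous : continuous (proj K).
Proof.
by apply: (@lipschitz_continuous _ _ _ 1) => x y; rewrite mul1r proj_lipschitz.
Qed.

Lemma dist_lipschitz y z : `|dist K y - dist K z| <= enorm (y - z).
Proof.
rewrite ler_norml; apply/andP; split.
  rewrite lerNl opprB lerBlDr (le_trans (dist_le z (proj_in y)))//.
  by rewrite (enormB y z) enorm_distD.
by rewrite lerBlDr (le_trans (dist_le y (proj_in z)))// enorm_distD.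
Qed.

Lemma dist_continuous : continuous (dist K).
Proof.
by apply: (@lipschitz_continuousR _ _ _ 1) => x y; rewrite mul1r dist_lipschitz.
Qed.

Lemma proj_id x : K x -> proj K x = x.
Proof.
by move=> Kx; apply: proj_unique => // y _; rewrite subrr dotv0r.
Qed.

Lemma dist_ge0 y : 0 <= dist K y. Proof. exact: enorm_ge0. Qed.

Lemma dist_eq0 y : (dist K y == 0) = (y \in K).
Proof.
apply/eqP/idP => [/enorm_eq0/eqP|/set_mem Ky].
  by rewrite subr_eq0 => /eqP ->; apply: mem_set; exact: proj_in.
by rewrite /dist proj_id// subrr enorm0.
Qed.

Lemma dist_gt0 y : ~ K y -> 0 < dist K y.
Proof.
move=> nK; rewrite lt_neqAle dist_ge0 andbT eq_sym dist_eq0.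
by apply: contra_notN nK => /set_mem.
Qed.

(** Outer normal rays are fibres of the projection; this is what inverts the map (p, s) |-> p + s
    nu(p). *)
Lemma proj_supported p v (s : R) : supports K p v -> 0 <= s -> proj K (p + s *: v) = p.
Proof.
move=> [Kp h] s0; apply: proj_unique => // x Kx.
by rewrite [p + _]addrC addrK dotvZr mulr_ge0_le0// h.
Qed.

Lemma dist_supported p v (s : R) : supports K p v -> enorm v = 1 -> 0 <= s ->
  dist K (p + s *: v) = s.
Proof.
move=> sp v1 s0; rewrite /dist (proj_supported sp)// [p + _]addrC addrK enormZ v1.
by rewrite mulr1 ger0_norm.
Qed.

Lemma normalized_supports y : ~ K y ->
  enorm ((dist K y)^-1 *: (y - proj K y)) = 1 /\
  supports K (proj K y) ((dist K y)^-1 *: (y - proj K y)).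
Proof.
move=> /dist_gt0 d0; split.
  by rewrite enormZ ger0_norm ?invr_ge0 ?dist_ge0// mulVf ?gt_eqF.
split; first exact: proj_in.
move=> x Kx; rewrite dotvZr mulr_ge0_le0 ?invr_ge0 ?dist_ge0//.
exact: proj_obtuse.
Qed.

(* Not being supported is an open condition on the pair (point, direction), so
   compactness of the set of directions makes it uniform. *)
Lemma near_not_supported (A : set 'rV[R]_n) p : compact A ->
  (forall w, A w -> exists2 x, K x & 0 < dotv (x - p) w) ->
  \forall q \near p, forall w, A w -> exists2 x, K x & 0 < dotv (x - q) w.
Proof.
move=> /compact_near_coveringP cA h.
have FF : Filter (nbhs p) := nbhs_filter p.
apply: (cA _ (nbhs p) (fun q w => exists2 x, K x & 0 < dotv (x - q) w) FF).
move=> w Aw; have [x Kx xw] := h w Aw.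
pose e := dotv (x - p) w.
pose B := enorm w + enorm (x - p) + 2.
have B0 : 0 < B by have := enorm_ge0 w; have := enorm_ge0 (x - p); rewrite /B; lra.
pose r := Num.min 1 (e / B).
have r0 : 0 < r by rewrite lt_min ltr01 divr_gt0.
have nw := near_enorm w r0; have nq := near_enorm p r0.
exists ([set y | enorm (y - w) < r], [set y | enorm (y - p) < r]) => //=.
move=> [w' q] /= [hw hq]; exists x => //.
have r1 : r <= 1 by rewrite ge_min lexx.
have rB : r * B <= e by rewrite -ler_pdivlMr// ge_min lexx orbT.
have -> : dotv (x - q) w' = e + dotv (x - p) (w' - w) - dotv (q - p) w - dotv (q - p) (w' - w).
  rewrite /e !dotvL; ring.
have := dotv_abs_le (x - p) (w' - w); have := dotv_abs_le (q - p) w.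
have := dotv_abs_le (q - p) (w' - w); rewrite !ler_norml.
move=> /andP[_ h1] /andP[_ h2] /andP[h3 _].
have h4 : enorm (q - p) * enorm (w' - w) < r.
  apply: (@le_lt_trans _ _ (1 * enorm (w' - w))); last by rewrite mul1r.
  by rewrite ler_wpM2r ?enorm_ge0//; apply: (le_trans (ltW hq)).
have h5 : enorm (q - p) * enorm w <= r * enorm w by rewrite ler_wpM2r ?enorm_ge0// ltW.
have h6 : enorm (x - p) * enorm (w' - w) <= enorm (x - p) * r.
  by rewrite ler_wpM2l ?enorm_ge0// ltW.
rewrite /B in rB; nra.
Qed.

End Body.
End ConvexBody.

(** * Boundary points of an open convex set *)

Section OpenConvex.
Context {R : realType} {n : nat}.
Implicit Types (x y z p q v w : 'rV[R]_n).
Variable Omega : set 'rV[R]_n.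
Hypotheses (oO : open Omega) (O0 : Omega !=set0) (bO : bounded_set Omega)
  (cO : convex_set Omega).

Let K := closure Omega.

Lemma open_convexP x y (t : R) : Omega x -> Omega y -> 0 <= t <= 1 ->
  Omega (x + t *: (y - x)).
Proof.
move=> Ox Oy /andP[t0 t1].
have /set_mem : t *: y + (1 - t) *: x \in Omega.
  exact: (cO (Itv01 t0 t1) (mem_set Oy) (mem_set Ox)).
by congr Omega; apply/rowP => i; rewrite !mxE; ring.
Qed.

Lemma closure_enormP (A : set 'rV[R]_n) x :
  closure A x <-> forall e, 0 < e -> exists2 y, A y & enorm (y - x) < e.
Proof.
split=> [h e e0|h B /nbhs_enormP[e e0 he]].
  by have [y [Ay hy]] := h _ (near_enorm x e0); exists y.
by have [y Ay /he By] := h e e0; exists y.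
Qed.

Lemma open_segment x y (t : R) : Omega x -> K y -> 0 < t <= 1 ->
  Omega (y + t *: (x - y)).
Proof.
move=> Ox Ky /andP[t0 t1].
have /nbhs_enormP[r r0 hr] : nbhs x Omega by exact: open_nbhs_nbhs.
have [y' Oy' hy'] : exists2 y', Omega y' & enorm (y' - y) < r * t.
  by apply: (iffLR (closure_enormP _ _) Ky); rewrite mulr_gt0.
(* The shift of x compensates exactly the replacement of y by the nearby point y' of [Omega], so the
   point on the segment is unchanged; y' was taken close enough to keep x' in [Omega]. *)
pose x' := x + (t^-1 - 1) *: (y - y').
have Ox' : Omega x'.
  apply: hr; rewrite /x' addrC addKr enormZ ger0_norm ?subr_ge0 ?invf_ge1// enormB.
  apply: (@le_lt_trans _ _ (t^-1 * enorm (y' - y))).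
    by rewrite ler_wpM2r ?enorm_ge0// gerBl.
  by rewrite ltr_pdivrMl// mulrC.
have -> : y + t *: (x - y) = y' + t *: (x' - y').
  by rewrite /x'; apply/rowP => i; rewrite !mxE; field; rewrite gt_eqF.
by apply: open_convexP => //; rewrite (ltW t0).
Qed.

Lemma closure_convex_body : convex_body K.
Proof.
split.
- apply: bounded_closed_compact; last exact: closed_closure.
  have [M [Mr hM]] := bO; exists M; split=> // N MN x Kx.
  apply/ler_addgt0Pr => e e0.
  have [y Oy hy] := iffLR (closure_enormP _ _) Kx _ e0.
  rewrite -(subrK y x) addrC (le_trans (ler_normD _ _))// lerD//; first exact: hM.
  by rewrite (le_trans (norm_le_enorm _))// enormB ltW.
- by have [x Ox] := O0; exists x; exact: subset_closure.
move=> x y t Kx Ky /andP[t0 t1]; apply/closure_enormP => e e0.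
have e2 : 0 < e / 2 by rewrite divr_gt0.
have [x' Ox' hx] := iffLR (closure_enormP _ _) Kx _ e2.
have [y' Oy' hy] := iffLR (closure_enormP _ _) Ky _ e2.
exists (x' + t *: (y' - x')); first by apply: open_convexP => //; rewrite t0.
have -> : x' + t *: (y' - x') - (x + t *: (y - x)) =
   (1 - t) *: (x' - x) + t *: (y' - y).
  by apply/rowP => i; rewrite !mxE; ring.
rewrite (le_lt_trans (enormD _ _))// !enormZ !ger0_norm ?subr_ge0//.
have := enorm_ge0 (x' - x); have := enorm_ge0 (y' - y); nra.
Qed.

Lemma boundaryE p : boundary Omega p <-> K p /\ ~ Omega p.
Proof. by rewrite /boundary (interior_id _).1. Qed.

(** Otherwise p would lie strictly between an interior point and a point of K, with weight e/(1+e)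
    on the former, and so be interior. *)
Lemma boundary_outside p x (e : R) : boundary Omega p -> Omega x -> 0 < e ->
  ~ K (p + e *: (p - x)).
Proof.
move=> /boundaryE[Kp nOp] Ox e0 Kq; apply: nOp.
have e1 : 0 < 1 + e by rewrite addr_gt0.
have -> : p = p + e *: (p - x) + (e / (1 + e)) *: (x - (p + e *: (p - x))).
  by apply/rowP => i; rewrite !mxE; field; rewrite gt_eqF.
apply: open_segment => //; rewrite divr_gt0//= ler_pdivrMr// mul1r lerDr.
exact: ler01.
Qed.

Lemma supports_interior p v x : supports K p v -> v != 0 -> Omega x ->
  dotv (x - p) v < 0.
Proof.
move=> [Kp h] v0 Ox.
have /nbhs_enormP[r r0 hr] : nbhs x Omega by exact: open_nbhs_nbhs.
have v1 : 0 < enorm v.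
  rewrite lt_neqAle enorm_ge0 andbT eq_sym; apply: contra_neq v0; exact: enorm_eq0.
pose s := r / 2 / enorm v.
have s0 : 0 < s by rewrite !divr_gt0.
have H : K (x + s *: v).
  apply: subset_closure; apply: hr.
  rewrite addrC addKr enormZ gtr0_norm// /s divfK ?gt_eqF//.
  by rewrite ltr_pdivrMr// mulr_natr mulr2n ltrDl.
have := h _ H; have : 0 < s * enorm v ^+ 2 by rewrite mulr_gt0// exprn_gt0.
have -> : x + s *: v - p = (x - p) + s *: v by rewrite addrAC.
by rewrite (dotvDl (x - p)) dotvZl -enorm2; lra.
Qed.

Lemma supports_boundary p v : supports K p v -> v != 0 -> boundary Omega p.
Proof.
move=> sp v0; apply/boundaryE; split; first by case: sp.
by move=> /(supports_interior sp v0); rewrite subrr dotv0l ltxx.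
Qed.

Lemma proj_boundary y : ~ K y -> boundary Omega (proj K y).
Proof.
move=> nK; have [v1 sv] := @normalized_supports _ _ K closure_convex_body y nK.
exact: supports_boundary sv (unit_neq0 v1).
Qed.

(** If no unit direction supported K at p, the same would hold at all points near p. But p is a
    limit of points outside K, whose projections are close to p and are supported. *)
Lemma supports_exists p : boundary Omega p -> exists2 v, enorm v = 1 & supports K p v.
Proof.
move=> bp; apply: contrapT => no.
have bK := closure_convex_body.
have Kp : K p by case: (iffLR (boundaryE p) bp).
have H : forall w, esphere R n w -> exists2 x, K x & 0 < dotv (x - p) w.
  move=> w w1; apply: contrapT => nx; apply: no; exists w => //; split=> // x Kx.
  by rewrite leNgt; apply/negP => h; apply: nx; exists x.
have /nbhs_enormP[r r0 hr] := near_not_supported esphere_compact H.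
have [x0 Ox0] := O0.
pose e := r / (enorm (p - x0) + 1).
have d0 : 0 < enorm (p - x0) + 1 by rewrite ltr_wpDl// enorm_ge0.
have e0 : 0 < e by rewrite divr_gt0.
have nK := boundary_outside bp Ox0 e0.
set y := p + _ in nK.
have [v1 [Kq sv]] := @normalized_supports _ _ K bK y nK.
have hq : enorm (proj K y - p) < r.
  rewrite -[X in _ - X](proj_id bK Kp) (le_lt_trans (proj_lipschitz bK _ _))//.
  rewrite /y addrC addKr enormZ gtr0_norm// /e mulrAC ltr_pdivrMr//.
  by rewrite ltr_pM2l// ltrDl.
have [x Kx] := hr _ hq _ v1.
by rewrite ltNge sv.
Qed.

End OpenConvex.

(** * Tangent frames and first-order conditions *)

Section Linear.
Context {R : realType}.

Lemma gram_unit n m (J : 'M[R]_(n, m)) : row_free J -> J *m J^T \in unitmx.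
Proof.
move=> fJ; rewrite -row_free_unit; apply/row_freeP.
have : row_free (J *m J^T).
  rewrite -kermx_eq0; apply/eqP/row_matrixP => i; rewrite row0.
  set u := row i _.
  have u0 : u *m (J *m J^T) = 0.
    by rewrite -row_mul mulmx_ker row0.
  have : u *m J = 0.
    apply: dotv_eq0; rewrite dotvE trmx_mul -mulmxA (mulmxA J) mulmxA u0.
    by rewrite mul0mx mxE.
  by move=> /eqP; rewrite mulmx_free_eq0// => /eqP.
by move=> /row_freeP.
Qed.

Lemma dotv_mulmx n m (w : 'rV[R]_n) (J : 'M[R]_(n, m)) (v : 'rV[R]_m) :
  dotv (w *m J) v = (w *m (J *m v^T)) 0 0.
Proof. by rewrite dotvE mulmxA. Qed.

(* A nonzero vector orthogonal to n independent vectors completes them to a basis of R^(n+1). *)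
Lemma frame_unit n (J : 'M[R]_(n, n.+1)) (v : 'rV[R]_n.+1) : row_free J ->
  J *m v^T = 0 -> v != 0 -> (col_mx v J : 'M[R]_(1 + n)) \in unitmx.
Proof.
move=> fJ Jv v0; pose A : 'M[R]_(1 + n) := col_mx v J.
have AA : A *m A^T = block_mx (dotv v v)%:M 0 0 (J *m J^T).
  rewrite /A tr_col_mx mul_col_row Jv; congr block_mx.
    by rewrite [LHS]mx11_scalar dotvE.
  by rewrite -[LHS]trmxK trmx_mul trmxK Jv trmx0.
have : A *m A^T \in unitmx.
  rewrite AA unitmxE det_ublock det_scalar1 unitrM -unitmxE gram_unit// andbT unitfE.
  by apply: contraNneq v0 => /dotv_eq0 ->.
by rewrite unitmx_mul => /andP[].
Qed.

Lemma orthogonal_complement n (J : 'M[R]_(n, n.+1)) (v w : 'rV[R]_n.+1) : row_free J ->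
  J *m v^T = 0 -> enorm v = 1 -> J *m w^T = 0 -> w = dotv w v *: v.
Proof.
move=> fJ Jv v1 Jw.
have uA := frame_unit fJ Jv (unit_neq0 v1).
set A : 'M[R]_(1 + n) := col_mx v J in uA.
have : (w - dotv w v *: v) *m A^T = 0.
  rewrite /A tr_col_mx mul_mx_row; apply/rowP => i; rewrite !mxE.
  case: splitP => j _.
    rewrite (ord1 j) -dotvE dotvBl dotvZl enorm1_dotv// mulr1 subrr//.
  have -> : (w - dotv w v *: v) *m J^T = 0; last by rewrite mxE.
  have tr0 (u : 'rV[R]_n.+1) : J *m u^T = 0 -> u *m J^T = 0.
    by move=> Ju; rewrite -[LHS]trmxK trmx_mul trmxK Ju trmx0.
  by rewrite mulmxBl -scalemxAl !tr0// scaler0 subrr.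
move=> /(congr1 (mulmx^~ (invmx A^T))); rewrite mulmxK ?unitmx_tr// mul0mx.
by move=> /eqP; rewrite subr_eq0 => /eqP.
Qed.

Lemma differentiable_has_derivative n m (f : 'rV[R]_n -> 'rV[R]_m) x :
  differentiable f x -> has_derivative f x ('J f x).
Proof.
move=> df e e0.
have /eqaddoP/(_ e e0)/nbhs_ballP[r /= r0 h] := diff_locally df.
apply/nbhs_ballP; exists r => // y; rewrite -ball_normE /= => hy.
have := h (y - x); rewrite -ball_normE /= sub0r normrN distrC => /(_ hy).
by rewrite !fctE /= subrK opprD addrA /jacobian mul_rV_lin1.
Qed.

(** The function y |-> <f y, v> has a local maximum at x, so its derivative vanishes; the argument
    is run in the directions w and -w. *)
Lemma has_derivative_le0 n m (f : 'rV[R]_n -> 'rV[R]_m) x L v :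
  has_derivative f x L -> (\forall y \near x, dotv (f y - f x) v <= 0) -> L *m v^T = 0.
Proof.
move=> df h.
have key (w : 'rV[R]_n) : dotv (w *m L) v <= 0.
  rewrite leNgt; apply/negP => a0; set a := dotv _ _ in a0.
  pose C := m%:R * enorm v * `|w| + 1.
  have C0 : 0 < C by rewrite ltr_wpDl// !mulr_ge0 ?enorm_ge0.
  have e0 : 0 < a / 2 / C by rewrite !divr_gt0.
  have /nbhs_ballP[r /= r0 hr] : nbhs x [set y | dotv (f y - f x) v <= 0 /\
    `|f y - f x - (y - x) *m L| <= a / 2 / C * `|y - x|] by exact: filterI h (df _ e0).
  pose t := r / 2 / (`|w| + 1).
  have t0 : 0 < t by rewrite !divr_gt0// ltr_wpDl.
  have tw : `|t *: w| < r.
    rewrite normrZ gtr0_norm// /t mulrAC ltr_pdivrMr ?ltr_wpDl//.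
    by have := normr_ge0 w; nra.
  have [] := hr (x + t *: w).
    by rewrite -ball_normE /= opprD addrA subrr sub0r normrN.
  rewrite [x + _]addrC addrK => h1 h2.
  set r1 := f _ - f x - _ in h2.
  have E : dotv (f (t *: w + x) - f x) v = t * a + dotv r1 v.
    by rewrite /r1 -scalemxAl !dotvL /a; ring.
  have h3 : `|dotv r1 v| <= a / 2 / C * (t * `|w|) * (m%:R * enorm v).
    rewrite (le_trans (dotv_abs_le _ _))//.
    apply: (@le_trans _ _ (m%:R * `|r1| * enorm v)).
      by rewrite ler_wpM2r ?enorm_ge0// enorm_le_norm.
    rewrite -mulrA mulrCA ler_wpM2r ?mulr_ge0 ?enorm_ge0//.
    by apply: (le_trans h2); rewrite normrZ gtr0_norm.
  have h4 : a / 2 / C * (t * `|w|) * (m%:R * enorm v) <= t * (a / 2).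
    have -> : a / 2 / C * (t * `|w|) * (m%:R * enorm v) = t * (a / 2) * ((C - 1) / C).
      by rewrite /C; field; rewrite gt_eqF// -/C.
    rewrite ler_piMr//; first by rewrite mulr_ge0 ?divr_ge0// ltW.
    by rewrite ler_pdivrMr// mul1r gerBl.
  move: h1; rewrite E; move: (le_trans h3 h4); rewrite ler_norml => /andP[h5 _].
  by have := mulr_gt0 t0 a0; lra.
apply/colP => i; rewrite mxE; apply/le_anti.
have := key (delta_mx 0 i); have := key (- delta_mx 0 i).
rewrite !dotv_mulmx mulNmx -rowE !mxE => h1 h2; apply/andP; split; first lra.
lra.
Qed.

End Linear.
Lemma continuous_coord {R : realType} n m (f : 'rV[R]_n -> 'rV[R]_m) x j :
  {for x, continuous f} -> {for x, continuous (fun y => f y 0 j)}.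
Proof.
move=> cf A hA.
exact: (cf [set z : 'rV[R]_m | A (z 0 j)] (@coord_continuous R 1 m 0 j (f x) A hA)).
Qed.

(** * Consequences of the definition of a local parametrization *)

Section Chart.
Context {R : realType} {n : nat}.
Variables (S : set 'rV[R]_n.+1) (U : set 'rV[R]_n) (phi : 'rV[R]_n -> 'rV[R]_n.+1).
Hypothesis lp : local_param S U phi.

Lemma chart_open : open U. Proof. by case: lp. Qed.

Lemma chart_differentiable x : U x -> differentiable phi x.
Proof. by case: lp => _ /(_ 1%N)[h _] _ _ _; exact: h. Qed.

Lemma chart_derivative x : U x -> has_derivative phi x ('J phi x).
Proof. by move=> /chart_differentiable/differentiable_has_derivative. Qed.

Lemma chart_continuous x : U x -> {for x, continuous phi}.
Proof. by move=> /chart_derivative/has_derivative_continuous. Qed.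

Lemma chart_jacobianE v x : U x -> 'D_v phi x = v *m 'J phi x.
Proof. by move=> /chart_differentiable; exact: deriveEjacobian. Qed.

Lemma chart_derivative2 v x : U x -> has_derivative ('D_v phi) x ('J ('D_v phi) x).
Proof.
move=> Ux; apply: differentiable_has_derivative.
by case: lp => _ /(_ 2%N)[_ /(_ v)[h _]] _ _ _; exact: h.
Qed.

Lemma chart_jacobianE2 v w x : U x -> 'D_w ('D_v phi) x = w *m 'J ('D_v phi) x.
Proof.
move=> Ux; apply: deriveEjacobian.
by case: lp => _ /(_ 2%N)[_ /(_ v)[h _]] _ _ _; exact: h.
Qed.

Lemma chart_continuous2 v w x : U x -> {for x, continuous ('D_w ('D_v phi))}.
Proof. by case: lp => _ /(_ 2%N)[_ /(_ v)[_ /(_ w) h]] _ _ _; exact: h. Qed.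

Lemma chart_row_free x : U x -> row_free ('J phi x).
Proof. by case: lp => _ _ h _ _; exact: h. Qed.

Lemma chart_inj x y : U x -> U y -> phi x = phi y -> x = y.
Proof. by case: lp => _ _ _ h _ Ux Uy; apply: h; exact: mem_set. Qed.

Lemma chart_image_open (W : set 'rV[R]_n) : open W -> W `<=` U ->
  exists2 V, open V & phi @` W = S `&` V.
Proof. by case: lp => _ _ _ _; apply. Qed.

Lemma chart_in x : U x -> S (phi x).
Proof.
move=> Ux; have [V oV E] := chart_image_open chart_open (@subset_refl _ U).
have : (phi @` U) (phi x) by exists x.
by rewrite E => -[].
Qed.

Lemma chart_nbhs x : U x -> nbhs x U.
Proof. by move=> Ux; apply: open_nbhs_nbhs; split=> //; exact: chart_open. Qed.

(** This is the homeomorphism clause: the part of [W] interior to [U] has relatively open image, so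
    every point of [S] close to [phi x] has a parameter in [W]. *)
Lemma chart_lift x (W : set 'rV[R]_n) : U x -> nbhs x W ->
  \forall q \near phi x, S q -> exists x', [/\ U x', W x' & phi x' = q].
Proof.
move=> Ux nW.
have oW : open (W° `&` U) by apply: openI; [exact: open_interior|exact: chart_open].
have [V oV E] := chart_image_open oW (@subIsetr _ _ _).
have Vx : V (phi x).
  have : (phi @` (W° `&` U)) (phi x) by exists x.
  by rewrite E => -[].
apply: filterS (open_nbhs_nbhs (conj oV Vx)) => q Vq Sq.
have : (S `&` V) q by [].
by rewrite -E => -[x' [/interior_subset Wx' Ux'] <-]; exists x'.
Qed.

(** The value 0 off the image is a placeholder; continuity is claimed only along [S]. *)
Definition chart_inverse (q : 'rV[R]_n.+1) : 'rV[R]_n := xget 0 [set x | U x /\ phi x = q].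

Lemma chart_inverseK x : U x -> chart_inverse (phi x) = x.
Proof.
move=> Ux; rewrite /chart_inverse; case: xgetP => [y _ [Uy h]|/(_ x)[]//].
exact: chart_inj.
Qed.

Lemma chart_inverse_continuous x : U x -> forall W, nbhs x W ->
  \forall q \near phi x, S q -> W (chart_inverse q).
Proof.
move=> Ux W nW; apply: filterS (chart_lift Ux nW) => q h /h[x' [Ux' Wx' <-]].
by rewrite chart_inverseK.
Qed.

(** On [U] the entries are components of the partial derivatives, which are themselves
    differentiable because the chart is C^2. *)
Lemma chart_jacobian_continuous x i j : U x -> {for x, continuous (fun y => 'J phi y i j)}.
Proof.
move=> Ux A hA.
have E : \forall y \near x, 'J phi y i j = ('D_(delta_mx 0 i) phi y) 0 j.
  by apply: filterS (chart_nbhs Ux) => y Uy; rewrite chart_jacobianE// -rowE [RHS]mxE.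
have c : {for x, continuous ('D_(delta_mx 0 i) phi)}.
  exact: has_derivative_continuous (chart_derivative2 _ Ux).
have c' := continuous_coord (j := j) c.
have {}hA : nbhs ('D_(delta_mx 0 i) phi x 0 j) A by rewrite -(nbhs_singleton E).
apply: filterS2 E (c' A hA) => y h1 h2.
by rewrite /= h1.
Qed.

End Chart.

(** * The outward normal is the supporting normal *)

Section OutwardNormal.
Context {R : realType} {n : nat}.
Variable Omega : set 'rV[R]_n.+1.
Hypotheses (oO : open Omega) (O0 : Omega !=set0) (bO : bounded_set Omega)
  (cO : convex_set Omega) (smO : smooth_hypersurface (boundary Omega)).
Implicit Types (p q v w : 'rV[R]_n.+1).

Let K := closure Omega.
Let bK : convex_body K := closure_convex_body O0 bO cO.

Let boundaryK p : boundary Omega p -> K p.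
Proof. by case. Qed.

Lemma supports_tangent p v U phi x : supports K p v ->
  local_param (boundary Omega) U phi -> U x -> phi x = p -> 'J phi x *m v^T = 0.
Proof.
move=> [_ h] lp Ux xp; apply: (has_derivative_le0 (chart_derivative lp Ux)).
apply: filterS (chart_nbhs lp Ux) => y Uy; rewrite xp; apply: h.
by apply: boundaryK; exact: (chart_in lp).
Qed.

(** Smoothness enters here: supporting vectors are orthogonal to the tangent space, a hyperplane, so
    w = v or w = -v. An interior point, strictly on the inner side of both supporting hyperplanes,
    excludes the second case. *)
Lemma supports_unique p v w : enorm v = 1 -> supports K p v ->
  enorm w = 1 -> supports K p w -> w = v.
Proof.
move=> v1 sv w1 sw.
have bp := supports_boundary oO sv (unit_neq0 v1).
have [U [phi [lp [x Ux xp]]]] := smO bp.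
have E := orthogonal_complement (chart_row_free lp Ux) (supports_tangent sv lp Ux xp) v1
  (supports_tangent sw lp Ux xp).
have : `|dotv w v| = 1 by have := w1; rewrite E enormZ v1 mulr1 dotvZl enorm1_dotv// mulr1.
move=> /eqP; rewrite eqr_norml ler01 andbT => /orP[|] /eqP h.
  by rewrite E h scale1r.
have {}E : w = - v by rewrite E h scaleN1r.
have [x0 Ox0] := O0.
have := supports_interior oO sv (unit_neq0 v1) Ox0.
have := supports_interior oO sw (unit_neq0 w1) Ox0.
by rewrite E dotvNr oppr_lt0 => /ltW h1; rewrite ltNge h1.
Qed.

Lemma supports_outward p v : enorm v = 1 -> supports K p v ->
  is_outward_unit_normal Omega p v.
Proof.
move=> v1 sv; split=> //; first by move=> U phi x lp Ux xp; exact: (supports_tangent sv lp Ux xp).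
apply: filterS (nbhs_right_gt 0) => t t0 Kt.
have [_ /(_ _ Kt)] := sv; rewrite addrC addKr dotvZl enorm1_dotv// mulr1.
by rewrite leNgt t0.
Qed.

Lemma compact_halfsphere v : compact [set w | enorm w = 1 /\ dotv w v <= 0].
Proof.
have -> : [set w | enorm w = 1 /\ dotv w v <= 0] =
   esphere R n.+1 `&` (fun w => dotv w v) @^-1` [set t | t <= 0] by [].
apply: compact_closedI; first exact: esphere_compact.
apply: preimage_closed; last exact: closed_le.
by move=> w _; exact: dotvl_continuous.
Qed.

Lemma not_supports_exists p w : K p -> ~ supports K p w ->
  exists2 x, K x & 0 < dotv (x - p) w.
Proof.
move=> Kp ns; apply: contrapT => nx; apply: ns; split=> // x Kx.
by rewrite leNgt; apply/negP => h; apply: nx; exists x.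
Qed.

(** The chosen vector is orthogonal to the tangent space, hence v or -v for the supporting normal v.
    The third clause of the definition has to exclude -v. *)
Lemma outward_normalP p : boundary Omega p ->
  enorm (outward_normal Omega p) = 1 /\ supports K p (outward_normal Omega p).
Proof.
move=> bp; have [v v1 sv] := supports_exists oO O0 bO cO bp.
have [w1 wt wo] : is_outward_unit_normal Omega p (outward_normal Omega p).
  exact: (@getPex _ _ (ex_intro _ v (supports_outward v1 sv))).
set w := outward_normal Omega p in w1 wt wo *.
suff -> : w = v by [].
have [U [phi [lp [x Ux xp]]]] := smO bp.
have E := orthogonal_complement (chart_row_free lp Ux) (supports_tangent sv lp Ux xp) v1
  (wt _ _ _ lp Ux xp).
have : `|dotv w v| = 1 by have := w1; rewrite E enormZ v1 mulr1 dotvZl enorm1_dotv// mulr1.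
move=> /eqP; rewrite eqr_norml ler01 andbT => /orP[|] /eqP h.
  by rewrite E h scale1r.
have {}E : w = - v by rewrite E h scaleN1r.
(* If w = - v, the points p - t v lie outside K, yet their nearest points in K
   have supporting normals close to v. *)
have Kp := boundaryK bp.
have H u : [set w | enorm w = 1 /\ dotv w v <= 0] u ->
    exists2 x, K x & 0 < dotv (x - p) u.
  move=> [u1 uv]; apply: not_supports_exists => // su.
  by move: uv; rewrite (supports_unique v1 sv u1 su) enorm1_dotv// leNgt ltr01.
have /nbhs_enormP[r r0 hr] := near_not_supported (compact_halfsphere (v := v)) H.
have [t [[nK t0] tr]] : exists t : R, (~ K (p + t *: w) /\ 0 < t) /\ t < r.
  have F : \forall t \near 0^'+, (~ K (p + t *: w) /\ 0 < t) /\ t < r.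
    apply: filterI; last exact: nbhs_right_lt.
    by apply: filterI => //; exact: nbhs_right_gt.
  exact: filter_ex F.
have [u1 [Kq su]] := normalized_supports bK nK.
set y := p + t *: w in nK u1 Kq su; set u := _ *: _ in u1 su.
have hq : enorm (proj K y - p) < r.
  rewrite -[X in _ - X](proj_id bK Kp) (le_lt_trans (proj_lipschitz bK _ _))//.
  by rewrite /y addrC addKr enormZ gtr0_norm// w1 mulr1.
have uv : 0 < dotv u v.
  rewrite ltNge; apply/negP => uv.
  by have [z Kz] := hr _ hq u (conj u1 uv); rewrite ltNge su.
have d0 := dist_gt0 bK nK.
have : dotv (y - proj K y) u = dist K y.
  have -> : y - proj K y = dist K y *: u by rewrite /u scalerA mulfV ?gt_eqF// scale1r.
  by rewrite dotvZl enorm1_dotv// mulr1.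
have -> : y - proj K y = (p - proj K y) - t *: v.
  by rewrite /y E scalerN addrAC.
rewrite dotvBl dotvZl (dotvC v) => h2.
have : dist K y < 0 by rewrite -h2 subr_lt0 (le_lt_trans (su _ Kp))// mulr_gt0.
by rewrite ltNge ltW.
Qed.

Lemma outward_normal_unit p : boundary Omega p -> enorm (outward_normal Omega p) = 1.
Proof. by case/outward_normalP. Qed.

Lemma outward_normal_supports p : boundary Omega p ->
  supports K p (outward_normal Omega p).
Proof. by case/outward_normalP. Qed.

Lemma outward_normal_eq p v : enorm v = 1 -> supports K p v -> outward_normal Omega p = v.
Proof.
move=> v1 sv; have bp := supports_boundary oO sv (unit_neq0 v1).
have [w1 sw] := outward_normalP bp; exact: supports_unique v1 sv w1 sw.
Qed.

(** The unit directions at distance at least e from the normal at p form a compact set of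
    non-supporting directions at p. They remain non-supporting at nearby points, whose normal is
    thus e-close. *)
Lemma outward_normal_continuous p (e : R) : boundary Omega p -> 0 < e ->
  \forall q \near p, boundary Omega q ->
    enorm (outward_normal Omega q - outward_normal Omega p) < e.
Proof.
move=> bp e0; have [v1 sv] := outward_normalP bp.
set v := outward_normal Omega p in v1 sv *.
pose A := esphere R n.+1 `&` (fun w => enorm (w - v)) @^-1` [set t | e <= t].
have cA : compact A.
  apply: compact_closedI; first exact: esphere_compact.
  apply: preimage_closed; last exact: closed_ge.
  move=> w _; apply: (@lipschitz_continuousR _ _ _ 1) => x z.
  rewrite mul1r (le_trans (enorm_lip _ _))// le_eqVlt; apply/orP; left.
  by apply/eqP; congr enorm; apply/rowP => i; rewrite !mxE; ring.
have H u : A u -> exists2 x, K x & 0 < dotv (x - p) u.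
  move=> [u1 uv]; apply: not_supports_exists; first exact: boundaryK.
  move=> su; move: uv; rewrite /= (supports_unique v1 sv u1 su) subrr enorm0 leNgt.
  by rewrite e0.
apply: filterS (near_not_supported cA H) => q hq bq.
rewrite ltNge; apply/negP => he; have [u1 su] := outward_normalP bq.
have [|x Kx] := hq (outward_normal Omega q); first by split.
by rewrite ltNge; case: su => _ ->.
Qed.

End OutwardNormal.

(** * Derivatives along lines *)

Section Directional.
Context {R : realType}.

Lemma near_line n (x w : 'rV[R]_n) (P : 'rV[R]_n -> Prop) :
  (\forall y \near x, P y) -> \forall t \near 0^'+, P (x + t *: w).
Proof.
move=> /nbhs_enormP[r r0 hr].
have w1 : 0 < enorm w + 1 by rewrite ltr_wpDl// enorm_ge0.
apply: filterS2 (nbhs_right_gt 0) (nbhs_right_lt (divr_gt0 r0 w1)) => t t0 tr.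
apply: hr; rewrite addrC addKr enormZ gtr0_norm//.
apply: (@le_lt_trans _ _ (t * (enorm w + 1))); first by rewrite ler_pM2l// lerDl.
by rewrite -ltr_pdivlMr.
Qed.

Lemma has_derivative_dir n m (f : 'rV[R]_n -> 'rV[R]_m) x L w (e : R) :
  has_derivative f x L -> 0 < e ->
  \forall t \near 0^'+, enorm (f (x + t *: w) - f x - t *: (w *m L)) <= e * t.
Proof.
move=> df e0.
have C0 : 0 < m%:R * `|w| + 1 :> R by rewrite ltr_wpDl// mulr_ge0.
have e1 : 0 < e / (m%:R * `|w| + 1) by rewrite divr_gt0.
apply: filterS2 (nbhs_right_gt 0) (near_line w (df _ e1)) => t t0.
rewrite [x + _]addrC addrK -scalemxAl normrZ gtr0_norm// => h.
apply: (le_trans (enorm_le_norm _)).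
apply: (@le_trans _ _ (m%:R * (e / (m%:R * `|w| + 1) * (t * `|w|)))).
  by rewrite ler_wpM2l.
have -> : m%:R * (e / (m%:R * `|w| + 1) * (t * `|w|)) =
  e * t * ((m%:R * `|w|) / (m%:R * `|w| + 1)) by field; rewrite gt_eqF.
rewrite ler_piMr//; first by rewrite mulr_ge0 ?ltW.
by rewrite ler_pdivrMr// mul1r lerDl.
Qed.

(** Along x + t w the inner product is t^2 <w L, w M> up to o(t^2). This will turn monotonicity of
    the normal into positivity of the second fundamental form. *)
Lemma has_derivative_monotone n m (f g : 'rV[R]_n -> 'rV[R]_m) x L M w :
  has_derivative f x L -> has_derivative g x M ->
  (\forall y \near x, 0 <= dotv (f y - f x) (g y - g x)) ->
  0 <= dotv (w *m L) (w *m M).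
Proof.
move=> df dg h; rewrite leNgt; apply/negP; set a := dotv _ _ => a0.
pose B := enorm (w *m L) + enorm (w *m M) + 1.
have := enorm_ge0 (w *m L); have := enorm_ge0 (w *m M) => ge1 ge2.
have B0 : 0 < B by rewrite /B; lra.
pose e := Num.min 1 (- a / 2 / B).
have e0 : 0 < e by rewrite lt_min ltr01 !divr_gt0// oppr_gt0.
have e1 : e <= 1 by rewrite ge_min lexx.
have eB : e * B <= - a / 2 by rewrite -ler_pdivlMr// ge_min lexx orbT.
have [t [[t0 h1] [h2 h3]]] : exists t : R, (0 < t /\ 0 <= dotv (f (x + t *: w) - f x) (g (x + t *: w) - g x)) /\
  (enorm (f (x + t *: w) - f x - t *: (w *m L)) <= e * t /\
   enorm (g (x + t *: w) - g x - t *: (w *m M)) <= e * t).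
  apply: (@filter_ex _ (0 : R)^'+).
  apply: filterI; apply: filterI.
  - exact: nbhs_right_gt.
  - exact: near_line h.
  - exact: has_derivative_dir.
  - exact: has_derivative_dir.
set F := f _ - f x in h1 h2; set G := g _ - g x in h1 h3.
have E : dotv F G = t * t * a + t * dotv (w *m L) (G - t *: (w *m M)) +
    t * dotv (F - t *: (w *m L)) (w *m M) + dotv (F - t *: (w *m L)) (G - t *: (w *m M)).
  rewrite /a !dotvL; ring.
have b1 := dotv_le_enorm (w *m L) (G - t *: (w *m M)).
have b2 := dotv_le_enorm (F - t *: (w *m L)) (w *m M).
have b3 := dotv_le_enorm (F - t *: (w *m L)) (G - t *: (w *m M)).
have c1 := ler_wpM2l ge2 h3.
have c2 := ler_wpM2r ge1 h2.
have c3 : enorm (F - t *: (w *m L)) * enorm (G - t *: (w *m M)) <= e * t * (1 * t).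
  apply: ler_pM => //; try exact: enorm_ge0.
  by apply: (le_trans h3); rewrite ler_wpM2r// ltW.
have d1 := ler_wpM2l (ltW t0) (le_trans b1 c1).
have d2 := ler_wpM2l (ltW t0) (le_trans b2 c2).
have d3 := le_trans b3 c3.
have tt : 0 < t * t by rewrite mulr_gt0.
have eBt := ler_wpM2l (ltW tt) eB.
have at0 : t * t * a < 0 by rewrite pmulr_rlt0.
have : dotv F G < 0.
  rewrite E /B in eBt *; move: d1 d2 d3 eBt at0; clear.
  move: (dotv _ _) (dotv _ _) (dotv _ _) => p q r; move: (enorm _) (enorm _) => u v.
  nra.
by rewrite ltNge h1.
Qed.

(** Passage to one-variable derivatives, so that the mean value theorem can be applied along a
    line. *)
Lemma is_derive_line n m (f : 'rV[R]_n -> 'rV[R]_m) x v (s : R) w L :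
  has_derivative f (x + s *: v) L ->
  is_derive s 1 (fun r : R => dotv (f (x + r *: v)) w) (dotv (v *m L) w).
Proof.
move=> df; set g := fun r => _; set l := dotv _ _.
suff H : (fun h => h^-1 *: ((g \o shift s) (h *: (1:R)) - g s)) @ 0^' --> l.
  by apply: DeriveDef; [apply/cvg_ex; exists l|exact/cvg_lim].
apply/cvgrPdist_le => e e0.
pose C := m%:R * `|v| * enorm w + 1.
have C0 : 0 < C by rewrite ltr_wpDl// !mulr_ge0 ?enorm_ge0.
have e1 : 0 < e / C by rewrite divr_gt0.
have /nbhs_ballP[r /= r0 hr] := df _ e1.
have v1 : 0 < `|v| + 1 by rewrite ltr_wpDl.
rewrite /dnbhs /within /=; apply/nbhs_ballP; exists (r / (`|v| + 1)) => /=.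
  by rewrite divr_gt0.
move=> h; rewrite /ball /= sub0r normrN => hh h0.
have := hr (x + (h + s) *: v).
have E : x + (h + s) *: v - (x + s *: v) = h *: v.
  by apply/rowP => i; rewrite !mxE; ring.
rewrite -ball_normE /= distrC E normrZ => H.
have {}H := H ltac:(by apply: (@le_lt_trans _ _ (`|h| * (`|v| + 1)));
  [rewrite ler_wpM2l// lerDl|rewrite -ltr_pdivlMr]).
have hn : h != 0 := h0.
have h0' : 0 < `|h| by rewrite normr_gt0.
rewrite -(ler_pM2l h0') -normrM.
set r1 := f _ - f _ - _ in H.
have -> : h * (l - h^-1 *: (g (h *: (1:R) + s) - g s)) = - dotv r1 w.
  rewrite /r1 /l /g -scalemxAl !dotvL.
  rewrite [h *: 1]mulr1 [_ *: (_ - _)]/(_ * _) mulrBr mulrA mulfV// mul1r.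
  ring.
rewrite normrN (le_trans (dotv_abs_le _ _))//.
apply: (@le_trans _ _ (m%:R * (e / C * (`|h| * `|v|)) * enorm w)).
  rewrite ler_wpM2r ?enorm_ge0// (le_trans (enorm_le_norm _))//.
  by rewrite ler_wpM2l.
have -> : m%:R * (e / C * (`|h| * `|v|)) * enorm w = `|h| * e * ((C - 1) / C).
  by rewrite /C; field; rewrite gt_eqF// -/C.
rewrite ler_piMr//; first by rewrite mulr_ge0// ltW.
by rewrite ler_pdivrMr// mul1r gerBl.
Qed.

End Directional.

(** * Symmetry of second derivatives *)

Section Schwarz.
Context {R : realType} {n m : nat}.
Variables (U : set 'rV[R]_n) (f : 'rV[R]_n -> 'rV[R]_m) (v : 'rV[R]_m).
Hypotheses (oU : open U) (df : forall x, U x -> differentiable f x).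

Let incr x p q (t : R) : R := dotv (f (x + t *: p + t *: q)) v -
  dotv (f (x + t *: p)) v - dotv (f (x + t *: q)) v + dotv (f x) v.

(** The second difference is an increment in the direction p of y |-> f(y + t q) - f(y). The mean
    value theorem makes it a difference of two values of ['D_p f], to which differentiability at x
    applies. *)
Let incr_approx x p q M : U x -> has_derivative ('D_p f) x M -> forall e, 0 < e ->
  \forall t \near 0^'+, `|incr x p q t - t ^+ 2 * dotv (q *m M) v| <= e * t ^+ 2.
Proof.
move=> Ux dM e e0.
pose C := m%:R * enorm v * (2 * `|p| + `|q|) + 1.
have C0 : 0 < C by rewrite ltr_wpDl// !mulr_ge0 ?enorm_ge0// addr_ge0// mulr_ge0.
have eC : 0 < e / C by rewrite divr_gt0.
have /nbhs_ballP[r /= r0 hr] : nbhs x [set y | U y /\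
    `|'D_p f y - 'D_p f x - (y - x) *m M| <= e / C * `|y - x|].
  by apply: filterI (dM _ eC); exact: open_nbhs_nbhs.
pose D := `|p| + `|q| + 1.
have D0 : 0 < D by rewrite ltr_wpDl// addr_ge0.
apply: filterS2 (nbhs_right_gt 0) (nbhs_right_lt (divr_gt0 r0 D0)) => t t0 tr.
have ptball (a b : R) : 0 <= a <= t -> 0 <= b <= t -> ball x r (x + a *: p + b *: q).
  move=> /andP[a0 at0] /andP[b0 bt0].
  rewrite -ball_normE /= -addrA opprD addrA subrr sub0r normrN.
  rewrite (le_lt_trans (ler_normD _ _))// !normrZ !ger0_norm//.
  apply: (@le_lt_trans _ _ (t * D)); last by rewrite -ltr_pdivlMr.
  have := ler_wpM2r (normr_ge0 p) at0; have := ler_wpM2r (normr_ge0 q) bt0.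
  by rewrite /D; nra.
have tt : 0 <= t <= t by rewrite lexx ltW.
have t00 : 0 <= (0:R) <= t by rewrite lexx ltW.
pose h s := dotv (f ((x + t *: q) + s *: p)) v - dotv (f (x + s *: p)) v.
pose dh s := dotv ('D_p f (x + s *: p + t *: q)) v - dotv ('D_p f (x + s *: p)) v.
have hder s : 0 <= s <= t -> is_derive s 1 h (dh s).
  move=> st.
  have U1 : U ((x + t *: q) + s *: p) by rewrite addrAC; case: (hr _ (ptball _ _ st tt)).
  have U2 : U (x + s *: p).
    by have [] := hr _ (ptball _ _ st t00); rewrite scale0r addr0.
  rewrite /dh addrAC !deriveEjacobian; try exact: df.
  have i1 := is_derive_line v (differentiable_has_derivative (df U1)).
  have i2 := is_derive_line v (differentiable_has_derivative (df U2)).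
  exact: (is_deriveB i1 i2).
have [c ct E] : exists2 c, c \in `]0, t[ & h t - h 0 = dh c * (t - 0).
  apply: MVT => //.
    by move=> s; rewrite in_itv /= => /andP[/ltW s0 /ltW st]; apply: hder; rewrite s0.
  apply: derivable_within_continuous => s; rewrite in_itv /= => hs.
  by have [] := hder s hs.
have {}ct : 0 <= c <= t by move: ct; rewrite in_itv /= => /andP[/ltW -> /ltW ->].
have -> : incr x p q t = t * dh c.
  rewrite mulrC -[t in RHS]subr0 -E /h /incr !scale0r !addr0 (addrAC x (t *: q)); ring.
have [_ h1] := hr _ (ptball c t ct tt).
have [_ h2] := hr _ (ptball c 0 ct t00).
rewrite scale0r addr0 in h2.
set y1 := x + c *: p + t *: q in h1; set y2 := x + c *: p in h2.
set r1 := 'D_p f y1 - _ - _ in h1; set r2 := 'D_p f y2 - _ - _ in h2.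
have -> : t * dh c - t ^+ 2 * dotv (q *m M) v = t * dotv (r1 - r2) v.
  rewrite /dh -/y1 -/y2.
  have -> : r1 - r2 = 'D_p f y1 - 'D_p f y2 - t *: (q *m M).
    have -> : t *: (q *m M) = (y1 - x) *m M - (y2 - x) *m M.
      by rewrite -mulmxBl scalemxAl; congr (_ *m _); apply/rowP => i; rewrite !mxE; ring.
    by apply/rowP => i; rewrite /r1 /r2 !(mxE, summxE); ring.
  rewrite !dotvL; ring.
have n1 : `|y1 - x| <= t * (`|p| + `|q|).
  have -> : y1 - x = c *: p + t *: q by apply/rowP => i; rewrite /y1 !mxE; ring.
  rewrite (le_trans (ler_normD _ _))// !normrZ !ger0_norm ?(ltW t0)//; last by case/andP: ct.
  by rewrite mulrDr lerD2r ler_wpM2r//; case/andP: ct.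
have n2 : `|y2 - x| <= t * `|p|.
  have -> : y2 - x = c *: p by apply/rowP => i; rewrite /y2 !mxE; ring.
  by rewrite normrZ ger0_norm; [rewrite ler_wpM2r//; case/andP: ct|case/andP: ct].
rewrite normrM gtr0_norm// expr2 mulrCA ler_pM2l//.
rewrite (le_trans (dotv_abs_le _ _))//.
apply: (@le_trans _ _ (m%:R * (e / C * (t * (2 * `|p| + `|q|))) * enorm v)).
  rewrite ler_wpM2r ?enorm_ge0// (le_trans (enorm_le_norm _))// ler_wpM2l//.
  rewrite (le_trans (ler_normB _ _))// (le_trans (lerD h1 h2))// -mulrDr ler_pM2l//.
  by apply: (le_trans (lerD n1 n2)); rewrite le_eqVlt; apply/orP; left; apply/eqP; ring.
have -> : m%:R * (e / C * (t * (2 * `|p| + `|q|))) * enorm v = e * t * ((C - 1) / C).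
  by rewrite /C; field; rewrite gt_eqF// -/C.
rewrite ler_piMr//; first by rewrite mulr_ge0// ltW.
by rewrite ler_pdivrMr// mul1r gerBl.
Qed.

(* Only differentiability at x of the two first derivatives is needed: both
   mixed derivatives are the limit of the same second difference quotient. *)
Lemma mixed_derivatives x p q M N : U x ->
  has_derivative ('D_p f) x M -> has_derivative ('D_q f) x N ->
  dotv (q *m M) v = dotv (p *m N) v.
Proof.
move=> Ux dM dN; apply/eqP; rewrite -subr_eq0 -normr_eq0; apply/eqP/le_anti.
rewrite normr_ge0 andbT; apply/ler_addgt0Pl => e e0; rewrite addr0.
have e2 : 0 < e / 2 by rewrite divr_gt0.
have [t [t0 [h1 h2]]] : exists t : R, 0 < t /\
   (`|incr x p q t - t ^+ 2 * dotv (q *m M) v| <= e / 2 * t ^+ 2 /\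
    `|incr x q p t - t ^+ 2 * dotv (p *m N) v| <= e / 2 * t ^+ 2).
  apply: (@filter_ex _ (0 : R)^'+); apply: filterI; first exact: nbhs_right_gt.
  by apply: filterI; apply: incr_approx.
have E : incr x q p t = incr x p q t by rewrite /incr (addrAC x); ring.
rewrite E in h2.
have tt : 0 < t ^+ 2 by rewrite exprn_gt0.
rewrite -(ler_pM2l tt) -[X in X * _](gtr0_norm tt) -normrM.
have -> : t ^+ 2 * (dotv (q *m M) v - dotv (p *m N) v) =
  (incr x p q t - t ^+ 2 * dotv (p *m N) v) - (incr x p q t - t ^+ 2 * dotv (q *m M) v).
  ring.
by rewrite (le_trans (ler_normB _ _))// (le_trans (lerD h2 h1))// -mulrDl -splitr mulrC.
Qed.

End Schwarz.

(** * The shape operator *)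

Lemma tangent_increment {R : realType} n (v w a b u : 'rV[R]_n) :
  dotv v a = 0 -> dotv w b = 0 ->
  dotv (w - v) a + dotv u v = - dotv (w - v) u - dotv w (b - a - u).
Proof.
move=> va wb; rewrite dotvBl va subr0 (dotvBl w) 2!(dotvBr _ _ w) wb sub0r (dotvC u).
ring.
Qed.

(** A unit vector moves tangentially to first order: the normal component of its increment is
    quadratic in the size of the increment. *)
Lemma unit_increment {R : realType} n (v w : 'rV[R]_n) : enorm v = 1 -> enorm w = 1 ->
  (w - v) *m v^T = (- (enorm (w - v) ^+ 2 / 2))%:M.
Proof.
move=> v1 w1; rewrite [LHS]mx11_scalar -dotvE enorm2 !dotvL !enorm1_dotv// (dotvC w).
by congr (_%:M); field.
Qed.

Lemma dotv_monotone {R : realType} n (p q v w : 'rV[R]_n) :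
  dotv (q - p) v <= 0 -> dotv (p - q) w <= 0 -> 0 <= dotv (q - p) (w - v).
Proof.
move=> h1 h2; rewrite dotvBr subr_ge0 (le_trans h1)//.
by rewrite -oppr_le0 -dotvNl opprB.
Qed.

Section ShapeOperator.
Context {R : realType} {n : nat}.
Variable Omega : set 'rV[R]_n.+1.
Hypotheses (oO : open Omega) (O0 : Omega !=set0) (bO : bounded_set Omega)
  (cO : convex_set Omega) (smO : smooth_hypersurface (boundary Omega)).
Variables (U : set 'rV[R]_n) (phi : 'rV[R]_n -> 'rV[R]_n.+1).
Hypothesis lp : local_param (boundary Omega) U phi.

Let K := closure Omega.
Let bK : convex_body K := closure_convex_body O0 bO cO.

Definition chart_normal Omega' (psi : 'rV[R]_n -> 'rV[R]_n.+1) x :=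
  outward_normal Omega' (psi x).

Local Notation N := (chart_normal Omega phi).
Local Notation J := (jacobian phi).
Local Notation g := (first_form phi).
Local Notation II := (second_form Omega phi).

(* The matrix of the differential of the normal in the frame 'J phi x; it is
   conjugate to the Weingarten matrix by the first fundamental form. *)
Definition shape_mx Omega' psi (x : 'rV[R]_n) : 'M[R]_n :=
  second_form Omega' psi x *m invmx (first_form psi x).

Lemma chart_normal_unit x : U x -> enorm (N x) = 1.
Proof. by move=> Ux; apply: (outward_normal_unit oO O0 bO cO smO); exact: (chart_in lp). Qed.

Lemma chart_normal_supports x : U x -> supports K (phi x) (N x).
Proof. by move=> Ux; apply: (outward_normal_supports oO O0 bO cO smO); exact: (chart_in lp). Qed.

Lemma chart_normal_tangent x : U x -> J x *m (N x)^T = 0.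
Proof. by move=> Ux; exact: (supports_tangent (chart_normal_supports Ux) lp Ux). Qed.

Lemma chart_normal_near x (e : R) : U x -> 0 < e -> \forall y \near x, enorm (N y - N x) < e.
Proof.
move=> Ux e0; have bx := chart_in lp Ux.
have h : \forall y \near x, boundary Omega (phi y) ->
    enorm (outward_normal Omega (phi y) - outward_normal Omega (phi x)) < e.
  have c : phi y @[y --> x] --> phi x := chart_continuous lp Ux.
  exact: c (outward_normal_continuous oO O0 bO cO smO bx e0).
by apply: filterS2 h (chart_nbhs lp Ux) => y h1 Uy; apply: h1; exact: (chart_in lp).
Qed.

Lemma first_form_unit x : U x -> g x \in unitmx.
Proof. by move=> Ux; apply: gram_unit; exact: (chart_row_free lp Ux). Qed.

Lemma mul_second_form u x j : U x ->
  (u *m II x) 0 j = - dotv (u *m 'J ('D_(delta_mx 0 j) phi) x) (N x).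
Proof.
move=> Ux; rewrite mxE dotvE -mulmxA mxE -sumrN; apply: eq_bigr => i _.
rewrite [second_form _ _ _ _ _]mxE (chart_jacobianE2 lp)// dotvE -mulmxA mulrN.
by rewrite -[delta_mx _ _ *m _]rowE [row _ _ _ _]mxE.
Qed.

(** The normal is only known to be continuous so far, but its products with the tangent vectors
    vanish identically, and these vectors are differentiable. The tangential components of its
    increment are therefore linear to first order, with matrix the second fundamental form. *)
Let tangential_derivative x (e : R) : U x -> 0 < e -> \forall y \near x,
  `|(N y - N x) *m (J x)^T - (y - x) *m II x| <= e * `|y - x|.
Proof.
move=> Ux e0.
suff H (j : 'I_n) : \forall y \near x,
    `|((N y - N x) *m (J x)^T - (y - x) *m II x) 0 j| <= e * `|y - x|.
  have FF : Filter (nbhs x) := nbhs_filter x.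
  apply: filterS (@filter_forall _ 'I_n _ _ FF H) => y hy.
  by apply: norm_le_coord => //; rewrite mulr_ge0// ltW.
set M := 'J ('D_(delta_mx 0 j) phi) x.
have dM : has_derivative ('D_(delta_mx 0 j) phi) x M := chart_derivative2 lp _ Ux.
have [C C0 hC] := mulmx_bound M.
have k0 : 0 < n.+1%:R :> R by [].
have e1 : 0 < e / (2 * n.+1%:R) by rewrite divr_gt0// mulr_gt0.
have e2 : 0 < e / (2 * n.+1%:R * C) by rewrite divr_gt0// !mulr_gt0.
apply: filterS3 (dM _ e1) (chart_normal_near Ux e2) (chart_nbhs lp Ux) => y h1 h2 Uy.
have dJ z : U z -> 'D_(delta_mx 0 j) phi z = row j (J z).
  by move=> Uz; rewrite (chart_jacobianE lp)// rowE.
have NJ z w : (w *m (J z)^T) 0 j = dotv w (row j (J z)).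
  rewrite mxE; apply: eq_bigr => i _.
  by rewrite [(J z)^T _ _]mxE [row _ _ _ _]mxE.
have NJ0 z : U z -> dotv (N z) (row j (J z)) = 0.
  move=> Uz; rewrite -NJ -[N z *m _]trmxK trmx_mul trmxK chart_normal_tangent//.
  by rewrite trmx0 mxE.
pose r := row j (J y) - row j (J x) - (y - x) *m M.
have {}h1 : `|r| <= e / (2 * n.+1%:R) * `|y - x|.
  exact: (eq_ind _ (fun z => `|z - (y - x) *m M| <= e / (2 * n.+1%:R) * `|y - x|) h1 _
    (congr2 (fun a b => a - b) (dJ y Uy) (dJ x Ux))).
(* Product rule in difference form for <N, d_j phi> = 0. The two terms left are a small increment of
   N against a linear term, and a unit vector against the remainder r. *)
have -> : ((N y - N x) *m (J x)^T - (y - x) *m II x) 0 j =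
   - dotv (N y - N x) ((y - x) *m M) - dotv (N y) r.
  rewrite [LHS]mxE [(- _ : 'rV__) _ _]mxE NJ mul_second_form// opprK.
  exact: (tangent_increment ((y - x) *m M) (NJ0 x Ux) (NJ0 y Uy)).
have a1 : `|dotv (N y - N x) ((y - x) *m M)| <= e / 2 * `|y - x|.
  rewrite (le_trans (dotv_abs_le _ _))//.
  apply: (@le_trans _ _ (e / (2 * n.+1%:R * C) * (n.+1%:R * (C * `|y - x|)))).
    apply: ler_pM; rewrite ?enorm_ge0//; first exact: ltW.
    by rewrite (le_trans (enorm_le_norm _))// ler_wpM2l.
  by rewrite le_eqVlt; apply/orP; left; apply/eqP; field; rewrite gt_eqF//= gt_eqF.
have a2 : `|dotv (N y) r| <= e / 2 * `|y - x|.
  rewrite (le_trans (dotv_abs_le _ _))// chart_normal_unit// mul1r.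
  rewrite (le_trans (enorm_le_norm _))//.
  apply: (@le_trans _ _ (n.+1%:R * (e / (2 * n.+1%:R) * `|y - x|))).
    by rewrite ler_wpM2l.
  by rewrite le_eqVlt; apply/orP; left; apply/eqP; field; rewrite gt_eqF.
rewrite (le_trans (ler_normB _ _))// normrN (splitr e) mulrDl.
exact: lerD.
Qed.

Lemma norm_row_mx p q (a : 'rV[R]_p) (b : 'rV[R]_q) : `|row_mx a b| <= `|a| + `|b|.
Proof.
apply: norm_le_coord => [|i]; first exact: addr_ge0.
rewrite mxE; case: splitP => j _; rewrite (le_trans (coord_le_norm _ _))//.
  by rewrite lerDl.
by rewrite lerDr.
Qed.

(** The frame of normal and tangent vectors recovers an increment F of the normal from its
    components. The normal component is of order |F|^2 and the tangential ones are linear up to o(|y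
    - x|), so first |F| = O(|y - x|), and then the normal component is negligible. *)
Lemma chart_normal_derivative x : U x -> has_derivative N x (shape_mx Omega phi x *m J x).
Proof.
move=> Ux e e0.
have uA := frame_unit (chart_row_free lp Ux) (chart_normal_tangent Ux)
  (unit_neq0 (chart_normal_unit Ux)).
set A : 'M[R]_(1 + n) := col_mx (N x) (J x) in uA.
have uAt : A^T \in unitmx by rewrite unitmx_tr.
have [Ci Ci0 hCi] := mulmx_bound (invmx A^T).
have [CI CI0 hCI] := mulmx_bound (II x).
have recover (v : 'rV[R]_(1 + n)) : `|v| <= Ci * `|v *m A^T|.
  by rewrite -{1}[v](mulmxK uAt).
have vA (v : 'rV[R]_n.+1) : v *m A^T = row_mx (v *m (N x)^T) (v *m (J x)^T).
  by rewrite /A tr_col_mx mul_mx_row.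
pose Cb := 1 + CI.
have Cb0 : 0 < Cb by rewrite addr_gt0.
pose k : R := n.+1%:R.
have k0 : 0 < k by rewrite ltr0n.
(* The first bound lets the normal component, at most k de |F|, be absorbed by |F|; the second makes
   it at most e/(2 Ci) |y - x| once |F| is bounded. *)
pose de := Num.min (2 * Ci * k)^-1 (e / (4 * k * Ci * Ci * Cb)).
have de0 : 0 < de by rewrite lt_min invr_gt0 divr_gt0 ?mulr_gt0.
have e2 : 0 < e / (2 * Ci) by rewrite divr_gt0// mulr_gt0.
apply: filterS2 (chart_normal_near Ux de0)
  (filterI (tangential_derivative Ux ltr01)
     (filterI (tangential_derivative Ux e2) (chart_nbhs lp Ux))) => y h1 [h2 [h3 Uy]].
set F := N y - N x in h1 h2 h3 *.
set d := `|y - x| in h2 h3 *.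
have d0 : 0 <= d := normr_ge0 _.
have aE : F *m (N x)^T = (- (enorm F ^+ 2 / 2))%:M.
  exact: unit_increment (chart_normal_unit Ux) (chart_normal_unit Uy).
have an : `|F *m (N x)^T| <= k * de * `|F|.
  rewrite aE; apply: norm_le_coord => [|i]; first by rewrite !mulr_ge0// ltW.
  rewrite (ord1 i) mxE eqxx mulr1n normrN ger0_norm ?divr_ge0 ?sqr_ge0//.
  apply: (@le_trans _ _ (enorm F ^+ 2)).
    by rewrite ler_pdivrMr// ler_peMr ?sqr_ge0// ler1n.
  rewrite expr2 -mulrA mulrCA; apply: ler_pM; rewrite ?enorm_ge0//; first exact: ltW.
  exact: enorm_le_norm.
have bn : `|F *m (J x)^T| <= Cb * d.
  rewrite -[X in `|X| <= _](subrK ((y - x) *m II x)) (le_trans (ler_normD _ _))//.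
  by rewrite /Cb mulrDl lerD.
have Fn : `|F| <= 2 * Ci * Cb * d.
  have f1 : `|F| <= Ci * (k * de * `|F| + Cb * d).
    rewrite (le_trans (recover F))// ler_pM2l// vA (le_trans (norm_row_mx _ _))//.
    exact: lerD.
  have f2 : Ci * (k * de) <= 2^-1.
    apply: (@le_trans _ _ (Ci * (k * (2 * Ci * k)^-1))).
      by rewrite ler_pM2l// ler_pM2l// /de ge_min lexx.
    by rewrite le_eqVlt; apply/orP; left; apply/eqP; field; rewrite !gt_eqF.
  have := ler_wpM2r (normr_ge0 F) f2; move: f1; clear.
  by move: (`|F|) => f; nra.
have an2 : `|F *m (N x)^T| <= e / (2 * Ci) * d.
  rewrite (le_trans an)//.
  apply: (@le_trans _ _ (k * (e / (4 * k * Ci * Ci * Cb)) * (2 * Ci * Cb * d))).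
    apply: ler_pM => //; first by rewrite mulr_ge0// ltW.
    by rewrite ler_pM2l// /de ge_min lexx orbT.
  by rewrite le_eqVlt; apply/orP; left; apply/eqP; field; rewrite !gt_eqF.
rewrite (le_trans (recover _))// mulmxBl vA.
have -> : (y - x) *m (shape_mx Omega phi x *m J x) *m A^T = row_mx 0 ((y - x) *m II x).
  rewrite vA -!mulmxA chart_normal_tangent// !mulmx0; congr row_mx.
  by rewrite [J x *m _]/(g x) mulVmx ?mulmx1// first_form_unit.
rewrite opp_row_mx add_row_mx oppr0 addr0.
apply: (@le_trans _ _ (Ci * (e / (2 * Ci) * d + e / (2 * Ci) * d))).
  rewrite ler_pM2l// (le_trans (norm_row_mx _ _))//; exact: lerD.
by rewrite le_eqVlt; apply/orP; left; apply/eqP; field; rewrite gt_eqF.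
Qed.

Lemma second_form_sym x : U x -> (II x)^T = II x.
Proof.
move=> Ux; apply/matrixP => i j; rewrite [LHS]mxE.
have E (a b : 'I_n) : 'D_(delta_mx 0 b) ('D_(delta_mx 0 a) phi) x = _ := chart_jacobianE2 lp _ _ Ux.
have D (a : 'I_n) : has_derivative ('D_(delta_mx 0 a) phi) x _ := chart_derivative2 lp _ Ux.
have S := mixed_derivatives (N x) (chart_open lp)
  (fun y Uy => chart_differentiable lp Uy) Ux (D i) (D j).
have S' := etrans (congr1 (fun z => dotv z (N x)) (E i j))
  (etrans S (esym (congr1 (fun z => dotv z (N x)) (E j i)))).
exact: (etrans (mxE _ _ _ _) (etrans (congr1 -%R S') (esym (mxE _ _ _ _)))).
Qed.

(** Supporting normals of a convex set are monotone, <q - p, nu(q) - nu(p)> >= 0, and the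
    second-order part of this inequality is the quadratic form of [II]. *)
Lemma second_form_psd x (w : 'rV[R]_n) : U x -> 0 <= (w *m II x *m w^T) 0 0.
Proof.
move=> Ux.
have := has_derivative_monotone w (chart_derivative lp Ux) (chart_normal_derivative Ux).
have -> : dotv (w *m J x) (w *m (shape_mx Omega phi x *m J x)) =
    (w *m II x *m w^T) 0 0.
  rewrite dotvC dotvE trmx_mul -!mulmxA.
  rewrite (mulmxA (J x)) -/(g x) (mulmxA (invmx _)) mulVmx ?mul1mx//.
  exact: first_form_unit.
apply; apply: filterS (chart_nbhs lp Ux) => y Uy.
have [Kx sx] := chart_normal_supports Ux; have [Ky sy] := chart_normal_supports Uy.
exact: dotv_monotone (sx _ Ky) (sy _ Kx).
Qed.

Lemma first_form_pd x (w : 'rV[R]_n) : U x -> w != 0 -> 0 < (w *m g x *m w^T) 0 0.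
Proof.
move=> Ux w0; rewrite /first_form mulmxA -mulmxA -trmx_mul -dotvE.
rewrite lt_neqAle dotv_ge0 andbT eq_sym; apply: contra_neq w0 => /dotv_eq0/eqP.
by rewrite mulmx_free_eq0 ?(chart_row_free lp Ux)// => /eqP.
Qed.

Lemma first_form_sym x : (g x)^T = g x.
Proof. by rewrite /first_form trmx_mul trmxK. Qed.

Lemma chart_normal_continuous x : U x -> {for x, continuous N}.
Proof. by move=> Ux; exact: has_derivative_continuous (chart_normal_derivative Ux). Qed.

End ShapeOperator.
From mathcomp Require Import complex.

(** * Real eigenvalues of symmetric pencils *)

Section SymmetricPencil.
Context {R : realType}.

Lemma char_poly_intertwine (F : fieldType) n (P A B : 'M[F]_n) :
  P \in unitmx -> P *m A = B *m P -> char_poly A = char_poly B.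
Proof.
move=> uP PA.
pose Pp := map_mx polyC P.
have detP : \det Pp != 0.
  rewrite /Pp det_map_mx polyC_eq0.
  by move: uP; rewrite unitmxE unitfE.
apply: (mulfI detP); rewrite [RHS]mulrC -!det_mulmx; congr (\det _).
rewrite /char_poly_mx mulmxBr mulmxBl -!map_mxM PA; congr (_ - _).
by rewrite mul_mx_scalar mul_scalar_mx.
Qed.

Lemma horner_char_poly (F : fieldType) n (A : 'M[F]_n) a :
  (char_poly A).[a] = \det (a%:M - A).
Proof.
rewrite -[LHS]/(horner_eval a (char_poly A)) -det_map_mx; congr (\det _).
apply/matrixP => i j; rewrite /char_poly_mx !mxE.
rewrite -[LHS]/(('X *+ (i == j) - (A i j)%:P).[a]).
by rewrite hornerD hornerN hornerC hornerMn hornerX.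
Qed.

Lemma det_one_add (n : nat) (A : 'M[R]_n) (k : 'rV[R]_n) (s : R) :
  char_poly A = \prod_(i < n) ('X - (k 0 i)%:P) ->
  \det (1%:M + s *: A) = \prod_i (1 + s * k 0 i).
Proof.
move=> pA; have [->|s0] := eqVneq s 0.
  by rewrite scale0r addr0 det1 big1// => i _; rewrite mul0r addr0.
(* For s nonzero the determinant is the characteristic polynomial evaluated at -1/s, up to the
   factor (-s)^n. *)
have -> : 1%:M + s *: A = (- s) *: ((- s^-1)%:M - A).
  by rewrite scalerBr [X in _ - X]scaleNr opprK scale_scalar_mx mulrNN mulfV.
rewrite detZ -horner_char_poly pA horner_prod.
rewrite -prod_cst_scale; apply: eq_bigr => i _.
by rewrite hornerXsubC; field.
Qed.

Lemma prod_one_add (n : nat) (k : 'rV[R]_n) (s : R) :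
  \prod_i (1 + s * k 0 i) = \sum_(j < n.+1) s ^+ j * elem_sym j k.
Proof.
under eq_bigr do rewrite addrC.
rewrite bigA_distr.
rewrite (partition_big (fun A : {set 'I_n} => inord #|A| : 'I_n.+1) predT)//=.
apply: eq_bigr => j _; rewrite /elem_sym mulr_sumr.
have cA (A : {set 'I_n}) : (#|A| <= n)%N.
  by rewrite -[X in (_ <= X)%N](card_ord n) max_card.
apply: eq_big => A.
  by rewrite -val_eqE /= inordK// ltnS cA.
move=> /eqP jA; rewrite -big_mkcond /= big_split /= prodr_const.
by rewrite -jA inordK// ltnS cA.
Qed.

(* The real and imaginary parts a, b of an eigenvector satisfy
   y (a g a^T + b g b^T) = 0 where y is the imaginary part of the eigenvalue. *)
Lemma symmetric_pencil_real n (S g : 'M[R]_n) (a b : 'rV[R]_n) (x y : R) :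
  S^T = S -> g^T = g -> (forall w : 'rV[R]_n, w != 0 -> 0 < (w *m g *m w^T) 0 0) ->
  a *m S = x *: (a *m g) - y *: (b *m g) ->
  b *m S = y *: (a *m g) + x *: (b *m g) ->
  (a != 0) || (b != 0) -> y = 0.
Proof.
move=> sS sg pg aS bS ab.
have sym (M : 'M[R]_n) (u v : 'rV[R]_n) : M^T = M -> (u *m M *m v^T) 0 0 = (v *m M *m u^T) 0 0.
  move=> sM; have -> : (u *m M *m v^T) 0 0 = ((u *m M *m v^T)^T) 0 0 by rewrite [RHS]mxE.
  by rewrite !trmx_mul trmxK sM mulmxA.
have ge (w : 'rV[R]_n) : 0 <= (w *m g *m w^T) 0 0.
  by have [->|/pg/ltW//] := eqVneq w 0; rewrite !mul0mx mxE.
have L (u v w : 'rV[R]_n) (s t : R) :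
    ((s *: (u *m g) + t *: (v *m g)) *m w^T) 0 0 =
    s * (u *m g *m w^T) 0 0 + t * (v *m g *m w^T) 0 0.
  by rewrite mulmxDl -!scalemxAl mxE [in LHS]mxE; congr (_ + _); rewrite mxE.
have h := sym S a b sS; rewrite aS bS -scaleNr !L (sym g b a sg) in h.
have := ge a; have := ge b.
have : (a != 0 -> 0 < (a *m g *m a^T) 0 0) by exact: pg.
have : (b != 0 -> 0 < (b *m g *m b^T) 0 0) by exact: pg.
have := ge b; move: h ab.
move: ((a *m g *m a^T) 0 0) ((b *m g *m b^T) 0 0) ((a *m g *m b^T) 0 0) => p q r h.
move=> ab _ pb pa q0 p0.
have z : y * (p + q) = 0 by move: h; clear; lra.
move/eqP: z; rewrite mulf_eq0 => /orP[/eqP//|/eqP z0]; exfalso.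
case/orP: ab => [/pa|/pb] h1; move: h1 z0 q0 p0; clear; lra.
Qed.

(** The characteristic polynomial splits over the complex numbers. The real and imaginary parts of
    an eigenvector satisfy the two equations of [symmetric_pencil_real], so each root is real. *)
Lemma symmetric_pencil_char_poly n (S g : 'M[R]_n) :
  S^T = S -> g^T = g -> (forall w : 'rV[R]_n, w != 0 -> 0 < (w *m g *m w^T) 0 0) ->
  g \in unitmx ->
  exists k : 'rV[R]_n, char_poly (S *m invmx g) = \prod_(i < n) ('X - (k 0 i)%:P).
Proof.
move=> sS sg pg ug; set B := S *m invmx g.
pose toC : {rmorphism R -> R[i]} := real_complex R.
have [r] := closed_field_poly_normal (map_poly toC (char_poly B)).
rewrite lead_coef_map (monicP (char_poly_monic B)) rmorph1 scale1r => E.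
have real_root z : z \in r -> z = toC (Re z).
  move=> zr; have : root (map_poly toC (char_poly B)) z.
    by rewrite E root_prod_XsubC.
  rewrite map_char_poly -eigenvalue_root_char => /eigenvalueP[v vB v0].
  pose a := map_mx (@Re R) v; pose b := map_mx (@Im R) v.
  have vE : v = map_mx toC a + 'i%C *: map_mx toC b.
    by apply/rowP => i; rewrite !mxE; case: (v 0 i) => p q; apply/eqP;
      rewrite eq_complex /=; apply/andP; split; apply/eqP; ring.
  have zE : z = toC (Re z) + 'i%C * toC (Im z).
    by case: (z) => p q; apply/eqP; rewrite eq_complex /=; apply/andP; split;
      apply/eqP; ring.
  have reE (p q : 'rV[R]_n) : forall i, Re ((map_mx toC p + 'i%C *: map_mx toC q) 0 i) = p 0 i /\
      Im ((map_mx toC p + 'i%C *: map_mx toC q) 0 i) = q 0 i.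
    by move=> i; rewrite !mxE /=; split; ring.
  have LHSE : v *m map_mx toC B = map_mx toC (a *m B) + 'i%C *: map_mx toC (b *m B).
    by rewrite {1}vE mulmxDl -scalemxAl -!map_mxM.
  have RHSE : z *: v = map_mx toC (Re z *: a - Im z *: b) +
      'i%C *: map_mx toC (Im z *: a + Re z *: b).
    apply/rowP => i; rewrite !mxE; case: (v 0 i) (z) => p q [p' q']; apply/eqP.
    by rewrite eq_complex /=; apply/andP; split; apply/eqP; ring.
  have aB : a *m B = Re z *: a - Im z *: b.
    apply/rowP => i; have [h1 _] := reE (a *m B) (b *m B) i.
    have [h2 _] := reE (Re z *: a - Im z *: b) (Im z *: a + Re z *: b) i.
    by rewrite -h1 -h2 -LHSE -RHSE vB.
  have bB : b *m B = Im z *: a + Re z *: b.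
    apply/rowP => i; have [_ h1] := reE (a *m B) (b *m B) i.
    have [_ h2] := reE (Re z *: a - Im z *: b) (Im z *: a + Re z *: b) i.
    by rewrite -h1 -h2 -LHSE -RHSE vB.
  have Bg (w : 'rV[R]_n) : w *m S = w *m B *m g by rewrite /B -!mulmxA mulVmx// mulmx1.
  have y0 : Im z = 0.
    apply: (@symmetric_pencil_real n S g a b (Re z) (Im z)) => //.
    - by rewrite Bg aB mulmxBl -!scalemxAl.
    - by rewrite Bg bB mulmxDl -!scalemxAl.
    rewrite -negb_and; apply: contra v0 => /andP[/eqP a0 /eqP b0].
    by rewrite vE a0 b0 !map_mx0 scaler0 addr0.
  by rewrite {1}zE y0 rmorph0 mulr0 addr0.
have {}E : char_poly B = \prod_(z <- r) ('X - (Re z)%:P).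
  apply: (map_poly_inj toC); rewrite E rmorph_prod /=.
  rewrite big_seq [RHS]big_seq; apply: eq_bigr => z zr.
  by rewrite map_polyXsubC {1}(real_root z zr).
have sr : size r = n.
  have := size_char_poly B; rewrite E.
  by rewrite -(big_map (@Re R) predT (fun z => 'X - z%:P)) size_prod_XsubC size_map => -[].
exists (\row_i Re (nth 0 r i)); rewrite E.
rewrite (big_nth 0) sr big_mkord; apply: eq_bigr => i _; by rewrite mxE.
Qed.

Lemma psd_pencil_eigenvalue_ge0 n (S g : 'M[R]_n) (k : 'rV[R]_n) :
  (forall w : 'rV[R]_n, 0 <= (w *m S *m w^T) 0 0) ->
  (forall w : 'rV[R]_n, w != 0 -> 0 < (w *m g *m w^T) 0 0) -> g \in unitmx ->
  char_poly (S *m invmx g) = \prod_(i < n) ('X - (k 0 i)%:P) ->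
  forall i, 0 <= k 0 i.
Proof.
move=> pS pg ug pB i.
have : root (char_poly (S *m invmx g)) (k 0 i).
  by rewrite pB -(big_map (fun i => k 0 i) predT (fun z => 'X - z%:P)) root_prod_XsubC map_f// mem_index_enum.
rewrite -eigenvalue_root_char => /eigenvalueP[v vB v0].
have vS : v *m S = k 0 i *: (v *m g).
  by rewrite scalemxAl -vB -!mulmxA mulVmx// mulmx1.
have := pS v; rewrite vS -scalemxAl mxE pmulr_lge0//; exact: pg.
Qed.

End SymmetricPencil.

(** * Independence of the chart *)

Section ChartInvariance.
Context {R : realType}.

(** [T] will be a transition map, known only to be continuous. The right inverse [Q] of [J] recovers
    T y - T x from the increment of f o T up to a remainder that is absorbed, as for inverse
    maps. *)
Lemma has_derivative_lift n m p (f : 'rV[R]_n -> 'rV[R]_m) (T : 'rV[R]_p -> 'rV[R]_n)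
    x (J : 'M[R]_(n, m)) J' (Q : 'M[R]_(m, n)) :
  has_derivative f (T x) J -> has_derivative (f \o T) x J' -> {for x, continuous T} ->
  J *m Q = 1%:M -> has_derivative T x (J' *m Q).
Proof.
move=> df dfT cT JQ e e0.
have [C C0 hC] := mulmx_bound Q.
have [D D0 hD] := has_derivative_lipschitz dfT.
have cT' : T y @[y --> x] --> T x := cT.
pose d := Num.min (2 * C)^-1 (e / (4 * C * C * D)).
have d0 : 0 < d by rewrite lt_min invr_gt0 divr_gt0 ?mulr_gt0.
have e2 : 0 < e / (2 * C) by rewrite divr_gt0// mulr_gt0.
have Hg : \forall y \near x, `|f (T y) - f (T x) - (T y - T x) *m J| <= d * `|T y - T x|
  := cT' _ (df _ d0).
apply: filterS3 Hg (dfT _ e2) hD => y h1 h2 h3; rewrite /= in h2 h3.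
set F := f (T y) - f (T x) in h1 h2 h3.
set r1 := F - _ *m J in h1; set r2 := F - _ in h2.
have E0 : T y - T x = F *m Q - r1 *m Q.
  by rewrite -mulmxBl /r1 opprB [F + _]addrC subrK -mulmxA JQ mulmx1.
have E1 : T y - T x - (y - x) *m (J' *m Q) = r2 *m Q - r1 *m Q.
  by rewrite E0 mulmxA addrAC -mulmxBl.
have n1 : `|r1 *m Q| <= C * (d * `|T y - T x|).
  by rewrite (le_trans (hC _))// ler_pM2l.
have nT : `|T y - T x| <= 2 * C * D * `|y - x|.
  have k1 : `|T y - T x| <= C * (D * `|y - x|) + C * (d * `|T y - T x|).
    rewrite {1}E0 (le_trans (ler_normB _ _))// lerD//.
    by rewrite (le_trans (hC _))// ler_pM2l.
  have k2 : C * d <= 2^-1.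
    apply: (@le_trans _ _ (C * (2 * C)^-1)).
      by rewrite ler_pM2l// /d ge_min lexx.
    by rewrite le_eqVlt; apply/orP; left; apply/eqP; field; rewrite gt_eqF.
  have := ler_wpM2r (normr_ge0 (T y - T x)) k2; move: k1.
  by move: (`|T y - T x|) => t k1 k3; lra.
rewrite E1 (le_trans (ler_normB _ _))// (splitr e) mulrDl lerD//.
  rewrite (le_trans (hC _))//.
  apply: (@le_trans _ _ (C * (e / (2 * C) * `|y - x|))); first by rewrite ler_pM2l.
  by rewrite le_eqVlt; apply/orP; left; apply/eqP; field; rewrite gt_eqF.
rewrite (le_trans n1)//.
apply: (@le_trans _ _ (C * (e / (4 * C * C * D) * (2 * C * D * `|y - x|)))).
  rewrite ler_pM2l//; apply: ler_pM => //; first exact: ltW.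
  by rewrite /d ge_min lexx orbT.
by rewrite le_eqVlt; apply/orP; left; apply/eqP; field; rewrite !gt_eqF.
Qed.

Lemma intertwine_cancel n m (P B B' : 'M[R]_n) (J : 'M[R]_(n, m)) Q : J *m Q = 1%:M ->
  B' *m (P *m J) = P *m (B *m J) -> P *m B = B' *m P.
Proof.
move=> JQ /(congr1 (mulmx^~ Q)).
by rewrite /= -!mulmxA JQ !mulmx1.
Qed.

Section TwoCharts.
Context {n : nat}.
Variable Omega : set 'rV[R]_n.+1.
Hypotheses (oO : open Omega) (O0 : Omega !=set0) (bO : bounded_set Omega)
  (cO : convex_set Omega) (smO : smooth_hypersurface (boundary Omega)).

(** With P the derivative of the transition map, differentiating phi' = phi o T and the same
    relation for the normals gives J' = P J and B' J' = P B J, where B, B' are the shape matrices.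
    Cancelling J shows that they are conjugate by P. *)
Lemma shape_char_poly_invariant U phi x U' phi' x' :
  local_param (boundary Omega) U phi -> U x ->
  local_param (boundary Omega) U' phi' -> U' x' -> phi' x' = phi x ->
  char_poly (shape_mx Omega phi' x') = char_poly (shape_mx Omega phi x).
Proof.
move=> lp Ux lp' Ux' xx'.
pose T := chart_inverse U phi \o phi'.
have Tx : T x' = x by rewrite /T /= xx' (chart_inverseK lp).
have near_in : \forall y \near x', boundary Omega (phi' y).
  by apply: filterS (chart_nbhs lp' Ux') => y Uy; exact: (chart_in lp').
have c' : phi' y @[y --> x'] --> phi' x' := chart_continuous lp' Ux'.
rewrite xx' in c'.
have cT : {for x', continuous T}.
  move=> W; rewrite Tx => nW.
  have h : \forall y \near x', boundary Omega (phi' y) -> W (T y).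
    exact: c' (chart_inverse_continuous lp Ux nW).
  by apply: filterS2 h near_in => y; apply.
have phiT : \forall y \near x', phi' y = phi (T y).
  have h : \forall y \near x', boundary Omega (phi' y) ->
      exists z, [/\ U z, setT z & phi z = phi' y].
    exact: c' (chart_lift lp Ux filterT).
  by apply: filterS2 h near_in => y h1 /h1[z [Uz _ zy]]; rewrite /T /= -zy (chart_inverseK lp).
pose J := 'J phi x; pose J' := 'J phi' x'.
pose Q := J^T *m invmx (first_form phi x).
have JQ : J *m Q = 1%:M by rewrite /Q mulmxA mulmxV// (first_form_unit lp).
have dphi : has_derivative phi (T x') J :=
  eq_ind_r (fun z => has_derivative phi z J) (chart_derivative lp Ux) Tx.
have dphiT : has_derivative (phi \o T) x' J'.
  exact: (has_derivative_near phiT (chart_derivative lp' Ux')).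
have dT := has_derivative_lift dphi dphiT cT JQ.
set P := J' *m Q in dT.
have JP : J' = P *m J := has_derivative_unique dphiT (has_derivative_comp dT dphi).
have uP : P \in unitmx.
  rewrite -row_free_unit -kermx_eq0; apply/eqP/row_matrixP => i; rewrite row0.
  set u := row i _.
  have : u *m J' = 0 by rewrite JP mulmxA -row_mul mulmx_ker row0 mul0mx.
  by move=> /eqP; rewrite mulmx_free_eq0 ?(chart_row_free lp' Ux')// => /eqP.
have dN : has_derivative (chart_normal Omega phi) (T x') (shape_mx Omega phi x *m J) :=
  eq_ind_r (fun z => has_derivative _ z _)
    (chart_normal_derivative oO O0 bO cO smO lp Ux) Tx.
have dN' := chart_normal_derivative oO O0 bO cO smO lp' Ux'.
have NT : \forall y \near x', chart_normal Omega phi' y = (chart_normal Omega phi \o T) y.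
  by apply: filterS phiT => y E; rewrite /chart_normal /= E.
have E := has_derivative_unique (has_derivative_near NT dN') (has_derivative_comp dT dN).
apply: esym; apply: (char_poly_intertwine uP).
exact: (intertwine_cancel JQ (eq_ind _ (fun M => _ *m M = _) E _ JP)).
Qed.

Lemma weingarten_shape_char_poly U phi x : local_param (boundary Omega) U phi -> U x ->
  char_poly (weingarten Omega phi x) = char_poly (shape_mx Omega phi x).
Proof.
move=> lp Ux; have ug := first_form_unit lp Ux.
apply: (char_poly_intertwine ug).
by rewrite /weingarten /shape_mx mulmxA mulmxV// mul1mx -mulmxA mulVmx// mulmx1.
Qed.

(** [get] may have used another chart and another base parameter. The pencil lemma shows that a
    suitable list exists, and invariance carries the chosen one to the chart at hand. *)
Lemma principal_curvaturesP U phi x : local_param (boundary Omega) U phi -> U x ->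
  char_poly (shape_mx Omega phi x) =
  \prod_(i < n) ('X - (principal_curvatures Omega (phi x) 0 i)%:P).
Proof.
move=> lp Ux.
have [k0 hk0] := symmetric_pencil_char_poly
  (second_form_sym lp Ux) (first_form_sym phi x)
  (fun w => first_form_pd lp (w := w) Ux) (first_form_unit lp Ux).
have [U' [phi' [x' [lp' Ux' xx' E]]]] :
    is_principal_curvatures Omega (phi x) (principal_curvatures Omega (phi x)).
  apply: (@getPex _ (is_principal_curvatures Omega (phi x))).
  exists k0, U, phi, x; split=> //.
  exact: (etrans (weingarten_shape_char_poly lp Ux) hk0).
exact: (etrans (esym (shape_char_poly_invariant lp Ux lp' Ux' xx'))
  (etrans (esym (weingarten_shape_char_poly lp' Ux')) E)).
Qed.

Lemma principal_curvatures_ge0 p i : boundary Omega p ->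
  0 <= principal_curvatures Omega p 0 i.
Proof.
move=> bp; have [U [phi [lp [x Ux <-]]]] := smO bp.
exact: (psd_pencil_eigenvalue_ge0 (fun w => second_form_psd oO O0 bO cO smO lp w Ux)
  (fun w => first_form_pd lp (w := w) Ux) (first_form_unit lp Ux)
  (principal_curvaturesP lp Ux)).
Qed.

Lemma det_one_add_shape U phi x s : local_param (boundary Omega) U phi -> U x ->
  \det (1%:M + s *: shape_mx Omega phi x) =
  \sum_(j < n.+1) s ^+ j * elem_sym j (principal_curvatures Omega (phi x)).
Proof.
move=> lp Ux; rewrite -prod_one_add; apply: det_one_add.
exact: (principal_curvaturesP lp Ux).
Qed.

End TwoCharts.
End ChartInvariance.

(** * Continuity of determinants, and slicing off the first coordinate *)

Section Continuity.
Context {R : realType}.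

Lemma continuous_sum_at (T : topologicalType) (I : Type) (r : seq I) (f : I -> T -> R) x :
  (forall i, {for x, continuous (f i)}) ->
  {for x, continuous (fun y => \sum_(i <- r) f i y)}.
Proof.
move=> cf; elim: r => [|i r IH].
  rewrite (_ : (fun _ => _) = cst 0); first exact: cst_continuous.
  by apply/funext => y; rewrite big_nil.
rewrite (_ : (fun _ => _) = (f i + (fun y => \sum_(i <- r) f i y))).
  exact: continuousD.
by apply/funext => y; rewrite big_cons.
Qed.

Lemma continuous_prod_at (T : topologicalType) (I : Type) (r : seq I) (f : I -> T -> R) x :
  (forall i, {for x, continuous (f i)}) ->
  {for x, continuous (fun y => \prod_(i <- r) f i y)}.
Proof.
move=> cf; elim: r => [|i r IH].
  rewrite (_ : (fun _ => _) = cst 1); first exact: cst_continuous.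
  by apply/funext => y; rewrite big_nil.
rewrite (_ : (fun _ => _) = (f i * (fun y => \prod_(i <- r) f i y))).
  exact: continuousM.
by apply/funext => y; rewrite big_cons.
Qed.

Lemma continuous_det_at (T : topologicalType) n (A : T -> 'M[R]_n) x :
  (forall i j, {for x, continuous (fun y => A y i j)}) ->
  {for x, continuous (fun y => \det (A y))}.
Proof.
move=> cA; rewrite /determinant.
apply: continuous_sum_at => s.
apply: (continuousM (@cst_continuous T R _ x)).
by apply: continuous_prod_at => i; exact: cA.
Qed.

Lemma continuous_dotv_at (T : topologicalType) n (f g : T -> 'rV[R]_n) x :
  {for x, continuous f} -> {for x, continuous g} ->
  {for x, continuous (fun y => dotv (f y) (g y))}.
Proof.
move=> cf cg; rewrite /dotv.
apply: continuous_sum_at => i.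
have c (h : T -> 'rV[R]_n) : {for x, continuous h} -> {for x, continuous (fun y => h y 0 i)}.
  move=> ch A hA.
  exact: (ch [set z : 'rV[R]_n | A (z 0 i)] (@coord_continuous R 1 n 0 i (h x) A hA)).
exact: continuousM (c f cf) (c g cg).
Qed.

End Continuity.

Section Slicing.
Context {R : realType} {n : nat}.
Local Notation leb := (lebesgue_rV R).
Local Open Scope ereal_scope.

Lemma ge0_integral_rVS (f : 'rV[R]_n.+1 -> \bar R) :
  measurable_fun setT f -> (forall x, 0 <= f x) ->
  measurable_fun setT (fun y : 'rV[R]_n => \int[@lebesgue_measure R]_t f (consv (t, y))) /\
  \int[leb n.+1]_x f x = \int[leb n]_y \int[@lebesgue_measure R]_t f (consv (t, y)).
Proof.
move=> mf f0.
have mfc : measurable_fun setT (f \o @consv R n).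
  by apply: measurableT_comp => //; exact: measurable_consv.
have fc0 p : 0 <= (f \o @consv R n) p by exact: f0.
have G1 := measurable_fun_fubini_tonelli_G (m1 := @lebesgue_measure R) _ mfc fc0.
have G2 := fubini_tonelli2 (m1 := @lebesgue_measure R) (m2 := leb n) _ mfc fc0.
split; first exact: G1.
have P := ge0_integral_pushforward (@measurable_consv R n)
  (@lebesgue_measure R \x leb n) measurableT mf (fun y _ => f0 y).
transitivity (\int[@lebesgue_measure R \x leb n]_p (f \o @consv R n) p); first exact: P.
exact: G2.
Qed.

Local Close Scope ereal_scope.

Definition tail_mx : 'M[R]_(1 + n, n) := col_mx 0 1%:M.

Definition tailv (z : 'rV[R]_n.+1) : 'rV[R]_n := (z : 'rV_(1 + n)) *m tail_mx.

Lemma tailv_consv t y : tailv (consv (t, y)) = y.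
Proof. by rewrite /tailv consvE mul_row_col mulmx0 add0r mulmx1. Qed.

Lemma consv0 t (y : 'rV[R]_n) : consv (t, y) 0 0 = t.
Proof. by rewrite mxE unlift_none. Qed.

Lemma consv_eta (z : 'rV[R]_n.+1) : z = consv (z 0 0, tailv z).
Proof.
apply/rowP => i; rewrite mxE /=; case: (unliftP ord0 i) => [j|] -> //=.
rewrite /tailv -[z in RHS](@hsubmxK _ 1 1 n) mul_row_col mulmx0 add0r mulmx1 mxE.
by congr (z _ _); apply/val_inj.
Qed.

Lemma tailv_lift (z : 'rV[R]_n.+1) i : tailv z 0 i = z 0 (lift ord0 i).
Proof. by rewrite [in RHS](consv_eta z) [RHS]mxE liftK. Qed.

Lemma tailv_norm (z : 'rV[R]_n.+1) : (`|tailv z| <= `|z|)%R.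
Proof. by apply: norm_le_coord => // i; rewrite tailv_lift coord_le_norm. Qed.

Lemma tailvB (z w : 'rV[R]_n.+1) : tailv (z - w) = (tailv z - tailv w)%R.
Proof. by rewrite /tailv -mulmxBl. Qed.

Lemma tailv_continuous : continuous tailv.
Proof.
move=> z A /nbhs_ballP[e /= e0 he]; apply/nbhs_ballP; exists e => // y.
rewrite -ball_normE /= => h; apply: he; rewrite -ball_normE /= -tailvB.
exact: le_lt_trans (tailv_norm _) h.
Qed.

End Slicing.
(** * The shell formula *)

Lemma mx_add_scaleE {R : nzRingType} m n (A S : 'M[R]_(m, n)) c i j :
  (A + c *: S) i j = A i j + c * S i j.
Proof. by rewrite !mxE. Qed.

Lemma frame_entryE {R : realType} n (v : 'rV[R]_n.+1) (M : 'M[R]_(n, n.+1)) (i : 'I_(1 + n)) j :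
  col_mx v M i j =
  match fintype.split i with inl _ => v 0 j | inr k => M k j end.
Proof. by rewrite mxE; case: fintype.split => k //; rewrite (ord1 k). Qed.

Section ChartShell.
Context {R : realType} {n : nat}.
Variable Omega : set 'rV[R]_n.+1.
Hypotheses (oO : open Omega) (O0 : Omega !=set0) (bO : bounded_set Omega)
  (cO : convex_set Omega) (smO : smooth_hypersurface (boundary Omega)).
Local Notation leb := (lebesgue_rV R).

Let K := closure Omega.
Let bK : convex_body K := closure_convex_body O0 bO cO.

(** The Jacobian of (p, s) |-> p + s nu(p) relative to area times length, that is det(1 + s B) for
    the shape matrix B, written so as to depend on the point only and not on a chart. *)
Definition shell_density (Omega' : set 'rV[R]_n.+1) (s : R) (p : 'rV[R]_n.+1) : R :=
  \sum_(j < n.+1) s ^+ j * elem_sym j (principal_curvatures Omega' p).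

Definition shell_integral (Omega' : set 'rV[R]_n.+1) (f : 'rV[R]_n.+1 -> \bar R) (p : 'rV[R]_n.+1) : \bar R :=
  (\int[@lebesgue_measure R]_(s in `]0%R, +oo[)
    (f (p + s *: outward_normal Omega' p)%R * (shell_density Omega' s p)%:E))%E.

Lemma elem_sym0 (k : 'rV[R]_n) : elem_sym 0 k = 1.
Proof.
rewrite /elem_sym (big_pred1 finset.set0) ?big_set0// => A.
by rewrite cards_eq0.
Qed.

Lemma elem_sym_ge0 j (k : 'rV[R]_n) : (forall i, 0 <= k 0 i) -> 0 <= elem_sym j k.
Proof. by move=> k0; apply: sumr_ge0 => A _; apply: prodr_ge0 => i _. Qed.

(** All curvatures are nonnegative and the term j = 0 equals 1, so the shell map is nondegenerate
    for every s >= 0. *)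
Lemma shell_density_ge1 s p : boundary Omega p -> 0 <= s -> 1 <= shell_density Omega s p.
Proof.
move=> bp s0; rewrite /shell_density big_ord_recl expr0 elem_sym0 mul1r lerDl.
apply: sumr_ge0 => j _; rewrite mulr_ge0 ?exprn_ge0// elem_sym_ge0// => i.
exact: (principal_curvatures_ge0 oO O0 bO cO smO).
Qed.

Section Chart.
Variables (U : set 'rV[R]_n) (phi : 'rV[R]_n -> 'rV[R]_n.+1).
Hypothesis lp : local_param (boundary Omega) U phi.
Local Notation N := (chart_normal Omega phi).
Local Notation J := (jacobian phi).
Local Notation B := (shape_mx Omega phi).

Definition shell_map (z : 'rV[R]_n.+1) : 'rV[R]_n.+1 :=
  phi (tailv z) + z 0 0 *: N (tailv z).

(** The derivative of [shell_map]: the normal for the variable s, and (1 + s B) J for the parameters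
    of the chart. *)
Definition shell_frame (z : 'rV[R]_n.+1) : 'M[R]_n.+1 :=
  (col_mx (N (tailv z)) ((1%:M + z 0 0 *: B (tailv z)) *m J (tailv z)) : 'M[R]_(1 + n)).

Let W : set 'rV[R]_n.+1 := [set z : 'rV[R]_n.+1 | 0 < z 0 0 /\ U (tailv z)].
Let V : set 'rV[R]_n.+1 := [set y : 'rV[R]_n.+1 | ~ K y /\ (phi @` U) (proj K y)].
Let Psi (y : 'rV[R]_n.+1) := consv (dist K y, chart_inverse U phi (proj K y)).

Lemma mul_frame (w v : 'rV[R]_n.+1) (M : 'M[R]_(n, n.+1)) :
  w *m (col_mx v M : 'M[R]_(1 + n)) = w 0 0 *: v + tailv w *m M.
Proof.
rewrite {1}(consv_eta w) consvE; apply: (etrans (@mul_row_col R 1 1 n n.+1 _ _ _ _)).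
by rewrite mul_scalar_mx.
Qed.

Let oW : open W.
Proof.
have -> : W = (fun z : 'rV[R]_n.+1 => z 0 0) @^-1` [set t | 0 < t] `&` tailv @^-1` U by [].
apply: openI.
  apply: open_comp; last exact: open_gt.
  by move=> z _; exact: coord_continuous.
apply: open_comp; last exact: chart_open lp.
by move=> z _; exact: tailv_continuous.
Qed.

Let oV : open V.
Proof.
have [Vp oVp E] := chart_image_open lp (chart_open lp) (@subset_refl _ U).
have -> : V = ~` K `&` proj K @^-1` Vp.
  apply/seteqP; split=> y [nK h]; split=> //.
    by move: h; rewrite E => -[].
  by rewrite E; split=> //; exact: proj_boundary.
apply: openI; first by apply: closed_openC; exact: closed_closure.
by apply: open_comp => // y _; exact: proj_continuous.
Qed.

Let WV z : W z -> V (shell_map z) /\ Psi (shell_map z) = z.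
Proof.
move=> [z0 Ux]; have sp := chart_normal_supports oO O0 bO cO smO lp Ux.
have v1 := chart_normal_unit oO O0 bO cO smO lp Ux.
have pE : proj K (shell_map z) = phi (tailv z) := proj_supported bK sp (ltW z0).
have dE : dist K (shell_map z) = z 0 0 := dist_supported bK sp v1 (ltW z0).
split.
  split; last by rewrite pE; exists (tailv z).
  move=> Ky; have := dist_eq0 bK (shell_map z); rewrite dE (mem_set Ky) => /eqP h.
  by rewrite h ltxx in z0.
by rewrite /Psi pE dE (chart_inverseK lp)// -consv_eta.
Qed.

Lemma shell_map_in z : W z -> V (shell_map z).
Proof. by move=> /WV[]. Qed.

Let VW y : V y -> W (Psi y) /\ shell_map (Psi y) = y.
Proof.
move=> [nK [x Ux xy]].
have TE : chart_inverse U phi (proj K y) = x by rewrite -xy (chart_inverseK lp).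
have d0 := dist_gt0 bK nK.
split; first by rewrite /W /Psi /= consv0 tailv_consv TE.
rewrite /shell_map /Psi consv0 tailv_consv TE /chart_normal xy.
have [v1 sv] := normalized_supports bK nK.
rewrite (outward_normal_eq oO O0 bO cO smO v1 sv) scalerA mulfV ?gt_eqF// scale1r.
by rewrite addrC subrK.
Qed.

Lemma shell_map_derivative z : W z -> has_derivative shell_map z (shell_frame z).
Proof.
move=> [z0 Ux] e e0; set x := tailv z in Ux *; set s := z 0 0 in z0 *.
have dphi := chart_derivative lp Ux.
have dN := chart_normal_derivative oO O0 bO cO smO lp Ux.
have e3 : 0 < e / 3 by rewrite divr_gt0.
have es : 0 < e / 3 / s by rewrite divr_gt0.
have ct : tailv z' @[z' --> z] --> x := @tailv_continuous _ _ z.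
have h1 : \forall z' \near z, `|phi (tailv z') - phi x - (tailv z' - x) *m J x| <=
   e / 3 * `|tailv z' - x| := ct _ (dphi _ e3).
have h2 : \forall z' \near z, `|N (tailv z') - N x - (tailv z' - x) *m (B x *m J x)| <=
   e / 3 / s * `|tailv z' - x| := ct _ (dN _ es).
have h3 : \forall z' \near z, enorm (N (tailv z') - N x) < e / 3 :=
  ct _ (chart_normal_near oO O0 bO cO smO lp Ux e3).
apply: filterS3 h1 h2 h3 => z' k1 k2 k3.
have xx : `|tailv z' - x| <= `|z' - z| by rewrite -tailvB tailv_norm.
have ss : `|z' 0 0 - s| <= `|z' - z|.
  by have := coord_le_norm (z' - z) 0; rewrite !mxE.
(* The first two remainders come from the derivatives of phi and N; for the last one continuity of N
   suffices, since the factor z' 0 0 - s is already of first order. *)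
have E : shell_map z' - shell_map z - (z' - z) *m shell_frame z =
  (phi (tailv z') - phi x - (tailv z' - x) *m J x) +
  s *: (N (tailv z') - N x - (tailv z' - x) *m (B x *m J x)) +
  (z' 0 0 - s) *: (N (tailv z') - N x).
  rewrite /shell_map /shell_frame mul_frame tailvB -/x -/s.
  have -> : (z' - z) 0 0 = z' 0 0 - s by rewrite !mxE.
  rewrite mulmxDl mul1mx -scalemxAl mulmxDr -scalemxAr.
  move: (_ *m J x) (_ *m (_ *m _)) (N x) (N (tailv z')) (phi (tailv z')) (phi x).
  by move=> a b c d f g; apply/rowP => i; rewrite !mxE; ring.
rewrite E (le_trans (ler_normD _ _))// (_ : e = (e / 3 + e / 3) + e / 3); last by field.
rewrite [leRHS]mulrDl lerD//.
  rewrite (le_trans (ler_normD _ _))// [leRHS]mulrDl lerD//.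
    by rewrite (le_trans k1)// ler_pM2l.
  rewrite normrZ gtr0_norm//.
  apply: (@le_trans _ _ (s * (e / 3 / s * `|tailv z' - x|))); first by rewrite ler_pM2l.
  by rewrite mulrA mulrCA mulfV ?gt_eqF// mulr1 ler_pM2l.
rewrite normrZ mulrC ler_pM//.
by rewrite (le_trans (norm_le_enorm _))// ltW.
Qed.

Lemma det_shell_frame z : \det (shell_frame z) =
  \det (1%:M + z 0 0 *: B (tailv z)) *
  \det (col_mx (N (tailv z)) (J (tailv z)) : 'M[R]_(1 + n)).
Proof.
have -> : shell_frame z = (block_mx 1%:M 0 0 (1%:M + z 0 0 *: B (tailv z)) : 'M[R]_(1 + n)) *m
    (col_mx (N (tailv z)) (J (tailv z)) : 'M[R]_(1 + n)).
  by rewrite mul_block_col !mul0mx mul1mx addr0 add0r.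
rewrite [LHS]det_mulmx; congr (_ * _).
have D := @det_lblock R 1 n 1%:M 0 (1%:M + z 0 0 *: B (tailv z)).
by rewrite det1 mul1r in D; exact: D.
Qed.

(** The product of the frame with its transpose is block diagonal with blocks 1 and the first
    fundamental form, since the normal is a unit vector orthogonal to the rows of J. *)
Lemma det_tangent_frame x : U x ->
  `|\det (col_mx (N x) (J x) : 'M[R]_(1 + n))| = Num.sqrt (\det (first_form phi x)).
Proof.
move=> Ux; rewrite -sqrtr_sqr expr2; congr Num.sqrt.
set A : 'M[R]_(1 + n) := col_mx _ _.
rewrite -{2}(det_tr A) -det_mulmx /A tr_col_mx mul_col_row.
have -> : N x *m (N x)^T = 1%:M.
  by rewrite [LHS]mx11_scalar -dotvE enorm1_dotv// (chart_normal_unit oO O0 bO cO smO lp).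
have -> : J x *m (N x)^T = 0 := chart_normal_tangent oO O0 bO cO smO lp Ux.
have D := @det_lblock R 1 n 1%:M 0 (J x *m (J x)^T); rewrite det1 mul1r in D.
rewrite -[RHS]D; congr (\det (block_mx _ _ _ _)).
by rewrite -[LHS]trmxK trmx_mul trmxK (chart_normal_tangent oO O0 bO cO smO lp Ux) trmx0.
Qed.

Lemma sqrt_det_gt0 x : U x -> 0 < Num.sqrt (\det (first_form phi x)).
Proof.
move=> Ux; rewrite -det_tangent_frame// normr_gt0.
have := frame_unit (chart_row_free lp Ux) (chart_normal_tangent oO O0 bO cO smO lp Ux)
  (unit_neq0 (chart_normal_unit oO O0 bO cO smO lp Ux)).
by rewrite unitmxE unitfE.
Qed.

Lemma abs_det_shell_frame z : W z -> `|\det (shell_frame z)| =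
  shell_density Omega (z 0 0) (phi (tailv z)) * Num.sqrt (\det (first_form phi (tailv z))).
Proof.
move=> [z0 Ux]; rewrite det_shell_frame normrM det_tangent_frame//; congr (_ * _).
rewrite (det_one_add_shape oO O0 bO cO smO _ lp Ux) ger0_norm//.
by apply: (le_trans ler01); apply: shell_density_ge1 (ltW z0); exact: (chart_in lp).
Qed.

Lemma det_shell_frame_cont z : W z -> {for z, continuous (fun z => \det (shell_frame z))}.
Proof.
move=> [z0 Ux].
have cJ i j : {for tailv z, continuous (fun y => J y i j)} := chart_jacobian_continuous lp Ux.
have cN i : {for tailv z, continuous (fun y => N y 0 i)} :=
  continuous_coord (chart_normal_continuous oO O0 bO cO smO lp Ux).
have cg i j : {for tailv z, continuous (fun y => first_form phi y i j)}.
  rewrite (_ : (fun _ => _) = (fun y => \sum_k (J y i k * J y j k))); last first.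
    apply/funext => y; rewrite [LHS]mxE; apply: eq_bigr => k _; congr (_ * _).
    exact: mxE.
  by apply: continuous_sum_at => k; exact: (continuousM (cJ i k) (cJ j k)).
have cS i j : {for tailv z, continuous (fun y => second_form Omega phi y i j)}.
  rewrite (_ : (fun _ => _) = - (fun y => dotv ('D_(delta_mx 0 i) ('D_(delta_mx 0 j) phi) y) (N y))).
    apply: continuousN; apply: continuous_dotv_at.
      exact: (@chart_continuous2 _ _ _ _ _ lp (delta_mx 0 j) (delta_mx 0 i) _ Ux).
    exact: (chart_normal_continuous oO O0 bO cO smO lp Ux).
  by apply/funext => y; exact: mxE.
have ug := first_form_unit lp Ux.
have comp (f : 'rV[R]_n -> R) : {for tailv z, continuous f} -> {for z, continuous (f \o tailv)}.
  by move=> cf A hA; exact: (@tailv_continuous R n z _ (cf A hA)).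
have c0 : {for z, continuous (fun z : 'rV[R]_n.+1 => z 0 0)} := @coord_continuous R 1 n.+1 0 0 z.
(* Writing det(1 + s II g^-1) as det(g + s II) / det g avoids the inverse matrix: continuity follows
   from that of the entries. *)
pose G (z' : 'rV[R]_n.+1) := \det (first_form phi (tailv z') + z' 0 0 *: second_form Omega phi (tailv z')) /
  \det (first_form phi (tailv z')) *
  \det (col_mx (N (tailv z')) (J (tailv z')) : 'M[R]_(1 + n)).
have near_eq : \forall z' \near z, G z' = \det (shell_frame z').
  have : nbhs z (tailv @^-1` U).
    exact: (@tailv_continuous R n z _ (chart_nbhs lp Ux)).
  apply: filterS => z' Uz'; rewrite /G det_shell_frame; congr (_ * _).
  have ug' := first_form_unit lp Uz'.
  rewrite /shape_mx scalemxAl.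
  have -> : 1%:M + (z' 0 0 *: second_form Omega phi (tailv z')) *m invmx (first_form phi (tailv z'))
     = (first_form phi (tailv z') + z' 0 0 *: second_form Omega phi (tailv z')) *m
       invmx (first_form phi (tailv z')).
    by rewrite mulmxDl mulmxV.
  by rewrite det_mulmx det_inv.
have cG : {for z, continuous G}.
  apply: continuousM; first apply: continuousM.
  - apply: continuous_det_at => i j.
    rewrite (_ : (fun _ => _) = ((fun y => first_form phi y i j) \o tailv) +
      (fun z' : 'rV[R]_n.+1 => z' 0 0) * ((fun y => second_form Omega phi y i j) \o tailv)).
      apply: continuousD; first exact: comp (cg i j).
      exact: continuousM c0 (comp _ (cS i j)).
    by apply/funext => y; exact: mx_add_scaleE.
  - apply: continuousV; first by move: ug; rewrite unitmxE unitfE.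
    by apply: continuous_det_at => i j; exact: comp (cg i j).
  - apply: continuous_det_at => i j.
    rewrite (_ : (fun _ => _) = fun z' => match fintype.split i with
        inl _ => ((fun y => N y 0 j) \o tailv) z' | inr k => ((fun y => J y k j) \o tailv) z' end).
      case: (fintype.split i) => k; [exact: (comp (fun y => N y 0 j) (cN j))|exact: (comp (fun y => J y k j) (cJ k j))].
    by apply/funext => z'; exact: frame_entryE.
move=> A hA.
have {}hA : nbhs (G z) A by rewrite (nbhs_singleton near_eq).
by apply: filterS2 near_eq (cG A hA) => z' h1 h2; rewrite /= -h1.
Qed.

Let cPsi y : V y -> {for y, continuous Psi}.
Proof.
move=> [nK [x Ux xy]] A /nbhs_ballP[r /= r0 hr].
have TE : chart_inverse U phi (proj K y) = x by rewrite -xy (chart_inverseK lp).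
have h1 : \forall y' \near y, `|dist K y' - dist K y| < r.
  apply: filterS (near_enorm y r0) => y' h; exact: le_lt_trans (dist_lipschitz bK _ _) h.
have h2 : \forall y' \near y, boundary Omega (proj K y') ->
    ball x r (chart_inverse U phi (proj K y')).
  have c : proj K y' @[y' --> y] --> proj K y := @proj_continuous _ _ _ bK y.
  rewrite -xy in c.
  exact: c (chart_inverse_continuous lp Ux (nbhsx_ballx x r r0)).
have h3 : \forall y' \near y, ~ K y'.
  apply: open_nbhs_nbhs; split=> //; apply: closed_openC; exact: closed_closure.
apply: filterS3 h1 h2 h3 => y' k1 k2 k3; apply: hr.
have /ball_rVP k4 := k2 (proj_boundary oO O0 bO cO k3).
apply/ball_rVP => // i; rewrite /Psi !mxE /= TE.
case: (unlift _ _) => [j|] /=; first exact: k4.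
by rewrite distrC.
Qed.

Let uL z : W z -> shell_frame z \in unitmx.
Proof.
move=> Wz; rewrite unitmxE unitfE -normr_gt0 abs_det_shell_frame//.
have [z0 Ux] := Wz; rewrite mulr_gt0 ?sqrt_det_gt0//.
by apply: (lt_le_trans ltr01); apply: shell_density_ge1 (ltW z0); exact: (chart_in lp).
Qed.

Lemma shell_change_of_variables A : measurable A -> A `<=` V ->
  leb n.+1 A = (\int[leb n.+1]_(z in W `&` shell_map @^-1` A) `|\det (shell_frame z)|%:E)%E.
Proof.
exact: (change_of_variables oW oV WV VW shell_map_derivative uL cPsi det_shell_frame_cont).
Qed.

End Chart.
End ChartShell.

(** * The shell formula in one chart *)

Section ChartFormula.
Context {R : realType} {n : nat}.
Variable Omega : set 'rV[R]_n.+1.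
Hypotheses (oO : open Omega) (O0 : Omega !=set0) (bO : bounded_set Omega)
  (cO : convex_set Omega) (smO : smooth_hypersurface (boundary Omega)).
Variable mu : {measure set 'rV[R]_n.+1 -> \bar R}.
Hypothesis mu_area : area_measure (boundary Omega) mu.
Local Notation leb := (lebesgue_rV R).
Local Notation Sigma := (boundary Omega).

Let K := closure Omega.
Let bK : convex_body K := closure_convex_body O0 bO cO.

Lemma measurable_boundary : measurable Sigma.
Proof.
rewrite /boundary setDE; apply: measurableI.
  by apply: closed_measurable_rV; exact: closed_closure.
by apply: measurableC; apply: open_measurable_rV; exact: open_interior.
Qed.

Lemma measurable_closure : measurable K.
Proof. by apply: closed_measurable_rV; exact: closed_closure. Qed.

Lemma measurable_proj : measurable_fun setT (proj K).
Proof.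
apply: continuous_on_measurable_rV; apply: continuous_continuous_on => x _.
exact: proj_continuous.
Qed.

Lemma measurable_ray (p v : 'rV[R]_n.+1) :
  measurable_fun setT (fun s : measurableTypeR R => p + s *: v).
Proof.
apply: measurable_fun_rV_in => i.
rewrite (_ : (fun _ => _) = (fun s : R => p 0 i + s * v 0 i)).
  by apply: measurable_funD => //; exact: measurable_funM.
by apply/funext => s; rewrite !mxE.
Qed.

Lemma measurable_shell_density p :
  measurable_fun setT (fun s : measurableTypeR R => shell_density Omega s p).
Proof.
rewrite /shell_density; apply: measurable_sum => j.
by apply: measurable_funM => //; exact: measurable_funX.
Qed.

Section Chart.
Variables (U : set 'rV[R]_n) (phi : 'rV[R]_n -> 'rV[R]_n.+1).
Hypothesis lp : local_param Sigma U phi.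
Local Notation N := (chart_normal Omega phi).
Local Notation w x := (Num.sqrt (\det (first_form phi x))).

Let mU : measurable U.
Proof. by apply: open_measurable_rV; exact: chart_open lp. Qed.

Lemma measurable_chart : measurable_fun U phi.
Proof.
apply: continuous_on_measurable_rV; apply: continuous_continuous_on => x.
exact: chart_continuous lp x.
Qed.

Lemma measurable_chart_image : measurable (phi @` U).
Proof.
have [V oV ->] := chart_image_open lp (chart_open lp) (@subset_refl _ U).
by apply: measurableI; [exact: measurable_boundary|exact: open_measurable_rV].
Qed.

Lemma measurable_chart_inverse : measurable_fun (phi @` U) (chart_inverse U phi).
Proof.
apply: continuous_on_measurable_rV => q [x Ux <-] A hA.
rewrite (chart_inverseK lp Ux) in hA.
apply: filterS (chart_inverse_continuous lp Ux hA) => y h [x' Ux' xy].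
by apply: h; rewrite -xy; exact: chart_in lp _ Ux'.
Qed.

Lemma measurable_sqrt_det : measurable_fun U (fun x => w x : measurableTypeR R).
Proof.
apply: continuous_on_measurable; apply: continuous_continuous_on => x Ux.
have cJ i j : {for x, continuous (fun y => 'J phi y i j)} := chart_jacobian_continuous lp Ux.
have cg : {for x, continuous (fun y => \det (first_form phi y))}.
  apply: continuous_det_at => i j.
  rewrite (_ : (fun _ => _) = (fun y => \sum_k ('J phi y i k * 'J phi y j k))); last first.
    apply/funext => y; rewrite [LHS]mxE; apply: eq_bigr => k _; congr (_ * _).
    exact: mxE.
  by apply: continuous_sum_at => k; exact: (continuousM (cJ i k) (cJ j k)).
move=> A hA; exact: cg (sqrt_continuous hA).
Qed.

Lemma ge0_integral_area (h : 'rV[R]_n.+1 -> \bar R) :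
  measurable_fun (phi @` U) h -> (forall p, (phi @` U) p -> 0 <= h p)%E ->
  (\int[mu]_(p in phi @` U) h p = \int[leb n]_(x in U) (h (phi x) * (w x)%:E))%E.
Proof.
move=> mh h0; apply: ge0_integral_transfer => //.
- exact: measurable_chart_image.
- exact: measurable_chart.
- exact: measurable_sqrt_det.
- move=> B mB BV; rewrite -(mu_area.2 _ _ lp).
  + congr (mu _); apply/seteqP; split=> q /=.
      by move=> Bq; have [x Ux xq] := BV _ Bq; exists x => //; split=> //=; rewrite xq.
    by move=> [x [Ux Bx] <-].
  + exact: measurable_chart.
  + by move=> x [].
Qed.

(** The change of variables in dimension n+1 is followed by slicing in the first coordinate s. The
    Jacobian splits into a function of the point and of s, and sqrt(det g), which is the density of
    [mu] in the chart. *)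
Lemma chart_shell_formula (f : 'rV[R]_n.+1 -> \bar R) :
  measurable_fun setT f -> (forall y, 0 <= f y)%E ->
  measurable_fun (phi @` U) (shell_integral Omega f) /\
  (\int[leb n.+1]_(y in [set y : 'rV[R]_n.+1 | ~ K y /\ (phi @` U) (proj K y)]) f y =
   \int[mu]_(p in phi @` U) shell_integral Omega f p)%E.
Proof.
move=> mf f0.
set V := [set y | _].
pose W : set 'rV[R]_n.+1 := [set z : 'rV[R]_n.+1 | 0 < z 0 0 /\ U (tailv z)].
have mW : measurable W.
  have -> : W = (fun z : 'rV[R]_n.+1 => z 0 0) @^-1` [set t | 0 < t] `&` tailv @^-1` U by [].
  apply: open_measurable_rV; apply: openI.
    apply: open_comp; last exact: open_gt.
    by move=> z _; exact: coord_continuous.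
  apply: open_comp; last exact: chart_open lp.
  by move=> z _; exact: tailv_continuous.
have mV : measurable V.
  have -> : V = ~` K `&` (setT `&` proj K @^-1` (phi @` U)).
    by rewrite setTI.
  apply: measurableI; first by apply: measurableC; exact: measurable_closure.
  exact: measurable_proj measurableT _ measurable_chart_image.
have mS : measurable_fun W (shell_map Omega phi).
  apply: continuous_on_measurable_rV; apply: continuous_continuous_on => z Wz.
  exact: has_derivative_continuous (shell_map_derivative oO O0 bO cO smO lp Wz).
pose D z := `|\det (shell_frame Omega phi z)|.
have mD : measurable_fun W (D : _ -> measurableTypeR R).
  apply: continuous_on_measurable; apply: continuous_continuous_on => z Wz A hA.
  exact: (det_shell_frame_cont oO O0 bO cO smO lp Wz (@norm_continuous _ _ _ A hA)).
have T1 : (\int[leb n.+1]_(y in V) f y =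
    \int[leb n.+1]_(z in W) (f (shell_map Omega phi z) * (D z)%:E))%E.
  apply: ge0_integral_transfer => //.
  - by move=> z _; exact: normr_ge0.
  - by move=> z Wz; exact: (shell_map_in oO O0 bO cO smO lp Wz).
  - by move=> B mB BV; exact: (shell_change_of_variables oO O0 bO cO smO lp mB BV).
  - exact: measurable_funTS.
pose G := ((fun z => f (shell_map Omega phi z) * (D z)%:E) \_ W)%E.
have mG : measurable_fun setT G.
  apply/(measurable_restrictT _ mW); apply: emeasurable_funM.
    by apply: (measurable_comp measurableT) => //.
  by apply/measurable_EFinP.
have G0 z : (0 <= G z)%E.
  by apply: erestrict_ge0 => z' _; rewrite mule_ge0// lee_fin normr_ge0.
have [mI I2] := ge0_integral_rVS mG G0.
have inner x : U x -> (\int[@lebesgue_measure R]_t G (consv (t, x)) =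
    shell_integral Omega f (phi x) * (w x)%:E)%E.
  move=> Ux; rewrite /shell_integral -ge0_integralZr//; last first.
  - move=> s /=; rewrite in_itv/= andbT => s0; rewrite mule_ge0// lee_fin.
    apply: (le_trans ler01); apply: (shell_density_ge1 oO O0 bO cO smO) (ltW s0).
    exact: chart_in lp _ Ux.
  - apply: measurable_funTS; apply: emeasurable_funM.
      by apply: (measurableT_comp mf); exact: measurable_ray.
    by apply/measurable_EFinP; exact: measurable_shell_density.
  rewrite [in RHS]integral_mkcond; apply: eq_integral => t _.
  rewrite /G !patchE !mem_setE.
  have -> : (consv (t, x) \in W) = (t \in `]0%R, +oo[).
    rewrite in_itv/= andbT; apply/idP/idP.
      by move=> /set_mem[]; rewrite consv0.
    by move=> t0; apply: mem_set; split; rewrite ?consv0 ?tailv_consv.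
  case: ifPn => // tt; rewrite in_itv/= andbT in tt.
  have Wz : W (consv (t, x)) by split; rewrite ?consv0 ?tailv_consv.
  rewrite /D (abs_det_shell_frame oO O0 bO cO smO lp Wz) /shell_map consv0 tailv_consv.
  by rewrite EFinM muleA.
have mh' : measurable_fun U (fun x => shell_integral Omega f (phi x) * (w x)%:E)%E.
  apply: (eq_measurable_fun (fun x => \int[@lebesgue_measure R]_t G (consv (t, x))))%E.
    by move=> x /set_mem Ux; exact: inner.
  exact: measurable_funTS.
(* Slicing gives measurability only of the product with the area density, which is positive on [U]
   and is divided out. *)
have mhp : measurable_fun U (shell_integral Omega f \o phi).
  apply: (eq_measurable_fun
    (fun x => (shell_integral Omega f (phi x) * (w x)%:E) * ((w x)^-1)%:E))%E.
    move=> x /set_mem Ux; rewrite -muleA -EFinM mulfV ?mule1//.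
    by rewrite gt_eqF// (sqrt_det_gt0 oO O0 bO cO smO lp Ux).
  apply: emeasurable_funM => //; apply/measurable_EFinP.
  apply: (eq_measurable_fun (fun x => w x `^ (-1) : measurableTypeR R)).
    by move=> x _; rewrite powR_inv1// sqrtr_ge0.
  have M := measurable_sqrt_det.
  have P := @measurable_powR R (-1).
  exact: (measurableT_comp (f := fun a : measurableTypeR R => a `^ (-1) : measurableTypeR R) P M).
have mh : measurable_fun (phi @` U) (shell_integral Omega f).
  apply: (eq_measurable_fun ((shell_integral Omega f \o phi) \o chart_inverse U phi)).
    by move=> q /set_mem[x Ux <-] /=; rewrite (chart_inverseK lp Ux).
  apply: (measurable_comp mU _ mhp measurable_chart_inverse).
  by move=> _ [q [x Ux <-] <-]; rewrite (chart_inverseK lp Ux).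
split=> //.
rewrite T1 integral_mkcond -/G.
rewrite ge0_integral_area//; last first.
  move=> p [x Ux <-]; apply: integral_ge0 => s /=; rewrite in_itv/= andbT => s0.
  rewrite mule_ge0// lee_fin.
  apply: (le_trans ler01); apply: (shell_density_ge1 oO O0 bO cO smO) (ltW s0).
  exact: chart_in lp _ Ux.
rewrite [LHS]I2 [in RHS]integral_mkcond; apply: eq_integral => x _.
rewrite patchE; case: ifPn => [/set_mem Ux|nUx]; first exact: inner.
apply: integral0_eq => t _; rewrite /G patchE ifN//.
apply: contraNN nUx => /set_mem[_]; rewrite tailv_consv; exact: mem_set.
Qed.

End Chart.
End ChartFormula.

(** * From charts to the whole boundary *)

Section ShellFormula.
Context {R : realType} {n : nat}.
Variable Omega : set 'rV[R]_n.+1.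
Hypotheses (oO : open Omega) (O0 : Omega !=set0) (bO : bounded_set Omega)
  (cO : convex_set Omega) (smO : smooth_hypersurface (boundary Omega)).
Variable mu : {measure set 'rV[R]_n.+1 -> \bar R}.
Hypothesis mu_area : area_measure (boundary Omega) mu.
Local Notation leb := (lebesgue_rV R).
Local Notation Sigma := (boundary Omega).

Let K := closure Omega.
Let bK : convex_body K := closure_convex_body O0 bO cO.

Variable f : 'rV[R]_n.+1 -> \bar R.
Hypotheses (mf : measurable_fun setT f) (f0 : forall y, (0 <= f y)%E).
Local Notation h := (shell_integral Omega f).

Lemma shell_integral_ge0 g p : (forall y, 0 <= g y)%E -> Sigma p -> (0 <= shell_integral Omega g p)%E.
Proof.
move=> g0 Sp; apply: integral_ge0 => s /=; rewrite in_itv/= andbT => s0.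
rewrite mule_ge0// lee_fin; apply: (le_trans ler01).
exact: (shell_density_ge1 oO O0 bO cO smO) (ltW s0).
Qed.

Let outer B : set 'rV[R]_n.+1 := ~` K `&` proj K @^-1` B.

(** The formula is required for every measurable part of [A], not for [A] alone: this hereditary
    form passes to finite unions without disjointness. *)
Let Loc (A : set 'rV[R]_n.+1) := [/\ measurable A, measurable_fun (A `&` Sigma) h &
  forall B, measurable B -> B `<=` A ->
    (\int[leb n.+1]_(y in outer B) f y = \int[mu]_(p in B `&` Sigma) h p)%E].

Let mouter B : measurable B -> measurable (outer B).
Proof.
move=> mB; apply: measurableI; first by apply: measurableC; exact: measurable_closure.
by have := measurable_proj O0 bO cO measurableT mB; rewrite setTI.
Qed.

Let LocU A A' : Loc A -> Loc A' -> Loc (A `|` A').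
Proof.
move=> [mA mh1 h1] [mA' mh2 h2].
have mS := measurable_boundary Omega.
have mh : measurable_fun ((A `|` A') `&` Sigma) h.
  rewrite setIUl; apply/measurable_funU => //; exact: measurableI.
split=> //; first exact: measurableU.
move=> B mB BA.
have BE : B = (B `&` A) `|` (B `\` A) by rewrite setUIDK.
have mBA : measurable (B `&` A) := measurableI _ _ mB mA.
have mBD : measurable (B `\` A) := measurableD mB mA.
have oE : outer B = outer (B `&` A) `|` outer (B `\` A).
  by rewrite {1}BE /outer preimage_setU setIUr.
have d1 : [disjoint outer (B `&` A) & outer (B `\` A)].
  by apply/disj_setPS => y [[_ [_ Ay]] [_ [_ /(_ Ay)]]].
have d2 : [disjoint (B `&` A) `&` Sigma & (B `\` A) `&` Sigma].
  by apply/disj_setPS => y [[[_ Ay] _] [[_ /(_ Ay)]]].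
rewrite oE ge0_integral_setU//; [|exact: mouter|exact: mouter|exact: measurable_funTS].
have sA : B `&` A `<=` A by move=> y [].
have sD : B `\` A `<=` A' by move=> y [/BA[Ay|//] /(_ Ay)].
rewrite (h1 _ mBA sA) (h2 _ mBD sD).
rewrite [in RHS]BE setIUl ge0_integral_setU//.
- exact: measurableI.
- exact: measurableI.
- rewrite -setIUl -BE; apply: measurable_funS mh; last by apply: setSI.
  by apply: measurableI => //; exact: measurableU.
- by move=> p [[_ Sp]|[_ Sp]]; exact: shell_integral_ge0.
Qed.

Let Loc0 : Loc set0.
Proof.
split=> //; first by rewrite set0I; exact: measurable_fun_set0.
by move=> B _; rewrite subset0 => ->; rewrite /outer preimage_set0 setI0 set0I !integral_set0.
Qed.

Let Loc_chart p : Sigma p -> exists V, [/\ open V, V p & Loc V].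
Proof.
move=> Sp; have [U [phi [lp Up]]] := smO Sp.
have [V oV UE] := chart_image_open lp (chart_open lp) (@subset_refl _ U).
have mV : measurable V := open_measurable_rV oV.
exists V; split=> //; first by move: Up; rewrite UE => -[].
have [mh _] := chart_shell_formula oO O0 bO cO smO mu_area lp mf f0.
split=> //; first by rewrite setIC -UE.
move=> B mB BV.
have mP : measurable (proj K @^-1` B).
  by have := measurable_proj O0 bO cO measurableT mB; rewrite setTI.
(* The chart formula is applied to f restricted to the points that project into B. Since the
   projection is constant along normal rays, the shell integral of the restriction is that of f over
   B and 0 elsewhere. *)
have mg : measurable_fun setT (f \_ (proj K @^-1` B)).
  by apply/(measurable_restrictT _ mP); exact: measurable_funTS.
have g0 y : (0 <= (f \_ (proj K @^-1` B)) y)%E by apply: erestrict_ge0.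
have [_ E] := chart_shell_formula oO O0 bO cO smO mu_area lp mg g0.
have -> : outer B = [set y : 'rV[R]_n.+1 | ~ K y /\ (phi @` U) (proj K y)] `&` proj K @^-1` B.
  apply/seteqP; split=> y.
    move=> [nK By]; split=> //; split=> //; rewrite UE; split; last exact: BV.
    exact: (proj_boundary oO O0 bO cO nK).
  by move=> [[nK _] By].
have -> : B `&` Sigma = (phi @` U) `&` B.
  rewrite UE; apply/seteqP; split=> q; first by move=> [Bq Sq]; split=> //; split=> //; exact: BV.
  by move=> [[Sq _] Bq].
rewrite integral_mkcondr E [RHS]integral_mkcondr; apply: eq_integral => q /set_mem.
rewrite UE => -[Sq _]; rewrite patchE /shell_integral.
have sp := outward_normal_supports oO O0 bO cO smO Sq.
case: ifPn => Bq.
  apply: eq_integral => s; rewrite inE /= in_itv/= andbT => s0.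
  rewrite patchE mem_set//=; rewrite (proj_supported bK sp (ltW s0)); exact: set_mem.
apply: integral0_eq => s /=; rewrite in_itv/= andbT => s0.
rewrite patchE memNset ?mul0e//= (proj_supported bK sp (ltW s0)).
by move=> h'; move/negP: Bq; apply; exact: mem_set.
Qed.

Lemma boundary_compact : compact Sigma.
Proof.
have cK : compact K by have [] := bK.
have -> : Sigma = K `&` ~` Omega°.
  by rewrite /boundary setDE.
apply: compact_closedI => //; apply: open_closedC; exact: open_interior.
Qed.

(** The boundary is compact, so finitely many chart domains cover it and [Loc] propagates to their
    union. Points outside K project to the boundary, hence none is lost. *)
Theorem shell_formula : measurable_fun Sigma h /\
  (\int[leb n.+1]_(y in ~` K) f y = \int[mu]_(p in Sigma) h p)%E.
Proof.
have ex p : exists V, Sigma p -> [/\ open V, V p & Loc V].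
  have [Sp|nS] := pselect (Sigma p); last by exists set0.
  by have [V hV] := Loc_chart Sp; exists V.
have [F hF] := @choice _ _ (fun p V => Sigma p -> [/\ open V, V p & Loc V]) ex.
have := boundary_compact; rewrite compact_cover => /(_ _ Sigma F).
move=> [p Sp||D DS cov]; first by have [] := hF _ Sp.
  by move=> p Sp; exists p => //; have [] := hF _ Sp.
have [mA mh hA] : Loc [set y | exists2 p, p \in finmap.enum_fset D & F p y].
  have: {subset finmap.enum_fset D <= Sigma} by move=> p /DS.
  move: (finmap.enum_fset D) => l; elim: l => [_|p s IH sub].
    rewrite (_ : [set y | _] = set0)//.
    by apply/seteqP; split=> y //= [].
  rewrite (_ : [set y | _] = F p `|` [set y | exists2 p, p \in s & F p y]).
    apply: LocU; last by apply: IH => q qs; apply: sub; rewrite inE qs orbT.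
    have Sp : Sigma p by apply: set_mem; apply: sub; rewrite mem_head.
    by have [] := hF _ Sp.
  apply/seteqP; split=> y /=.
    move=> [q]; rewrite inE => /orP[/eqP -> ?|qs Fy]; first by left.
    by right; exists q.
  move=> [Fy|[q qs Fy]]; first by exists p; rewrite ?mem_head.
  by exists q; rewrite // inE qs orbT.
have SA : Sigma `<=` [set y | exists2 p, p \in finmap.enum_fset D & F p y].
  by move=> y /cov[p pD Fy]; exists p.
have mS := measurable_boundary Omega.
split.
  by move: mh; rewrite (_ : _ `&` _ = Sigma)// setIidr.
have := hA _ mS SA; rewrite setIid => <-; congr (integral _ _ _).
apply/seteqP; split=> [y nK|y []//]; split=> //.
exact: (proj_boundary oO O0 bO cO nK).
Qed.

End ShellFormula.

(** * Polynomials in the radius *)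

Section PowerSums.
Context {R : realType}.

Definition power_sum (N : nat) (a : nat -> R) (s : R) := \sum_(k < N) a k * s ^+ k.

Definition power_prim (N : nat) (a : nat -> R) (t : R) :=
  \sum_(k < N) a k * (t ^+ k.+1 / k.+1%:R).

Lemma power_sum_continuous N a : continuous (power_sum N a).
Proof.
move=> s; apply: continuous_sum_at => k.
have c1 : {for s, continuous (fun _ : R => a k)} := @cst_continuous _ _ (a k) s.
have c2 : {for s, continuous (fun s : R => s ^+ k)} := @exprn_continuous _ k s.
exact: (continuousM c1 c2).
Qed.

Lemma power_prim_derive N a (t : R) : is_derive t 1 (power_prim N a) (power_sum N a t).
Proof.
rewrite /power_prim /power_sum.
elim: N => [|N IH].
  rewrite big_ord0 (_ : (fun _ => _) = cst 0); first exact: is_derive_cst.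
  by apply/funext => s; rewrite big_ord0.
rewrite big_ord_recr (_ : (fun _ => _) = (fun t => \sum_(k < N) a k * (t ^+ k.+1 / k.+1%:R)) +
   (a N / N.+1%:R) *: (fun s : R => s ^+ N.+1)); last first.
  apply/funext => s; rewrite big_ord_recr /=; congr (_ + _).
  by change (a N * (s ^+ N.+1 / N.+1%:R) = (a N / N.+1%:R) * s ^+ N.+1); rewrite mulrA mulrAC.
apply: is_deriveD.
have dX : is_derive t 1 (fun s : R => s ^+ N.+1) (N.+1%:R * t ^+ N).
  apply: DeriveDef; first exact: exprn_derivable.
  rewrite exp_derive /=; exact: mulr1.
have D := @is_deriveZ _ _ _ (fun s : R => s ^+ N.+1) (a N / N.+1%:R) t 1 _ dX.
apply: is_derive_eq D _.
rewrite /GRing.scale /=; field.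
by rewrite addrC natr1 pnatr_eq0.
Qed.

Lemma integral_power_sum N a (t : R) : 0 <= t ->
  (\int[@lebesgue_measure R]_(s in `]0%R, t]) (power_sum N a s)%:E = (power_prim N a t)%:E)%E.
Proof.
rewrite le_eqVlt => /predU1P[<-|t0].
  rewrite set_itvoc0 integral_set0 /power_prim big1// => k _.
  by rewrite expr0n /= mul0r mulr0.
have c : continuous (power_sum N a) := @power_sum_continuous N a.
have mS : measurable_fun setT (power_sum N a) by apply: continuous_measurable_fun.
rewrite integral_itv_obnd_cbnd; last by apply/measurable_EFinP; exact: measurable_funTS.
rewrite (@continuous_FTC2 _ _ (power_prim N a))//.
- rewrite -EFinB {2}/power_prim big1 ?subr0// => k _.
  by rewrite expr0n /= mul0r mulr0.
- by apply: continuous_subspaceT.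
- have cP x : {for x, continuous (power_prim N a)}.
    apply: differentiable_continuous; apply/derivable1_diffP.
    by have [] := power_prim_derive N a x.
  split.
  + by move=> x _; have [] := power_prim_derive N a x.
  + exact: cvg_at_right_filter (cP 0).
  + exact: cvg_at_left_filter (cP t).
- by move=> x _; rewrite derive1E; have [_ ->] := power_prim_derive N a x.
Qed.

(** Vandermonde inversion at the nodes 1, ..., N. The matrix [c] does not depend on [a], so
    coefficients that vary with a point are fixed combinations of values, and inherit their
    measurability. *)
Lemma power_sum_coef N : exists c : 'I_N -> 'I_N -> R, forall (a : nat -> R) (j : 'I_N),
  a j = \sum_i c j i * power_sum N a i.+1%:R.
Proof.
pose r : 'rV[R]_N := \row_(i < N) i.+1%:R.
pose V := Vandermonde N r.
have uV : V \in unitmx.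
  rewrite unitmxE unitfE det_Vandermonde; apply/prodf_neq0 => i _; apply/prodf_neq0 => j ij.
  rewrite !mxE -natrB 1?ltnW ?ltnS// pnatr_eq0; by rewrite subn_eq0 -ltnNge ltnS.
exists (fun j i => (invmx V) i j) => a j.
pose v : 'rV[R]_N := \row_k a k.
have vE i : (v *m V) 0 i = power_sum N a i.+1%:R.
  by rewrite mxE; apply: eq_bigr => k _; rewrite !mxE.
have -> : a j = (v *m V *m invmx V) 0 j by rewrite mulmxK// mxE.
by rewrite mxE; apply: eq_bigr => i _; rewrite vE mulrC.
Qed.

Lemma power_sum_eq0 N (a : nat -> R) : (forall t, 0 < t -> power_sum N a t = 0) ->
  forall j, (j < N)%N -> a j = 0.
Proof.
move=> h j jN; have [c hc] := power_sum_coef N.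
by rewrite (hc a (Ordinal jN)) big1// => i _; rewrite h ?mulr0 ?ltr0n.
Qed.

Lemma power_taylor1 b (x C : R) : 0 <= C -> exists2 D, 0 <= D & forall (y h : R),
  `|y| <= C -> `|h| <= 1 -> `|(x + h * y) ^+ b - x ^+ b - h * (b%:R * y * x ^+ b.-1)| <= D * h ^+ 2.
Proof.
move=> C0; elim: b => [|b [D D0 IH]].
  by exists 0 => // y h _ _; rewrite !expr0 subrr !mul0r mulr0 subrr normr0.
exists ((`|x| + C) * D + C * (b%:R * C * `|x| ^+ b.-1)) => [|y h yC h1].
  by rewrite addr_ge0// ?mulr_ge0// ?addr_ge0// ?mulr_ge0// exprn_ge0.
have {}IH := IH y h yC h1.
have hy : `|h * y| <= C by rewrite normrM -(mul1r C) ler_pM.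
have E : (x + h * y) ^+ b.+1 - x ^+ b.+1 - h * (b.+1%:R * y * x ^+ b.+1.-1) =
   (x + h * y) * ((x + h * y) ^+ b - x ^+ b - h * (b%:R * y * x ^+ b.-1)) +
   h ^+ 2 * (y * (b%:R * y * x ^+ b.-1)).
  rewrite !exprS /= -natr1; case: b {IH} => [|b] /=; rewrite ?expr0 ?exprS -?natr1; ring.
rewrite E (le_trans (ler_normD _ _))// [leRHS]mulrDl lerD//.
  rewrite normrM -[leRHS]mulrA ler_pM//.
  by rewrite (le_trans (ler_normD _ _))// lerD2l.
rewrite normrM mulrC [`|h ^+ 2|]ger0_norm ?sqr_ge0// ler_wpM2r ?sqr_ge0//.
rewrite !normrM normrX ler_pM// ?mulr_ge0// ?exprn_ge0//.
by rewrite normr_nat ler_wpM2r ?exprn_ge0// ler_wpM2l.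
Qed.

(** First-order expansion in h with an error uniform in u: u will be the support height, bounded
    over the boundary, and the expansion will be integrated. *)
Lemma scaled_power_taylor1 a b (t C : R) : 0 <= C -> exists2 D, 0 <= D & forall (u h : R),
  `|u| <= C -> `|h| <= 1 ->
  `|(1 + h) ^+ a * (t - h * u) ^+ b - t ^+ b -
     h * (a%:R * t ^+ b - b%:R * u * t ^+ b.-1)| <= D * h ^+ 2.
Proof.
move=> C0.
have [D1 D10 H1] := @power_taylor1 a 1 1 ler01.
have [D2 D20 H2] := @power_taylor1 b t C C0.
pose E := (`|t| + C) ^+ b.
exists (D1 * E + D2 + a%:R * (D2 + b%:R * C * `|t| ^+ b.-1)) => [|u h uC h1].
  by rewrite !addr_ge0// ?mulr_ge0 ?addr_ge0 ?mulr_ge0 ?exprn_ge0 ?addr_ge0.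
have := H1 1 h; rewrite normr1 lexx => /(_ isT h1).
have := H2 (- u) h; rewrite normrN => /(_ uC h1).
rewrite !mulr1 !expr1n !mulr1 mulrN.
set q1 := (1 + h) ^+ a; set q2 := (t - h * u) ^+ b => k2 k1.
set T := t ^+ b in k2 *; set T1 := t ^+ b.-1 in k2 *.
have q2E : `|q2| <= E.
  rewrite normrX lerXn2r ?nnegrE ?addr_ge0//.
  rewrite (le_trans (ler_normB _ _))// lerD2l normrM -(mul1r C) ler_pM//.
have h2 : 0 <= h ^+ 2 by exact: sqr_ge0.
have -> : q1 * q2 - T - h * (a%:R * T - b%:R * u * T1) =
  (q1 - 1 - h * a%:R) * q2 + (q2 - T - h * (b%:R * - u * T1)) +
  (h * a%:R) * (q2 - T - h * (b%:R * - u * T1)) + h ^+ 2 * (a%:R * (b%:R * - u * T1)).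
  by ring.
have T1E : `|T1| = `|t| ^+ b.-1 by rewrite normrX.
apply: (@le_trans _ _ (D1 * h ^+ 2 * E + D2 * h ^+ 2 + a%:R * (D2 * h ^+ 2) +
   h ^+ 2 * (a%:R * (b%:R * C * `|t| ^+ b.-1)))); last first.
  by rewrite le_eqVlt; apply/orP; left; apply/eqP; ring.
rewrite (le_trans (ler_normD _ _))// lerD//.
  rewrite (le_trans (ler_normD _ _))// lerD//.
    rewrite (le_trans (ler_normD _ _))// lerD//.
    by rewrite normrM ler_pM.
  rewrite normrM ler_pM// normrM normr_nat -[leRHS]mul1r ler_wpM2r//.
rewrite normrM ger0_norm// ler_wpM2l// normrM normr_nat ler_wpM2l// !normrM normrN T1E.
by rewrite normr_nat ler_wpM2r ?exprn_ge0// ler_wpM2l.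
Qed.

End PowerSums.

(** * Real-valued integrals *)

Section RealIntegrals.
Context d (T : measurableType d) (R : realType) (m : {measure set T -> \bar R}).
Variables (D : set T) (mD : measurable D).
Implicit Types (f g : T -> R).

Lemma EFin_Rintegral f : m.-integrable D (EFin \o f) ->
  (\int[m]_(x in D) (f x)%:E = (\int[m]_(x in D) f x)%:E)%E.
Proof. by move=> i; rewrite /Rintegral fineK// integrable_fin_num. Qed.

Lemma ge0_integrable f : measurable_fun D f -> (forall x, D x -> 0 <= f x) ->
  (\int[m]_(x in D) (f x)%:E < +oo)%E -> m.-integrable D (EFin \o f).
Proof.
move=> mf f0 fin; apply/integrableP; split; first exact/measurable_EFinP.
rewrite (eq_integral (fun x => (f x)%:E))// => x /set_mem Dx.
by rewrite /= ger0_norm// f0.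
Qed.

Lemma integrable_bounded_mul f g (C : R) : measurable_fun D f ->
  (forall x, D x -> `|f x| <= C) -> m.-integrable D (EFin \o g) ->
  m.-integrable D (EFin \o (fun x => f x * g x)).
Proof.
move=> mf fC ig.
have mg : measurable_fun D g by apply/measurable_EFinP; exact: measurable_int ig.
have iCg := @integrableZl _ _ _ m D mD C _ ig.
have mfg : measurable_fun D (EFin \o (fun x => f x * g x)).
  by apply/measurable_EFinP; exact: measurable_funM.
apply: (le_integrable mD mfg _ iCg) => x Dx /=.
by rewrite lee_fin !normrM ler_wpM2r// (le_trans (fC x Dx))// ler_norm.
Qed.

Lemma integrableDR f g : m.-integrable D (EFin \o f) -> m.-integrable D (EFin \o g) ->
  m.-integrable D (EFin \o (fun x => f x + g x)).
Proof. by move=> i j; have k := integrableD mD i j; apply: eq_integrable k. Qed.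

Lemma integrableMR f c : m.-integrable D (EFin \o f) ->
  m.-integrable D (EFin \o (fun x => f x * c)).
Proof.
move=> i; have k := integrableZl mD c i; apply: eq_integrable k => // x _ /=.
by rewrite mulrC.
Qed.

Lemma Rintegral_sum N (g : nat -> T -> R) (q : nat -> R) :
  (forall k, m.-integrable D (EFin \o g k)) ->
  m.-integrable D (EFin \o (fun x => \sum_(k < N) g k x * q k)) /\
  \int[m]_(x in D) (\sum_(k < N) g k x * q k) = \sum_(k < N) (\int[m]_(x in D) g k x) * q k.
Proof.
move=> ig; elim: N => [|N [i E]].
  split; last first.
    rewrite big_ord0 (_ : (fun _ => _) = cst 0); first by rewrite Rintegral_cst// mul0r.
    by apply/funext => x; rewrite big_ord0.
  rewrite (_ : EFin \o _ = cst 0%E); first exact: integrable0.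
  by apply/funext => x; rewrite /= big_ord0.
have iN := integrableMR (q N) (ig N).
have -> : (fun x => \sum_(k < N.+1) g k x * q k) = (fun x => (\sum_(k < N) g k x * q k) + g N x * q N).
  by apply/funext => x; rewrite big_ord_recr.
split; first exact: integrableDR.
by rewrite RintegralD// E RintegralZr// big_ord_recr.
Qed.

End RealIntegrals.

Lemma quadratic_bound_eq0 {R : realType} (x C e : R) : 0 < e ->
  (forall h, `|h| <= e -> 0 <= h * x + C * h ^+ 2) -> x = 0.
Proof.
move=> e0 H; apply/eqP; rewrite -normr_le0; apply/ler_addgt0Pr => r r0; rewrite add0r.
pose h := Num.min e (r / (`|C| + 1)).
have C1 : 0 < `|C| + 1 by rewrite ltr_wpDl.
have h0 : 0 < h by rewrite lt_min e0 divr_gt0.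
have he : h <= e by rewrite ge_min lexx.
have hr : h * (`|C| + 1) <= r by rewrite -ler_pdivlMr// ge_min lexx orbT.
have hC : h * C <= r.
  apply: le_trans hr; rewrite ler_pM2l//; have := ler_norm C; lra.
have h1 : 0 <= h * x + C * h ^+ 2 by apply: H; rewrite gtr0_norm.
have h2 : 0 <= (- h) * x + C * (- h) ^+ 2 by apply: H; rewrite normrN gtr0_norm.
have E1 : h * x + C * h ^+ 2 = h * (x + h * C) by ring.
have E2 : - h * x + C * (- h) ^+ 2 = h * (- x + h * C) by ring.
rewrite E1 pmulr_rge0// in h1; rewrite E2 pmulr_rge0// in h2.
by rewrite ler_norml; apply/andP; split; lra.
Qed.

(** * Bounded sets and dilations *)

Section Tubes.
Context {R : realType} {n : nat}.
Local Notation leb := (lebesgue_rV R).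

Lemma bounded_lebesgue_lty (A : set 'rV[R]_n) (M : R) : measurable A ->
  (forall y, A y -> enorm y <= M) -> (leb n A < +oo)%E.
Proof.
move=> mA AM.
have [[y Ay]|nA] := pselect (A !=set0); last first.
  by rewrite (_ : A = set0) ?measure0//; apply/eqP/negPn/negP => /set0P.
have M0 : 0 <= M := le_trans (enorm_ge0 _) (AM y Ay).
pose b : 'rV[R]_n := const_mx (M + 1).
have sub : A `<=` box (- b) b.
  move=> x /AM xM i; have := le_trans (coord_le_norm x i) (le_trans (norm_le_enorm x) xM).
  by rewrite ler_norml /b !mxE => /andP[h1 h2]; apply/andP; split; lra.
have mb : measurable (box (- b) b) := measurable_box (- b) b.
have fin : (leb n (box (- b) b) < +oo)%E.
  by rewrite lebesgue_box ?ltry// => i; rewrite /b !mxE; lra.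
by apply: le_lt_trans fin; apply: le_measure; rewrite ?inE.
Qed.

Lemma lebesgue_dilation (X0 : 'rV[R]_n) (c : R) (g : 'rV[R]_n -> R) : 0 < c ->
  measurable_fun setT g -> (forall y, 0 <= g y) ->
  (\int[leb n]_y (g y)%:E = (c ^+ n)%:E * \int[leb n]_y (g (X0 + c *: (y - X0)))%:E)%E.
Proof.
move=> c0 mg g0.
have mP : measurable_fun setT (fun y : 'rV[R]_n => X0 + c *: (y - X0)).
  have -> : (fun y : 'rV[R]_n => X0 + c *: (y - X0)) =
     (fun y => y *m c%:M + (X0 - c *: X0)).
    by apply/funext => y; rewrite mul_mx_scalar scalerBr addrC addrA addrAC -addrA [- _ + _]addrC.
  exact: measurable_affine.
have cn : 0 < c ^+ n by rewrite exprn_gt0.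
have T := @ge0_integral_transfer _ _ _ _ R (leb n) (leb n) setT setT
  (fun y : 'rV[R]_n => X0 + c *: (y - X0)) (fun=> c ^+ n) (EFin \o g).
rewrite T//; last first.
- by move=> y _; rewrite /= lee_fin.
- exact/measurable_EFinP.
- move=> B mB _; rewrite setTI integral_cst; last first.
    by have := mP measurableT B mB; rewrite setTI.
  have u : (c%:M : 'M[R]_n) \in unitmx by rewrite unitmxE det_scalar unitfE gt_eqF.
  pose B' : set 'rV[R]_n := [set x | B (x + (X0 - c *: X0))].
  have mB' : measurable B'.
    have := measurable_affine_preimage 1%:M (X0 - c *: X0) mB.
    by congr measurable; apply/seteqP; split=> x /=; rewrite mulmx1.
  have E := lebesgue_linear u mB'.
  rewrite det_scalar gtr0_norm// in E.
  have -> : (fun y : 'rV[R]_n => X0 + c *: (y - X0)) @^-1` B = [set x | B' (x *m c%:M)].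
    apply/seteqP; split=> x; rewrite /B' /= mul_mx_scalar scalerBr;
    by rewrite [X in B X -> _](_ : _ = c *: x + (X0 - c *: X0))//
      addrC addrA addrAC -addrA [- _ + _]addrC.
  by rewrite [X in (_ * X)%E]E lebesgue_translate// muleA -EFinM mulfV ?gt_eqF// mul1e.
- by move=> x _; exact: ltW.
rewrite -ge0_integralZl//; first by apply: eq_integral => y _; rewrite /= muleC.
- by apply/measurable_EFinP; apply: measurableT_comp mP.
- by move=> y _; rewrite lee_fin.
- by rewrite lee_fin ltW.
Qed.

End Tubes.
(** * Minkowski identities *)

(** Here [W] is the weight of K, [P] that of the tube outside K, [Q] = (1+h)^N, and [I] the integral
    over the boundary with the modified radius; [s1], [s2] are its first-order terms and [s3] its
    error. *)
Lemma scaling_arith {R : realFieldType} (W P Q I s1 s2 s3 M D h : R) :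
  Q * I <= P + h * s1 + - (h * s2) + s3 * h ^+ 2 -> W + P <= Q * (W + I) ->
  Q * W <= (1 + h * M + D * h ^+ 2) * W ->
  0 <= h * (M * W + s1 - s2) + (D * W + s3) * h ^+ 2.
Proof. by move=> l1 l2 l3; lra. Qed.

Section Scaling.
Context {R : realType} {n : nat}.
Variable Omega : set 'rV[R]_n.+1.
Hypotheses (oO : open Omega) (O0 : Omega !=set0) (bO : bounded_set Omega)
  (cO : convex_set Omega) (smO : smooth_hypersurface (boundary Omega)).
Variable mu : {measure set 'rV[R]_n.+1 -> \bar R}.
Hypothesis mu_area : area_measure (boundary Omega) mu.
Local Notation leb := (lebesgue_rV R).
Local Notation Sigma := (boundary Omega).
Local Notation nu := (outward_normal Omega).
Local Notation K := (closure Omega).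

Let bK : convex_body K := closure_convex_body O0 bO cO.
Let mS : measurable Sigma := measurable_boundary Omega.
Let mK : measurable K := measurable_closure Omega.

Definition parallel_body (Omega' : set 'rV[R]_n.+1) (t : R) := [set y | dist (closure Omega') y <= t].
Local Notation tube := (parallel_body Omega).

Lemma measurable_tube t : measurable (tube t).
Proof.
apply: closed_measurable_rV; apply: (@preimage_closed _ _ (dist K) [set x | x <= t]).
  by move=> y _; exact: dist_continuous.
exact: closed_le.
Qed.

Lemma closure_bounded : exists2 C, 0 < C & forall y, K y -> enorm y <= C.
Proof.
have [cK _ _] := bK.
have [C C0 hC] := @compact_image_bounded R n.+1 R K (@enorm R n.+1) cK
  (fun x _ => @enorm_continuous R n.+1 x).
by exists C => // y Ky; rewrite (le_trans (ler_norm _))// hC.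
Qed.

Lemma boundary_closure p : Sigma p -> K p.
Proof. by case. Qed.

Lemma closure_tube t : 0 <= t -> K `<=` tube t.
Proof.
move=> t0 y Ky; rewrite /parallel_body /=.
by have /eqP -> : dist K y == 0 by rewrite (dist_eq0 bK) mem_set.
Qed.

Lemma tube_lebesgue_lty t : (leb n.+1 (tube t) < +oo)%E.
Proof.
have [C C0 hC] := closure_bounded.
apply: (@bounded_lebesgue_lty _ _ _ (C + t)); first exact: measurable_tube.
move=> y yt; rewrite -(subrK (proj K y) y) (le_trans (enormD _ _))// addrC lerD//.
by apply: hC; exact: (proj_in bK).
Qed.

Lemma shell_integral_power (f : 'rV[R]_n.+1 -> \bar R) p N a t : 0 <= t ->
  (forall s, 0 < s -> (f (p + s *: nu p)%R * (shell_density Omega s p)%:E =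
     if (s <= t)%R then (power_sum N a s)%:E else 0)%E) ->
  shell_integral Omega f p = (power_prim N a t)%:E.
Proof.
move=> t0 H; rewrite /shell_integral -integral_power_sum// [LHS]integral_mkcond [RHS]integral_mkcond.
apply: eq_integral => s _; rewrite !patchE !mem_setE !in_itv /= andbT.
by case: ifPn => // s0; rewrite H.
Qed.

Lemma tube_ray s t p : Sigma p -> 0 < s -> \1_(tube t) (p + s *: nu p) = (s <= t)%R%:R :> R.
Proof.
move=> Sp s0; rewrite indicE; congr (_ : bool)%:R.
have sp := outward_normal_supports oO O0 bO cO smO Sp.
have v1 := outward_normal_unit oO O0 bO cO smO Sp.
have E := dist_supported bK sp v1 (ltW s0).
by apply/idP/idP => [/set_mem|h]; [|apply: mem_set]; rewrite /parallel_body /= E.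
Qed.

Lemma ge0_integral_tube (f : 'rV[R]_n.+1 -> R) :
  measurable_fun setT f -> (forall y, 0 <= f y) ->
  (\int[leb n.+1]_y (f y)%:E = \int[leb n.+1]_(y in K) (f y)%:E +
    \int[mu]_(p in Sigma) shell_integral Omega (EFin \o f) p)%E.
Proof.
move=> mf f0.
have [_ <-] := shell_formula oO O0 bO cO smO mu_area (f := EFin \o f)
  ltac:(exact/measurable_EFinP) ltac:(by move=> y; rewrite /= lee_fin).
rewrite -(setUv K) ge0_integral_setU//.
- exact: measurableC.
- by apply/measurable_EFinP; exact: measurable_funTS.
- by move=> y _; rewrite lee_fin.
- by apply/disj_setPS => y [].
Qed.

(** The shell formula for the tube of radius 1 shows that the sum of the integrals of sigma_j/(j+1)
    is at most the volume of the tube. All terms are nonnegative, so each is finite. *)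
Lemma elem_sym_integrable j : mu.-integrable Sigma
  (EFin \o (fun p => elem_sym j (principal_curvatures Omega p))).
Proof.
pose a p k := elem_sym k (principal_curvatures Omega p).
have a0 p k : Sigma p -> 0 <= a p k.
  move=> Sp; apply: elem_sym_ge0 => i; exact: (principal_curvatures_ge0 oO O0 bO cO smO).
have shE t p : 0 <= t -> Sigma p ->
    shell_integral Omega (EFin \o \1_(tube t)) p = (power_prim n.+1 (a p) t)%:E.
  move=> t0 Sp; apply: shell_integral_power => // s s0.
  rewrite /= tube_ray//; case: ifP => _; rewrite ?mul0e// mul1e.
  by congr (_%:E); apply: eq_bigr => k _; rewrite mulrC.
have mI t : measurable_fun setT (\1_(tube t) : _ -> R) :=
  measurable_indic (measurable_tube t).
have mprim t : 0 <= t -> measurable_fun Sigma (fun p => power_prim n.+1 (a p) t).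
  move=> t0; apply/measurable_EFinP.
  have [h _] := shell_formula oO O0 bO cO smO mu_area (f := EFin \o \1_(tube t))
    ltac:(exact/measurable_EFinP) ltac:(by move=> y; rewrite /= lee_fin).
  by apply: eq_measurable_fun h => p /set_mem Sp; exact: shE.
have [jn|jn] := ltnP j n.+1; last first.
  rewrite (_ : _ \o _ = cst 0%E); first exact: integrable0.
  apply/funext => p /=; rewrite /elem_sym big_pred0// => A; apply/negP => /eqP Aj.
  by move: (max_card (mem A)); rewrite card_ord Aj leqNgt jn.
have mj : measurable_fun Sigma (fun p => a p j).
  have [c hc] := @power_sum_coef R n.+1.
  (* The shell integral at radius t is measurable in p for each t and, divided by t, is a polynomial
     with coefficients sigma_k/(k+1); Vandermonde inversion isolates one of them. *)
  have -> : (fun p => a p j) = (fun p => j.+1%:R *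
      \sum_(i < n.+1) c (Ordinal jn) i * (i.+1%:R^-1 * power_prim n.+1 (a p) i.+1%:R)).
    apply/funext => p; have := hc (fun k => a p k / k.+1%:R) (Ordinal jn).
    move=> /= E; have -> : a p j = j.+1%:R * (a p j / j.+1%:R).
      by rewrite mulrCA mulfV ?mulr1// pnatr_eq0.
    rewrite E; congr (_ * _); apply: eq_bigr => i _; congr (_ * _).
    rewrite /power_prim mulr_sumr; apply: eq_bigr => k _.
    rewrite exprS; field; by rewrite !(addrC 1) !natr1 !pnatr_eq0.
  apply: measurable_funM => //; apply: measurable_sum => i.
  by do 2! apply: measurable_funM => //; exact: mprim.
apply: ge0_integrable => //; first by move=> p Sp; exact: a0.
have fin : (\int[mu]_(p in Sigma) (power_prim n.+1 (a p) 1)%:E < +oo)%E.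
  have E := ge0_integral_tube (mI 1) (fun y => ler0n _ _).
  have E1 : (\int[leb n.+1]_y (\1_(tube 1) y)%:E = leb n.+1 (tube 1))%E.
    by rewrite integral_indic ?setIT//; exact: measurable_tube.
  have lt := tube_lebesgue_lty 1; rewrite -E1 E in lt.
  rewrite -(eq_integral _ _ (fun p Sp => shE 1 p ler01 (set_mem Sp))).
  by apply: le_lt_trans lt; rewrite leeDr// integral_ge0// => y _; rewrite lee_fin.
have le1 : (\int[mu]_(p in Sigma) (a p j / j.+1%:R)%:E <=
   \int[mu]_(p in Sigma) (power_prim n.+1 (a p) 1)%:E)%E.
  apply: ge0_le_integral => //.
  - by move=> p Sp; rewrite lee_fin divr_ge0// a0.
  - by apply/measurable_EFinP; exact: measurable_funM.
  - by apply/measurable_EFinP; exact: mprim.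
  - move=> p Sp; rewrite lee_fin /power_prim (bigD1 (Ordinal jn))//= expr1n mul1r lerDl.
    by apply: sumr_ge0 => k _; rewrite expr1n mul1r mulr_ge0// ?invr_ge0// a0.
have jE : (\int[mu]_(p in Sigma) (a p j)%:E =
    j.+1%:R%:E * \int[mu]_(p in Sigma) (a p j / j.+1%:R)%:E)%E.
  rewrite -ge0_integralZl//; last first.
  - by move=> p Sp; rewrite lee_fin divr_ge0// a0.
  - by apply/measurable_EFinP; exact: measurable_funM.
  by apply: eq_integral => p _; rewrite -EFinM mulrCA mulfV ?mulr1// pnatr_eq0.
rewrite [X in (X < _)%E]jE lte_mul_pinfty// ?lee_fin//.
exact: le_lt_trans le1 fin.
Qed.

(** K lies in the half-space supported at p, and the distance to the half-space is at most the
    distance to K. *)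
Lemma dist_support p y : Sigma p -> dotv (y - p) (nu p) <= dist K y.
Proof.
move=> Sp; have [_ sp] := outward_normal_supports oO O0 bO cO smO Sp.
have v1 := outward_normal_unit oO O0 bO cO smO Sp.
have -> : y - p = (y - proj K y) + (proj K y - p) by rewrite addrA subrK.
rewrite dotvDl -[leRHS]addr0 lerD//; last by apply: sp; exact: (proj_in bK).
by rewrite (le_trans (dotv_le_enorm _ _))// v1 mulr1.
Qed.

Variables (X0 : 'rV[R]_n.+1) (w : 'rV[R]_n.+1 -> R) (d : nat) (a : nat -> 'rV[R]_n.+1 -> R).
Local Notation N := (n.+1 + d)%N.
Local Notation u p := (dotv (p - X0) (nu p)).
Local Notation dil c y := (X0 + c *: (y - X0)).
Hypotheses (w0 : forall y, 0 <= w y) (mw : measurable_fun setT w)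
  (whom : forall c y, 0 < c -> w (dil c y) = c ^+ d * w y)
  (wray : forall p s, Sigma p -> 0 < s ->
     w (p + s *: nu p) * shell_density Omega s p = power_sum N (a^~ p) s)
  (ia : forall k, mu.-integrable Sigma (EFin \o a k))
  (wfin : (\int[leb n.+1]_(y in K) (w y)%:E < +oo)%E).

Let W0 := \int[leb n.+1]_(y in K) w y.
Let A k := \int[mu]_(p in Sigma) a k p.
Let B k := \int[mu]_(p in Sigma) (u p * a k p).

Let iw : (leb n.+1).-integrable K (EFin \o w).
Proof. by apply: ge0_integrable => //; exact: measurable_funTS. Qed.

Let W0E : (\int[leb n.+1]_(y in K) (w y)%:E = W0%:E)%E.
Proof. exact: EFin_Rintegral iw. Qed.

Let iprim t : mu.-integrable Sigma (EFin \o (fun p => power_prim N (a^~ p) t)) /\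
  \int[mu]_(p in Sigma) power_prim N (a^~ p) t = power_prim N A t.
Proof. exact: (Rintegral_sum mS N (fun k => t ^+ k.+1 / k.+1%:R) ia). Qed.

Let mI t : measurable_fun setT (\1_(tube t) : _ -> R) :=
  measurable_indic (measurable_tube t).

(** The weight is homogeneous of degree [d] about X0 and, times the shell density, polynomial along
    normal rays, so its integral over a tube is a polynomial in t. The instances used are w = 1 with
    d = 0 and w = |y - X0|^2 with d = 2. *)
Lemma integral_weighted_tube t : 0 <= t ->
  (\int[leb n.+1]_y (w y * \1_(tube t) y)%:E = (W0 + power_prim N A t)%:E)%E.
Proof.
move=> t0; rewrite ge0_integral_tube; [|exact: measurable_funM|by move=> y; rewrite mulr_ge0].
rewrite EFinD; congr (_ + _)%E.
  rewrite -W0E; apply: eq_integral => y /set_mem Ky.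
  by rewrite indicE mem_set ?mulr1//; exact: closure_tube.
have [i <-] := iprim t; rewrite -EFin_Rintegral//.
apply: eq_integral => p /set_mem Sp; apply: shell_integral_power => // s s0.
rewrite /= tube_ray//; case: ifP => _; last by rewrite mulr0 mul0e.
by rewrite mulr1 -EFinM wray.
Qed.

Lemma measurable_outward_normal : measurable_fun Sigma nu.
Proof.
apply: continuous_on_measurable_rV => p Sp A0 /nbhs_enormP[e e0 he].
apply: filterS (outward_normal_continuous oO O0 bO cO smO Sp e0) => q h Sq.
exact/he/h.
Qed.

Lemma measurable_support_height : measurable_fun Sigma (fun p => u p).
Proof.
rewrite /dotv; apply: measurable_sum => i; apply: measurable_funM.
  rewrite (_ : (fun p : 'rV[R]_n.+1 => _) = (fun p : 'rV[R]_n.+1 => p 0 i - X0 0 i)).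
    apply: measurable_funB => //; apply: measurable_funTS; exact: measurable_rV_coord.
  by apply/funext => p; rewrite !mxE.
exact: (measurableT_comp (@measurable_rV_coord R n.+1 i) measurable_outward_normal).
Qed.

Lemma support_height_bounded : exists2 C, 0 < C & forall p, Sigma p ->
  enorm (p - X0) <= C /\ `|u p| <= C.
Proof.
have [C C0 hC] := closure_bounded; exists (C + enorm X0) => [|p Sp].
  by rewrite ltr_wpDr// enorm_ge0.
have h : enorm (p - X0) <= C + enorm X0.
  by rewrite (le_trans (enormD _ _))// enormN lerD2r hC//; exact: boundary_closure.
split=> //; rewrite (le_trans (dotv_abs_le _ _))//.
by rewrite (outward_normal_unit oO O0 bO cO smO Sp) mulr1.
Qed.

Lemma support_height_integrable g : mu.-integrable Sigma (EFin \o g) ->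
  mu.-integrable Sigma (EFin \o (fun p => u p * g p)).
Proof.
have [C C0 hC] := support_height_bounded.
apply: (integrable_bounded_mul mS (C := C)); first exact: measurable_support_height.
by move=> p /hC[].
Qed.

Let tau t h p := (t - h * u p) / (1 + h).

Let itau t h : mu.-integrable Sigma (EFin \o (fun p => power_prim N (a^~ p) (tau t h p))).
Proof.
have [C C0 hC] := support_height_bounded.
pose g k p := (tau t h p) ^+ k.+1 / k.+1%:R * a k p.
have ig k : mu.-integrable Sigma (EFin \o g k).
  apply: (integrable_bounded_mul mS (C := ((`|t| + `|h| * C) / `|1 + h|) ^+ k.+1 / k.+1%:R)) => //.
    apply: measurable_funM => //; apply: measurable_funX; apply: measurable_funM => //.
    apply: measurable_funB => //; apply: measurable_funM => //.
    exact: measurable_support_height.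
  move=> p Sp; rewrite normrM normrX [`|_^-1|]ger0_norm// ler_wpM2r// lerXn2r ?nnegrE//.
    by rewrite divr_ge0// addr_ge0// mulr_ge0// ltW.
  rewrite /tau normrM normfV ler_wpM2r// (le_trans (ler_normB _ _))// lerD2l normrM.
  by rewrite ler_wpM2l//; case: (hC p Sp).
have [i _] := Rintegral_sum mS N (fun=> 1) ig.
apply: eq_integrable i => // p _; congr EFin; rewrite /power_prim.
by apply: eq_bigr => k _; rewrite /g mulr1 mulrC.
Qed.

(* The dilated point (1 + h)(p + s nu), taken about X0, is at distance at least
   h u p + (1 + h) s from K: only s <= tau t h p contributes. *)
Lemma weighted_tube_dilation_le t h : 0 <= t -> 0 < 1 + h ->
  (forall p, Sigma p -> h * u p <= t) ->
  W0 + power_prim N A t <= (1 + h) ^+ N *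
    (W0 + \int[mu]_(p in Sigma) power_prim N (a^~ p) (tau t h p)).
Proof.
move=> t0 h0 hu.
have mw' : measurable_fun setT (fun y => w y * \1_(parallel_body Omega t) y).
  exact: measurable_funM.
have w'0 y : 0 <= w y * \1_(parallel_body Omega t) y by rewrite mulr_ge0.
have E := lebesgue_dilation X0 h0 mw' w'0.
rewrite integral_weighted_tube// in E.
pose g y := w y * \1_(parallel_body Omega t) (dil (1 + h) y).
have g0 y : 0 <= g y by rewrite mulr_ge0.
have mg : measurable_fun setT g.
  apply: measurable_funM => //; apply: (measurableT_comp (mI t)).
  have -> : (fun y : 'rV[R]_n.+1 => dil (1 + h) y) =
     (fun y => y *m (1 + h)%:M + (X0 - (1 + h) *: X0)).
    apply/funext => y.
    by rewrite mul_mx_scalar scalerBr addrC addrA addrAC -addrA [- _ + _]addrC.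
  exact: measurable_affine.
have gE : (\int[leb n.+1]_y (w (dil (1 + h) y) * \1_(parallel_body Omega t) (dil (1 + h) y))%:E =
    ((1 + h) ^+ d)%:E * \int[leb n.+1]_y (g y)%:E)%E.
  rewrite -ge0_integralZl//.
  - by apply: eq_integral => y _; rewrite -EFinM whom// mulrA.
  - exact/measurable_EFinP.
  - by move=> y _; rewrite lee_fin.
  - by rewrite lee_fin exprn_ge0// ltW.
have up : (\int[leb n.+1]_y (g y)%:E <=
   (W0 + \int[mu]_(p in Sigma) power_prim N (a^~ p) (tau t h p))%:E)%E.
  rewrite (ge0_integral_tube mg g0) EFinD leeD//.
    rewrite -W0E; apply: ge0_le_integral => //.
    - by move=> y _; rewrite lee_fin.
    - by apply/measurable_EFinP; exact: measurable_funTS.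
    - by apply/measurable_EFinP; exact: measurable_funTS.
    - move=> y _; rewrite lee_fin /g indicE; case: (_ \in _); rewrite ?mulr1 ?mulr0//.
  have mgE : measurable_fun setT (EFin \o g) by exact/measurable_EFinP.
  have gE0 y : (0 <= (EFin \o g) y)%E by rewrite /= lee_fin.
  have [msh _] := shell_formula oO O0 bO cO smO mu_area mgE gE0.
  rewrite -(EFin_Rintegral mS (itau t h)).
  apply: ge0_le_integral => //.
  - by move=> p Sp; exact: (shell_integral_ge0 oO O0 bO cO smO).
  - exact: measurable_int (itau t h).
  move=> p Sp.
  have tau0 : 0 <= tau t h p by rewrite divr_ge0 ?subr_ge0 ?hu// ltW.
  rewrite -integral_power_sum// [leRHS]integral_mkcond /shell_integral [leLHS]integral_mkcond.
  have mden : measurable_fun setT (fun s : measurableTypeR R => shell_density Omega s p) :=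
    measurable_shell_density Omega p.
  have mray := measurable_ray p (nu p).
  have cps : continuous (power_sum N (a^~ p)) := @power_sum_continuous R N _.
  apply: ge0_le_integral => //.
  - move=> s _; apply: erestrict_ge0 => s'; rewrite /= in_itv /= andbT => s0.
    rewrite mule_ge0 ?lee_fin// (le_trans ler01)//.
    exact: (shell_density_ge1 oO O0 bO cO smO) (ltW s0).
  - apply/(measurable_restrictT _ (measurable_itv _)); apply: measurable_funTS.
    apply: emeasurable_funM; first exact: (measurableT_comp mgE).
    exact/measurable_EFinP.
  - apply/(measurable_restrictT _ (measurable_itv _)); apply: measurable_funTS.
    by apply/measurable_EFinP; exact: continuous_measurable_fun.
  move=> s _; rewrite !patchE !mem_setE !in_itv /= andbT.
  case: ifPn => s0 //=.
  have pos : 0 <= power_sum N (a^~ p) s.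
    rewrite -wray// mulr_ge0// (le_trans ler01)//.
    exact: (shell_density_ge1 oO O0 bO cO smO) (ltW s0).
  rewrite -EFinM /g indicE.
  have [yt|yt] := boolP (dil (1 + h) (p + s *: nu p) \in parallel_body Omega t).
    rewrite mulr1 wray// ifT//.
    have := set_mem yt; rewrite /parallel_body /=.
    have ds := dist_support (dil (1 + h) (p + s *: nu p)) Sp.
    have v1 := enorm1_dotv (outward_normal_unit oO O0 bO cO smO Sp).
    have E2 : dotv (dil (1 + h) (p + s *: nu p) - p) (nu p) = h * u p + (1 + h) * s.
      have -> : dil (1 + h) (p + s *: nu p) - p = h *: (p - X0) + ((1 + h) * s) *: nu p.
        by apply/rowP => i; rewrite !mxE; ring.
      by rewrite [LHS]dotvDl !dotvZl v1 mulr1.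
    move=> h1; rewrite /tau ler_pdivlMr//.
    have := le_trans ds h1; rewrite E2; move: (u p) => u0; lra.
  rewrite mulr0 mul0r; case: ifP => _; by rewrite lee_fin.
rewrite -lee_fin E gE muleA -EFinM -exprD [in leRHS]EFinM.
by apply: lee_wpmul2l up; rewrite lee_fin exprn_ge0// ltW.
Qed.

Let b k : R := (N - k.+1)%:R.

(** Expanding the dilation inequality to first order in h leaves 0 <= h x + C' h^2, where x is the
    left-hand side below. Small h of both signs are allowed, so x = 0. *)
Lemma scaling_identity_tube t : 0 < t ->
  N%:R * W0 + \sum_(k < N) A k * (b k * t ^+ k.+1 / k.+1%:R) - \sum_(k < N) B k * t ^+ k = 0.
Proof.
move=> t0; have [C C0 hC] := support_height_bounded.
have exD k : exists D, 0 <= D /\ forall u0 h, `|u0| <= C -> `|h| <= 1 ->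
  `|(1 + h) ^+ (N - k.+1) * (t - h * u0) ^+ k.+1 - t ^+ k.+1 -
     h * (b k * t ^+ k.+1 - k.+1%:R * u0 * t ^+ k)| <= D * h ^+ 2.
  have [D D0 hD] := @scaled_power_taylor1 R (N - k.+1) k.+1 t C (ltW C0).
  by exists D.
have [D hD] := choice exD.
have [D1 D10 hD1] := @power_taylor1 R N 1 1 ler01.
pose L k := \int[mu]_(p in Sigma) `|a k p|.
pose C' := D1 * W0 + \sum_(k < N) L k * (D k / k.+1%:R).
(* The bound 1/2 keeps 1 + h positive; the bound t / C gives h u <= t, so the modified radius is
   nonnegative at every boundary point. *)
pose e := Num.min (2^-1) (t / C).
have e0 : 0 < e by rewrite /e lt_min invr_gt0 ltr0n divr_gt0.
apply: (@quadratic_bound_eq0 R _ C' e) => // h; rewrite /e le_min => /andP[h2 htC].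
have h1 : `|h| <= 1.
  by apply: le_trans h2 _; rewrite invf_le1 ?ltr0n// ler1n.
have hpos : 0 < 1 + h by move: h2; rewrite ler_norml => /andP[h3 _]; lra.
have hu p : Sigma p -> h * u p <= t.
  move=> Sp; rewrite (le_trans (ler_norm _))// normrM.
  have [_ uC] := hC p Sp.
  rewrite (@le_trans _ _ (t / C * C))//; first by rewrite ler_pM.
  by rewrite divfK// gt_eqF.
have ineq := weighted_tube_dilation_le (ltW t0) hpos hu.
have W00 : 0 <= W0 by apply: Rintegral_ge0.
have iL k : mu.-integrable Sigma (EFin \o (fun p => `|a k p|)).
  by apply: eq_integrable (integrable_abse (ia k)).
have iB k : mu.-integrable Sigma (EFin \o (fun p => u p * a k p)).
  exact: support_height_integrable.
have [i1 I1] := Rintegral_sum mS N (fun k => t ^+ k.+1 / k.+1%:R + h * (b k * t ^+ k.+1 / k.+1%:R)) ia.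
have [i2 I2] := Rintegral_sum mS N (fun k => - (h * t ^+ k)) iB.
have [i3 I3] := Rintegral_sum mS N (fun k => D k / k.+1%:R * h ^+ 2) iL.
have up : (1 + h) ^+ N * \int[mu]_(p in Sigma) power_prim N (a^~ p) (tau t h p) <=
   \sum_(k < N) A k * (t ^+ k.+1 / k.+1%:R + h * (b k * t ^+ k.+1 / k.+1%:R)) +
   \sum_(k < N) B k * (- (h * t ^+ k)) + \sum_(k < N) L k * (D k / k.+1%:R * h ^+ 2).
  rewrite -I1 -I2 -I3 -RintegralZl// -RintegralD// -RintegralD//; last exact: integrableDR.
  apply: le_Rintegral => //.
  - by apply: eq_integrable (integrableZl mS ((1 + h) ^+ N) (itau t h)).
  - by apply: integrableDR => //; exact: integrableDR.
  move=> p Sp; rewrite -!big_split /= /power_prim mulr_sumr.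
  apply: ler_sum => -[k kN] _ /=.
  have [D0 hDk] := hD k; have [_ uC] := hC p Sp.
  have {hDk} := hDk (u p) h uC h1.
  have EN : N = (N - k.+1 + k.+1)%N by rewrite subnK.
  (* The denominators of the modified radius cancel against (1+h)^N, which leaves the polynomial
     form expanded by [scaled_power_taylor1]. *)
  have tE : (1 + h) ^+ N * (a k p * (tau t h p ^+ k.+1 / k.+1%:R)) =
      a k p * ((1 + h) ^+ (N - k.+1) * (t - h * u p) ^+ k.+1 / k.+1%:R).
    rewrite {1}EN exprD /tau expr_div_n; field.
    by rewrite addrC natr1 pnatr_eq0 /= expf_neq0// gt_eqF.
  rewrite tE; move: ((1 + h) ^+ (N - k.+1) * _) (b k) (D k) D0 => q bk Dk D0.
  move: (u p) (a k p) => u0 ak.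
  set T := t ^+ k.+1; set T' := t ^+ k => Hq.
  have k0 : 0 < k.+1%:R :> R by rewrite ltr0n.
  rewrite -subr_ge0.
  have -> : ak * (T / k.+1%:R + h * (bk * T / k.+1%:R)) + u0 * ak * - (h * T') +
     `|ak| * (Dk / k.+1%:R * h ^+ 2) - ak * (q / k.+1%:R) =
     (`|ak| * (Dk * h ^+ 2) - ak * (q - T - h * (bk * T - k.+1%:R * u0 * T'))) / k.+1%:R.
    by field; rewrite addrC natr1 gt_eqF.
  apply: divr_ge0; last exact: ltW.
  rewrite subr_ge0 (le_trans (ler_norm _))// normrM ler_wpM2l//.
have := hD1 1 h; rewrite normr1 lexx => /(_ isT h1); rewrite !mulr1 !expr1n !mulr1.
rewrite ler_norml => /andP[_ hN].
have hN' : (1 + h) ^+ N * W0 <= (1 + h * N%:R + D1 * h ^+ 2) * W0.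
  by rewrite ler_wpM2r//; move: hN; lra.
have E1 : \sum_(k < N) A k * (t ^+ k.+1 / k.+1%:R + h * (b k * t ^+ k.+1 / k.+1%:R)) =
   power_prim N A t + h * \sum_(k < N) A k * (b k * t ^+ k.+1 / k.+1%:R).
  rewrite mulr_sumr -big_split /=; apply: eq_bigr => k _; ring.
have E2 : \sum_(k < N) B k * (- (h * t ^+ k)) = - (h * \sum_(k < N) B k * t ^+ k).
  rewrite mulr_sumr -sumrN; apply: eq_bigr => k _; ring.
have E3 : \sum_(k < N) L k * (D k / k.+1%:R * h ^+ 2) = (\sum_(k < N) L k * (D k / k.+1%:R)) * h ^+ 2.
  rewrite mulr_suml; apply: eq_bigr => k _; ring.
rewrite E1 E2 E3 in up.
exact: scaling_arith up ineq hN'.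
Qed.

(** The identity holds for every t > 0, so its coefficients vanish: the constant one gives the
    volume term, and t^k pairs A_(k-1), which carries t^k after integration in s, with B_k. *)
Theorem scaling_identity :
  N%:R * W0 = B 0 /\
  forall k, (0 < k < N)%N -> A k.-1 * ((N - k)%:R / k%:R) = B k.
Proof.
(* There are N + 1 coefficients: the [A] terms are shifted up by one, and [B] stops at N - 1. *)
pose e k := (if k is k'.+1 then A k' * ((N - k)%:R / k%:R) else N%:R * W0) -
  (if (k < N)%N then B k else 0).
have H k : (k < N.+1)%N -> e k = 0.
  apply: power_sum_eq0 => t t0; rewrite -[RHS](scaling_identity_tube t0) /power_sum.
  have -> : \sum_(k < N.+1) e k * t ^+ k =
    \sum_(k < N.+1) (if (k : nat) is k'.+1 then A k' * ((N - k)%:R / k%:R) else N%:R * W0) * t ^+ k -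
    \sum_(k < N.+1) (if (k < N)%N then B k else 0) * t ^+ k.
    by rewrite -sumrB; apply: eq_bigr => i _; rewrite mulrBl.
  congr (_ - _).
    rewrite big_ord_recl expr0 mulr1; congr (_ + _); apply: eq_bigr => i _.
    by rewrite /b /= /bump /= add1n -!mulrA; congr (_ * (_ * _)); rewrite mulrC.
  rewrite big_ord_recr /= ltnn mul0r addr0; apply: eq_bigr => i _.
  by rewrite ltn_ord.
split.
  by apply/eqP; rewrite -subr_eq0; apply/eqP; exact: (H 0).
move=> [|k] // /andP[_ kN]; apply/eqP; rewrite -subr_eq0; apply/eqP.
by have := H k.+1 (ltnW kN); rewrite /e kN.
Qed.

End Scaling.

(** * Minkowski formulas and the second moment *)

Lemma elem_sym_large {R : realType} n j (k : 'rV[R]_n) : (n < j)%N -> elem_sym j k = 0.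
Proof.
move=> nj; rewrite /elem_sym big_pred0// => A; apply/negP => /eqP Aj.
by move: (max_card (mem A)); rewrite card_ord Aj leqNgt nj.
Qed.

(** Minkowski's formula at k = m - 1, where (m + 1 - k)/k = 2/(m - 1). For m = 1 both sides are 0,
    which is the convention sigma_(-1) = 0. *)
Lemma minkowski_arith {R : numFieldType} m (S U : nat -> R) : (1 <= m)%N ->
  (forall k, (0 < k <= m)%N -> S k.-1 * ((m.+1 - k)%:R / k%:R) = U k) ->
  (if m is m'.+2 then S m' else 0) = m.-1%:R / 2 * U m.-1.
Proof.
case: m => [|[|m]] // _ H; first by rewrite mul0r mul0r.
have -> : U m.+2.-1 = S m * (2 / m.+1%:R).
  by rewrite -(H m.+1)//= (_ : (m.+3 - m.+1 = 2)%N)// !subSS -addn2 addKn.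
by rewrite /=; field; rewrite addrC natr1 pnatr_eq0.
Qed.

Lemma second_moment_arith {R : realFieldType} (N x y z : R) : N != 0 ->
  (x + 2 * y + (N - 2) / 2 * y) * (2 / N) = 2 * z + y -> x + y = N * z.
Proof.
move=> N0 E.
have E' : (x + 2 * y + (N - 2) / 2 * y) * 2 = (2 * z + y) * N by rewrite -E; field.
lra.
Qed.

Section Minkowski.
Context {R : realType} {n : nat}.
Variable Omega : set 'rV[R]_n.+1.
Hypotheses (oO : open Omega) (O0 : Omega !=set0) (bO : bounded_set Omega)
  (cO : convex_set Omega) (smO : smooth_hypersurface (boundary Omega)).
Variable mu : {measure set 'rV[R]_n.+1 -> \bar R}.
Hypothesis mu_area : area_measure (boundary Omega) mu.
Variable X0 : 'rV[R]_n.+1.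
Local Notation leb := (lebesgue_rV R).
Local Notation Sigma := (boundary Omega).
Local Notation nu := (outward_normal Omega).
Local Notation K := (closure Omega).
Local Notation sigma j p := (elem_sym j (principal_curvatures Omega p)).
Local Notation u p := (dotv (p - X0) (nu p)).
Local Notation sqd p := (dotv (p - X0) (p - X0)).

Let mS : measurable Sigma := measurable_boundary Omega.
Let isigma j : mu.-integrable Sigma (EFin \o (fun p => sigma j p)) :=
  elem_sym_integrable oO O0 bO cO smO mu_area j.
Let iu g : mu.-integrable Sigma (EFin \o g) ->
    mu.-integrable Sigma (EFin \o (fun p => u p * g p)) :=
  support_height_integrable oO O0 bO cO smO X0 (mu := mu) (g := g).

Lemma closure_lebesgue_lty : (leb n.+1 K < +oo)%E.
Proof.
apply: le_lt_trans (tube_lebesgue_lty O0 bO cO 0); apply: le_measure; rewrite ?inE.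
- exact: measurable_closure.
- exact: measurable_tube.
- exact: closure_tube.
Qed.

Lemma measurable_sqd : measurable_fun setT (fun p : 'rV[R]_n.+1 => sqd p).
Proof.
rewrite /dotv; apply: measurable_sum => i; apply: measurable_funM;
  rewrite (_ : (fun p : 'rV[R]_n.+1 => _) = (fun p : 'rV[R]_n.+1 => p 0 i - X0 0 i));
  try (by apply/funext => p; rewrite !mxE);
  by apply: measurable_funB => //; exact: measurable_rV_coord.
Qed.

Lemma sqd_bounded : exists2 C, 0 < C & forall p, K p -> `|sqd p| <= C.
Proof.
have [C C0 hC] := closure_bounded O0 bO cO; exists ((C + enorm X0) ^+ 2) => [|p Kp].
  by rewrite exprn_gt0// ltr_wpDr// enorm_ge0.
rewrite ger0_norm ?dotv_ge0// -enorm2 lerXn2r ?nnegrE ?enorm_ge0// ?addr_ge0 ?enorm_ge0// ?(ltW C0)//.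
by rewrite (le_trans (enormD _ _))// enormN lerD2r hC.
Qed.

Lemma sqd_integrable g : mu.-integrable Sigma (EFin \o g) ->
  mu.-integrable Sigma (EFin \o (fun p => sqd p * g p)).
Proof.
have [C C0 hC] := sqd_bounded.
apply: (integrable_bounded_mul mS (C := C)).
  by apply: measurable_funTS; exact: measurable_sqd.
by move=> p [Kp _]; exact: hC.
Qed.

(** The constant weight, whose coefficients are the sigma_k themselves. After division by binomial
    coefficients, the second part says that H_(k-1) and u H_k have the same integral. *)
Lemma minkowski :
  n.+1%:R * fine (leb n.+1 K) = \int[mu]_(p in Sigma) (u p * sigma 0 p) /\
  forall k, (0 < k <= n)%N -> \int[mu]_(p in Sigma) sigma k.-1 p * ((n.+1 - k)%:R / k%:R) =
    \int[mu]_(p in Sigma) (u p * sigma k p).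
Proof.
have [] := @scaling_identity R n Omega oO O0 bO cO smO mu mu_area X0 (cst 1) 0
  (fun k p => sigma k p).
- by move=> y; exact: ler01.
- exact: measurable_cst.
- by move=> c y _; rewrite expr0 mulr1.
- move=> p s Sp s0; rewrite mul1r addn0 /shell_density /power_sum.
  by apply: eq_bigr => i _; rewrite mulrC.
- exact: isigma.
- rewrite (_ : (fun y => _) = cst 1%:E)//; rewrite integral_cst ?mul1e; first exact: closure_lebesgue_lty.
  exact: measurable_closure.
rewrite !addn0 => h0 h1; split; last by move=> k; rewrite -ltnS => /h1.
by rewrite -h0 /cst Rintegral_cst ?mul1r//; exact: measurable_closure.
Qed.

(** The weight |y - X0|^2 at k = n + 1, where N - k = 2. Along a normal ray it is |p - X0|^2 + 2 s u
    + s^2, so a_k combines sigma_k, sigma_(k-1) and sigma_(k-2); in a_(n+1) the term sigma_(n+1)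
    vanishes. *)
Lemma second_moment_aux : (1 <= n)%N ->
  (\int[mu]_(p in Sigma) (sqd p * sigma n p) + 2 * \int[mu]_(p in Sigma) (u p * sigma n.-1 p) +
     (if n is n'.+2 then \int[mu]_(p in Sigma) sigma n' p else 0)) * (2 / n.+1%:R) =
  2 * \int[mu]_(p in Sigma) (u p * (u p * sigma n p)) + \int[mu]_(p in Sigma) (u p * sigma n.-1 p).
Proof.
move=> n1.
(* [c1] and [c2] are sigma shifted by one and two places, with value 0 where the index would be
   negative; the factor 2 of the middle term enters in [a]. *)
pose c1 k p := if k is k'.+1 then u p * sigma k' p else 0.
pose c2 k p := if k is k'.+2 then sigma k' p else 0.
have c1E k p : (0 < k)%N -> c1 k p = u p * sigma k.-1 p by case: k.
pose a k p := sqd p * sigma k p + c1 k p * 2 + c2 k p.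
have i0 : mu.-integrable Sigma (EFin \o (fun=> 0 : R)) by exact: integrable0.
have i1 k : mu.-integrable Sigma (EFin \o c1 k).
  by case: k => [|k]; [exact: i0|exact: iu].
have i2 k : mu.-integrable Sigma (EFin \o c2 k).
  by case: k => [|[|k]]; [exact: i0|exact: i0|exact: isigma].
have im k : mu.-integrable Sigma (EFin \o (fun p => sqd p * sigma k p)) := sqd_integrable (isigma k).
have ia k : mu.-integrable Sigma (EFin \o a k).
  apply: (integrableDR mS) => //; apply: (integrableDR mS) => //; exact: (integrableMR mS).
have iD k : mu.-integrable Sigma (EFin \o (fun p => sqd p * sigma k p + c1 k p * 2)).
  apply: (integrableDR mS) => //; exact: (integrableMR mS).
have [] := @scaling_identity R n Omega oO O0 bO cO smO mu mu_area X0 (fun y => sqd y) 2 a.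
- by move=> y; exact: dotv_ge0.
- exact: measurable_sqd.
- move=> c y _; have -> : X0 + c *: (y - X0) - X0 = c *: (y - X0) by rewrite [X0 + _]addrC addrK.
  by rewrite dotvZl dotvZr mulrA.
- move=> p s Sp s0.
  have v1 := enorm1_dotv (outward_normal_unit oO O0 bO cO smO Sp).
  have -> : p + s *: nu p - X0 = (p - X0) + s *: nu p by rewrite addrAC.
  have -> : dotv ((p - X0) + s *: nu p) ((p - X0) + s *: nu p) = sqd p + u p * 2 * s + s ^+ 2.
    move: (p - X0) => q; rewrite [LHS]dotvDl !dotvDr !dotvZl !dotvZr v1 (dotvC (nu p) q).
    move: (dotv _ _) (dotv _ _) => x y; ring.
  rewrite /shell_density addn2 /power_sum.
  have z1 : sigma n.+1 p = 0 by exact: elem_sym_large.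
  have z2 : sigma n.+2 p = 0 by apply: elem_sym_large; rewrite ltnW.
  have Ea : \sum_(k < n.+3) a k p * s ^+ k =
     \sum_(k < n.+3) sqd p * sigma k p * s ^+ k + \sum_(k < n.+3) c1 k p * 2 * s ^+ k +
     \sum_(k < n.+3) c2 k p * s ^+ k.
    by rewrite -!big_split /=; apply: eq_bigr => k _; rewrite /a !mulrDl.
  rewrite Ea.
  rewrite [X in _ = X + _ + _]big_ord_recr [X in _ = X + _ + _ + _]big_ord_recr /= z1 z2 !mulr0 !mul0r !addr0.
  rewrite [X in _ = _ + X + _]big_ord_recl [X in _ = _ + (_ + X) + _]big_ord_recr /= z1 !mulr0 !mul0r add0r addr0.
  rewrite [X in _ = _ + _ + X]big_ord_recl big_ord_recl /= !mul0r !add0r.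
  rewrite 2!mulrDl !mulr_sumr -!big_split /=; apply: eq_bigr => k _.
  rewrite /bump /= !add1n !exprS; move: (elem_sym _ _) (dotv _ _) (dotv _ _) (s ^+ k) => x y z r; ring.
- exact: ia.
- have [C C0 hC] := sqd_bounded.
  have fin : (\int[leb n.+1]_(y in K) C%:E < +oo)%E.
    rewrite integral_cst; last exact: measurable_closure.
    by rewrite lte_mul_pinfty ?lee_fin ?(ltW C0)//; exact: closure_lebesgue_lty.
  apply: le_lt_trans fin; apply: ge0_le_integral => //.
  + exact: measurable_closure.
  + by move=> y _; rewrite lee_fin dotv_ge0.
  + by apply/measurable_EFinP; apply: measurable_funTS; exact: measurable_sqd.
  + by move=> y Ky; rewrite lee_fin (le_trans (ler_norm _))// hC.
have nn : (0 < n.+1 < n.+1 + 2)%N by rewrite addn2 /= ltnS ltnW.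
move=> _ /(_ n.+1 nn); rewrite addn2 /=.
have -> : (n.+3 - n.+1)%N = 2 by rewrite !subSS -addn2 addKn.
have -> : \int[mu]_(p in Sigma) a n p = \int[mu]_(p in Sigma) (sqd p * sigma n p) +
   2 * \int[mu]_(p in Sigma) (u p * sigma n.-1 p) +
     (if n is n'.+2 then \int[mu]_(p in Sigma) sigma n' p else 0).
  rewrite /a RintegralD// RintegralD//; last exact: (integrableMR mS).
  rewrite RintegralZr//; congr (_ + _ + _).
    by rewrite mulrC (_ : c1 n = (fun p => u p * sigma n.-1 p))//; apply/funext => p; exact: c1E.
  have c2E k : \int[mu]_(p in Sigma) c2 k p =
      if k is k'.+2 then \int[mu]_(p in Sigma) sigma k' p else 0.
    by case: k => [|[|k]] //; rewrite Rintegral_cst ?mul0r.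
  exact: c2E.
move=> ->.
have -> : (fun p => u p * a n.+1 p) = (fun p => (u p * (u p * sigma n p)) * 2 + u p * sigma n.-1 p).
  apply/funext => p; rewrite /a elem_sym_large// mulr0 add0r mulrDr mulrA /=; congr (_ + _ * _).
  have c2E k : (0 < k)%N -> c2 k.+1 p = sigma k.-1 p by case: k.
  exact: c2E.
rewrite RintegralD//; [|exact: (integrableMR mS 2 (iu (iu (isigma n))))|exact: iu (isigma _)].
by rewrite RintegralZr// 1?mulrC//; exact: iu (iu (isigma n)).
Qed.

(** Minkowski's formula at k = n - 1 expresses the sigma_(n-2) term of the auxiliary identity
    through u sigma_(n-1), leaving only the terms displayed. *)
Theorem second_moment : (1 <= n)%N ->
  \int[mu]_(p in Sigma) (sqd p * sigma n p) + \int[mu]_(p in Sigma) (u p * sigma n.-1 p) =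
  n.+1%:R * \int[mu]_(p in Sigma) (u p * (u p * sigma n p)).
Proof.
move=> n1; have [_ H] := minkowski; have E := second_moment_aux n1.
have {H} : (if n is n'.+2 then \int[mu]_(p in Sigma) sigma n' p else 0) =
   n.-1%:R / 2 * \int[mu]_(p in Sigma) (u p * sigma n.-1 p).
  exact: minkowski_arith n1 H.
move=> E2; rewrite E2 in E.
have n0 : n.+1%:R != 0 :> R by rewrite pnatr_eq0.
have nE : n.-1%:R = n.+1%:R - 2 :> R by rewrite -{2}(prednK n1) -addn2 natrD addrK.
by rewrite nE in E; exact: second_moment_arith n0 E.
Qed.

End Minkowski.
(** * The Gauss map *)

(** Division by t^(m+1) and t tending to infinity. The shift by c only affects lower orders, which
    is made quantitative by t = c/x with x small. *)
Lemma leading_coef_le {R : realType} (G1 G2 C c : R) m : 0 <= G2 -> 0 <= C -> 0 < c ->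
  (forall t, 1 <= t -> G1 * t ^+ m.+1 <= G2 * (t + c) ^+ m.+1 + C * (t + c) ^+ m) -> G1 <= G2.
Proof.
move=> G20 C0 c0 H.
have [D D0 hD] := @power_taylor1 R m.+1 1 1 ler01.
pose E := G2 * (m.+1%:R + D) + C / c * 2 ^+ m.
have E0 : 0 <= E by rewrite addr_ge0// mulr_ge0// ?addr_ge0// ?exprn_ge0// divr_ge0// ltW.
apply/ler_addgt0Pr => e e0.
pose x := Num.min 1 (Num.min c (e / (E + 1))).
have x0 : 0 < x by rewrite /x !lt_min ltr01 c0 divr_gt0// ltr_wpDl.
have x1 : x <= 1 by rewrite /x ge_min lexx.
have xc : x <= c by rewrite /x !ge_min lexx orbT.
have xe : x * (E + 1) <= e.
  by rewrite -ler_pdivlMr ?ltr_wpDl// /x !ge_min lexx !orbT.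
(* The radius is y = c/x, so that y + c = y (1 + x) and the factor y^m can be cancelled; x <= c
   ensures y >= 1. *)
have [y yx] : exists y, y * x = c by exists (c / x); rewrite divfK// gt_eqF.
have t0 : 0 < y by rewrite -(pmulr_lgt0 _ x0) yx.
have t1 : 1 <= y by rewrite -(ler_pM2r x0) mul1r yx.
have := H _ t1.
have -> : y + c = y * (1 + x) by rewrite mulrDr mulr1 yx.
rewrite !exprMn.
have := hD 1 x; rewrite normr1 lexx gtr0_norm// => /(_ isT x1).
rewrite !mulr1 !expr1n !mulr1 ler_norml => /andP[_ h1].
have h2 : (1 + x) ^+ m <= 2 ^+ m by rewrite lerXn2r ?nnegrE//; lra.
set P := (1 + x) ^+ m.+1 in h1 *; set Q := (1 + x) ^+ m in h2 *.
have Tm : 0 < y ^+ m by rewrite exprn_gt0.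
rewrite exprS; set T := y ^+ m in Tm * => h3.
have h4 : G1 * y <= G2 * (y * P) + C * Q.
  rewrite -(ler_pM2r Tm) (_ : G1 * y * T = G1 * (y * T)); last by ring.
  by rewrite (_ : (G2 * (y * P) + C * Q) * T = G2 * (y * T * P) + C * (T * Q)); last by ring.
have h5 : G1 <= G2 * P + C / c * Q * x.
  rewrite -(ler_pM2r t0) (_ : (G2 * P + C / c * Q * x) * y = G2 * (y * P) + C * Q)//.
  by rewrite -yx; field; rewrite !gt_eqF.
have h6 : P <= 1 + x * (m.+1%:R + D).
  have : D * x ^+ 2 <= D * x by rewrite ler_wpM2l// expr2 -[leRHS]mulr1 ler_pM2l.
  move: (m.+1%:R : R) h1 => M h1 h7; lra.
apply: (le_trans h5); rewrite (le_trans (lerD (ler_wpM2l G20 h6) (_ : _ <= C / c * 2 ^+ m * x)))//.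
  by rewrite ler_pM2r// ler_wpM2l// divr_ge0// ltW.
have -> : G2 * (1 + x * (m.+1%:R + D)) + C / c * 2 ^+ m * x = G2 + x * E by rewrite /E; ring.
by rewrite lerD2l; lra.
Qed.

Lemma gauss_arith {R : realFieldType} (N G1 G2 C1 C2 p q p' q' : R) : 0 < N ->
  G1 * (q / N) <= G2 * (q' / N) + C2 * p' + C1 * p -> C1 * p <= C1 * p' ->
  G1 * q <= G2 * q' + (C1 + C2) * N * p'.
Proof.
move=> N0 h1 h2; have h3 : G1 * (q / N) <= G2 * (q' / N) + C2 * p' + C1 * p' by lra.
rewrite -(ler_pM2r N0) in h3.
rewrite (_ : G1 * (q / N) * N = G1 * q) in h3; last by field; rewrite gt_eqF.
by rewrite (_ : _ + _ = (G2 * (q' / N) + C2 * p' + C1 * p') * N)//; field; rewrite gt_eqF.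
Qed.

(** * Integrals of squares over large tubes *)

Section TubeAsymptotics.
Context {R : realType} {n : nat}.
Variable Omega : set 'rV[R]_n.+1.
Hypotheses (oO : open Omega) (O0 : Omega !=set0) (bO : bounded_set Omega)
  (cO : convex_set Omega) (smO : smooth_hypersurface (boundary Omega)).
Variable mu : {measure set 'rV[R]_n.+1 -> \bar R}.
Hypothesis mu_area : area_measure (boundary Omega) mu.
Local Notation leb := (lebesgue_rV R).
Local Notation Sigma := (boundary Omega).
Local Notation nu := (outward_normal Omega).
Local Notation K := (closure Omega).
Local Notation sigma j p := (elem_sym j (principal_curvatures Omega p)).
Variables (F : 'rV[R]_n.+1 -> R) (L : R).
Hypotheses (L0 : 0 <= L) (FL : forall x y, `|F x - F y| <= L * enorm (x - y))
  (Fh : forall s y, 0 <= s -> F (s *: y) = s * F y).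

Let mS : measurable Sigma := measurable_boundary Omega.
Let isigma j : mu.-integrable Sigma (EFin \o (fun p => sigma j p)) :=
  elem_sym_integrable oO O0 bO cO smO mu_area j.

Let sigma_ge0 j p : Sigma p -> 0 <= sigma j p.
Proof.
by move=> Sp; apply: elem_sym_ge0 => i; exact: (principal_curvatures_ge0 oO O0 bO cO smO).
Qed.

Lemma homogeneous_unit_bound v : enorm v = 1 -> `|F v| <= L.
Proof.
move=> v1; have F0 : F 0 = 0 by rewrite -(scale0r 0) Fh// mul0r.
by have := FL v 0; rewrite F0 !subr0 v1 mulr1.
Qed.

Let mF : measurable_fun setT F.
Proof.
apply: continuous_on_measurable; apply: continuous_continuous_on => x _.
exact: (lipschitz_continuousR FL).
Qed.

Lemma homogeneous_normal_integrable g : mu.-integrable Sigma (EFin \o g) ->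
  mu.-integrable Sigma (EFin \o (fun p => F (nu p) * g p)).
Proof.
apply: (integrable_bounded_mul mS (C := L)).
  exact: (measurableT_comp mF (measurable_outward_normal oO O0 bO cO smO)).
by move=> p Sp; apply: homogeneous_unit_bound; exact: (outward_normal_unit oO O0 bO cO smO).
Qed.

Let G := \int[mu]_(p in Sigma) (F (nu p) * (F (nu p) * sigma n p)).
Let f t y := F y ^+ 2 * \1_(parallel_body Omega t) y.

Let iG : mu.-integrable Sigma (EFin \o (fun p => F (nu p) * (F (nu p) * sigma n p))).
Proof. by do 2! apply: homogeneous_normal_integrable. Qed.

Let Dp p := \sum_(j < n.+1) sigma j p * 1.

Let iD : mu.-integrable Sigma (EFin \o Dp).
Proof. by have [i _] := Rintegral_sum mS n.+1 (fun=> 1) isigma. Qed.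

Let mf t : measurable_fun setT (f t).
Proof.
apply: measurable_funM; first exact: measurable_funX.
exact: measurable_indic (measurable_tube O0 bO cO t).
Qed.

Let f0 t y : 0 <= f t y. Proof. by rewrite mulr_ge0 ?sqr_ge0. Qed.

(** Coefficients of y + x s^(n+2). Bounds of this shape are integrated over ]0, t] by the formula
    for power sums. *)
Let edge (x y : R) k := if k == n.+2 then x else if k == 0%N then y else 0.

Let edgeE x y (q : nat -> R) : \sum_(k < n.+3) edge x y k * q k = y * q 0%N + x * q n.+2.
Proof.
rewrite big_ord_recr big_ord_recl /= /edge /= eqxx; congr (_ + _).
rewrite big1 ?addr0// => i _; rewrite /bump /= add1n ifN ?mul0r//.
by rewrite eqSS neq_ltn ltn_ord.
Qed.

Let edge_sum x y s : power_sum n.+3 (edge x y) s = y + x * s ^+ n.+2.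
Proof. by rewrite [LHS](edgeE x y (fun k => s ^+ k)) expr0 mulr1. Qed.

Let edge_prim x y t : power_prim n.+3 (edge x y) t = y * t + x * (t ^+ n.+3 / n.+3%:R).
Proof. by rewrite [LHS](edgeE x y (fun k => t ^+ k.+1 / k.+1%:R)) expr1 divr1. Qed.

(** Since F is Lipschitz and homogeneous and p is bounded, F(p + s nu) = s F(nu) + O(1). Only the
    term s^n sigma_n of the density then reaches order s^(n+2). *)
Let shell_bounds : exists2 H, 0 <= H & forall p s t, Sigma p -> 1 <= t -> 0 < s <= t ->
  `|F (p + s *: nu p) ^+ 2 * shell_density Omega s p -
    F (nu p) * (F (nu p) * sigma n p) * s ^+ n.+2| <= H * Dp p * t ^+ n.+1.
Proof.
have [C C0 hC] := closure_bounded O0 bO cO.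
pose c := L * C; have c0 : 0 <= c by rewrite mulr_ge0// ltW.
exists (L ^+ 2 + (2 * L * c + c ^+ 2)) => [|p s t Sp t1 /andP[s0 st]].
  by apply: addr_ge0; [exact: sqr_ge0|apply: addr_ge0; [exact: mulr_ge0 (mulr_ge0 (ler0n _ 2) L0) c0|exact: sqr_ge0]].
have t0 : 0 <= t := le_trans ler01 t1.
have v1 := outward_normal_unit oO O0 bO cO smO Sp.
have gL := homogeneous_unit_bound v1.
set x := F (nu p) in gL *; set y := F (p + s *: nu p).
have yx : `|y - s * x| <= c.
  rewrite -(Fh (nu p) (ltW s0)) /y; apply: (le_trans (FL _ _)); rewrite addrK ler_wpM2l// hC//.
  by case: Sp.
have xs : `|x * s| <= L * t by rewrite normrM (gtr0_norm s0) ler_pM// ltW.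
have e1 : `|y ^+ 2 - (x * s) ^+ 2| <= (2 * L * c + c ^+ 2) * t.
  have -> : y ^+ 2 - (x * s) ^+ 2 = (y - s * x) * ((y - s * x) + 2 * (x * s)) by ring.
  rewrite normrM; have -> : (2 * L * c + c ^+ 2) * t = c * (c * t + 2 * (L * t)) by ring.
  rewrite ler_pM// (le_trans (ler_normD _ _))// lerD//.
    by rewrite (le_trans yx)// -[leLHS]mulr1 ler_wpM2l.
  by rewrite normrM normr_nat ler_wpM2l.
have e2 : `|(x * s) ^+ 2| <= L ^+ 2 * t ^+ 2 by rewrite normrX -exprMn lerXn2r ?nnegrE// mulr_ge0.
(* For j < n the whole term is error, of degree at most j + 2 <= n + 1; for j = n only the
   difference between F^2 and its leading part is. *)
have -> : y ^+ 2 * shell_density Omega s p - x * (x * sigma n p) * s ^+ n.+2 =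
  \sum_(j < n.+1) sigma j p * (((y ^+ 2 - (x * s) ^+ 2) + (if (j < n)%N then (x * s) ^+ 2 else 0)) * s ^+ j).
  rewrite /shell_density mulr_sumr big_ord_recr [RHS]big_ord_recr /= ltnn addr0.
  have -> : \sum_(i < n) sigma i p * ((y ^+ 2 - (x * s) ^+ 2 + (if (i < n)%N then (x * s) ^+ 2 else 0)) * s ^+ i)
    = \sum_(i < n) y ^+ 2 * (s ^+ i * sigma i p).
    by apply: eq_bigr => i _; rewrite ltn_ord subrK mulrCA [sigma i p * _]mulrC.
  by rewrite !exprS; ring.
rewrite (le_trans (ler_norm_sum _ _ _))// -mulrA mulrCA mulr_suml.
apply: ler_sum => -[j jn] _ /=; rewrite mulr1 normrM ger0_norm ?sigma_ge0//.
apply: ler_wpM2l; first exact: sigma_ge0.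
have sj : `|s ^+ j| <= t ^+ j.
  by rewrite normrX gtr0_norm// lerXn2r ?nnegrE// ltW.
have tj k : (j + k <= n.+1)%N -> t ^+ j * t ^+ k <= t ^+ n.+1.
  by move=> jk; rewrite -exprD ler_weXn2l.
rewrite mulrDl (le_trans (ler_normD _ _))// [leRHS]mulrDl addrC lerD//.
  rewrite normrM; case: ifPn => jn'; last by rewrite normr0 mul0r mulr_ge0 ?sqr_ge0// exprn_ge0.
  rewrite (le_trans (ler_pM _ _ e2 sj))// -[leLHS]mulrA ler_wpM2l ?sqr_ge0//.
  by rewrite mulrC tj// addn2 ltnS.
rewrite normrM (le_trans (ler_pM _ _ e1 sj))// -[leLHS]mulrA ler_wpM2l//.
  by apply: addr_ge0; [exact: mulr_ge0 (mulr_ge0 (ler0n _ 2) L0) c0|exact: sqr_ge0].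
by rewrite mulrC -{2}(expr1 t) tj// addn1.
Qed.

(** Integration of the pointwise bounds over s and over the boundary; the contribution of K itself
    is constant and goes into the error. The second inequality is written additively because
    subtraction of extended reals would need finiteness. *)
Lemma tube_square_integral : 0 <= G /\ exists2 C, 0 <= C & forall t, 1 <= t ->
  (\int[leb n.+1]_y (f t y)%:E <= (G * (t ^+ n.+3 / n.+3%:R) + C * t ^+ n.+2)%:E)%E /\
  ((G * (t ^+ n.+3 / n.+3%:R))%:E <= \int[leb n.+1]_y (f t y)%:E + (C * t ^+ n.+2)%:E)%E.
Proof.
have [H H0 hH] := shell_bounds.
have bK : convex_body K := closure_convex_body O0 bO cO.
have D0 p : Sigma p -> 0 <= Dp p by move=> Sp; apply: sumr_ge0 => j _; rewrite mulr1 sigma_ge0.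
split; first by apply: Rintegral_ge0 => p Sp; rewrite mulrA -expr2 mulr_ge0 ?sqr_ge0// sigma_ge0.
have mK : measurable K := measurable_closure Omega.
have iW : (leb n.+1).-integrable K (EFin \o (fun y => F y ^+ 2)).
  have [cK _ _] := bK.
  have [C C0 hC] := @compact_image_bounded R n.+1 R K F cK (fun x _ => @lipschitz_continuousR R n.+1 F L FL x).
  have i1 : (leb n.+1).-integrable K (EFin \o cst 1).
    apply: ge0_integrable => //; rewrite (_ : (fun x => _) = cst 1%:E)//.
    by rewrite integral_cst ?mul1e//; exact: closure_lebesgue_lty.
  have mFK : measurable_fun K F by exact: measurable_funTS.
  have i2 := integrable_bounded_mul mK mFK hC i1.
  have := integrable_bounded_mul mK mFK hC i2.
  by apply: eq_integrable => // y _; rewrite /= mulr1 expr2.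
pose W0 := \int[leb n.+1]_(y in K) F y ^+ 2.
have W00 : 0 <= W0 by apply: Rintegral_ge0 => y _; exact: sqr_ge0.
pose D := \int[mu]_(p in Sigma) Dp p.
have DD0 : 0 <= D by exact: Rintegral_ge0.
exists (W0 + H * D) => [|t t1]; first by rewrite addr_ge0// mulr_ge0.
have t0 : 0 < t by exact: lt_le_trans ltr01 t1.
have tn : 1 <= t ^+ n.+2 by rewrite exprn_ege1.
set q := t ^+ n.+3 / n.+3%:R.
rewrite (ge0_integral_tube oO O0 bO cO smO mu_area (@mf t) (@f0 t)).
have -> : (\int[leb n.+1]_(y in K) (f t y)%:E = W0%:E)%E.
  rewrite -(EFin_Rintegral mK iW); apply: eq_integral => y /set_mem Ky.
  by rewrite /f indicE mem_set ?mulr1//; apply: closure_tube Ky => //; exact: ltW.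
pose g p := F (nu p) * (F (nu p) * sigma n p).
have g0 p : Sigma p -> 0 <= g p by move=> Sp; rewrite /g mulrA -expr2 mulr_ge0 ?sqr_ge0// sigma_ge0.
pose h p s := F (p + s *: nu p) ^+ 2 * shell_density Omega s p.
have mh p : measurable_fun setT (fun s : measurableTypeR R => h p s).
  apply: measurable_funM; last exact: measurable_shell_density.
  by apply: measurable_funX; apply: measurableT_comp mF _; exact: measurable_ray.
have h0 p s : Sigma p -> 0 < s -> 0 <= h p s.
  move=> Sp s0; rewrite mulr_ge0 ?sqr_ge0// (le_trans ler01)//.
  exact: (shell_density_ge1 oO O0 bO cO smO) (ltW s0).
have shE p : Sigma p -> (shell_integral Omega (EFin \o f t) p =
    \int[@lebesgue_measure R]_(s in `]0%R, t]) (h p s)%:E)%E.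
  move=> Sp; rewrite /shell_integral [LHS]integral_mkcond [RHS]integral_mkcond.
  apply: eq_integral => s _; rewrite !patchE !mem_setE !in_itv /= andbT.
  case: ifPn => // s0 /=; rewrite /f (tube_ray oO O0 bO cO smO)//.
  by case: ifPn => _; rewrite ?mulr1 ?mulr0 -EFinM ?mul0r.
have itv s : s \in `]0, t] -> 0 < s <= t by rewrite in_itv.
have mitv : measurable (`]0, t]%classic : set (measurableTypeR R)) := measurable_itv _.
have up p : Sigma p -> (shell_integral Omega (EFin \o f t) p <=
    (g p * q + H * Dp p * t ^+ n.+2)%:E)%E.
  move=> Sp; rewrite shE//.
  have -> : g p * q + H * Dp p * t ^+ n.+2 = power_prim n.+3 (edge (g p) (H * Dp p * t ^+ n.+1)) t.
    by rewrite edge_prim addrC; congr (_ + _); rewrite [t ^+ n.+2]exprSr mulrA.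
  rewrite -integral_power_sum ?(ltW t0)//; apply: ge0_le_integral => //.
  - by move=> s /itv/andP[s0 _]; rewrite lee_fin h0.
  - by apply/measurable_EFinP; exact: measurable_funTS.
  - apply/measurable_EFinP; apply: measurable_funTS.
    by apply: continuous_measurable_fun; exact: power_sum_continuous.
  move=> s /itv st; rewrite lee_fin edge_sum.
  by have := hH p s t Sp t1 st; rewrite ler_norml => /andP[_]; rewrite lerBlDr.
have lo p : Sigma p -> ((g p * q)%:E <=
    shell_integral Omega (EFin \o f t) p + (H * Dp p * t ^+ n.+2)%:E)%E.
  move=> Sp; rewrite shE//.
  have -> : g p * q = power_prim n.+3 (edge (g p) 0) t.
    by rewrite edge_prim mul0r add0r.
  have -> : H * Dp p * t ^+ n.+2 = power_prim n.+3 (edge 0 (H * Dp p * t ^+ n.+1)) t.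
    by rewrite edge_prim mul0r addr0 [t ^+ n.+2]exprSr mulrA.
  have mps a : measurable_fun setT (power_sum n.+3 a : measurableTypeR R -> _).
    by apply: continuous_measurable_fun; exact: power_sum_continuous.
  have HD0 : 0 <= H * Dp p * t ^+ n.+1 by rewrite !mulr_ge0 ?D0// exprn_ge0// ltW.
  rewrite -!integral_power_sum ?(ltW t0)// -ge0_integralD//; last first.
  - by apply/measurable_EFinP; exact: measurable_funTS.
  - by move=> s _; rewrite lee_fin edge_sum mul0r addr0.
  - by apply/measurable_EFinP; exact: measurable_funTS.
  - by move=> s /itv/andP[s0 _]; rewrite lee_fin h0.
  apply: ge0_le_integral => //.
  - by move=> s /itv/andP[s0 _]; rewrite lee_fin edge_sum add0r mulr_ge0 ?g0// exprn_ge0// ltW.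
  - by apply/measurable_EFinP; exact: measurable_funTS.
  - apply/measurable_EFinP; apply: measurable_funD; first exact: measurable_funTS.
    exact: measurable_funTS.
  move=> s /itv st; rewrite lee_fin !edge_sum add0r mul0r addr0.
  by have := hH p s t Sp t1 st; rewrite ler_norml => /andP[+ _]; rewrite -/(g p) -/(h p s); lra.
have mft : measurable_fun setT (EFin \o f t) by exact/measurable_EFinP.
have ft0 y : (0 <= (EFin \o f t) y)%E by rewrite /= lee_fin.
have [msh _] := shell_formula oO O0 bO cO smO mu_area mft ft0.
have sh0 p : Sigma p -> (0 <= shell_integral Omega (EFin \o f t) p)%E.
  by move=> Sp; exact: (shell_integral_ge0 oO O0 bO cO smO).
have igq : mu.-integrable Sigma (EFin \o (fun p => g p * q)) := integrableMR mS q iG.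
have iHD : mu.-integrable Sigma (EFin \o (fun p => H * Dp p * t ^+ n.+2)).
  apply: (integrableMR mS); have := integrableMR mS H iD.
  by apply: eq_integrable => // p _; rewrite /= mulrC.
have EHD : \int[mu]_(p in Sigma) (H * Dp p * t ^+ n.+2) = H * D * t ^+ n.+2.
  rewrite RintegralZr//; last first.
    by have := integrableMR mS H iD; apply: eq_integrable => // p _; rewrite /= mulrC.
  by rewrite RintegralZl.
have EGq : \int[mu]_(p in Sigma) (g p * q) = G * q by rewrite RintegralZr.
have isum := integrableDR mS igq iHD.
have Esum : \int[mu]_(p in Sigma) (g p * q + H * Dp p * t ^+ n.+2) = G * q + H * D * t ^+ n.+2.
  by rewrite RintegralD// EGq EHD.
split.
  apply: (@le_trans _ _ (W0%:E + (G * q + H * D * t ^+ n.+2)%:E)%E).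
    apply: leeD => //.
    rewrite -Esum -(EFin_Rintegral mS isum).
    apply: ge0_le_integral => //; exact: measurable_int isum.
  rewrite -EFinD lee_fin addrCA lerD2l mulrDl lerD2r -[leLHS]mulr1 ler_wpM2l//.
apply: (@le_trans _ _ (\int[mu]_(p in Sigma) shell_integral Omega (EFin \o f t) p +
   (H * D * t ^+ n.+2)%:E)%E).
  rewrite -EGq -EHD -(EFin_Rintegral mS igq) -(EFin_Rintegral mS iHD) -ge0_integralD//.
  - apply: ge0_le_integral => //.
    + by move=> p Sp; rewrite lee_fin mulr_ge0 ?g0// divr_ge0// exprn_ge0// ltW.
    + exact: measurable_int igq.
    + by apply: emeasurable_funD => //; exact: measurable_int iHD.
  - move=> p Sp; rewrite lee_fin; apply: mulr_ge0; last by apply: exprn_ge0; exact: ltW.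
    by apply: mulr_ge0 => //; exact: D0.
  - exact: measurable_int iHD.
rewrite mulrDl EFinD addeA; apply: leeD => //.
rewrite -addeA addeCA leeDl// -EFinD lee_fin; apply: addr_ge0 => //.
by apply: mulr_ge0 => //; apply: exprn_ge0; exact: ltW.
Qed.

End TubeAsymptotics.

(** A tube of the first body is contained in a tube of the second whose radius is larger by a
    constant, so the leading coefficients are ordered. [F'] is allowed to differ from [F] for the
    sake of the reflection of the sphere, where F'(x) = F(-x). *)
Theorem gauss_map_le {R : realType} {n : nat} (Om1 Om2 : set 'rV[R]_n.+1)
    (mu1 mu2 : {measure set 'rV[R]_n.+1 -> \bar R}) (F : 'rV[R]_n.+1 -> R) (L : R) :
  open Om1 -> Om1 !=set0 -> bounded_set Om1 -> convex_set Om1 ->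
  smooth_hypersurface (boundary Om1) -> area_measure (boundary Om1) mu1 ->
  open Om2 -> Om2 !=set0 -> bounded_set Om2 -> convex_set Om2 ->
  smooth_hypersurface (boundary Om2) -> area_measure (boundary Om2) mu2 ->
  0 <= L -> (forall x y, `|F x - F y| <= L * enorm (x - y)) ->
  (forall s y, 0 <= s -> F (s *: y) = s * F y) ->
  forall (F' : 'rV[R]_n.+1 -> R),
  (forall t, \int[lebesgue_rV R n.+1]_y (F' y ^+ 2 * \1_(parallel_body Om1 t) y)%:E =
     \int[lebesgue_rV R n.+1]_y (F y ^+ 2 * \1_(parallel_body Om1 t) y)%:E)%E ->
  (forall x y, `|F' x - F' y| <= L * enorm (x - y)) ->
  (forall s y, 0 <= s -> F' (s *: y) = s * F' y) ->
  \int[mu1]_(p in boundary Om1)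
    (F' (outward_normal Om1 p) * (F' (outward_normal Om1 p) * elem_sym n (principal_curvatures Om1 p))) <=
  \int[mu2]_(p in boundary Om2)
    (F (outward_normal Om2 p) * (F (outward_normal Om2 p) * elem_sym n (principal_curvatures Om2 p))).
Proof.
move=> o1 z1 b1 c1 s1 a1 o2 z2 b2 c2 s2 a2 L0 FL Fh F' EF FL' Fh'.
have [_ [C1 C10 H1]] := tube_square_integral o1 z1 b1 c1 s1 a1 L0 FL' Fh'.
have [G20 [C2 C20 H2]] := tube_square_integral o2 z2 b2 c2 s2 a2 L0 FL Fh.
set G1 := \int[mu1]_(p in _) _ in H1 *; set G2 := \int[mu2]_(p in _) _ in H2 G20 *.
have [A A0 hA] := closure_bounded z1 b1 c1; have [B B0 hB] := closure_bounded z2 b2 c2.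
have k1 : convex_body (closure Om1) := closure_convex_body z1 b1 c1.
have k2 : convex_body (closure Om2) := closure_convex_body z2 b2 c2.
have [x2 Kx2] : closure Om2 !=set0 by case: k2.
(* The shift A + B bounds the distance from the foot point in the first body to a fixed point of the
   second. *)
have sub t : parallel_body Om1 t `<=` parallel_body Om2 (t + (A + B)).
  move=> y; rewrite /parallel_body /= => yt; apply: (le_trans (dist_le k2 y Kx2)).
  rewrite (le_trans (enorm_distD (proj (closure Om1) y) _ _))// lerD//.
  by rewrite (le_trans (enormD _ _))// enormN lerD ?hB// hA//; exact: proj_in.
have c0 : 0 < A + B by rewrite addr_gt0.
apply: (@leading_coef_le R G1 G2 ((C1 + C2) * n.+3%:R) (A + B) n.+2) => //.
  by rewrite mulr_ge0// addr_ge0.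
move=> t t1; have t1' : 1 <= t + (A + B) by rewrite (le_trans t1)// lerDl ltW.
have t0 : 0 <= t := le_trans ler01 t1.
have [_ h1] := H1 _ t1; have [h2 _] := H2 _ t1'.
have h3 : (\int[lebesgue_rV R n.+1]_y (F y ^+ 2 * \1_(parallel_body Om1 t) y)%:E <=
   \int[lebesgue_rV R n.+1]_y (F y ^+ 2 * \1_(parallel_body Om2 (t + (A + B))) y)%:E)%E.
  have mF : measurable_fun setT F.
    apply: continuous_on_measurable; apply: continuous_continuous_on => x _.
    exact: (lipschitz_continuousR FL).
  apply: ge0_le_integral => //.
  - by move=> y _; rewrite lee_fin mulr_ge0 ?sqr_ge0.
  - apply/measurable_EFinP; apply: measurable_funM; first exact: measurable_funX.
    exact: measurable_indic (measurable_tube z1 b1 c1 t).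
  - apply/measurable_EFinP; apply: measurable_funM; first exact: measurable_funX.
    exact: measurable_indic (measurable_tube z2 b2 c2 _).
  move=> y _; rewrite lee_fin ler_wpM2l ?sqr_ge0// !indicE ler_nat.
  case: (boolP (y \in parallel_body Om1 t)) => // /set_mem/sub/mem_set.
  by move=> /= ->.
rewrite EF in h1.
have h4 := le_trans h1 (leeD (le_trans h3 h2) (lexx _)).
rewrite -EFinD lee_fin in h4.
have h5 : t ^+ n.+2 <= (t + (A + B)) ^+ n.+2.
  by rewrite lerXn2r ?nnegrE// ?(le_trans ler01 t1')// lerDl ltW.
exact: (gauss_arith (ltr0Sn R n.+2) h4 (ler_wpM2l C10 h5)).
Qed.
(** * The unit sphere *)

Section RationalFunctions.
Context {R : realType} {n : nat}.

(** A class stable under directional derivatives, so smoothness of all orders follows by induction.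
    Inverses are restricted to functions without zeros, which keeps every member differentiable
    everywhere. *)
Inductive rational_fun : ('rV[R]_n -> R) -> Prop :=
| rational_cst c : rational_fun (fun=> c)
| rational_coord i : rational_fun (fun x => x 0 i)
| rational_add f g : rational_fun f -> rational_fun g -> rational_fun (fun x => f x + g x)
| rational_mul f g : rational_fun f -> rational_fun g -> rational_fun (fun x => f x * g x)
| rational_inv f : rational_fun f -> (forall x, f x != 0) -> rational_fun (fun x => (f x)^-1).

Lemma rational_differentiable f : rational_fun f -> forall x, differentiable f x.
Proof.
elim=> [c|i|g h _ dg _ dh|g h _ dg _ dh|g _ dg g0] x.
- exact: differentiable_cst.
- exact: differentiable_coord.
- exact: (@differentiableD _ _ _ g h x (dg x) (dh x)).
- exact: (@differentiableM _ _ g h x (dg x) (dh x)).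
- exact: (@differentiableV _ _ g x (dg x) (g0 x)).
Qed.

Lemma derive_coord (v x : 'rV[R]_n) i : 'D_v (fun y : 'rV[R]_n => y 0 i) x = v 0 i.
Proof.
have h : derivable (fun y : 'rV[R]_n => y) x v by exact: derivable_id.
have := derive_mx h; rewrite derive_id => /matrixP/(_ 0 i) ->.
by rewrite mxE.
Qed.

Lemma rational_derive f v : rational_fun f -> rational_fun ('D_v f).
Proof.
elim=> [c|i|g h rg ig rh ih|g h rg ig rh ih|g rg ig g0].
- rewrite (_ : 'D_v _ = fun=> 0); first exact: rational_cst.
  by apply/funext => x; exact: derive_cst.
- rewrite (_ : 'D_v _ = fun=> v 0 i); first exact: rational_cst.
  by apply/funext => x; exact: derive_coord.
- rewrite (_ : 'D_v _ = fun x => 'D_v g x + 'D_v h x); first exact: rational_add.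
  apply/funext => x; apply: (@deriveD _ _ _ g h); apply: diff_derivable; exact: rational_differentiable.
- rewrite (_ : 'D_v _ = fun x => g x * 'D_v h x + h x * 'D_v g x).
    by apply: rational_add; apply: rational_mul.
  apply/funext => x; apply: (@deriveM _ _ g h); apply: diff_derivable; exact: rational_differentiable.
- rewrite (_ : 'D_v _ = fun x => (-1) * (((g x)^-1 * (g x)^-1) * 'D_v g x)).
    apply: rational_mul; first exact: rational_cst.
    by apply: rational_mul => //; apply: rational_mul; exact: rational_inv.
  apply/funext => x; rewrite [LHS](@deriveV _ _ g) //; last first.
    by apply: diff_derivable; exact: rational_differentiable.
  by rewrite /GRing.scale /= mulN1r mulNr; congr (- (_ * _)); rewrite -exprVn expr2.
Qed.

Lemma rational_dotv : rational_fun (fun x => dotv x x).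
Proof.
rewrite /dotv; elim: (index_enum _) => [|i r IH].
  by rewrite (_ : (fun _ => _) = fun=> 0); [exact: rational_cst|apply/funext => x; rewrite big_nil].
have -> : (fun x : 'rV[R]_n => \sum_(j <- i :: r) x 0 j * x 0 j) =
    (fun x : 'rV[R]_n => x 0 i * x 0 i + \sum_(j <- r) x 0 j * x 0 j).
  by apply/funext => x; rewrite big_cons.
by apply: rational_add => //; apply: rational_mul; exact: rational_coord.
Qed.

Lemma differentiable_rowv m p (f : 'rV[R]_m -> 'rV[R]_p) x :
  (forall j, differentiable (fun y => f y 0 j) x) -> differentiable f x.
Proof.
move=> df; have -> : f = \sum_(j < p) (fun y => f y 0 j *: (delta_mx 0 j : 'rV[R]_p)).
  apply/funext => y; rewrite fct_sumE; exact: row_sum_delta.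
by apply: differentiable_sum => j; apply: differentiableZl; exact: df.
Qed.

Lemma rational_smooth p (f : 'rV[R]_n -> 'rV[R]_p) :
  (forall j, rational_fun (fun x => f x 0 j)) -> smooth setT f.
Proof.
move=> rf k; elim: k f rf => [|k IH] f rf.
  move=> x _; apply: differentiable_continuous; apply: differentiable_rowv => j.
  exact: rational_differentiable.
have df x : differentiable f x.
  by apply: differentiable_rowv => j; exact: rational_differentiable.
split=> [x _|v]; first exact: df.
apply: IH => j; rewrite (_ : (fun _ => _) = 'D_v (fun y => f y 0 j)).
  exact: rational_derive.
by apply/funext => x; rewrite derive_mx ?mxE//; exact: diff_derivable.
Qed.

End RationalFunctions.

Section Sphere.
Context {R : realType} {n : nat}.
Implicit Types (x : 'rV[R]_n) (y : 'rV[R]_n.+1).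

Lemma dotv_consv (s t : R) x z : dotv (consv (s, x)) (consv (t, z)) = s * t + dotv x z.
Proof.
rewrite /dotv big_ord_recl !consv0; congr (_ + _); apply: eq_bigr => i _.
by rewrite -!tailv_lift !tailv_consv.
Qed.

(** Inverse stereographic projection from the pole (e, 0) with e = 1 or e = -1; two of them cover
    the sphere. The entries are written with the operations of [rational_fun]. *)
Definition stereo (e : R) x : 'rV[R]_n.+1 :=
  consv (e * ((dotv x x + -1) * (1 + dotv x x)^-1), (2 * (1 + dotv x x)^-1) *: x).

Definition unstereo (e : R) y : 'rV[R]_n := (1 - e * y 0 0)^-1 *: tailv y.

Variable e : R.
Hypothesis e2 : e * e = 1.

Lemma one_add_dotv_gt0 x : 0 < 1 + dotv x x.
Proof. by rewrite ltr_pwDl// dotv_ge0. Qed.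

Lemma stereo_unit x : enorm (stereo e x) = 1.
Proof.
rewrite /enorm dotv_consv dotvZl dotvZr; have := one_add_dotv_gt0 x.
move: (dotv x x) => s s0; rewrite (_ : _ + _ = 1) ?sqrtr1//.
rewrite (_ : e * _ * _ = (e * e) * ((s + -1) * (1 + s)^-1) ^+ 2); last by ring.
by rewrite e2; field; rewrite gt_eqF.
Qed.

Lemma stereo_height x : 1 - e * stereo e x 0 0 = 2 * (1 + dotv x x)^-1.
Proof.
rewrite consv0 mulrA e2 mul1r; have := one_add_dotv_gt0 x.
by move: (dotv x x) => s s0; field; rewrite gt_eqF.
Qed.

Lemma stereoK x : unstereo e (stereo e x) = x.
Proof.
rewrite /unstereo stereo_height tailv_consv scalerA mulVf ?scale1r//.
by rewrite mulf_neq0 ?pnatr_eq0// invr_eq0 gt_eqF// one_add_dotv_gt0.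
Qed.

Lemma unstereoK y : enorm y = 1 -> e * y 0 0 < 1 -> stereo e (unstereo e y) = y.
Proof.
move=> /enorm1_dotv; rewrite {1 2}(consv_eta y) dotv_consv => y1 h.
rewrite [RHS](consv_eta y) /stereo /unstereo dotvZl dotvZr scalerA.
move: (dotv _ _) y1 => s y1; move: (y 0 0) h y1 => t h y1.
have sE : s = 1 - (e * t) * (e * t) by rewrite mulrACA e2 mul1r -y1 addrAC subrr add0r.
have d0 : 1 - e * t != 0 by rewrite subr_eq0 gt_eqF.
have QE : 1 + (1 - e * t)^-1 * ((1 - e * t)^-1 * s) = 2 / (1 - e * t).
  rewrite sE; move: (e * t) d0 => a a0; field; exact: a0.
have PE : (1 - e * t)^-1 * ((1 - e * t)^-1 * s) + -1 = 2 * (e * t) / (1 - e * t).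
  rewrite sE; move: (e * t) d0 => a a0; field; exact: a0.
rewrite QE PE; congr (consv (_, _)).
  transitivity (e * (e * t)); last by rewrite mulrA e2 mul1r.
  by move: d0; move: (e * t) => a a0; field; exact: a0.
rewrite (_ : _ * _ = 1) ?scale1r//; field; exact: d0.
Qed.

Lemma unstereo_differentiable y : 1 - e * y 0 0 != 0 -> differentiable (unstereo e) y.
Proof.
move=> y0; apply: differentiable_rowv => j.
have -> : (fun y => unstereo e y 0 j) =
    (fun y : 'rV[R]_n.+1 => (1 - e * y 0 0)^-1) * (fun y : 'rV[R]_n.+1 => y 0 (lift ord0 j)).
  by apply/funext => z; rewrite /unstereo mxE tailv_lift.
have c00 : differentiable (fun y : 'rV[R]_n.+1 => y 0 0) y by exact: differentiable_coord.
have cj : differentiable (fun y : 'rV[R]_n.+1 => y 0 (lift ord0 j)) y by exact: differentiable_coord.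
apply: differentiableM => //; apply: (@differentiableV _ _ (fun y : 'rV[R]_n.+1 => 1 - e * y 0 0)) => //.
have -> : (fun y : 'rV[R]_n.+1 => 1 - e * y 0 0) = cst 1 - e *: (fun y : 'rV[R]_n.+1 => y 0 0) by [].
by apply: differentiableB => //; exact: differentiableZ.
Qed.

Lemma stereo_smooth : smooth setT (stereo e).
Proof.
have rq : rational_fun (fun x : 'rV[R]_n => (1 + dotv x x)^-1).
  apply: rational_inv => [|x]; last by rewrite gt_eqF// one_add_dotv_gt0.
  by apply: rational_add; [exact: rational_cst|exact: rational_dotv].
apply: rational_smooth => j; case: (unliftP ord0 j) => [i|] ->.
  rewrite (_ : (fun _ => _) = fun x : 'rV[R]_n => (2 * (1 + dotv x x)^-1) * x 0 i).
    by do !apply: rational_mul => //; [exact: rational_cst|exact: rational_coord].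
  by apply/funext => x; rewrite -tailv_lift tailv_consv mxE.
rewrite (_ : (fun _ => _) = fun x : 'rV[R]_n => e * ((dotv x x + -1) * (1 + dotv x x)^-1)).
  apply: rational_mul; first exact: rational_cst.
  by apply: rational_mul => //; apply: rational_add; [exact: rational_dotv|exact: rational_cst].
by apply/funext => x; rewrite consv0.
Qed.

Lemma stereo_height_lt1 x : e * stereo e x 0 0 < 1.
Proof.
by rewrite -subr_gt0 stereo_height mulr_gt0// ?invr_gt0 ?one_add_dotv_gt0 ?ltr0n.
Qed.

(** The chain rule for [unstereo e \o stereo e] = id exhibits a right inverse of the Jacobian. *)
Lemma stereo_row_free x : row_free ('J (stereo e) x).
Proof.
have d1 : has_derivative (stereo e) x ('J (stereo e) x).
  by apply: differentiable_has_derivative; have [h _] := stereo_smooth 1; exact: h.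
have d2 : has_derivative (unstereo e) (stereo e x) ('J (unstereo e) (stereo e x)).
  apply: differentiable_has_derivative; apply: unstereo_differentiable.
  by rewrite subr_eq0 gt_eqF// stereo_height_lt1.
have d3 := has_derivative_comp d1 d2.
have d4 : has_derivative (unstereo e \o stereo e) x 1%:M.
  have E : unstereo e \o stereo e = (fun z : 'rV[R]_n => z *m 1%:M + 0).
    by apply/funext => z; rewrite mulmx1 addr0; exact: stereoK.
  by rewrite E; exact: has_derivative_affine.
have E := has_derivative_unique d3 d4.
by apply/row_freeP; exists ('J (unstereo e) (stereo e x)).
Qed.

Lemma stereo_local_param : local_param (esphere R n.+1) setT (stereo e).
Proof.
split=> //; first exact: openT.
- exact: stereo_smooth.
- by move=> x _; exact: stereo_row_free.
- by move=> x z _ _ E; rewrite -(stereoK x) E stereoK.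
move=> W oW _; exists [set y : 'rV[R]_n.+1 | e * y 0 0 < 1 /\ W (unstereo e y)].
  rewrite openE => y [y1 Wy].
  have c1 : \forall z \near (y : 'rV[R]_n.+1), e * (z : 'rV[R]_n.+1) 0 0 < 1.
    have c : {for y, continuous (fun z : 'rV[R]_n.+1 => e * z 0 0)}.
      exact: (continuousM (@cst_continuous _ _ e y) (@coord_continuous R 1 n.+1 0 0 y)).
    have n1 : nbhs (e * y 0 0) [set t : R | t < 1].
      by apply: open_nbhs_nbhs; split=> //; exact: open_lt.
    exact: (c _ n1).
  have c2 : \forall z \near (y : 'rV[R]_n.+1), W (unstereo e z).
    have c : {for y, continuous (unstereo e)}.
      by apply: differentiable_continuous; apply: unstereo_differentiable; rewrite subr_eq0 gt_eqF.
    have n1 : nbhs (unstereo e y) W by apply: open_nbhs_nbhs.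
    exact: (c _ n1).
  exact: filterS2 c1 c2.
apply/seteqP; split=> y.
  by move=> [x Wx <-]; split; [exact: stereo_unit|split; [exact: stereo_height_lt1|rewrite stereoK]].
by move=> [y1 [h Wy]]; exists (unstereo e y) => //; exact: unstereoK.
Qed.

End Sphere.

Lemma esphere_smooth {R : realType} n : smooth_hypersurface (esphere R n.+1).
Proof.
move=> y y1; have [y0|y0] := ltP (y 0 0) 1.
  exists setT, (stereo 1); split; first by apply: stereo_local_param; rewrite mulr1.
  by exists (unstereo 1 y) => //; apply: unstereoK; rewrite ?mulr1// mul1r.
exists setT, (stereo (-1)); split; first by apply: stereo_local_param; rewrite mulrNN mulr1.
exists (unstereo (-1) y) => //; apply: unstereoK; rewrite ?mulrNN ?mulr1// mulN1r.
by move: (y 0 0) y0 => t t0; lra.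
Qed.

(** * The unit ball as a body with smooth boundary *)

Section UnitBall.
Context {R : realType} {n : nat}.

Definition unit_ball : set 'rV[R]_n.+1 := [set x | enorm x < 1].

Lemma unit_ball_open : open unit_ball.
Proof.
have -> : unit_ball = (@enorm R n.+1) @^-1` [set t | t < 1] by [].
by apply: open_comp; [move=> x _; exact: enorm_continuous|exact: open_lt].
Qed.

Lemma unit_ball_neq0 : unit_ball !=set0.
Proof. by exists 0; rewrite /unit_ball /= enorm0 ltr01. Qed.

Lemma unit_ball_bounded : bounded_set unit_ball.
Proof.
exists 1; split=> // M M1 x /= x1.
by rewrite (le_trans (norm_le_enorm x))// (le_trans (ltW x1))// ltW.
Qed.

Lemma closure_unit_ball : closure unit_ball = eball 0 1.
Proof.
apply/seteqP; split=> x.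
  have c : closed (eball (0 : 'rV[R]_n.+1) 1).
    have -> : eball (0 : 'rV[R]_n.+1) 1 = (@enorm R n.+1) @^-1` [set t | t <= 1].
      by apply/seteqP; split=> y; rewrite /eball /= subr0.
    apply: preimage_closed; last exact: closed_le.
    by move=> y _; exact: enorm_continuous.
  move=> h; have E := (closure_id _).1 c; rewrite E; move: h.
  apply: closure_subset => y; rewrite /eball /= subr0; exact: ltW.
rewrite /eball /= subr0 => x1; apply/closure_enormP => r r0.
pose s := Num.min 2^-1 (r / 2).
have s0 : 0 < s by rewrite /s lt_min divr_gt0// invr_gt0 ltr0n.
have s1 : s <= 2^-1 by rewrite /s ge_min lexx.
have sr : s <= r / 2 by rewrite /s ge_min lexx orbT.
exists ((1 - s) *: x).
  rewrite /unit_ball /= enormZ ger0_norm; last by lra.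
  have := enorm_ge0 x; move: (enorm x) x1 => a a1 a0; nra.
have -> : (1 - s) *: x - x = (- s) *: x by rewrite scalerBl scale1r addrAC subrr add0r scaleNr.
rewrite enormZ normrN gtr0_norm//.
have := enorm_ge0 x; move: (enorm x) x1 => a a1 a0; nra.
Qed.

Lemma boundary_unit_ball : boundary unit_ball = esphere R n.+1.
Proof.
rewrite /boundary closure_unit_ball (interior_id _).1; last exact: unit_ball_open.
apply/seteqP; split=> x; rewrite /eball /unit_ball /esphere /= subr0.
  by move=> [h1 /negP]; rewrite -leNgt => h2; apply/le_anti; rewrite h1 h2.
by move=> ->; rewrite lexx ltxx.
Qed.

Lemma unit_ball_convex : convex_set unit_ball.
Proof.
move=> x y l /set_mem xb /set_mem yb; apply/mem_set.
change (enorm (l%:num *: x + (1 - l%:num) *: y) < 1).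
have l0 : 0 <= l%:num by [].
have l1 : l%:num <= 1 by [].
move: (l%:num) l0 l1 => t t0 t1.
apply: (le_lt_trans (enormD _ _)); rewrite !enormZ !ger0_norm ?subr_ge0//.
rewrite /unit_ball /= in xb yb; move: (enorm x) (enorm y) xb yb => a b a1 b1.
by have [ab|ba] := lerP a b; nra.
Qed.

Lemma smooth_boundary_unit_ball : smooth_hypersurface (boundary unit_ball).
Proof. by rewrite boundary_unit_ball; exact: esphere_smooth. Qed.

Lemma outward_normal_unit_ball p : esphere R n.+1 p -> outward_normal unit_ball p = p.
Proof.
move=> p1; apply: (outward_normal_eq unit_ball_open unit_ball_neq0 unit_ball_bounded
  unit_ball_convex smooth_boundary_unit_ball p1).
rewrite closure_unit_ball; split; first by rewrite /eball /= subr0 p1.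
move=> x; rewrite /eball /= subr0 => x1.
rewrite dotvBl (enorm1_dotv p1) subr_le0 (le_trans (dotv_le_enorm _ _))//.
by rewrite p1 mulr1.
Qed.

(** On the sphere the normal is the position vector, so the derivative of the normal in a chart
    reads B J = J, and J has a right inverse. *)
Lemma shape_mx_unit_ball U phi x : local_param (boundary unit_ball) U phi -> U x ->
  shape_mx unit_ball phi x = 1%:M.
Proof.
move=> lp Ux.
have dN := chart_normal_derivative unit_ball_open unit_ball_neq0 unit_ball_bounded
  unit_ball_convex smooth_boundary_unit_ball lp Ux.
have near_eq : \forall y \near x, phi y = chart_normal unit_ball phi y.
  apply: filterS (chart_nbhs lp Ux) => y Uy; apply: esym.
  apply: outward_normal_unit_ball; rewrite -boundary_unit_ball; exact: (chart_in lp Uy).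
have E := has_derivative_unique dN (has_derivative_near near_eq (chart_derivative lp Ux)).
have /row_freeP[Q JQ] := chart_row_free lp Ux.
by rewrite -[LHS]mulmx1 -JQ mulmxA; apply: (etrans (congr1 (fun M => M *m Q) E)).
Qed.

(** The curvatures enter only through det(1 + s B) = (1 + s)^n; comparing the coefficients of s^n
    gives the value 'C(n, n). *)
Lemma elem_sym_unit_ball p : esphere R n.+1 p ->
  elem_sym n (principal_curvatures unit_ball p) = 1.
Proof.
rewrite -boundary_unit_ball => /smooth_boundary_unit_ball[U [phi [lp [x Ux <-]]]].
set k := principal_curvatures unit_ball (phi x).
have H s : \sum_(j < n.+1) s ^+ j * elem_sym j k = (1 + s) ^+ n.
  rewrite -(det_one_add_shape unit_ball_open unit_ball_neq0 unit_ball_bounded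
    unit_ball_convex smooth_boundary_unit_ball s lp Ux) (shape_mx_unit_ball lp Ux).
  by rewrite scalemx1 -raddfD /= det_scalar.
have := @power_sum_eq0 R n.+1 (fun j => elem_sym j k - 'C(n, j)%:R) _ n (ltnSn n).
rewrite binn => h; apply/eqP; rewrite -subr_eq0; apply/eqP; apply: h => t _.
rewrite /power_sum; have := H t; rewrite exprDn => E.
transitivity (\sum_(j < n.+1) t ^+ j * elem_sym j k - \sum_(j < n.+1) 1 ^+ (n - j) * t ^+ j *+ 'C(n, j)).
  rewrite -sumrB; apply: eq_bigr => j _.
  by rewrite mulrBl mulrC expr1n mul1r mulr_natl.
by rewrite E subrr.
Qed.

End UnitBall.

(** * Lipschitz positively homogeneous functions *)

Section LipschitzHomogeneous.
Context {R : realType} {n : nat}.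
Implicit Types (F G : 'rV[R]_n -> R).

(** The test functions for the Gauss map. They form a vector space, as polarization requires,
    containing support functions, linear forms and the norm, the homogeneous extension of the
    constant 1 on the sphere. *)
Definition lipschitz_homogeneous F := exists2 L, 0 <= L &
  (forall x y, `|F x - F y| <= L * enorm (x - y)) /\
  (forall s y, 0 <= s -> F (s *: y) = s * F y).

Lemma lipschitz_homogeneousD F G : lipschitz_homogeneous F -> lipschitz_homogeneous G ->
  lipschitz_homogeneous (fun x => F x + G x).
Proof.
move=> [L L0 [FL Fh]] [M M0 [GL Gh]]; exists (L + M); first exact: addr_ge0.
split=> [x y|s y s0]; last by rewrite Fh// Gh// mulrDr.
by rewrite opprD addrACA (le_trans (ler_normD _ _))// mulrDl lerD.
Qed.

Lemma lipschitz_homogeneousZ c F : lipschitz_homogeneous F ->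
  lipschitz_homogeneous (fun x => c * F x).
Proof.
move=> [L L0 [FL Fh]]; exists (`|c| * L); first exact: mulr_ge0.
split=> [x y|s y s0]; last by rewrite Fh// mulrCA.
by rewrite -mulrBr normrM -mulrA ler_wpM2l.
Qed.

Lemma lipschitz_homogeneous_enorm : lipschitz_homogeneous (@enorm R n).
Proof.
exists 1 => //; split=> [x y|s y s0]; first by rewrite mul1r enorm_lip.
by rewrite enormZ ger0_norm.
Qed.

Lemma lipschitz_homogeneous_dotv v : lipschitz_homogeneous (fun x => dotv v x).
Proof.
exists (enorm v); first exact: enorm_ge0.
by split=> [x y|s y s0]; [rewrite -dotvBr dotv_abs_le|rewrite dotvZr].
Qed.

Lemma lipschitz_homogeneousN F : lipschitz_homogeneous F ->
  lipschitz_homogeneous (fun x => F (- x)).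
Proof.
move=> [L L0 [FL Fh]]; exists L => //; split=> [x y|s y s0]; last by rewrite -scalerN Fh.
by rewrite (le_trans (FL _ _))// opprK addrC enormB.
Qed.

End LipschitzHomogeneous.

Section SupportFunction.
Context {R : realType} {n : nat}.
Variable A : set 'rV[R]_n.+1.
Hypotheses (A0 : A !=set0) (C : R) (AC : forall x, A x -> enorm x <= C).

Lemma support_fun_ge x v : A x -> dotv x v <= support_fun A v.
Proof.
move=> Ax; apply: sup_upper_bound; last by exists x.
split; first by exists (dotv x v), x.
exists (C * enorm v) => _ [y Ay <-]; rewrite (le_trans (dotv_le_enorm _ _))//.
by rewrite ler_wpM2r ?enorm_ge0// AC.
Qed.

Lemma support_fun_le v (c : R) : (forall x, A x -> dotv x v <= c) -> support_fun A v <= c.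
Proof.
move=> h; apply: ge_sup; last by move=> _ [y Ay <-]; exact: h.
by have [x Ax] := A0; exists (dotv x v), x.
Qed.

Lemma support_fun_lipschitz_homogeneous : lipschitz_homogeneous (support_fun A).
Proof.
have [x0 Ax0] := A0.
have C0 : 0 <= C := le_trans (enorm_ge0 _) (AC Ax0).
have half v w : support_fun A v - support_fun A w <= C * enorm (v - w).
  rewrite lerBlDr; apply: support_fun_le => x Ax.
  have -> : dotv x v = dotv x (v - w) + dotv x w by rewrite -dotvDr subrK.
  rewrite lerD ?support_fun_ge// (le_trans (dotv_le_enorm _ _))//.
  by rewrite ler_wpM2r ?enorm_ge0// AC.
have zero : support_fun A 0 = 0.
  apply/le_anti/andP; split; first by apply: support_fun_le => x _; rewrite dotv0r.
  by rewrite -(dotv0r x0) support_fun_ge.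
have leZ s v : 0 < s -> support_fun A (s *: v) <= s * support_fun A v.
  move=> s0; apply: support_fun_le => x Ax.
  by rewrite dotvZr ler_pM2l// support_fun_ge.
exists C => //; split=> [v w|s v].
  rewrite ler_norml half andbT lerNl opprB (le_trans (half _ _))//.
  by rewrite -(enormB v w).
rewrite le_eqVlt => /predU1P[<-|s0]; first by rewrite scale0r zero mul0r.
apply/le_anti; rewrite leZ//= -ler_pdivlMl//.
have := leZ s^-1 (s *: v); rewrite scalerA mulVf ?gt_eqF// scale1r; apply.
by rewrite invr_gt0.
Qed.

End SupportFunction.

(** * Reflection and the Gauss map *)

Section Reflection.
Context {R : realType} {n : nat}.
Local Notation leb := (lebesgue_rV R).

Lemma lebesgue_reflection (g : 'rV[R]_n -> R) : measurable_fun setT g -> (forall y, 0 <= g y) ->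
  (\int[leb n]_y (g y)%:E = \int[leb n]_y (g (- y))%:E)%E.
Proof.
move=> mg g0; pose M : 'M[R]_n := (-1)%:M.
have NE : (fun y : 'rV[R]_n => - y) = (fun y => y *m M + 0).
  by apply/funext => y; rewrite addr0 /M mul_mx_scalar scaleN1r.
have mN : measurable_fun setT (fun y : 'rV[R]_n => - y) by rewrite NE; exact: measurable_affine.
have uM : M \in unitmx by rewrite unitmxE det_scalar unitfE expf_neq0// oppr_eq0 oner_eq0.
have inv B : measurable B -> leb n ((fun y : 'rV[R]_n => - y) @^-1` B) = leb n B.
  move=> mB; have := lebesgue_linear uM mB.
  rewrite det_scalar normrX normrN1 expr1n invr1 mul1e => <-; congr (leb n _).
  by apply/seteqP; split=> x; rewrite /= /M mul_mx_scalar scaleN1r.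
have mpre B : measurable B -> measurable ((fun y : 'rV[R]_n => - y) @^-1` B).
  by move=> mB; have := mN measurableT B mB; rewrite setTI.
have T := @ge0_integral_transfer _ _ _ _ R (leb n) (leb n) setT setT
  (fun y : 'rV[R]_n => - y) (fun=> 1) (EFin \o g).
transitivity (\int[leb n]_(x in setT) ((EFin \o g) (- x)%R * 1%:E))%E; last first.
  by apply: eq_integral => x _; rewrite mule1.
apply: T => //.
- move=> B mB _; rewrite setTI (_ : (fun x => _) = cst 1%:E)//.
  have mp := mpre B mB; rewrite integral_cst// mul1e; exact: (esym (inv B mB)).
- exact/measurable_EFinP.
- by move=> y _; rewrite /= lee_fin.
Qed.

End Reflection.

Section GaussMap.
Context {R : realType} {n : nat}.
Variable theta : {measure set 'rV[R]_n.+1 -> \bar R}.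
Hypothesis theta_area : area_measure (esphere R n.+1) theta.
Local Notation sphere := (esphere R n.+1).
Implicit Types (F G : 'rV[R]_n.+1 -> R).

Let bo := @unit_ball_open R n.
Let b0 := @unit_ball_neq0 R n.
Let bb := @unit_ball_bounded R n.
Let bc := @unit_ball_convex R n.
Let bs := @smooth_boundary_unit_ball R n.
Let ba : area_measure (boundary (@unit_ball R n)) theta.
Proof. by rewrite boundary_unit_ball. Qed.

Let mS : measurable sphere.
Proof. by rewrite -boundary_unit_ball; exact: measurable_boundary. Qed.

Definition sphere_dot F G := \int[theta]_(xi in sphere) (F xi * G xi).

Let sphereE F G : \int[theta]_(p in boundary unit_ball)
    (F (outward_normal unit_ball p) * (G (outward_normal unit_ball p) *
       elem_sym n (principal_curvatures unit_ball p))) = sphere_dot F G.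
Proof.
rewrite boundary_unit_ball; apply: eq_Rintegral => p /set_mem p1.
by rewrite outward_normal_unit_ball// elem_sym_unit_ball// mulr1.
Qed.

Lemma sphere_dot_integrable F G : lipschitz_homogeneous F -> lipschitz_homogeneous G ->
  theta.-integrable sphere (EFin \o (fun xi => F xi * G xi)).
Proof.
move=> [L L0 [FL Fh]] [M M0 [GL Gh]].
have i0 := elem_sym_integrable bo b0 bb bc bs ba n.
have i1 := homogeneous_normal_integrable bo b0 bb bc bs (mu := theta) GL Gh i0.
have i2 := homogeneous_normal_integrable bo b0 bb bc bs (mu := theta) FL Fh i1.
rewrite boundary_unit_ball in i2; apply: eq_integrable i2 => // p /set_mem p1 /=.
by rewrite outward_normal_unit_ball// elem_sym_unit_ball// mulr1.
Qed.

Lemma sphere_dotDl F F' G : lipschitz_homogeneous F -> lipschitz_homogeneous F' ->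
  lipschitz_homogeneous G ->
  sphere_dot (fun x => F x + F' x) G = sphere_dot F G + sphere_dot F' G.
Proof.
move=> hF hF' hG; rewrite /sphere_dot -RintegralD//; try exact: sphere_dot_integrable.
by apply: eq_Rintegral => p _; rewrite mulrDl.
Qed.

Lemma sphere_dotC F G : sphere_dot F G = sphere_dot G F.
Proof. by apply: eq_Rintegral => p _; rewrite mulrC. Qed.

Lemma sphere_dotZl c F G : lipschitz_homogeneous F -> lipschitz_homogeneous G ->
  sphere_dot (fun x => c * F x) G = c * sphere_dot F G.
Proof.
move=> hF hG; rewrite /sphere_dot -RintegralZl//; last exact: sphere_dot_integrable.
by apply: eq_Rintegral => p _; rewrite mulrA.
Qed.

Lemma sphere_dot_sq F G c : lipschitz_homogeneous F -> lipschitz_homogeneous G ->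
  sphere_dot (fun x => F x + c * G x) (fun x => F x + c * G x) =
  sphere_dot F F + 2 * c * sphere_dot F G + c ^+ 2 * sphere_dot G G.
Proof.
move=> hF hG; have hcG := lipschitz_homogeneousZ c hG.
have hs := lipschitz_homogeneousD hF hcG.
rewrite sphere_dotDl// sphere_dotZl// (sphere_dotC F) (sphere_dotC G).
by rewrite !sphere_dotDl// !sphere_dotZl// (sphere_dotC G F); ring.
Qed.

(** Tubes of the ball are symmetric and Lebesgue measure is reflection invariant, so F and F(-.)
    have the same integrals over them; the comparison theorem carries this to the sphere. *)
Lemma sphere_dot_reflection F : lipschitz_homogeneous F ->
  sphere_dot (fun x => F (- x)) (fun x => F (- x)) = sphere_dot F F.
Proof.
have half F' : lipschitz_homogeneous F' ->
    sphere_dot (fun x => F' (- x)) (fun x => F' (- x)) <= sphere_dot F' F'.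
  move=> hF; have [L L0 [FL Fh]] := hF.
  rewrite -!sphereE; apply: (@gauss_map_le R n _ _ theta theta F' L bo b0 bb bc bs ba bo b0 bb bc bs ba L0 FL Fh (fun x => F' (- x))).
  - move=> t.
    have kb : convex_body (closure (@unit_ball R n)) := closure_convex_body b0 bb bc.
    have cN x : closure (@unit_ball R n) x -> closure (@unit_ball R n) (- x).
      by rewrite closure_unit_ball /eball /= !subr0 enormN.
    have leN y : dist (closure (@unit_ball R n)) (- y) <= dist (closure (@unit_ball R n)) y.
      rewrite (le_trans (dist_le kb _ (cN _ (proj_in kb y))))//.
      by rewrite -opprD enormN.
    have tN y : \1_(parallel_body (@unit_ball R n) t) (- y) =
        \1_(parallel_body (@unit_ball R n) t) y :> R.
      rewrite !indicE; congr (_ : bool)%:R.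
      apply/idP/idP => /set_mem h; apply: mem_set; rewrite /parallel_body /= in h *.
        by rewrite -(opprK y) (le_trans (leN _)).
      by rewrite (le_trans (leN _)).
    have mF : measurable_fun setT F'.
      apply: continuous_on_measurable; apply: continuous_continuous_on => x _.
      exact: (@lipschitz_continuousR R n.+1 F' L FL x).
    rewrite [RHS]lebesgue_reflection.
    + by apply: eq_integral => y _; rewrite tN.
    + apply: measurable_funM; first exact: measurable_funX.
      exact: measurable_indic (measurable_tube b0 bb bc t).
    + by move=> y; rewrite mulr_ge0 ?sqr_ge0.
  - by move=> x y; rewrite (le_trans (FL _ _))// opprK addrC enormB.
  - by move=> s y s0; rewrite -scalerN Fh.
move=> hF; apply/le_anti; rewrite half//=.
have := half _ (lipschitz_homogeneousN hF).
by rewrite (_ : (fun x => F (- - x)) = F)//; apply/funext => x; rewrite opprK.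
Qed.

Lemma sphere_dot_polar F G : lipschitz_homogeneous F -> lipschitz_homogeneous G ->
  sphere_dot F G = (sphere_dot (fun x => F x + 1 * G x) (fun x => F x + 1 * G x) -
    sphere_dot F F - sphere_dot G G) / 2.
Proof. by move=> hF hG; rewrite sphere_dot_sq//; field. Qed.

(** Polarization reduces this to squares, and the norm is even. *)
Lemma sphere_dot_one_reflection F : lipschitz_homogeneous F ->
  sphere_dot (fun x => F (- x)) (@enorm R n.+1) = sphere_dot F (@enorm R n.+1).
Proof.
move=> hF; have hE := @lipschitz_homogeneous_enorm R n.+1.
have hN := lipschitz_homogeneousN hF.
rewrite (sphere_dot_polar hN hE) (sphere_dot_polar hF hE) (sphere_dot_reflection hF); congr ((_ - _ - _) / _).
have := sphere_dot_reflection (lipschitz_homogeneousD hF (lipschitz_homogeneousZ 1 hE)).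
by move=> <-; apply: eq_Rintegral => x _; rewrite enormN.
Qed.

Section Body.
Variable Omega : set 'rV[R]_n.+1.
Hypotheses (oO : open Omega) (O0 : Omega !=set0) (bO : bounded_set Omega)
  (cO : convex_set Omega) (smO : smooth_hypersurface (boundary Omega)).
Variable mu : {measure set 'rV[R]_n.+1 -> \bar R}.
Hypothesis mu_area : area_measure (boundary Omega) mu.
Local Notation nu := (outward_normal Omega).
Local Notation sigma p := (elem_sym n (principal_curvatures Omega p)).

(** The comparison theorem is used twice, with the body and the unit ball exchanged. *)
Let gauss_sq F : lipschitz_homogeneous F ->
  \int[mu]_(p in boundary Omega) (F (nu p) * (F (nu p) * sigma p)) = sphere_dot F F.
Proof.
move=> [L L0 [FL Fh]]; apply/le_anti; rewrite -sphereE; apply/andP; split.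
  exact: (@gauss_map_le R n _ _ mu theta F L oO O0 bO cO smO mu_area bo b0 bb bc bs ba L0 FL Fh F (fun t => erefl) FL Fh).
exact: (@gauss_map_le R n _ _ theta mu F L bo b0 bb bc bs ba oO O0 bO cO smO mu_area L0 FL Fh F (fun t => erefl) FL Fh).
Qed.

(* Polarization of the case F = G. *)
Theorem gauss_map F G : lipschitz_homogeneous F -> lipschitz_homogeneous G ->
  \int[mu]_(p in boundary Omega) (F (nu p) * (G (nu p) * sigma p)) = sphere_dot F G.
Proof.
move=> hF hG; rewrite sphere_dot_polar//.
rewrite -(gauss_sq hF) -(gauss_sq hG) -(gauss_sq (lipschitz_homogeneousD hF (lipschitz_homogeneousZ 1 hG))).
have mB : measurable (boundary Omega) := measurable_boundary Omega.
have i0 := elem_sym_integrable oO O0 bO cO smO mu_area n.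
have hn H g : lipschitz_homogeneous H -> mu.-integrable (boundary Omega) (EFin \o g) ->
    mu.-integrable (boundary Omega) (EFin \o (fun p => H (nu p) * g p)).
  by move=> [L L0 [HL Hh]]; exact: (homogeneous_normal_integrable oO O0 bO cO smO HL Hh).
have iFF := hn _ _ hF (hn _ _ hF i0); have iGG := hn _ _ hG (hn _ _ hG i0).
have iFG := hn _ _ hF (hn _ _ hG i0).
have -> : \int[mu]_(p in boundary Omega) ((F (nu p) + 1 * G (nu p)) * ((F (nu p) + 1 * G (nu p)) * sigma p)) =
   \int[mu]_(p in boundary Omega) (F (nu p) * (F (nu p) * sigma p)) +
   \int[mu]_(p in boundary Omega) (F (nu p) * (G (nu p) * sigma p)) * 2 +
   \int[mu]_(p in boundary Omega) (G (nu p) * (G (nu p) * sigma p)).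
  rewrite -RintegralZr// -RintegralD//; last exact: (integrableMR mB).
  rewrite -RintegralD//; last by apply: (integrableDR mB) => //; exact: (integrableMR mB).
  by apply: eq_Rintegral => p _; ring.
by field.
Qed.

End Body.
End GaussMap.
(** * The Steiner point *)

Section CurvatureIntegrals.
Context {R : realType} {n : nat}.
Variable Omega : set 'rV[R]_n.+1.
Hypotheses (oO : open Omega) (O0 : Omega !=set0) (bO : bounded_set Omega)
  (cO : convex_set Omega) (smO : smooth_hypersurface (boundary Omega)).
Variable mu : {measure set 'rV[R]_n.+1 -> \bar R}.
Hypothesis mu_area : area_measure (boundary Omega) mu.
Local Notation leb := (lebesgue_rV R).
Local Notation Sigma := (boundary Omega).
Local Notation nu := (outward_normal Omega).
Local Notation sigma j p := (elem_sym j (principal_curvatures Omega p)).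

(** Contracting the closure by s < 1 about a point of [Omega] lands in [Omega], so s^(n+1) times the
    volume of the closure is at most that of [Omega], and s tends to 1. *)
Lemma lebesgue_closure : leb n.+1 (closure Omega) = leb n.+1 Omega.
Proof.
have mO : measurable Omega := open_measurable_rV oO.
have mK : measurable (closure Omega) := measurable_closure Omega.
have [X0 OX0] := O0.
have finK := closure_lebesgue_lty O0 bO cO.
have le1 : (leb n.+1 Omega <= leb n.+1 (closure Omega))%E.
  by apply: le_measure; rewrite ?inE//; exact: subset_closure.
have finO := le_lt_trans le1 finK.
have fK : leb n.+1 (closure Omega) \is a fin_num by rewrite ge0_fin_numE.
have fO : leb n.+1 Omega \is a fin_num by rewrite ge0_fin_numE.
apply/le_anti; rewrite le1 andbT -(fineK fK) -(fineK fO) lee_fin.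
set a := fine (leb n.+1 (closure Omega)); set b := fine _.
have a0 : 0 <= a by exact: fine_ge0.
have key s : 0 < s < 1 -> s ^+ n.+1 * a <= b.
  move=> /andP[s0 s1]; rewrite -lee_fin EFinM /a /b !fineK//.
  have mI : measurable_fun setT (\1_Omega : _ -> R) := measurable_indic mO.
  have E := lebesgue_dilation X0 s0 mI (fun y => ler0n _ _).
  have E1 : (\int[leb n.+1]_y (\1_Omega y)%:E = leb n.+1 Omega)%E.
    by rewrite integral_indic// setIT.
  have E2 : (\int[leb n.+1]_y (\1_(closure Omega) y)%:E = leb n.+1 (closure Omega))%E.
    by rewrite integral_indic// setIT.
  rewrite -E1 E -E2; apply: lee_wpmul2l; first by rewrite lee_fin exprn_ge0// ltW.
  have mIK : measurable_fun setT (EFin \o (\1_(closure Omega) : _ -> R)).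
    by apply/measurable_EFinP; exact: measurable_indic.
  have mIO : measurable_fun setT (EFin \o (fun y : 'rV[R]_n.+1 => \1_Omega (X0 + s *: (y - X0)) : R)).
    apply/measurable_EFinP; apply: (measurableT_comp mI).
    have -> : (fun y : 'rV[R]_n.+1 => X0 + s *: (y - X0)) =
       (fun y => y *m s%:M + (X0 - s *: X0)).
      apply/funext => y.
      by rewrite mul_mx_scalar scalerBr addrC addrA addrAC -addrA [- _ + _]addrC.
    exact: measurable_affine.
  apply: ge0_le_integral => // y _; rewrite lee_fin !indicE ler_nat.
  case: (boolP (y \in closure Omega)) => // /set_mem Ky /=.
  have Os : Omega (X0 + s *: (y - X0)).
    have -> : X0 + s *: (y - X0) = y + (1 - s) *: (X0 - y).
      by apply/rowP => i; rewrite !mxE; ring.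
    by apply: open_segment => //; apply/andP; split; [rewrite subr_gt0|rewrite gerBl ltW].
  by rewrite (mem_set Os).
apply/ler_addgt0Pr => e e0.
have e1 : 0 < e / (a + 1) by rewrite divr_gt0// ltr_wpDl.
(* The contraction factor is 1 - 2t; the tolerance e/(a + 1) makes the loss of volume at most e. *)
have [t /andP[t0 t2] [_ h]] := power_near1 n.+1 e1.
have := key (1 - 2 * t); have -> : 0 < 1 - 2 * t < 1.
  by apply/andP; split; move: t2; rewrite -(ltr_pM2l (ltr0n R 2)) ?mulfV ?pnatr_eq0//; lra.
move=> /(_ isT) k; have h2 := le_trans (ler_wpM2r a0 h) k.
have h3 : e / (a + 1) * a <= e.
  by rewrite mulrAC ler_pdivrMr ?ltr_wpDl// ler_pM2l// lerDl.
by move: h2 h3; rewrite mulrBl mul1r; lra.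
Qed.

Lemma curv_integralE j :
  curv_integral Omega mu (Posz j) = ('C(n, j)%:R)^-1 * \int[mu]_(p in Sigma) sigma j p.
Proof.
rewrite /curv_integral /mean_curv RintegralZl//; first exact: measurable_boundary.
exact: (elem_sym_integrable oO O0 bO cO smO mu_area).
Qed.

(** Minkowski's formula at k = n - 1, with 'C(n, n-2) = n(n-1)/2. For n = 1 the index n - 2 is -1,
    and the volume formula takes its place. *)
Lemma penultimate_height_integral (X0 : 'rV[R]_n.+1) : (1 <= n)%N ->
  \int[mu]_(p in Sigma) (dotv (p - X0) (nu p) * sigma n.-1 p) =
  n%:R * curv_integral Omega mu (n%:Z - 2).
Proof.
move=> n1; have [h0 h1] := minkowski oO O0 bO cO smO mu_area X0.
have [ne|n2] := eqVneq n 1%N.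
  have e0 : n.-1 = 0%N by rewrite ne.
  have e2 : n%:Z - 2 = Negz 0 by rewrite ne.
  have e3 : n%:R = 1 :> R by rewrite ne.
  by rewrite e0 e2 e3 mul1r -h0 /= /volume lebesgue_closure.
have {}n2 : (1 < n)%N by rewrite ltn_neqAle eq_sym n2.
have p0 : (0 < n.-1)%N by rewrite -ltnS prednK.
have e2 : n%:Z - 2 = Posz n.-2 by rewrite subzn// subn2.
have hk : (0 < n.-1 <= n)%N by rewrite p0 leq_pred.
rewrite e2 curv_integralE -(h1 n.-1 hk) (_ : (n.+1 - n.-1 = 2)%N); last first.
  by rewrite -{1}(prednK n1) -addn2 addKn.
have C2 : 'C(n, n.-2)%:R * 2 = n%:R * n.-1%:R :> R.
  have E := bin_ffact n 2; rewrite !ffactnS ffactn0 muln1 in E.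
  have bE : 'C(n, n.-2) = 'C(n, 2) by rewrite -subn2 bin_sub.
  by rewrite bE -!natrM; congr (_%:R); exact: E.
have nn : n%:R != 0 :> R by rewrite pnatr_eq0 -lt0n.
have pp : n.-1%:R != 0 :> R by rewrite pnatr_eq0 -lt0n.
have CE : 'C(n, n.-2)%:R = n%:R * n.-1%:R / 2 :> R by rewrite -C2 mulfK// pnatr_eq0.
rewrite CE; move: (\int[mu]_(p in _) _) (n%:R : R) (n.-1%:R : R) nn pp => s N M N0 M0.
by field; rewrite N0 M0.
Qed.

End CurvatureIntegrals.

(** The three equations are the second-moment identity of the unit ball centred at v, -v and 0. Here
    w is the area of the sphere, q = |v|^2, e and f are the first and second moments of <v, .>, and
    c is n I_(n-2). *)
Lemma ball_moment_arith {R : realFieldType} (N w q c e f : R) : 1 < N ->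
  w - 2 * e + q * w + c = N * (w - 2 * e + f) ->
  w + 2 * e + q * w + c = N * (w + 2 * e + f) -> w + c = N * w ->
  e = 0 /\ N * f = q * w.
Proof.
move=> N1 h1 h2 h3.
have E : (N - 1) * e = 0 by lra.
have e0 : e = 0.
  by move/eqP: E; rewrite mulf_eq0 subr_eq0 gt_eqF//= => /eqP.
by split=> //; rewrite e0 in h1; lra.
Qed.

(** * First and second moments of the sphere *)

Section SphereMoments.
Context {R : realType} {n : nat}.
Variable theta : {measure set 'rV[R]_n.+1 -> \bar R}.
Hypothesis theta_area : area_measure (esphere R n.+1) theta.
Local Notation sphere := (esphere R n.+1).
Local Notation dot := (sphere_dot theta).
Local Notation one := (@enorm R n.+1).
Local Notation ell v := (fun x : 'rV[R]_n.+1 => dotv v x).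

Let bo := @unit_ball_open R n.
Let b0 := @unit_ball_neq0 R n.
Let bb := @unit_ball_bounded R n.
Let bc := @unit_ball_convex R n.
Let bs := @smooth_boundary_unit_ball R n.
Let ba : area_measure (boundary (@unit_ball R n)) theta.
Proof. by rewrite boundary_unit_ball. Qed.
Let mS : measurable sphere.
Proof. by rewrite -boundary_unit_ball; exact: measurable_boundary. Qed.
Let hE := @lipschitz_homogeneous_enorm R n.+1.
Let hl v := @lipschitz_homogeneous_dotv R n.+1 v.

Lemma sphere_dot_one : dot one one = sphere_area theta.
Proof.
transitivity (\int[theta]_(xi in sphere) (1 : R)); last by rewrite Rintegral_cst// mul1r.
by apply: eq_Rintegral => p /set_mem ->; rewrite mulr1.
Qed.

(** The volume part of Minkowski's formulas for the unit ball centred at 0, whose support height is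
    1. *)
Lemma volume_eball : n.+1%:R * volume (eball (0 : 'rV[R]_n.+1) 1) = sphere_area theta.
Proof.
have [h _] := minkowski bo b0 bb bc bs ba 0.
rewrite /volume -closure_unit_ball h boundary_unit_ball -sphere_dot_one.
apply: eq_Rintegral => p /set_mem p1.
by rewrite outward_normal_unit_ball// subr0 elem_sym0 enorm1_dotv// p1.
Qed.

Lemma volume_eball_gt0 : 0 < volume (eball (0 : 'rV[R]_n.+1) 1).
Proof.
pose r : R := n.+1%:R^-1; have r0 : 0 < r by rewrite invr_gt0 ltr0n.
pose b : 'rV[R]_n.+1 := const_mx r.
have sub : box (- b) b `<=` eball (0 : 'rV[R]_n.+1) 1.
  move=> x hx; rewrite /eball /= subr0 (le_trans (enorm_le_norm x))//.
  apply: (@le_trans _ _ (n.+1%:R * r)); last by rewrite /r mulfV ?pnatr_eq0.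
  rewrite ler_wpM2l//.
  apply: norm_le_coord => [|i]; first exact: ltW.
  have /andP[h1 h2] := hx i; rewrite !mxE in h1 h2.
  by rewrite ler_norml h2 (ltW h1).
have mb : measurable (eball (0 : 'rV[R]_n.+1) 1).
  by rewrite -closure_unit_ball; exact: measurable_closure.
have h : (lebesgue_rV R n.+1 (box (- b) b) <= lebesgue_rV R n.+1 (eball (0 : 'rV[R]_n.+1) 1))%E.
  by apply: le_measure; rewrite ?inE//; exact: measurable_box.
rewrite lebesgue_box in h; last by move=> i; rewrite !mxE; lra.
have fin : (lebesgue_rV R n.+1 (eball (0 : 'rV[R]_n.+1) 1) < +oo)%E.
  by rewrite -closure_unit_ball; exact: closure_lebesgue_lty.
rewrite /volume -lte_fin fineK ?ge0_fin_numE//; apply: lt_le_trans h.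
rewrite lte_fin; apply: prodr_gt0 => i _; rewrite !mxE; lra.
Qed.

Lemma unit_ball_moment v : (1 <= n)%N ->
  sphere_area theta - 2 * dot (ell v) one + dotv v v * sphere_area theta +
    n%:R * curv_integral (@unit_ball R n) theta (n%:Z - 2) =
  n.+1%:R * (sphere_area theta - 2 * dot (ell v) one + dot (ell v) (ell v)).
Proof.
move=> n1; have := second_moment bo b0 bb bc bs ba v n1.
rewrite (penultimate_height_integral bo b0 bb bc bs ba)// => E.
have hv p : sphere p -> dotv (p - v) p = one p + (-1) * dotv v p.
  by move=> p1; rewrite dotvBl enorm1_dotv// p1 mulN1r.
have E1 : \int[theta]_(p in boundary unit_ball)
    (dotv (p - v) (outward_normal unit_ball p) * (dotv (p - v) (outward_normal unit_ball p) *
      elem_sym n (principal_curvatures unit_ball p))) =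
    sphere_area theta - 2 * dot (ell v) one + dot (ell v) (ell v).
  rewrite boundary_unit_ball.
  transitivity (dot (fun x => one x + (-1) * dotv v x) (fun x => one x + (-1) * dotv v x)).
    apply: eq_Rintegral => p /set_mem p1.
    by rewrite outward_normal_unit_ball// elem_sym_unit_ball// mulr1 hv.
  rewrite (sphere_dot_sq theta_area (-1) hE (hl v)) sphere_dot_one.
  by rewrite (sphere_dotC theta one) expr2; ring.
have E2 : \int[theta]_(p in boundary unit_ball)
    (dotv (p - v) (p - v) * elem_sym n (principal_curvatures unit_ball p)) =
    sphere_area theta - 2 * dot (ell v) one + dotv v v * sphere_area theta.
  rewrite boundary_unit_ball.
  have i1 := sphere_dot_integrable theta_area hE hE.
  have i2 := sphere_dot_integrable theta_area (hl v) hE.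
  transitivity (\int[theta]_(p in sphere)
     (one p * one p * (1 + dotv v v) + dotv v p * one p * (-2))).
    apply: eq_Rintegral => p /set_mem p1.
    rewrite elem_sym_unit_ball// mulr1 dotvBl !dotvBr enorm1_dotv// p1 (dotvC p v).
    by ring.
  rewrite RintegralD//; [|exact: (integrableMR mS)|exact: (integrableMR mS)].
  rewrite !RintegralZr// -/(dot one one) -/(dot (ell v) one) sphere_dot_one.
  by ring.
by rewrite E1 E2 in E.
Qed.

(** Instead of rotation invariance, the second-moment identity of the ball is used for three
    centres: its odd part in v gives the first moment, its even part the second. *)
Lemma sphere_dot_linear v : (1 <= n)%N -> dot (ell v) one = 0 /\
  dot (ell v) (ell v) = dotv v v * volume (eball (0 : 'rV[R]_n.+1) 1).
Proof.
move=> n1.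
have N1 : 1 < n.+1%:R :> R by rewrite ltr1n.
have H1 := unit_ball_moment v n1.
have := unit_ball_moment (- v) n1.
have NE : ell (- v) = (fun x => (-1) * dotv v x).
  by apply/funext => x; rewrite dotvNl mulN1r.
have hN := lipschitz_homogeneousZ (-1) (hl v).
rewrite NE (sphere_dotZl theta_area (-1) (hl v) hE) (sphere_dotZl theta_area (-1) (hl v) hN).
rewrite (sphere_dotC theta (ell v) (fun x => _ * _)) (sphere_dotZl theta_area (-1) (hl v) (hl v)).
rewrite dotvNl dotvNr opprK !mulN1r opprK mulrN opprK => H2.
have := unit_ball_moment 0 n1.
have ZE : ell (0 : 'rV[R]_n.+1) = (fun x => 0 * dotv v x).
  by apply/funext => x; rewrite dotv0l mul0r.
have hZ := lipschitz_homogeneousZ 0 (hl v).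
rewrite ZE (sphere_dotZl theta_area 0 (hl v) hE) (sphere_dotZl theta_area 0 (hl v) hZ).
rewrite dotv0l !mul0r mulr0 subr0 !addr0 => H3.
have [e0 f0] := ball_moment_arith N1 H1 H2 H3.
split=> //; apply: (@mulfI _ (n.+1%:R : R)); first by rewrite pnatr_eq0.
by rewrite f0 -volume_eball mulrCA.
Qed.

End SphereMoments.

(** * The weighted curvature integral as a function of its centre *)

Section SteinerPoint.
Context {R : realType} {n : nat}.
Variables (Omega : set 'rV[R]_n.+1) (mu theta : {measure set 'rV[R]_n.+1 -> \bar R}).
Hypotheses (n1 : (1 <= n)%N) (oO : open Omega) (O0 : Omega !=set0) (bO : bounded_set Omega)
  (cO : convex_set Omega) (smO : smooth_hypersurface (boundary Omega))
  (mu_area : area_measure (boundary Omega) mu)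
  (theta_area : area_measure (esphere R n.+1) theta).
Local Notation Sigma := (boundary Omega).
Local Notation sphere := (esphere R n.+1).
Local Notation nu := (outward_normal Omega).
Local Notation sigma j p := (elem_sym j (principal_curvatures Omega p)).
Local Notation dot := (sphere_dot theta).
Local Notation one := (@enorm R n.+1).
Local Notation ell v := (fun x : 'rV[R]_n.+1 => dotv v x).
Local Notation u := (support_fun Omega).
Local Notation omega := (sphere_area theta).
Local Notation b := (volume (eball (0 : 'rV[R]_n.+1) 1)).

Let hE := @lipschitz_homogeneous_enorm R n.+1.
Let hl v := @lipschitz_homogeneous_dotv R n.+1 v.

Let mS : measurable sphere.
Proof. by rewrite -boundary_unit_ball; exact: measurable_boundary. Qed.

Let bound : exists C, forall x, Omega x -> enorm x <= C.
Proof.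
by have [C _ hC] := closure_bounded O0 bO cO; exists C => x Ox; apply: hC; exact: subset_closure.
Qed.

Let hu : lipschitz_homogeneous u.
Proof. by have [C hC] := bound; exact: (support_fun_lipschitz_homogeneous O0 hC). Qed.

(** The supremum defining u is over the open set, while p lies only in the closure; closed
    half-spaces bridge the gap. *)
Lemma support_fun_normal p : Sigma p -> dotv p (nu p) = u (nu p).
Proof.
move=> Sp; have [Kp sp] := outward_normal_supports oO O0 bO cO smO Sp.
have [C hC] := bound.
apply/le_anti/andP; split.
  have c : closed [set x : 'rV[R]_n.+1 | dotv x (nu p) <= u (nu p)].
    apply: (@preimage_closed _ _ (fun x : 'rV[R]_n.+1 => dotv x (nu p)) [set t | t <= u (nu p)]).
      by move=> y _; exact: dotvl_continuous.
    exact: closed_le.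
  suff : closure Omega `<=` [set x : 'rV[R]_n.+1 | dotv x (nu p) <= u (nu p)] by apply.
  have E := (closure_id _).1 c; rewrite E.
  by apply: closure_subset => x Ox; exact: (support_fun_ge hC).
apply: (support_fun_le O0) => x Ox.
by have := sp x (subset_closure Ox); rewrite dotvBl subr_le0.
Qed.

(** The support function of the body translated by -X0; at the normal of a boundary point it is the
    support height. The factor (-1) fits the lemmas on linear combinations. *)
Definition centered_support (X0 : 'rV[R]_n.+1) x := u x + (-1) * dotv X0 x.
Local Notation F := centered_support.

Let hF X0 : lipschitz_homogeneous (F X0).
Proof. exact: lipschitz_homogeneousD hu (lipschitz_homogeneousZ (-1) (hl X0)). Qed.

Let heightE X0 p : Sigma p -> dotv (p - X0) (nu p) = F X0 (nu p).
Proof. by move=> Sp; rewrite dotvBl support_fun_normal// /F mulN1r. Qed.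

Lemma sphere_dot_centered_one X0 : dot (F X0) one = dot u one.
Proof.
rewrite /F (sphere_dotDl theta_area hu (lipschitz_homogeneousZ (-1) (hl X0)) hE).
by rewrite (sphere_dotZl theta_area (-1) (hl X0) hE) (sphere_dot_linear theta_area X0 n1).1 mulr0 addr0.
Qed.

(** Minkowski's formula at k = n turns the integral of sigma_(n-1)/n into that of u sigma_n, which
    the Gauss map carries to the sphere. *)
Lemma curv_integral_width : curv_integral Omega mu (n%:Z - 1) = dot u one.
Proof.
have -> : n%:Z - 1 = Posz n.-1 by rewrite subzn// subn1.
rewrite (curv_integralE oO O0 bO cO smO mu_area) -(sphere_dot_centered_one 0).
rewrite -(gauss_map theta_area oO O0 bO cO smO mu_area (hF 0) hE).
have [_ h] := minkowski oO O0 bO cO smO mu_area 0.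
have := h n; rewrite n1 leqnn subSnn => /(_ isT) E.
have -> : 'C(n, n.-1) = n by rewrite -subn1 bin_sub// bin1.
transitivity (\int[mu]_(p in Sigma) (dotv (p - 0) (nu p) * sigma n p)).
  by rewrite -E mul1r mulrC.
apply: eq_Rintegral => p /set_mem Sp.
by rewrite heightE// (outward_normal_unit oO O0 bO cO smO Sp) mul1r.
Qed.

Lemma weighted_curv_integralE X0 : weighted_curv_integral Omega mu X0 =
  n.+1%:R * dot (F X0) (F X0) - n%:R * curv_integral Omega mu (n%:Z - 2).
Proof.
have E := second_moment oO O0 bO cO smO mu_area X0 n1.
rewrite (penultimate_height_integral oO O0 bO cO smO mu_area X0 n1) in E.
rewrite -(gauss_map theta_area oO O0 bO cO smO mu_area (hF X0) (hF X0)).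
have -> : \int[mu]_(p in Sigma) (F X0 (nu p) * (F X0 (nu p) * sigma n p)) =
   \int[mu]_(p in Sigma) (dotv (p - X0) (nu p) * (dotv (p - X0) (nu p) * sigma n p)).
  by apply: eq_Rintegral => p /set_mem Sp; rewrite heightE.
rewrite -E addrK; apply: eq_Rintegral => p _.
by rewrite /mean_curv binn invr1 mul1r enorm2 mulrC.
Qed.

Local Notation z := (steiner_point theta Omega).

Lemma sphere_dot_steiner v : dot u (ell v) = b * dotv z v.
Proof.
(* Coordinates are indexed by naturals through [inord] because [Rintegral_sum] expects a sequence of
   functions. *)
pose g k (xi : 'rV[R]_n.+1) := u xi * xi 0 (inord k).
have ig k : theta.-integrable sphere (EFin \o g k).
  have := sphere_dot_integrable theta_area hu (hl (delta_mx 0 (inord k))).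
  apply: eq_integrable => // xi _ /=; congr (_ * _)%:E.
  rewrite /dotv (bigD1 (inord k))//= big1 ?addr0 ?mxE ?eqxx ?mul1r// => i ik.
  by rewrite mxE (negbTE ik) andbF mul0r.
have [_ E] := Rintegral_sum mS n.+1 (fun k => v 0 (inord k)) ig.
transitivity (\int[theta]_(xi in sphere) (\sum_(k < n.+1) g k xi * v 0 (inord k))).
  apply: eq_Rintegral => xi _; rewrite /dotv mulr_sumr; apply: eq_bigr => i _.
  by rewrite /g inord_val -mulrA [xi 0 i * _]mulrC.
rewrite E /dotv mulr_sumr; apply: eq_bigr => i _; rewrite mxE inord_val mulrA.
congr (_ * _); rewrite mulrA mulfV ?mul1r ?gt_eqF ?volume_eball_gt0//.
by apply: eq_Rintegral => xi _; rewrite /g inord_val.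
Qed.

(** By the sphere moments, the square of F_v integrates to a constant - 2 b <z, v> + b |v|^2. The
    coefficient of the linear term comes from the definition of z and that of the quadratic one from
    the second moment; both are the volume b of the unit ball, so the vertex is z. *)
Lemma centered_support_square X0 : dot (F X0) (F X0) =
  dot (F z) (F z) + b * dotv (X0 - z) (X0 - z).
Proof.
have sq v : dot (F v) (F v) = dot u u - 2 * (b * dotv z v) + dotv v v * b.
  rewrite (sphere_dot_sq theta_area (-1) hu (hl v)) sphere_dot_steiner.
  by rewrite (sphere_dot_linear theta_area v n1).2 expr2; ring.
rewrite !sq dotvBl !dotvBr (dotvC X0 z); ring.
Qed.

Let omega_gt0 : 0 < omega.
Proof. by rewrite -volume_eball// mulr_gt0 ?ltr0n ?volume_eball_gt0. Qed.

(** By reflection symmetry both terms of the width have the same mean, so the radius of the Steiner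
    ball is the mean of u. *)
Lemma half_mean_width : mean_width theta Omega / 2 = dot u one / omega.
Proof.
have iu := sphere_dot_integrable theta_area hu hE.
have iN := sphere_dot_integrable theta_area (lipschitz_homogeneousN hu) hE.
have -> : mean_width theta Omega = omega^-1 * (dot u one + dot (fun x => u (- x)) one).
  rewrite /mean_width; congr (_ * _); rewrite -RintegralD//.
  by apply: eq_Rintegral => xi /set_mem ->; rewrite !mulr1.
rewrite (sphere_dot_one_reflection theta_area hu); field.
by rewrite gt_eqF.
Qed.

Lemma half_mean_width_ge0 : 0 <= mean_width theta Omega / 2.
Proof.
have [C hC] := bound; have [x0 Ox0] := O0.
rewrite /mean_width divr_ge0// mulr_ge0//; first by rewrite invr_ge0 ltW.
apply: Rintegral_ge0 => xi _.
by rewrite (le_trans _ (lerD (support_fun_ge hC xi Ox0) (support_fun_ge hC (- xi) Ox0)))// dotvNr subrr.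
Qed.

Lemma support_fun_eball (c : 'rV[R]_n.+1) r xi : 0 <= r -> enorm xi = 1 ->
  support_fun (eball c r) xi = dotv c xi + r.
Proof.
move=> r0 xi1.
have hC x : eball c r x -> enorm x <= enorm c + r.
  by rewrite /eball /= => h; rewrite -(subrK c x) (le_trans (enormD _ _))// addrC lerD2l.
apply/le_anti/andP; split.
  apply: support_fun_le; first by exists c; rewrite /eball /= subrr enorm0.
  move=> x; rewrite /eball /= => h; rewrite -{1}(subrK c x) dotvDl addrC lerD2l.
  by rewrite (le_trans (dotv_le_enorm _ _))// xi1 mulr1.
have Bx : eball c r (c + r *: xi).
  by rewrite /eball /= [c + _]addrC addrK enormZ xi1 mulr1 ger0_norm.
have := support_fun_ge hC xi Bx.
by rewrite dotvDl dotvZl enorm1_dotv// mulr1.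
Qed.

(** On the sphere the Steiner ball has support function <z, xi> + r, with r the mean of the centred
    support function. The squared distance is thus a variance: mean-square part minus the square of
    the integral over [omega]. *)
Lemma delta2_steiner_ball : delta2 theta Omega (steiner_ball theta Omega) ^+ 2 =
  dot (F z) (F z) - dot u one ^+ 2 / omega.
Proof.
set r := mean_width theta Omega / 2.
have -> : delta2 theta Omega (steiner_ball theta Omega) ^+ 2 =
    dot (fun x => F z x + (- r) * one x) (fun x => F z x + (- r) * one x).
  rewrite /delta2 sqr_sqrtr; last by apply: Rintegral_ge0 => xi _; exact: sqr_ge0.
  apply: eq_Rintegral => xi /set_mem xi1; rewrite /steiner_ball support_fun_eball//; last first.
    exact: half_mean_width_ge0.
  by rewrite -/r xi1 /F expr2; ring.
rewrite (sphere_dot_sq theta_area (- r) (hF z) hE) sphere_dot_centered_one.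
rewrite sphere_dot_one /r half_mean_width expr2.
by field; rewrite gt_eqF.
Qed.

Lemma weighted_curv_integral_steiner_min X0 :
  weighted_curv_integral Omega mu z <= weighted_curv_integral Omega mu X0.
Proof.
rewrite !weighted_curv_integralE lerD2r ler_wpM2l// (centered_support_square X0) lerDl.
by rewrite mulr_ge0 ?dotv_ge0// ltW// volume_eball_gt0.
Qed.

Lemma weighted_curv_integral_steiner : weighted_curv_integral Omega mu z =
  n.+1%:R / omega * curv_integral Omega mu (n%:Z - 1) ^+ 2
  - n%:R * curv_integral Omega mu (n%:Z - 2)
  + n.+1%:R * delta2 theta Omega (steiner_ball theta Omega) ^+ 2.
Proof.
rewrite weighted_curv_integralE delta2_steiner_ball curv_integral_width.
by field; rewrite gt_eqF.
Qed.

End SteinerPoint.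

Theorem corollary5p3 (R : realType) (n : nat) (Omega : set 'rV[R]_n.+1)
    (mu theta : {measure set 'rV[R]_n.+1 -> \bar R})
    (n_ge1 : (1 <= n)%N)
    (Omega_open : open Omega)
    (Omega_neq0 : Omega !=set0)
    (Omega_bounded : bounded_set Omega)
    (Omega_convex : convex_set Omega)
    (Sigma_smooth : smooth_hypersurface (boundary Omega))
    (mu_area : area_measure (boundary Omega) mu)
    (theta_area : area_measure (esphere R n.+1) theta) :
  (forall X0 : 'rV[R]_n.+1,
     weighted_curv_integral Omega mu (steiner_point theta Omega) <=
     weighted_curv_integral Omega mu X0) /\
  weighted_curv_integral Omega mu (steiner_point theta Omega) =
    n.+1%:R / sphere_area theta * curv_integral Omega mu (n%:Z - 1) ^+ 2
    - n%:R * curv_integral Omega mu (n%:Z - 2)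
    + n.+1%:R * delta2 theta Omega (steiner_ball theta Omega) ^+ 2.
Proof.
split=> [X0|].
  exact: (weighted_curv_integral_steiner_min n_ge1 Omega_open Omega_neq0 Omega_bounded
    Omega_convex Sigma_smooth mu_area theta_area).
exact: (weighted_curv_integral_steiner n_ge1 Omega_open Omega_neq0 Omega_bounded
  Omega_convex Sigma_smooth mu_area theta_area).
Qed.
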